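(* For any spherical mixed even $p$-spin model with no external field ($h=0$), $$\lim_{N\to\infty}\frac1N\mathrm{Var}(L_N)=0.$$
   Context: For $N\ge1$ let $S_N=\{\sigma\in\mathbb R^N:\sum_i\sigma_i^2=N\}$. Let $(\gamma_p)_{p\ge2}$ be real with $\sum_{p\ge2}2^p\gamma_p^2<\infty$ and $\gamma_p=0$ for every odd $p$. With $g_{i_1,\dots,i_p}$ i.i.d. standard Gaussians, $X_N(\sigma)=\sum_{p\ge2}\gamma_pN^{-(p-1)/2}\sum_{i_1,\dots,i_p=1}^N g_{i_1,\dots,i_p}\sigma_{i_1}\cdots\sigma_{i_p}$, $H_N(\sigma)=X_N(\sigma)+h\sum_i\sigma_i$ and $L_N=\max_{\sigma\in S_N}H_N(\sigma)$. *)

(* Defs.v *)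
From HB Require Import structures.
From mathcomp Require Import all_boot all_order all_algebra.
From mathcomp Require Import all_classical all_reals all_analysis.
Set Implicit Arguments. Unset Strict Implicit. Unset Printing Implicit Defensive.
Import Order.TTheory GRing.Theory Num.Theory.
Import numFieldNormedType.Exports.
Local Open Scope classical_set_scope.
Local Open Scope ring_scope.

Section spin.
Context {R : realType}.

(* Index of the disorder variable g_{i_1,...,i_p}: the pair (p, [:: i_1; ...; i_p]). *)
Definition gindex := (nat * seq nat)%type.

Definition mutually_independent d (T : measurableType d) (P : probability T R)
    (I : eqType) (g : I -> T -> R) : Prop :=
  forall (J : seq I) (B : I -> set R), uniq J ->
    (forall i, measurable (B i)) ->
    P (\bigcap_(i in [set i | i \in J]) (g i @^-1` B i)) =
    (\prod_(i <- J) P (g i @^-1` B i))%E.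

Definition standard_gaussian d (T : measurableType d) (P : probability T R)
    (X : T -> R) : Prop :=
  measurable_fun setT X /\
  forall B : set R, measurable B -> P (X @^-1` B) = normal_prob 0 1 B.

Definition spin_sphere (N : nat) : set ('I_N -> R) :=
  [set s | \sum_(i < N) s i ^+ 2 = N%:R].

Definition pspin_term T (gamma : nat -> R) (g : gindex -> T -> R) (N p : nat)
    (s : 'I_N -> R) (w : T) : R :=
  gamma p * (N%:R `^ (- ((p%:R - 1) / 2))) *
  \sum_(i : {ffun 'I_p -> 'I_N})
     (g (p, [seq (i k : nat) | k <- enum 'I_p]) w * \prod_(k < p) s (i k)).

Definition XN T (gamma : nat -> R) (g : gindex -> T -> R) (N : nat)
    (s : 'I_N -> R) (w : T) : R :=
  limn (fun n => \sum_(2 <= p < n) @pspin_term _ gamma g N p s w).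

Definition HN T (gamma : nat -> R) (g : gindex -> T -> R) (h : R) (N : nat)
    (s : 'I_N -> R) (w : T) : R :=
  @XN _ gamma g N s w + h * \sum_(i < N) s i.

Definition LN T (gamma : nat -> R) (g : gindex -> T -> R) (h : R) (N : nat)
    (w : T) : R :=
  sup [set @HN _ gamma g h N s w | s in @spin_sphere N].

End spin.

Arguments spin_sphere {R} N.
Arguments pspin_term {R T} gamma g N p s w.
Arguments XN {R T} gamma g N s w.
Arguments HN {R T} gamma g h N s w.
Arguments LN {R T} gamma g h N w.

(* Main.v *)
Require Import Defs.
From HB Require Import structures.
From mathcomp Require Import all_boot all_order all_algebra.
From mathcomp Require Import all_classical all_reals all_analysis.
From mathcomp Require Import measurable_realfun ring lra.
Set Implicit Arguments. Unset Strict Implicit. Unset Printing Implicit Defensive.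
Import Order.TTheory GRing.Theory Num.Theory.
Import numFieldNormedType.Exports.
Local Open Scope classical_set_scope.
Local Open Scope ring_scope.

(** On the unit sphere the Hamiltonian is H_G(v) = sum_a G_a e_a(v), with covariance N xi(v . w).
    Interpolating between two copies of the disorder with correlation a gives
    Var F <= (1 - a) c(1) + a c(a) for the free energy F at inverse temperature be, where c(a) is the
    correlation of the two gradients.  Log-convexity gives c(a)^2 <= c(1) c(a^2), so a bound
    c(eps^2) = o(N) at one fixed eps < 1 (disorder chaos) propagates to every a < 1, and letting a tend
    to 1 shows Var F = o(N), uniformly in be >= 1.  Evenness gives xi(s) <= xi(1) s^2, hence
    c(eps^2) <= N xi(1) E<(v . w)^2>, where v and w are replicas of the two systems.

    This overlap is O(N^(-1/2)): for the rotation fields X_j = (v . w) d_j - v_j w one has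
    sum_j X_j((v . w) v_j) = N (v . w)^2 - 1.  Integration by parts on the sphere turns N E<(v . w)^2>
    into a Gibbs covariance with X_j H, which is estimated by Cauchy-Schwarz.  The disorder private to
    one system drops out of it, because X_j applied to a rotation invariant kernel is antisymmetric,
    and Gaussian integration by parts in the shared disorder produces the factor eps^2 that closes
    the estimate.

    The uniform measure on the sphere is replaced by finitely supported measures, so that all Gaussian
    calculus involves finitely many variables; the mesh tends to 0, then be to infinity, and then the
    degree at which the mixture is truncated to infinity, N being fixed. *)

(** * Expectations and functions of finitely many variables *)

(** Poincare's inequality alone gives Var F <= N xi(1). The gain of o(1) must be uniform in
    everything later sent to a limit, so [eps] and all constants depend only on a lower bound [lo]
    of xi'(1) and an upper bound [M] of the sum of gamma_p^2 p^3. The estimate of phi = E<(v . w)^2>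
    closes as a linear system with three more unknowns: D, the Gibbs spread of the vector (v . w) v;
    Q, a self-overlap deficit; S, the Gibbs variance of the shared part of X_j H. Integration by
    parts in the private disorder bounds D by N phi + sqrt N even for large [be], because the
    derivative field involved splits into a tangential and a radial part. The radial field has
    supremum O(N) with fluctuations O(sqrt N), and these fluctuations produce the rate N^(-1/2). A
    finite measure is not rotation invariant, so the sphere identities acquire errors on the grid.
    Errors of size 1 are harmless, since they compete with N phi and sqrt N. Evenness enters a
    second time, in the scalar inequalities comparing xi' and xi'' with the quadratic form [DD]:
    these decide the signs of the terms in D. *)

Section expectation.
Context {R : realType} {d : measure_display} {T : measurableType d}.
Variable P : probability T R.
Implicit Types f g : T -> R.

Definition L1 f := P.-integrable setT (EFin \o f).
Definition Ex f : R := \int[P]_x f x.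

Lemma L1_meas f : L1 f -> measurable_fun setT f.
Proof. by move=> /measurable_int /measurable_EFinP. Qed.

Lemma L1_le f g : measurable_fun setT f -> (forall x, `|f x| <= g x) -> L1 g -> L1 f.
Proof.
move=> mf fg ig; apply: (le_integrable _ _ _ ig) => //; first exact/measurable_EFinP.
by move=> x _ /=; rewrite lee_fin (le_trans (fg x))// ler_norm.
Qed.

Lemma L1_cst c : L1 (fun=> c).
Proof. exact: finite_measure_integrable_cst. Qed.

Lemma L1D f g : L1 f -> L1 g -> L1 (fun x => f x + g x).
Proof. by move=> iF ig; rewrite /L1 (_ : _ \o _ = (EFin \o f) \+ (EFin \o g))%E//; exact: integrableD. Qed.

Lemma L1Z c f : L1 f -> L1 (fun x => c * f x).
Proof. by move=> iF; apply: (integrableZl _ c iF). Qed.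

Lemma L1N f : L1 f -> L1 (fun x => - f x).
Proof. by move=> iF; under eq_fun do rewrite -mulN1r; exact: L1Z. Qed.

Lemma L1B f g : L1 f -> L1 g -> L1 (fun x => f x - g x).
Proof. by move=> iF ig; apply: L1D => //; exact: L1N. Qed.

Lemma L1_abs f : L1 f -> L1 (fun x => `|f x|).
Proof. by move=> iF; apply: (integrable_norm iF). Qed.

Lemma L1_sum (I : Type) (s : seq I) (Q : pred I) (F : I -> T -> R) :
  (forall i, L1 (F i)) -> L1 (fun x => \sum_(i <- s | Q i) F i x).
Proof.
move=> iF; elim: s => [|i s IH].
  by under eq_fun do rewrite big_nil; exact: L1_cst.
under eq_fun do rewrite big_cons.
by case: (Q i) => //; exact: L1D.
Qed.

Lemma ExD f g : L1 f -> L1 g -> Ex (fun x => f x + g x) = Ex f + Ex g.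
Proof. by move=> iF ig; exact: RintegralD. Qed.

Lemma ExB f g : L1 f -> L1 g -> Ex (fun x => f x - g x) = Ex f - Ex g.
Proof. by move=> iF ig; exact: RintegralB. Qed.

Lemma ExZ c f : L1 f -> Ex (fun x => c * f x) = c * Ex f.
Proof. by move=> iF; exact: RintegralZl. Qed.

Lemma Ex_cst c : Ex (fun=> c) = c.
Proof. by rewrite /Ex Rintegral_cst// [X in fine X](@probability_setT _ _ _ P)/= mulr1. Qed.

Lemma Ex_ge0 f : (forall x, 0 <= f x) -> 0 <= Ex f.
Proof. by move=> f0; apply: Rintegral_ge0. Qed.

Lemma Ex_le f g : L1 f -> L1 g -> (forall x, f x <= g x) -> Ex f <= Ex g.
Proof. by move=> iF ig fg; apply: le_Rintegral. Qed.

Lemma Ex_abs f : L1 f -> `|Ex f| <= Ex (fun x => `|f x|).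
Proof. by move=> iF; apply: le_normr_Rintegral. Qed.

Lemma Ex_sum (I : Type) (s : seq I) (Q : pred I) (F : I -> T -> R) :
  (forall i, L1 (F i)) ->
  Ex (fun x => \sum_(i <- s | Q i) F i x) = \sum_(i <- s | Q i) Ex (F i).
Proof.
move=> iF; elim: s => [|i s IH].
  by under eq_fun do rewrite big_nil; rewrite Ex_cst big_nil.
under eq_fun do rewrite big_cons.
by rewrite big_cons; case: (Q i) => //; rewrite ExD ?IH//; exact: L1_sum.
Qed.

Lemma L1_sqrM f g : measurable_fun setT f -> measurable_fun setT g ->
  L1 (fun x => f x ^+ 2) -> L1 (fun x => g x ^+ 2) -> L1 (fun x => f x * g x).
Proof.
move=> mf mg if2 ig2.
apply: (L1_le _ _ (L1D if2 ig2)); first exact: measurable_funM.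
by move=> x; rewrite ler_norml; nra.
Qed.

Lemma Ex_CS f g : measurable_fun setT f -> measurable_fun setT g ->
  L1 (fun x => f x ^+ 2) -> L1 (fun x => g x ^+ 2) ->
  Ex (fun x => f x * g x) ^+ 2 <= Ex (fun x => f x ^+ 2) * Ex (fun x => g x ^+ 2).
Proof.
move=> mf mg if2 ig2; have ifg := L1_sqrM mf mg if2 ig2.
set a := Ex (fun x => f x ^+ 2); set b := Ex _; set c := Ex (fun x => g x ^+ 2).
have a0 : 0 <= a by apply: Ex_ge0 => x; exact: sqr_ge0.
have c0 : 0 <= c by apply: Ex_ge0 => x; exact: sqr_ge0.
have H (s t : R) : 0 <= s ^+ 2 * a + 2 * s * t * b + t ^+ 2 * c.
  have -> : s ^+ 2 * a + 2 * s * t * b + t ^+ 2 * c =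
      Ex (fun x => s ^+ 2 * f x ^+ 2 + 2 * s * t * (f x * g x) + t ^+ 2 * g x ^+ 2).
    by rewrite !ExD ?ExZ//; do ?[apply: L1D]; exact: L1Z.
  apply: Ex_ge0 => x; rewrite (_ : _ + _ = (s * f x + t * g x) ^+ 2) ?sqr_ge0//.
  by ring.
have [c00|cn0] := eqVneq c 0.
  (* With c = 0 the form at (-b, a + 1) equals -(a + 2) b^2, which forces b = 0. *)
  have := H (- b) (a + 1); rewrite c00 mulr0 addr0 => H3.
  by rewrite mulr0; nra.
have cp : 0 < c by rewrite lt_def cn0.
have := H c (- b).
rewrite (_ : _ + _ = c * (a * c - b ^+ 2)); last by ring.
by rewrite pmulr_rge0// subr_ge0.
Qed.

End expectation.

(** * Functions of finitely many variables: growth, continuity and derivatives *)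

Section functions.
Context {R : realType}.
Implicit Types M I : finType.

(** The summand 1 makes the powers of [vbnd] increase with the exponent, so polynomial bounds of
    different degrees can be added. *)
Definition vbnd M (u : M -> R) : R := 1 + \sum_m `|u m|.

Definition pbd M (f : (M -> R) -> R) :=
  exists C k, forall u, `|f u| <= C * vbnd u ^+ k.

(* [f] preserves measurability of coordinate families on every space; this
   avoids choosing a sigma-algebra on [M -> R]. *)
Definition mcl M (f : (M -> R) -> R) :=
  forall (d : measure_display) (U : measurableType d) (X : M -> U -> R),
  (forall m, measurable_fun setT (X m)) ->
  measurable_fun setT (fun w => f (fun m => X m w)).

(** Continuity for coordinatewise convergence along an arbitrary filter. It will be applied to
    sequences, to a single real variable and to a filter of boxes, and no topology on [M -> R] has
    to be chosen. *)
Definition ccl M (f : (M -> R) -> R) :=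
  forall (S : Type) (F : set_system S) (FF : Filter F) (x : S -> M -> R) (l : M -> R),
  (forall m, x s m @[s --> F] --> l m) -> f (x s) @[s --> F] --> f l.

Definition nice M (f : (M -> R) -> R) := [/\ mcl f, pbd f & ccl f].

(* Differentiability along every differentiable curve, [df] being the gradient. *)
Definition cdf M (f : (M -> R) -> R) (df : M -> (M -> R) -> R) :=
  forall (u : R -> M -> R) (u' : M -> R) (t : R),
  (forall m, is_derive t (1 : R) (fun s => u s m) (u' m)) ->
  is_derive t (1 : R) (fun s => f (u s)) (\sum_m df m (u t) * u' m).

(** The class in which Gaussian integration by parts holds. It is closed under sums, products and
    linear substitutions, so smoothness of composite expressions is obtained by assembling terms
    rather than by analysis. *)
Definition smooth1 M (f : (M -> R) -> R) (df : M -> (M -> R) -> R) :=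
  [/\ nice f, forall m, nice (df m) & cdf f df].

Lemma vbnd_ge1 M (u : M -> R) : 1 <= vbnd u.
Proof. by rewrite lerDl sumr_ge0. Qed.

Lemma vbndX_ge1 M (u : M -> R) k : 1 <= vbnd u ^+ k.
Proof. by rewrite exprn_ege1// vbnd_ge1. Qed.

Lemma pbd_posC M (f : (M -> R) -> R) : pbd f ->
  exists C k, 0 <= C /\ forall u, `|f u| <= C * vbnd u ^+ k.
Proof.
move=> [C [k fC]]; exists `|C|, k; split => // u.
rewrite (le_trans (fC u))// ler_wpM2r ?ler_norm// (le_trans ler01)// vbndX_ge1//.
Qed.

Lemma pbd_bounded M (f : (M -> R) -> R) C : (forall u, `|f u| <= C) -> pbd f.
Proof. by move=> fC; exists C, 0%N => u; rewrite expr0 mulr1. Qed.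

Lemma pbdD M (f g : (M -> R) -> R) : pbd f -> pbd g -> pbd (fun u => f u + g u).
Proof.
move=> /pbd_posC[C [k [C0 fC]]] /pbd_posC[D [l [D0 gD]]].
exists (C + D), (k + l)%N => u.
rewrite (le_trans (ler_normD _ _))// mulrDl lerD//.
  rewrite (le_trans (fC u))// ler_wpM2l// exprD ler_peMr ?vbndX_ge1// (le_trans ler01)// vbndX_ge1//.
rewrite (le_trans (gD u))// ler_wpM2l// exprD ler_peMl ?vbndX_ge1// (le_trans ler01)// vbndX_ge1//.
Qed.

Lemma pbdM M (f g : (M -> R) -> R) : pbd f -> pbd g -> pbd (fun u => f u * g u).
Proof.
move=> /pbd_posC[C [k [C0 fC]]] /pbd_posC[D [l [D0 gD]]].
exists (C * D), (k + l)%N => u.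
by rewrite normrM exprD mulrACA ler_pM.
Qed.

Lemma nice_cst M (c : R) : nice (fun _ : M -> R => c).
Proof.
split; first by move=> *; exact: measurable_cst.
- exact: (@pbd_bounded _ _ `|c|).
- by move=> *; exact: cvg_cst.
Qed.

Lemma nice_proj M (m : M) : nice (fun u : M -> R => u m).
Proof.
split; first by move=> d U X mX; exact: mX.
- exists 1, 1%N => u; rewrite mul1r expr1 /vbnd (bigD1 m)//= addrCA lerDl.
  by rewrite addr_ge0// sumr_ge0.
- by move=> S F FF x l xl; exact: xl.
Qed.

Lemma niceD M (f g : (M -> R) -> R) : nice f -> nice g -> nice (fun u => f u + g u).
Proof.
move=> [mf pf cf] [mg pg cg]; split.
- by move=> d U X mX; apply: measurable_funD; [exact: mf|exact: mg].
- exact: pbdD.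
- by move=> S F FF x l xl; apply: cvgD; [exact: cf|exact: cg].
Qed.

Lemma niceM M (f g : (M -> R) -> R) : nice f -> nice g -> nice (fun u => f u * g u).
Proof.
move=> [mf pf cf] [mg pg cg]; split.
- by move=> d U X mX; apply: measurable_funM; [exact: mf|exact: mg].
- exact: pbdM.
- by move=> S F FF x l xl; apply: cvgM; [exact: cf|exact: cg].
Qed.

Lemma niceZ M c (f : (M -> R) -> R) : nice f -> nice (fun u => c * f u).
Proof. by move=> nf; apply: niceM => //; exact: nice_cst. Qed.

Lemma niceN M (f : (M -> R) -> R) : nice f -> nice (fun u => - f u).
Proof. by move=> nf; under eq_fun do rewrite -mulN1r; exact: niceZ. Qed.

Lemma niceB M (f g : (M -> R) -> R) : nice f -> nice g -> nice (fun u => f u - g u).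
Proof. by move=> nf ng; apply: niceD => //; exact: niceN. Qed.

Lemma nice_sum M (J : Type) (s : seq J) (Q : pred J) (f : J -> (M -> R) -> R) :
  (forall j, nice (f j)) -> nice (fun u => \sum_(j <- s | Q j) f j u).
Proof.
move=> nf; elim: s => [|j s IH].
  by under eq_fun do rewrite big_nil; exact: nice_cst.
under eq_fun do rewrite big_cons.
by case: (Q j) => //; exact: niceD.
Qed.

Definition lin M I (A : M -> I -> R) (x : I -> R) : M -> R :=
  fun m => \sum_i A m i * x i.

Lemma vbnd_lin M I (A : M -> I -> R) x :
  vbnd (lin A x) <= (1 + \sum_m \sum_i `|A m i|) * vbnd x.
Proof.
set S := \sum_m _.
have S0 : 0 <= S by apply: sumr_ge0 => m _; apply: sumr_ge0.
have X0 : 0 <= \sum_i `|x i| by apply: sumr_ge0.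
have : \sum_m `|lin A x m| <= S * \sum_i `|x i|.
  rewrite mulr_suml ler_sum// => m _.
  rewrite (le_trans (ler_norm_sum _ _ _))// mulr_suml ler_sum// => i _.
  by rewrite normrM ler_wpM2l// (bigD1 i)//= lerDl sumr_ge0.
by rewrite /vbnd; nra.
Qed.

Lemma nice_comp M I (f : (M -> R) -> R) (g : M -> (I -> R) -> R) :
  nice f -> (forall m, nice (g m)) -> nice (fun x => f (fun m => g m x)).
Proof.
move=> [mf pf cf] ng; split.
- move=> d U X mX; apply: (mf _ _ (fun m w => g m (fun i => X i w))) => m.
  by have [mg _ _] := ng m; exact: mg.
- have : pbd (fun x => vbnd (fun m => g m x)).
    apply: pbdD; first by apply: (@pbd_bounded _ _ 1) => u; rewrite normr1.
    have nS (s : seq M) : pbd (fun x => \sum_(m <- s) `|g m x|).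
      elim: s => [|m s IH].
        by apply: (@pbd_bounded _ _ 0) => u; rewrite big_nil normr0.
      under eq_fun do rewrite big_cons.
      apply: pbdD IH; have [_ [C [k H]] _] := ng m.
      by exists C, k => u; rewrite normr_id.
    exact: nS.
  move=> /pbd_posC[D [l [D0 HD]]].
  have [C [k [C0 HC]]] := pbd_posC pf.
  exists (C * D ^+ k), (l * k)%N => x.
  rewrite (le_trans (HC _))// -mulrA ler_wpM2l// exprM -exprMn.
  rewrite lerXn2r ?nnegrE//; [exact: le_trans ler01 (vbnd_ge1 _)| |].
    by rewrite mulr_ge0// exprn_ge0// (le_trans ler01)// vbnd_ge1.
  by rewrite (le_trans _ (HD x))// ler_norm.
- move=> S F FF x l xl; apply: (cf _ _ _ (fun s m => g m (x s)) (fun m => g m l)) => m.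
  by have [_ _ cg] := ng m; exact: cg.
Qed.

Lemma nice_lin_coord M I (A : M -> I -> R) m : nice (fun x => lin A x m).
Proof. by apply: nice_sum => i; apply: niceZ; exact: nice_proj. Qed.

Lemma nice_lin M I (f : (M -> R) -> R) (A : M -> I -> R) :
  nice f -> nice (fun x => f (lin A x)).
Proof.
move=> nf; apply: (nice_comp (g := fun m x => lin A x m)) => // m.
exact: nice_lin_coord.
Qed.

Lemma is_derive_bsum (J : Type) (s : seq J) (f : J -> R -> R) (df : J -> R) (t : R) :
  (forall j, is_derive t (1 : R) (f j) (df j)) ->
  is_derive t (1 : R) (fun x => \sum_(j <- s) f j x) (\sum_(j <- s) df j).
Proof.
move=> H; elim: s => [|j s IH].
  rewrite big_nil (_ : (fun x => _) = cst 0); first exact: is_derive_cst.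
  by apply/funext => x; rewrite big_nil.
rewrite big_cons (_ : (fun x => _) = f j + (fun x => \sum_(j <- s) f j x)).
  exact: is_deriveD.
by apply/funext => x; rewrite big_cons.
Qed.

Lemma cdf_cst M (c : R) : cdf (fun _ : M -> R => c) (fun _ _ => 0).
Proof.
move=> u u' t _; rewrite big1 => [|m _]; last by rewrite mul0r.
exact: is_derive_cst.
Qed.

Lemma cdf_proj M (m : M) : cdf (fun u : M -> R => u m) (fun i _ => (i == m)%:R).
Proof.
move=> u u' t du; rewrite (bigD1 m)//= eqxx mul1r big1 ?addr0// => i /negPf->.
by rewrite mul0r.
Qed.

Lemma cdfD M (f g : (M -> R) -> R) df dg : cdf f df -> cdf g dg ->
  cdf (fun u => f u + g u) (fun m u => df m u + dg m u).
Proof.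
move=> cf cg u u' t du.
under eq_bigr do rewrite mulrDl; rewrite big_split/=.
by apply: is_deriveD; [exact: cf|exact: cg].
Qed.

Lemma cdfM M (f g : (M -> R) -> R) df dg : cdf f df -> cdf g dg ->
  cdf (fun u => f u * g u) (fun m u => f u * dg m u + g u * df m u).
Proof.
move=> cf cg u u' t du.
have := is_deriveM (cf _ _ _ du) (cg _ _ _ du).
rewrite (_ : _ + _ = \sum_m (f (u t) * dg m (u t) + g (u t) * df m (u t)) * u' m)//.
rewrite !scaler_sumr -big_split/=; apply: eq_bigr => m _.
by rewrite !mulrDl -!mulrA.
Qed.

Lemma cdf_comp1 M (h h' : R -> R) (f : (M -> R) -> R) df :
  (forall u, is_derive (f u) (1 : R) h (h' (f u))) -> cdf f df ->
  cdf (fun u => h (f u)) (fun m u => h' (f u) * df m u).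
Proof.
move=> dh cf u u' t du.
have Hf := cf _ _ _ du.
have Hh := dh (u t).
rewrite (_ : \sum_m _ = h' (f (u t)) * \sum_m df m (u t) * u' m); last first.
  by rewrite mulr_sumr; apply: eq_bigr => m _; rewrite mulrA.
exact: (@is_derive1_comp _ h (fun s => f (u s)) t).
Qed.

Lemma cdf_ext M (f g : (M -> R) -> R) df dg :
  (forall u, f u = g u) -> (forall m u, df m u = dg m u) -> cdf f df -> cdf g dg.
Proof.
move=> fg e; rewrite (_ : g = f); last by apply/funext => u.
by rewrite (_ : df = dg)//; apply/funext => m; apply/funext => u.
Qed.

Lemma cdf_sum M (J : Type) (s : seq J) (f : J -> (M -> R) -> R) df :
  (forall j, cdf (f j) (df j)) ->
  cdf (fun u => \sum_(j <- s) f j u) (fun m u => \sum_(j <- s) df j m u).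
Proof.
move=> cf; elim: s => [|j s IH].
  by refine (cdf_ext _ _ (@cdf_cst _ 0)) => *; rewrite big_nil.
by refine (cdf_ext _ _ (cdfD (cf j) IH)) => *; rewrite big_cons.
Qed.

Lemma cdf_lin M I (f : (M -> R) -> R) df (A : M -> I -> R) : cdf f df ->
  cdf (fun x => f (lin A x)) (fun i x => \sum_m df m (lin A x) * A m i).
Proof.
move=> cf u u' t du.
have := cf (fun s => lin A (u s)) (lin A u') t.
rewrite (_ : \sum_m _ * lin A u' m = \sum_i (\sum_m df m (lin A (u t)) * A m i) * u' i).
  apply=> m; rewrite /lin.
  exact: (@is_derive_bsum _ _ (fun i s => A m i * u s i) (fun i => A m i * u' i) t
    (fun i => is_deriveZ (A m i) (du i))).
under [RHS]eq_bigr do rewrite mulr_suml.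
rewrite exchange_big/=; apply: eq_bigr => m _.
by rewrite /lin mulr_sumr; apply: eq_bigr => i _; rewrite mulrA.
Qed.

Lemma smooth1_cst M (c : R) : smooth1 (fun _ : M -> R => c) (fun _ _ => 0).
Proof. split; [exact: nice_cst|move=> m; exact: nice_cst|exact: cdf_cst]. Qed.

Lemma smooth1_proj M (m : M) : smooth1 (fun u : M -> R => u m) (fun i _ => (i == m)%:R).
Proof. split; [exact: nice_proj|move=> i; exact: nice_cst|exact: cdf_proj]. Qed.

Lemma smooth1D M (f g : (M -> R) -> R) df dg : smooth1 f df -> smooth1 g dg ->
  smooth1 (fun u => f u + g u) (fun m u => df m u + dg m u).
Proof.
move=> [nf ndf cf] [ng ndg cg]; split; [exact: niceD|move=> m; exact: niceD|exact: cdfD].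
Qed.

Lemma smooth1M M (f g : (M -> R) -> R) df dg : smooth1 f df -> smooth1 g dg ->
  smooth1 (fun u => f u * g u) (fun m u => f u * dg m u + g u * df m u).
Proof.
move=> [nf ndf cf] [ng ndg cg]; split; [exact: niceM| |exact: cdfM].
by move=> m; apply: niceD; exact: niceM.
Qed.

Lemma smooth1_lin M I (f : (M -> R) -> R) df (A : M -> I -> R) : smooth1 f df ->
  smooth1 (fun x => f (lin A x)) (fun i x => \sum_m df m (lin A x) * A m i).
Proof.
move=> [nf ndf cf]; split; [exact: nice_lin| |exact: cdf_lin].
move=> i; apply: nice_sum => m; apply: niceM; last exact: nice_cst.
exact: (nice_lin (f := df m)).
Qed.

Lemma smooth1_ext M (f g : (M -> R) -> R) df dg :
  (forall u, f u = g u) -> (forall m u, df m u = dg m u) -> smooth1 f df -> smooth1 g dg.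
Proof.
move=> fg dfg; rewrite (_ : g = f); last by apply/funext => u.
by rewrite (_ : dg = df)//; apply/funext => m; apply/funext => u.
Qed.

Lemma smooth1Z M c (f : (M -> R) -> R) df : smooth1 f df ->
  smooth1 (fun u => c * f u) (fun m u => c * df m u).
Proof.
move=> sf; refine (smooth1_ext _ _ (smooth1M (smooth1_cst _ c) sf)) => // m u.
by rewrite mulr0 addr0.
Qed.

End functions.

(** * Gaussian families *)

Section normal.
Context {R : realType}.
Local Notation mu := (@lebesgue_measure R).
Local Notation gam := (@normal_prob R 0 1).
Local Notation phi := (@normal_pdf R 0 1).

Lemma integral_normal_prob (f : R -> \bar R) : gam.-integrable setT f ->
  (\int[gam]_x f x = \int[mu]_x (f x * (phi x)%:E))%E.
Proof.
move=> iF.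
have dom : gam `<< mu := normal_prob_dominates 0 1.
rewrite -(Radon_Nikodym_change_of_variables dom)//=.
apply: ae_eq_integral => //.
- apply: emeasurable_funM; first exact: measurable_int iF.
  by apply: (measurable_int mu); apply: Radon_Nikodym_integrable; exact: dom.
- apply: emeasurable_funM; first exact: measurable_int iF.
  by apply/measurable_EFinP; exact: measurable_normal_pdf.
(* The Radon-Nikodym derivative and the density have the same integral over every measurable set,
   hence agree almost everywhere. *)
- apply: ae_eqe_mul2l => /=.
  rewrite Radon_NikodymE//=.
  case: cid => /= h [h1 h2 h3].
  apply: integral_ae_eq => //=.
  + by apply/measurable_EFinP; exact: measurable_normal_pdf.
  + by move=> E E01 mE; rewrite -h3.
Qed.

(** [integral_normal_prob] presupposes integrability under the Gaussian law. Here it is derived from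
    the Lebesgue side: the truncations of |f| at level n are bounded, hence integrable, and monotone
    convergence removes the truncation. *)
Lemma integrable_normal_prob (f : R -> R) : measurable_fun setT f ->
  mu.-integrable setT (fun x => (f x * phi x)%:E) ->
  gam.-integrable setT (EFin \o f).
Proof.
move=> mf iF.
apply/integrableP; split; first exact/measurable_EFinP.
pose F n x := Num.min `|f x| n%:R.
have F0 n x : 0 <= F n x by rewrite le_min normr_ge0 ler0n.
have mF n : measurable_fun setT (F n).
  by apply: measurable_minr => //; exact: measurableT_comp.
have iFn n : gam.-integrable setT (EFin \o F n).
  have H x : `|F n x| <= n%:R by rewrite ger0_norm// ge_min lexx orbT.
  exact: (@L1_le _ _ _ (normal_prob 0 1 : probability _ R) _ _ (mF n) H (L1_cst _ n%:R)).
have key n : (\int[gam]_x (F n x)%:E <= \int[mu]_x `|(f x * phi x)%:E|)%E.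
  rewrite integral_normal_prob; last exact: iFn.
  apply: ge0_le_integral => //=.
  - by move=> x _; rewrite mule_ge0// lee_fin// ?F0// normal_pdf_ge0.
  - apply: emeasurable_funM; first by apply/measurable_EFinP; exact: mF.
    by apply/measurable_EFinP; exact: measurable_normal_pdf.
  - apply/measurable_EFinP/measurableT_comp => //.
    by apply: measurable_funM => //; exact: measurable_normal_pdf.
  - move=> x _; rewrite -EFinM lee_fin normrM ler_pM// ?normal_pdf_ge0//.
      by rewrite ge_min lexx.
    by rewrite ger0_norm// normal_pdf_ge0.
have lim : (\int[gam]_x (F n x)%:E)%E @[n --> \oo] --> (\int[gam]_x `|(f x)%:E|)%E.
  have -> : (\int[gam]_x `|(f x)%:E|)%E = (\int[gam]_x limn (fun n => (F n x)%:E))%E.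
    apply: eq_integral => x _; apply/esym/cvg_lim => //.
    apply: cvg_EFin; first exact: nearW.
    apply: cvg_near_cst; near=> n.
    rewrite /= /F min_l//; near: n; exact: nbhs_infty_ger.
  apply: cvg_monotone_convergence => //.
  - by move=> n; apply/measurable_EFinP; exact: mF.
  - by move=> n x _; rewrite lee_fin.
  - move=> x _ m n mn; rewrite lee_fin le_min ge_min lexx/= ge_min.
    by rewrite ler_nat mn orbT.
apply: (@le_lt_trans _ _ (\int[mu]_x `|(f x * phi x)%:E|)%E); last first.
  by move/integrableP : iF => [].
have -> : (\int[gam]_x `|(EFin \o f) x| = limn (fun n => \int[gam]_x (F n x)%:E))%E.
  by apply/esym/cvg_lim => //; exact: lim.
apply: lime_le; first by apply/cvg_ex; eexists; exact: lim.
exact: nearW.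
Unshelve. all: end_near. Qed.

Lemma expr_le_expR (x : R) k : 0 <= x -> x ^+ k <= k`!%:R * expR x.
Proof.
move=> x0; case: k => [|k].
  by rewrite expr0 fact0 mul1r (le_trans _ (expR_ge1Dx _))// lerDl.
have H := expR_ge1Dxn k x0.
have f0 : 0 < k.+1`!%:R :> R by rewrite ltr0n fact_gt0.
have : x ^+ k.+1 / k.+1`!%:R <= expR x by rewrite (le_trans _ H)// lerDr.
by rewrite ler_pdivrMr// mulrC.
Qed.

Lemma normal_pdfE1 (x : R) : phi x = normal_peak 1 * expR (- (x ^+ 2 / 2)).
Proof.
rewrite /normal_pdf oner_eq0 /normal_fun subr0 expr1n; congr (_ * expR _).
by rewrite mulNr.
Qed.

(** The dominating function is itself a normal density, of variance 2, so its integrability is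
    known. The constant e^2 comes from 1 + y - y^2/2 <= 2 - y^2/4, that is (y - 2)^2 >= 0. *)
Lemma normal_tail k : exists2 C : R, 0 <= C & forall x : R,
  (1 + `|x|) ^+ k * phi x <= C * normal_pdf 0 (Num.sqrt 2) x.
Proof.
have s20 : Num.sqrt 2 != 0 :> R by rewrite gt_eqF// sqrtr_gt0.
have p1 : 0 <= normal_peak 1 :> R := normal_peak_ge0 _.
have p2 : 0 < normal_peak (Num.sqrt 2) :> R by exact: normal_peak_gt0.
exists (k`!%:R * expR 2 * normal_peak 1 / normal_peak (Num.sqrt 2)).
  by rewrite divr_ge0 ?mulr_ge0 ?expR_ge0// ltW.
move=> x; rewrite normal_pdfE1 (normal_pdfE _ s20) /normal_fun subr0 sqr_sqrtr//.
have h : (1 + `|x|) ^+ k <= k`!%:R * expR (1 + `|x|) by exact: expr_le_expR.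
have e : x ^+ 2 = `|x| ^+ 2 by rewrite real_normK// num_real.
have key : (1 + `|x|) ^+ k * expR (- (x ^+ 2 / 2)) <=
           k`!%:R * expR 2 * expR (- x ^+ 2 / (2 *+ 2)).
  rewrite (le_trans (ler_wpM2r (expR_ge0 _) h))// -[leLHS]mulrA -[leRHS]mulrA ler_wpM2l// -!expRD ler_expR e.
  by rewrite (_ : 2 *+ 2 = 4 :> R); [set y := `|x|; have := sqr_ge0 (y - 2); nra|ring].
set E2 := expR (- x ^+ 2 / _) in key *.
rewrite (_ : _ * (normal_peak (Num.sqrt 2) * E2) = normal_peak 1 * (k`!%:R * expR 2 * E2)); last first.
  by field; rewrite gt_eqF.
by rewrite mulrCA ler_wpM2l.
Qed.

Lemma normal_moment k : gam.-integrable setT (EFin \o (fun x : R => (1 + `|x|) ^+ k)).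
Proof.
apply: integrable_normal_prob.
  apply: measurable_funX; apply: measurable_funD => //; exact: measurableT_comp.
have [C C0 H] := normal_tail k.
have iC : mu.-integrable setT (fun x => C%:E * (normal_pdf 0 (Num.sqrt 2) x)%:E)%E.
  by apply: integrableZl => //; exact: integrable_normal_pdf.
apply: (le_integrable _ _ _ iC) => //.
  apply/measurable_EFinP/measurable_funM; last exact: measurable_normal_pdf.
  by apply: measurable_funX; apply: measurable_funD => //; exact: measurableT_comp.
move=> x _; rewrite lee_fin ger0_norm; last first.
  by rewrite mulr_ge0 ?normal_pdf_ge0// exprn_ge0// addr_ge0.
by rewrite (le_trans (H x))// ler_norm.
Qed.

Lemma normal_L1 (f : R -> R) C k : measurable_fun setT f ->
  (forall x, `|f x| <= C * (1 + `|x|) ^+ k) -> gam.-integrable setT (EFin \o f).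
Proof.
move=> mf H; apply: (@L1_le _ _ _ (normal_prob 0 1 : probability _ R) _ _ mf H).
by apply: L1Z; exact: normal_moment.
Qed.

Lemma is_derive_normal_pdf (x : R) : is_derive x (1 : R) phi (- x * phi x).
Proof.
have -> : phi = normal_peak 1 \*: (expR \o (fun y : R => - (y ^+ 2 / 2))).
  by apply/funext => y; rewrite normal_pdfE1.
have d1 : is_derive x (1 : R) (fun y : R => - (y ^+ 2 / 2)) (- x).
  have := is_deriveZ (- 2^-1) (is_deriveM (is_derive_id x (1 : R)) (is_derive_id x (1 : R))).
  rewrite (_ : _ \*: _ = (fun y : R => - (y ^+ 2 / 2))); last first.
    by apply/funext => y; rewrite -[LHS]/(- 2^-1 * (y * y)); field.
  by rewrite (_ : _ *: _ = - x)// /GRing.scale/=; field.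
have d2 := is_derive_expR (- (x ^+ 2 / 2)).
have := is_deriveZ (normal_peak 1) (@is_derive1_comp _ expR _ x _ _ d2 d1).
by rewrite /GRing.scale/= mulrA mulrC.
Qed.

(** The function [(f' x - x * f x) * phi x] is the derivative of [f * phi]. Its integral over
    [-(n+1), n+1] is a difference of boundary values, which tends to 0, while dominated convergence
    gives the integral over the line. *)
Lemma normal_ibp (f f' : R -> R) C k :
  (forall x, is_derive x (1 : R) f (f' x)) -> continuous f' ->
  (forall x, `|f x| <= C * (1 + `|x|) ^+ k) ->
  (forall x, `|f' x| <= C * (1 + `|x|) ^+ k) ->
  \int[gam]_x (x * f x) = \int[gam]_x f' x.
Proof.
move=> df cf' bf bf'.
have cf : continuous f.
  by move=> x; apply/differentiable_continuous/derivable1_diffP; case: (df x).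
have mf : measurable_fun setT f by exact: continuous_measurable_fun.
have mf' : measurable_fun setT f' by exact: continuous_measurable_fun.
have B1 (x : R) : 1 <= 1 + `|x| by rewrite lerDl.
have Bx (x : R) : `|x| <= 1 + `|x| by rewrite lerDr.
have if' : gam.-integrable setT (EFin \o f') by exact: normal_L1 bf'.
have ixf : gam.-integrable setT (EFin \o (fun x => x * f x)).
  apply: (@normal_L1 _ C k.+1); first exact: measurable_funM.
  move=> x; rewrite normrM exprS mulrCA ler_pM//.
pose g x := (f' x - x * f x) * phi x.
have ig : gam.-integrable setT (EFin \o (fun x => f' x - x * f x)).
  exact: (@L1B _ _ _ (normal_prob 0 1 : probability _ R)).
have img : mu.-integrable setT (EFin \o g).
  have [D D0 HD] := normal_tail k.+1.
  have iD : mu.-integrable setT (fun x => (2 * C * D)%:E * (normal_pdf 0 (Num.sqrt 2) x)%:E)%E.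
    by apply: integrableZl => //; exact: integrable_normal_pdf.
  have C0 : 0 <= C by have := le_trans (normr_ge0 _) (bf 0); rewrite normr0 addr0 expr1n mulr1.
  apply: (le_integrable _ _ _ iD) => //.
    apply/measurable_EFinP/measurable_funM; last exact: measurable_normal_pdf.
    by apply: measurable_funB => //; exact: measurable_funM.
  move=> x _; rewrite [leRHS](_ : _ = `|2 * C * D * normal_pdf 0 (Num.sqrt 2) x|%:E)//.
  rewrite lee_fin normrM (ger0_norm (normal_pdf_ge0 _ _ _)).
  apply: (@le_trans _ _ (2 * C * ((1 + `|x|) ^+ k.+1 * phi x))); last first.
    by rewrite (le_trans _ (ler_norm _))// -[leRHS]mulrA ler_wpM2l ?mulr_ge0.
  rewrite mulrA ler_wpM2r ?normal_pdf_ge0//.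
  rewrite (le_trans (ler_normB _ _))// -mulrA mulr_natl mulr2n lerD//.
    have h0 : 0 <= (1 + `|x|) ^+ k by rewrite exprn_ge0// (le_trans ler01).
    by rewrite (le_trans (bf' x))// ler_wpM2l// exprS ler_peMl.
  by rewrite normrM exprS mulrCA ler_pM.
have cg : continuous g.
  move=> x; apply: cvgM; last exact: continuous_normal_pdf.
  by apply: cvgB; [exact: cf'|apply: cvgM; [exact: cvg_id|exact: cf]].
have dG x : is_derive x (1 : R) (fun y => f y * phi y) (g x).
  have := is_deriveM (df x) (is_derive_normal_pdf x).
  rewrite (_ : _ + _ = g x)//.
  by rewrite /g /GRing.scale/=; ring.
have FTC n : (\int[mu]_(x in `[(- n.+1%:R)%R, (n.+1%:R : R)%R]) (g x)%:E =
    (f n.+1%:R * phi n.+1%:R)%R%:E - (f (- n.+1%:R) * phi (- n.+1%:R))%R%:E)%E.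
  have cG x : {for x, continuous (fun y => f y * phi y)}.
    by apply/differentiable_continuous/derivable1_diffP; case: (dG x).
  rewrite (continuous_FTC2 (F := fun y => f y * phi y))//.
  - by rewrite gtrN// ltr0n.
  - exact: continuous_subspaceT.
  - split; first by move=> x _; case: (dG x).
    + by apply: cvg_at_right_filter; exact: cG.
    + by apply: cvg_at_left_filter; exact: cG.
  - by move=> x _; rewrite derive1E; apply: derive_val.
suff g0 : (\int[mu]_x (g x)%:E = 0)%E.
  apply/esym/eqP; rewrite -subr_eq0 -RintegralB//.
  rewrite /Rintegral integral_normal_prob//.
  by rewrite (_ : integral _ _ _ = 0%E)//; rewrite -[RHS]g0; apply: eq_integral => x _; rewrite -EFinM.
have L1 : (\int[mu]_(x in `[(- n.+1%:R)%R, (n.+1%:R : R)%R]) (g x)%:E)%E @[n --> \oo] --> (\int[mu]_x (g x)%:E)%E.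
  under eq_fun do rewrite integral_mkcond.
  have mg : measurable_fun setT (EFin \o g) by exact: measurable_int img.
  pose gn n := (EFin \o g) \_ `[(- n.+1%:R)%R, (n.+1%:R : R)%R].
  have mgn n : measurable_fun setT (gn n).
    by apply/(measurable_restrictT _ _).1 => //; exact: measurable_funTS.
  have lgn : {ae mu, forall x, setT x -> gn ^~ x @ \oo --> (EFin \o g) x}.
    apply: aeW => x _; apply: cvg_near_cst; near=> n.
    rewrite /gn patchE mem_set//= in_itv/= -ler_norml.
    near: n; apply: filterS (nbhs_infty_ger `|x|) => n /= /le_trans; apply.
    by rewrite ler_nat.
  have bgn : {ae mu, forall x n, setT x -> (`|gn n x| <= (abse \o (EFin \o g)) x)%E}.
    by apply: aeW => x n _; rewrite /gn patchE; case: ifP => //= _; rewrite normr0 lee_fin.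
  have [_ _] := @dominated_convergence _ _ _ mu setT measurableT gn (EFin \o g) (abse \o (EFin \o g))
    mgn mg lgn (integrable_abse img) bgn.
  by [].
have L2 : (\int[mu]_(x in `[(- n.+1%:R)%R, (n.+1%:R : R)%R]) (g x)%:E)%E @[n --> \oo] --> 0%E.
  under eq_fun do rewrite FTC.
  have [D D0 HD] := normal_tail k.
  have C0 : 0 <= C by have := le_trans (normr_ge0 _) (bf 0); rewrite normr0 addr0 expr1n mulr1.
  have s20 : Num.sqrt 2 != 0 :> R by rewrite gt_eqF// sqrtr_gt0.
  pose K : R := C * D * normal_peak (Num.sqrt 2).
  have K0 : 0 <= K by rewrite !mulr_ge0// normal_peak_ge0.
  (* Of the Gaussian decay only exp(- x^2 / 4) <= 1 / |x| is kept; it follows from exp(x^2 / 4) >= 1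
     + x^2 / 4 >= |x|. *)
  have bG (x : R) : 0 < `|x| -> `|f x * phi x| <= K * `|x|^-1.
    move=> x0; rewrite normrM (ger0_norm (normal_pdf_ge0 _ _ _)).
    apply: (le_trans (ler_wpM2r (normal_pdf_ge0 _ _ _) (bf x))).
    rewrite -mulrA (le_trans (ler_wpM2l C0 (HD x)))// /K -!mulrA !ler_wpM2l//.
    rewrite (normal_pdfE _ s20) /normal_fun ler_wpM2l ?normal_peak_ge0//.
    rewrite subr0 sqr_sqrtr// mulNr expRN lef_pV2 ?posrE ?expR_gt0//.
    apply: le_trans (expR_ge1Dx _).
    have e : x ^+ 2 = `|x| ^+ 2 by rewrite real_normK// num_real.
    rewrite e (_ : 2 *+ 2 = 4 :> R); last by ring.
    by set y := `|x|; have := sqr_ge0 (y - 2); nra.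
  apply: cvg_EFin; first exact: nearW.
  have Kh : (2 * K) * (@harmonic R n) @[n --> \oo] --> 0.
    by rewrite -[X in _ --> X](mulr0 (2 * K)); apply: cvgM; [exact: cvg_cst|exact: cvg_harmonic].
  apply: norm_cvg0; apply: (squeeze_cvgr _ (cvg_cst 0) Kh).
  apply: nearW => n; rewrite normr_ge0/= (le_trans (ler_normB _ _))//.
  have n0 : 0 < n.+1%:R :> R by rewrite ltr0n.
  have h1 := bG n.+1%:R; have h2 := bG (- n.+1%:R).
  rewrite normrN gtr0_norm// in h2; rewrite gtr0_norm// in h1.
  by rewrite -mulrA mulr_natl mulr2n lerD// ?h1// ?h2.
exact: (cvg_unique _ L1 L2).
Unshelve. all: end_near. Qed.

End normal.

Section gaussian_family.
Context {R : realType}.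

(* Independent standard Gaussians, known only through their moments and integration by parts:
   both are preserved by the products and reindexings used below. *)
Record gfam d (T : measurableType d) (P : probability T R) (I : finType)
    (X : I -> T -> R) : Prop := {
  gf_meas : forall i, measurable_fun setT (X i);
  gf_mom : forall i k, L1 P (fun w => `|X i w| ^+ k);
  gf_ibp : forall f df, smooth1 f df -> forall i,
    Ex P (fun w => X i w * f (X^~ w)) = Ex P (fun w => df i (X^~ w)) }.

Lemma exprD_le (a b : R) k : 0 <= a -> 0 <= b ->
  (a + b) ^+ k <= 2 ^+ k * (a ^+ k + b ^+ k).
Proof.
move=> a0 b0; wlog ab : a b a0 b0 / a <= b.
  move=> H; have [ab|/ltW ba] := leP a b; first exact: H.
  by have := H b a b0 a0 ba; rewrite addrC [b ^+ k + _]addrC.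
apply: (@le_trans _ _ ((2 * b) ^+ k)).
  by rewrite lerXn2r ?nnegrE ?addr_ge0 ?mulr_ge0// mulr_natl mulr2n lerD2r.
by rewrite exprMn ler_wpM2l ?exprn_ge0// lerDr exprn_ge0.
Qed.

Lemma measurable_norm d (T : measurableType d) (f : T -> R) :
  measurable_fun setT f -> measurable_fun setT (fun w => `|f w|).
Proof. by move=> mf; exact: (measurableT_comp (@normr_measurable R setT) mf). Qed.

Section lemmas.
Context d (T : measurableType d) (P : probability T R) (I : finType) (X : I -> T -> R).
Hypothesis gX : gfam P X.

Lemma gfam_vbnd k : L1 P (fun w => vbnd (X^~ w) ^+ k).
Proof.
suff H (s : seq I) : L1 P (fun w => (1 + \sum_(i <- s) `|X i w|) ^+ k) by exact: H.
elim: s => [|i s IH].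
  by under eq_fun do rewrite big_nil addr0; exact: L1_cst.
apply: (L1_le _ _ (L1Z (2 ^+ k) (L1D (gf_mom gX i k) IH))).
  apply: measurable_funX; apply: measurable_funD => //.
  by apply: measurable_sum => j; apply: measurable_norm; exact: (gf_meas gX).
move=> w; rewrite big_cons ger0_norm.
  by rewrite addrCA exprD_le// addr_ge0// sumr_ge0.
by rewrite exprn_ge0// !addr_ge0// sumr_ge0.
Qed.

Lemma gfam_L1 f : nice f -> L1 P (fun w => f (X^~ w)).
Proof.
move=> [mf [C [k bf]] _]; apply: (L1_le _ _ (L1Z C (gfam_vbnd k))).
  exact: mf (gf_meas gX).
by move=> w; exact: bf.
Qed.

Lemma gfam_meas f : nice f -> measurable_fun setT (fun w => f (X^~ w)).
Proof. by move=> [mf _ _]; exact: mf (gf_meas gX). Qed.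

End lemmas.
End gaussian_family.

(** * From mutual independence to joint laws and integration by parts *)

Section independent_gaussians.
Context {R : realType} {d : measure_display} {T : measurableType d}.
Variables (P : probability T R) (I0 : eqType) (g : I0 -> T -> R).
Hypothesis hg : forall i, standard_gaussian P (g i).
Hypothesis ig : mutually_independent P g.

Let mg i : measurable_fun setT (g i). Proof. by case: (hg i). Qed.

Definition gvec n (s : n.-tuple I0) (w : T) : n.-tuple R := map_tuple (g^~ w) s.

Lemma measurable_gvec n (s : n.-tuple I0) : measurable_fun setT (gvec s).
Proof.
apply/measurable_fun_tnthP => i.
by rewrite (_ : _ \o _ = g (tnth s i))//; apply/funext => w /=; rewrite tnth_map.
Qed.

Definition gcyl (J : seq I0) (B : I0 -> set R) : set T :=
  \bigcap_(i in [set i | i \in J]) (g i @^-1` B i).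

Lemma gcyl_cons i J B : gcyl (i :: J) B = (g i @^-1` B i) `&` gcyl J B.
Proof.
apply/seteqP; split=> w.
  by move=> H; split; [apply: H => /=; rewrite mem_head|move=> j /= jJ; apply: H => /=; rewrite inE jJ orbT].
by move=> [H1 H2] j /=; rewrite inE => /predU1P[->//|jJ]; exact: H2.
Qed.

Lemma measurable_gcyl J B : (forall i, measurable (B i)) -> measurable (gcyl J B).
Proof.
move=> mB; elim: J => [|i J IH].
  by rewrite (_ : gcyl _ _ = setT)//; apply/seteqP; split.
rewrite gcyl_cons; apply: measurableI => //.
by rewrite -[_ @^-1` _]setTI; exact: mg.
Qed.

Lemma eq_gcyl J B B' : (forall i, i \in J -> B i = B' i) -> gcyl J B = gcyl J B'.
Proof.
by move=> H; apply/seteqP; split=> w h j jJ; have := h _ jJ; rewrite H.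
Qed.

(** Induction on the length of the block. The law of the pair (first coordinate, remaining block),
    and the same law conditioned on the cylinder, both agree with a product measure on rectangles.
    Uniqueness of product measures extends the agreement to all measurable sets, and comparing the
    two laws gives independence. *)
Lemma gvec_indep n (s : n.-tuple I0) (J : seq I0) B (A : set (n.-tuple R)) :
  uniq (s ++ J) -> (forall i, measurable (B i)) -> measurable A ->
  P ((gvec s @^-1` A) `&` gcyl J B) =
  (P (gvec s @^-1` A) * \prod_(i <- J) P (g i @^-1` B i))%E.
Proof.
elim: n s J B A => [|n IH] s J B A us mB mA.
  have uJ : uniq J by move: us; rewrite (tuple0 s).
  have [A0|A0] := pselect (A [tuple]).
    have -> : gvec s @^-1` A = setT.
      by apply/seteqP; split=> // w _ /=; rewrite (tuple0 (gvec s w)).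
    by rewrite setTI probability_setT mul1e; exact: ig.
  have -> : gvec s @^-1` A = set0.
    by apply/seteqP; split=> // w /=; rewrite (tuple0 (gvec s w)).
  by rewrite set0I measure0 mul0e.
case/tupleP: s us => i s us.
have {}us : uniq (s ++ i :: J) by rewrite -cat1s uniq_catCA.
have usJ : uniq (s ++ [:: i]).
  by move: us; rewrite -cat1s catA cat_uniq => /andP[].
pose psi w : (measurableTypeR R * n.-tuple R)%type := (g i w, gvec s w).
have mpsi : measurable_fun setT psi.
  by apply: measurable_fun_pair; [exact: mg|exact: measurable_gvec].
pose A' := [set zt : measurableTypeR R * n.-tuple R | A [tuple of zt.1 :: zt.2]].
have mA' : measurable A'.
  have mc : measurable_fun setT (fun zt : measurableTypeR R * n.-tuple R => [the n.+1.-tuple R of zt.1 :: zt.2]).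
    exact: measurable_cons.
  by rewrite -[A']setTI; exact: mc.
have eA : gvec [tuple of i :: s] @^-1` A = psi @^-1` A'.
  apply/seteqP; split=> w /=; rewrite /A' /=.
    by rewrite (_ : gvec _ w = [tuple of g i w :: gvec s w])//; exact: val_inj.
  by rewrite (_ : gvec _ w = [tuple of g i w :: gvec s w])//; exact: val_inj.
have mE := measurable_gcyl J mB.
have ePg j D : measurable D -> P (g j @^-1` D) = normal_prob 0 1 D by case: (hg j) => _; exact.
have uJ : uniq J by move: us; rewrite cat_uniq /= => /and3P[_ _ /andP[]].
set c : \bar R := (\prod_(j <- J) P (g j @^-1` B j))%E.
have cE : c = P (gcyl J B) by rewrite /c -ig.
have rect B0 A0 (J1 : seq I0) : uniq (s ++ i :: J1) -> measurable B0 -> measurable A0 ->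
    P (psi @^-1` (B0 `*` A0) `&` gcyl J1 B) =
    (normal_prob 0 1 B0 * P (gvec s @^-1` A0) * \prod_(j <- J1) P (g j @^-1` B j))%E.
  move=> us1 mB0 mA0.
  have iJ1 : i \notin J1 by move: us1; rewrite cat_uniq /= => /and3P[_ _ /andP[]].
  (* Coordinate [i] is moved from the vector into the cylinder, where the induction hypothesis
     applies. *)
  pose B' j := if j == i then B0 else B j.
  have mB' j : measurable (B' j) by rewrite /B'; case: eqP => _; [exact: mB0|exact: mB].
  have -> : psi @^-1` (B0 `*` A0) `&` gcyl J1 B = (gvec s @^-1` A0) `&` gcyl (i :: J1) B'.
    rewrite gcyl_cons {1}/B' eqxx -(@eq_gcyl J1 B) => [|j jJ].
      by apply/seteqP; split=> w; [move=> [[a b] e]|move=> [b [a e]]]; do !split.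
    by rewrite /B'; case: eqP => // ji; rewrite -ji jJ in iJ1.
  rewrite IH// big_cons {1}/B' eqxx ePg// muleCA muleA; congr (_ * _)%E.
  by apply: eq_big_seq => j jJ; rewrite /B'; case: eqP => // ji; rewrite -ji jJ in iJ1.
rewrite eA.
pose psim : {mfun T >-> (measurableTypeR R * n.-tuple R)%type} := mfun_Sub (mem_set mpsi).
pose gvm : {mfun T >-> n.-tuple R} := mfun_Sub (mem_set (measurable_gvec s)).
have law1 : P (psi @^-1` A') = ((normal_prob 0 1 : probability _ R) \x distribution P gvm)%E A'.
  have := @product_measure_unique _ _ _ _ _ (normal_prob 0 1 : probability _ R)
    (distribution P gvm) (distribution P psim).
  move=> /(_ _ A' mA') -> //  B0 A0 mB0 mA0.
  have := rect B0 A0 [::] usJ mB0 mA0; rewrite big_nil mule1 => <-.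
  rewrite /distribution /pushforward/=; congr (P _).
  by apply/seteqP; split=> w // [].
(* Conditioning divides by the probability of the cylinder; if that is 0, both sides vanish. *)
have [c00|cn0] := eqVneq c 0%E.
  rewrite c00 mule0; apply/eqP; rewrite eq_le measure_ge0 andbT -c00 cE.
  apply: le_measure; rewrite ?inE//.
  by apply: measurableI => //; rewrite -[_ @^-1` _]setTI; exact: (mpsi measurableT A' mA').
have fc : c \is a fin_num by rewrite cE fin_num_measure.
have c1 : 0 < fine c.
  by rewrite fine_gt0// ltey_eq fc andbT lt_neqAle eq_sym cn0 cE measure_ge0.
have ci0 : 0 <= (fine c)^-1 by rewrite invr_ge0 ltW.
pose mJ0 : {measure set (measurableTypeR R * n.-tuple R) -> \bar R} :=
  mscale (NngNum ci0) (pushforward (mrestr P mE) psi).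
pose mJ := mJ0 mpsi.
have law2 : mJ A' = ((normal_prob 0 1 : probability _ R) \x distribution P gvm)%E A'.
  have := @product_measure_unique _ _ _ _ _ (normal_prob 0 1 : probability _ R)
    (distribution P gvm) mJ.
  move=> /(_ _ A' mA') -> //  B0 A0 mB0 mA0.
  rewrite -[LHS]/((fine c)^-1%:E * P (psi @^-1` (B0 `*` A0) `&` gcyl J B))%E.
  rewrite (rect B0 A0 J)// -/c -[in X in (_ * (_ * X))%E](fineK fc) muleC -muleA -EFinM.
  by rewrite mulfV ?gt_eqF// mule1.
rewrite law1 -law2 -[mJ A']/((fine c)^-1%:E * P (psi @^-1` A' `&` gcyl J B))%E.
by rewrite -[c](fineK fc) muleAC -EFinM mulVf ?gt_eqF// mul1e.
Qed.

Let gvm n (s : n.-tuple I0) : {mfun T >-> n.-tuple R} := mfun_Sub (mem_set (measurable_gvec s)).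

Lemma law_pair n (s : n.-tuple I0) i (A : set (measurableTypeR R * n.-tuple R)) :
  uniq (i :: s) -> measurable A ->
  P ((fun w => (g i w, gvec s w)) @^-1` A) =
  ((normal_prob 0 1 : probability _ R) \x distribution P (gvm s))%E A.
Proof.
move=> us mA.
pose psi w : (measurableTypeR R * n.-tuple R)%type := (g i w, gvec s w).
have mpsi : measurable_fun setT psi.
  by apply: measurable_fun_pair; [exact: mg|exact: measurable_gvec].
pose psim : {mfun T >-> (measurableTypeR R * n.-tuple R)%type} := mfun_Sub (mem_set mpsi).
have := @product_measure_unique _ _ _ _ _ (normal_prob 0 1 : probability _ R)
  (distribution P (gvm s)) (distribution P psim).
move=> /(_ _ A mA) -> // B0 A0 mB0 mA0.
have us1 : uniq (s ++ [:: i]) by rewrite cats1 rcons_uniq.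
have := gvec_indep us1 (fun=> mB0) mA0.
rewrite gcyl_cons (_ : gcyl [::] _ = setT); last by apply/seteqP; split.
rewrite setIT big_cons big_nil mule1.
have -> : P (g i @^-1` B0) = normal_prob 0 1 B0 by case: (hg i) => _; exact.
rewrite muleC => <-; rewrite /distribution /pushforward/=; congr (P _).
by apply/seteqP; split=> w; move=> [].
Qed.

Lemma integral_law_pair n (s : n.-tuple I0) i (K : R * n.-tuple R -> R) :
  uniq (i :: s) ->
  measurable_fun setT (K : measurableTypeR R * n.-tuple R -> R) ->
  L1 P (fun w => K (g i w, gvec s w)) ->
  (\int[P]_w (K (g i w, gvec s w))%:E =
   \int[distribution P (gvm s)]_t \int[normal_prob 0 1]_z (K (z, t))%:E)%E.
Proof.
move=> us mK iK.
pose psi w : (measurableTypeR R * n.-tuple R)%type := (g i w, gvec s w).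
have mpsi : measurable_fun setT psi.
  by apply: measurable_fun_pair; [exact: mg|exact: measurable_gvec].
pose K' : measurableTypeR R * n.-tuple R -> \bar R := EFin \o K.
have mK' : measurable_fun setT K' by exact/measurable_EFinP.
pose mu2 := ((normal_prob 0 1 : probability _ R) \x distribution P (gvm s))%E.
pose mu1 : {measure set (measurableTypeR R * n.-tuple R) -> \bar R} := pushforward P psi.
have emu : forall A, measurable A -> A `<=` setT -> mu1 mpsi A = mu2 A.
  by move=> A mA _; exact: law_pair.
have i1 : (mu1 mpsi).-integrable setT K' by exact: integrable_pushforward.
have i2 : mu2.-integrable setT K'.
  move/integrableP : i1 => [_ h]; apply/integrableP; split => //.
  by rewrite -(eq_measure_integral mu2 emu).
have -> : (\int[P]_w (K (g i w, gvec s w))%:E = \int[mu1 mpsi]_x K' x)%E.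
  by rewrite integral_pushforward.
by rewrite (eq_measure_integral mu2 emu) -integral21_prod_meas1.
Qed.

Lemma L1_g i k : L1 P (fun w => `|g i w| ^+ k).
Proof.
pose mu1 : {measure set (measurableTypeR R) -> \bar R} :=
  pushforward P (g i : T -> measurableTypeR R).
have mgi : measurable_fun setT (g i : T -> measurableTypeR R) by exact: mg.
pose h : measurableTypeR R -> R := fun z => `|z| ^+ k.
have mh : measurable_fun setT (EFin \o h).
  by apply/measurable_EFinP; apply: measurable_funX; exact: measurable_norm.
have i2 : (normal_prob 0 1 : probability _ R).-integrable setT (EFin \o h).
  apply: (@normal_L1 _ _ 1 k); first exact/measurable_EFinP.
  move=> x; rewrite mul1r ger0_norm ?exprn_ge0// lerXn2r ?nnegrE ?addr_ge0//.
  by rewrite lerDr.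
have emu : forall A, measurable A -> A `<=` setT -> mu1 mgi A = normal_prob 0 1 A.
  by move=> A mA _; case: (hg i) => _; exact.
have i1 : (mu1 mgi).-integrable setT (EFin \o h).
  move/integrableP : i2 => [_ hh]; apply/integrableP; split => //.
  by rewrite (eq_measure_integral (normal_prob 0 1) emu).
rewrite /L1; apply/integrableP; split.
  by apply/measurable_EFinP; apply: measurable_funX; apply: measurable_norm; exact: mg.
move/integrableP : i1 => [_]; rewrite ge0_integral_pushforward//.
exact: measurableT_comp.
Qed.

Lemma measurable_nth n k : measurable_fun setT (fun t : n.-tuple R => nth 0 t k).
Proof.
have [kn|kn] := ltnP k n.
  rewrite (_ : (fun t => _) = (fun t : n.-tuple R => tnth t (Ordinal kn))).
    exact: measurable_tnth.
  by apply/funext => t; rewrite (tnth_nth 0).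
rewrite (_ : (fun t => _) = cst 0); first exact: measurable_cst.
by apply/funext => t; rewrite nth_default// size_tuple.
Qed.

(** Fubini for the joint law of coordinate [i] and the tuple of all others reduces the claim to
    [normal_ibp] in one variable, with the other coordinates frozen. *)
Lemma gfam_indep (I : finType) (iota : I -> I0) : injective iota ->
  gfam P (fun i => g (iota i)).
Proof.
move=> inj; split; [by move=> i; exact: mg|by move=> i k; exact: L1_g|].
move=> f df [nf ndf cf] i.
pose s0 := [seq iota j | j <- enum (predC1 i)].
pose s : (size s0).-tuple I0 := in_tuple s0.
have us : uniq (iota i :: s).
  rewrite /= (map_inj_uniq inj) enum_uniq andbT.
  by rewrite (mem_map inj) mem_enum !inE eqxx.
(* [rec] rebuilds the whole family from coordinate [i] and the tuple of the others. *)
pose rec (zt : R * (size s0).-tuple R) : I -> R :=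
  fun j => if j == i then zt.1 else nth 0 zt.2 (index (iota j) s0).
have recE w : rec (g (iota i) w, gvec s w) = (fun j => g (iota j) w).
  apply/funext => j; rewrite /rec /=; case: eqP => [->//|/eqP ji].
  have js : iota j \in s0 by rewrite (mem_map inj) mem_enum !inE.
  by rewrite (nth_map (iota j)) ?index_mem// nth_index.
have mrec j : measurable_fun setT (fun zt : measurableTypeR R * (size s0).-tuple R => rec zt j).
  rewrite /rec; case: eqP => _; first exact: measurable_fst.
  have := measurableT_comp (@measurable_nth (size s0) (index (iota j) s0))
    (@measurable_snd _ _ (measurableTypeR R) ((size s0).-tuple R)).
  by [].
pose K1 zt := zt.1 * f (rec zt).
pose K2 zt := df i (rec zt).
have mK1 : measurable_fun setT (K1 : measurableTypeR R * (size s0).-tuple R -> R).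
  apply: measurable_funM; first exact: measurable_fst.
  by case: nf => mf _ _; exact: (mf _ _ (fun j zt => rec zt j)).
have mK2 : measurable_fun setT (K2 : measurableTypeR R * (size s0).-tuple R -> R).
  by case: (ndf i) => mf _ _; exact: (mf _ _ (fun j zt => rec zt j)).
have L1X h : nice h -> L1 P (fun w => h (fun j => g (iota j) w)).
  move=> [mh [C [k bh]] _].
  have lv : L1 P (fun w => vbnd (fun j => g (iota j) w) ^+ k).
    suff H (r : seq I) : L1 P (fun w => (1 + \sum_(j <- r) `|g (iota j) w|) ^+ k) by exact: H.
    elim: r => [|j r IH]; first by under eq_fun do rewrite big_nil addr0; exact: L1_cst.
    apply: (L1_le _ _ (L1Z (2 ^+ k) (L1D (L1_g (iota j) k) IH))).
      apply: measurable_funX; apply: measurable_funD => //.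
      by apply: measurable_sum => l; apply: measurable_norm; exact: mg.
    move=> w; rewrite big_cons ger0_norm.
      by rewrite addrCA exprD_le// addr_ge0// sumr_ge0.
    by rewrite exprn_ge0// !addr_ge0// sumr_ge0.
  apply: (L1_le _ _ (L1Z C lv)) => [|w]; last exact: bh.
  by apply: (mh _ _ (fun j w => g (iota j) w)) => j; exact: mg.
have iK1 : L1 P (fun w => K1 (g (iota i) w, gvec s w)).
  rewrite (_ : (fun w => _) = (fun w => g (iota i) w * f (fun j => g (iota j) w))).
    by apply: (L1X (fun u => u i * f u)); apply: niceM => //; exact: nice_proj.
  by apply/funext => w; rewrite /K1 recE.
have iK2 : L1 P (fun w => K2 (g (iota i) w, gvec s w)).
  rewrite (_ : (fun w => _) = (fun w => df i (fun j => g (iota j) w))); first exact: L1X.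
  by apply/funext => w; rewrite /K2 recE.
rewrite /Ex /Rintegral; congr fine.
transitivity (\int[P]_w (K1 (g (iota i) w, gvec s w))%:E)%E.
  by apply: eq_integral => w _; rewrite /K1 recE.
transitivity (\int[P]_w (K2 (g (iota i) w, gvec s w))%:E)%E; last first.
  by apply: eq_integral => w _; rewrite /K2 recE.
rewrite (integral_law_pair us mK1 iK1) (integral_law_pair us mK2 iK2).
apply: eq_integral => t _.
have [C [k [C0 bf]]] := pbd_posC (let: And3 _ b _ := nf in b).
have [C' [k' [C0' bf']]] := pbd_posC (let: And3 _ b _ := ndf i in b).
set S := \sum_j `|rec (0, t) j|.
have S0 : 0 <= S by apply: sumr_ge0.
(* The bound factors into a frozen part and a part in [z], which gives the polynomial growth in one
   variable that [normal_ibp] asks for. *)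
have vb z : vbnd (rec (z, t)) <= (1 + S) * (1 + `|z|).
  have -> : vbnd (rec (z, t)) = 1 + (`|z| + S).
    rewrite /vbnd /S (bigD1 i)//= [in RHS](bigD1 i)//= {1 3}/rec /= eqxx normr0 add0r.
    by congr (_ + (_ + _)); apply: eq_bigr => j ji; rewrite /rec (negPf ji).
  by have := normr_ge0 z; nra.
have mz : measurable_fun setT (fun z : R => (z, t) : measurableTypeR R * (size s0).-tuple R).
  by apply: measurable_fun_pair; [exact: measurable_id|exact: measurable_cst].
have bb D l (h : (I -> R) -> R) : 0 <= D -> (forall u, `|h u| <= D * vbnd u ^+ l) -> (l <= k + k')%N ->
    forall z, `|h (rec (z, t))| <= D * (1 + S) ^+ l * (1 + `|z|) ^+ (k + k').
  move=> D0 bh lk z; rewrite (le_trans (bh _))// -mulrA ler_wpM2l//.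
  apply: (@le_trans _ _ (((1 + S) * (1 + `|z|)) ^+ l)).
    by rewrite lerXn2r ?nnegrE// ?(le_trans ler01 (vbnd_ge1 _))// mulr_ge0// addr_ge0.
  rewrite exprMn ler_wpM2l ?exprn_ge0 ?addr_ge0//.
  by rewrite ler_weXn2l// lerDl.
pose E := Num.max (C * (1 + S) ^+ k) (C' * (1 + S) ^+ k').
have e1 z : `|f (rec (z, t))| <= E * (1 + `|z|) ^+ (k + k').
  rewrite (le_trans (bb _ _ _ C0 bf _ z)) ?leq_addr// ler_wpM2r ?exprn_ge0 ?addr_ge0//.
  by rewrite le_max lexx.
have e2 z : `|df i (rec (z, t))| <= E * (1 + `|z|) ^+ (k + k').
  rewrite (le_trans (bb _ _ _ C0' bf' _ z)) ?leq_addl// ler_wpM2r ?exprn_ge0 ?addr_ge0//.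
  by rewrite le_max lexx orbT.
have dd (z : R) : is_derive z (1 : R) (fun z => f (rec (z, t))) (df i (rec (z, t))).
  have := cf (fun z => rec (z, t)) (fun j => (j == i)%:R) z.
  rewrite (bigD1 i)//= eqxx mulr1 big1 ?addr0; last by move=> j /negPf ->; rewrite mulr0.
  apply=> j; rewrite /rec /=; case: eqP => _; first exact: is_derive_id.
  exact: is_derive_cst.
have cc : continuous (fun z => df i (rec (z, t))).
  move=> z; case: (ndf i) => _ _ cdfi.
  apply: (cdfi _ _ _ (fun z => rec (z, t)) (rec (z, t))) => j.
  by rewrite /rec /=; case: eqP => _; [exact: cvg_id|exact: cvg_cst].
have := normal_ibp dd cc e1 e2.
have l1 : (normal_prob 0 1 : probability _ R).-integrable setT (EFin \o (fun z => K1 (z, t))).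
  apply: (@normal_L1 _ _ E (k + k').+1); first exact: (measurableT_comp mK1 mz).
  by move=> z; rewrite /K1 /= normrM exprS mulrCA ler_pM// lerDr.
have l2 : (normal_prob 0 1 : probability _ R).-integrable setT (EFin \o (fun z => K2 (z, t))).
  by apply: (@normal_L1 _ _ E (k + k')) => //; exact: (measurableT_comp mK2 mz).
rewrite /Rintegral => e.
rewrite -[LHS]fineK; last exact: (integrable_fin_num measurableT l1).
rewrite -[RHS]fineK; last exact: (integrable_fin_num measurableT l2).
by congr (_%:E).
Qed.

End independent_gaussians.

(** * Product spaces *)

Section product_probability.
Context {R : realType} {d1 d2 : measure_display}.
Context {T1 : measurableType d1} {T2 : measurableType d2}.
Variables (P : probability T1 R) (Q : probability T2 R).

(** The product measure under its own name, so that it can carry a probability structure and serve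
    as the base space of [Ex] and [gfam]. *)
Definition pprod : set (T1 * T2) -> \bar R := (P \x Q)%E.

HB.instance Definition _ := Measure.on pprod.

Let pprod_setT : pprod setT = 1%E.
Proof.
rewrite /pprod -setXTT product_measure1E//.
by rewrite [X in (X * _)%E](@probability_setT _ _ _ P) [X in (_ * X)%E](@probability_setT _ _ _ Q) mul1e.
Qed.

HB.instance Definition _ := @Measure_isProbability.Build _ _ R pprod pprod_setT.

End product_probability.

Section fubini.
Context {R : realType} {d1 d2 : measure_display}.
Context {T1 : measurableType d1} {T2 : measurableType d2}.
Variables (P : probability T1 R) (Q : probability T2 R).
Local Notation PQ := (pprod P Q : probability _ R).

Lemma Ex_pprod12 (f : T1 * T2 -> R) : L1 PQ f ->
  (forall x, L1 Q (fun y => f (x, y))) ->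
  Ex PQ f = Ex P (fun x => Ex Q (fun y => f (x, y))).
Proof.
move=> iF iy; rewrite /Ex /Rintegral; congr fine.
rewrite -[LHS](integral12_prod_meas1 (m1 := P) (m2 := Q))//.
apply: eq_integral => x _; rewrite fineK//.
exact: (integrable_fin_num measurableT (iy x)).
Qed.

Lemma Ex_pprod21 (f : T1 * T2 -> R) : L1 PQ f ->
  (forall y, L1 P (fun x => f (x, y))) ->
  Ex PQ f = Ex Q (fun y => Ex P (fun x => f (x, y))).
Proof.
move=> iF ix; rewrite /Ex /Rintegral; congr fine.
rewrite -[LHS](integral21_prod_meas1 (m1 := P) (m2 := Q))//.
apply: eq_integral => y _; rewrite fineK//.
exact: (integrable_fin_num measurableT (ix y)).
Qed.

Lemma L1_inner (f : T1 * T2 -> R) : L1 PQ f ->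
  (forall x, L1 Q (fun y => f (x, y))) -> L1 P (fun x => Ex Q (fun y => f (x, y))).
Proof.
move=> iF iy.
have := integrable_fubini_F (m1 := P) (m2 := Q) iF.
apply: eq_integrable => // x _; rewrite /= /Ex /Rintegral fineK//.
exact: (integrable_fin_num measurableT (iy x)).
Qed.

Lemma L1_fst (f : T1 -> R) : L1 P f -> L1 PQ (fun z => f z.1).
Proof.
move=> iF; apply/integrableP; split.
  apply/measurable_EFinP; exact: (measurableT_comp (L1_meas iF) measurable_fst).
rewrite (_ : (\int[PQ]_x _ = \int[P]_x `|(f x)%:E|)%E); first by case/integrableP : iF.
transitivity (\int[P]_x \int[Q]_y `|(f x)%:E|)%E.
  apply: (fubini_tonelli1 (m1 := P) (m2 := Q) (fun z => `|(f z.1)%:E|%E)) => //.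
  apply: measurableT_comp => //; apply/measurable_EFinP.
  exact: (measurableT_comp (L1_meas iF) measurable_fst).
by apply: eq_integral => x _; rewrite integral_cst// [X in (_ * X)%E](@probability_setT _ _ _ Q) mule1.
Qed.

Lemma L1_snd (f : T2 -> R) : L1 Q f -> L1 PQ (fun z => f z.2).
Proof.
move=> iF; apply/integrableP; split.
  apply/measurable_EFinP; exact: (measurableT_comp (L1_meas iF) measurable_snd).
rewrite (_ : (\int[PQ]_x _ = \int[Q]_x `|(f x)%:E|)%E); first by case/integrableP : iF.
transitivity (\int[Q]_y \int[P]_x `|(f y)%:E|)%E.
  apply: (fubini_tonelli2 (m1 := P) (m2 := Q) (fun z => `|(f z.2)%:E|%E)) => //.
  apply: measurableT_comp => //; apply/measurable_EFinP.
  exact: (measurableT_comp (L1_meas iF) measurable_snd).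
by apply: eq_integral => x _; rewrite integral_cst// [X in (_ * X)%E](@probability_setT _ _ _ P) mule1.
Qed.

Definition sumv (I J : Type) (u : I -> R) (v : J -> R) (k : I + J) : R :=
  match k with inl i => u i | inr j => v j end.

Definition sumf (I J : Type) (X : I -> T1 -> R) (Y : J -> T2 -> R) (k : I + J) (z : T1 * T2) : R :=
  match k with inl i => X i z.1 | inr j => Y j z.2 end.

Lemma sumfE I J (X : I -> T1 -> R) (Y : J -> T2 -> R) z :
  (sumf X Y)^~ z = sumv (X^~ z.1) (Y^~ z.2).
Proof. by apply/funext => -[]. Qed.

Lemma smooth1_suml (I J : finType) (f : (I + J -> R) -> R) df v : smooth1 f df ->
  smooth1 (fun u : I -> R => f (sumv u v)) (fun i u => df (inl i) (sumv u v)).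
Proof.
move=> [nf ndf cf].
have nc h : nice h -> nice (fun u : I -> R => h (sumv u v)).
  move=> nh; have -> : (fun u => h (sumv u v)) =
      (fun u => h (fun k => (match k with inl i => fun u : I -> R => u i | inr j => fun=> v j end) u)).
    by apply/funext => u; congr h; apply/funext => -[].
  by apply: nice_comp => // -[i|j]; [exact: nice_proj|exact: nice_cst].
split; [exact: nc|by move=> i; exact: nc|].
move=> u u' t du.
have := cf (fun s => sumv (u s) v) (sumv u' (fun=> 0)) t.
rewrite big_sumType/= [X in _ + X]big1 ?addr0 => [|j _]; last by rewrite mulr0.
by apply=> -[i|j] /=; [exact: du|exact: is_derive_cst].
Qed.

Lemma smooth1_sumr (I J : finType) (f : (I + J -> R) -> R) df u : smooth1 f df ->
  smooth1 (fun v : J -> R => f (sumv u v)) (fun j v => df (inr j) (sumv u v)).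
Proof.
move=> [nf ndf cf].
have nc h : nice h -> nice (fun v : J -> R => h (sumv u v)).
  move=> nh; have -> : (fun v => h (sumv u v)) =
      (fun v => h (fun k => (match k with inl i => fun=> u i | inr j => fun v : J -> R => v j end) v)).
    by apply/funext => v; congr h; apply/funext => -[].
  by apply: nice_comp => // -[i|j]; [exact: nice_cst|exact: nice_proj].
split; [exact: nc|by move=> i; exact: nc|].
move=> v v' t dv.
have := cf (fun s => sumv u (v s)) (sumv (fun=> 0) v') t.
rewrite big_sumType/= [X in X + _]big1 ?add0r => [|j _]; last by rewrite mulr0.
by apply=> -[i|j] /=; [exact: is_derive_cst|exact: dv].
Qed.

(** Fubini with the other factor innermost or outermost: for a coordinate of one factor, the other
    factor is frozen and its variables become parameters of the test function. Independent copies of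
    the disorder are built this way. *)
Lemma gfam_prod (I J : finType) (X : I -> T1 -> R) (Y : J -> T2 -> R) :
  gfam P X -> gfam Q Y -> gfam PQ (sumf X Y).
Proof.
move=> gX gY.
have mZ k : measurable_fun setT (sumf X Y k).
  case: k => k.
    exact: (measurableT_comp (gf_meas gX k) measurable_fst).
  exact: (measurableT_comp (gf_meas gY k) measurable_snd).
have Zmom i k : L1 PQ (fun w => `|sumf X Y i w| ^+ k).
  case: i => i; first exact: L1_fst (gf_mom gX i k).
  exact: L1_snd (gf_mom gY i k).
have L1Z h : nice h -> L1 PQ (fun w => h ((sumf X Y)^~ w)).
  move=> [mh [C [k bh]] _].
  have lv : L1 PQ (fun w => vbnd ((sumf X Y)^~ w) ^+ k).
    suff H (r : seq (I + J)) : L1 PQ (fun w => (1 + \sum_(j <- r) `|sumf X Y j w|) ^+ k) by exact: H.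
    elim: r => [|j r IH]; first by under eq_fun do rewrite big_nil addr0; exact: L1_cst.
    apply: (L1_le _ _ (L1Z (2 ^+ k) (L1D (Zmom j k) IH))).
      apply: measurable_funX; apply: measurable_funD => //.
      by apply: measurable_sum => l; apply: measurable_norm; exact: mZ.
    move=> w; rewrite big_cons ger0_norm.
      by rewrite addrCA exprD_le// addr_ge0// sumr_ge0.
    by rewrite exprn_ge0// !addr_ge0// sumr_ge0.
  apply: (L1_le _ _ (L1Z C lv)) => [|w]; last exact: bh.
  exact: mh mZ.
split=> // f df sf [i|j].
- have [nf ndf _] := sf.
  have s1 y := smooth1_suml y sf.
  rewrite (Ex_pprod21 (f := fun z => X i z.1 * f ((sumf X Y)^~ z))).
  + rewrite (Ex_pprod21 (f := fun z => df (inl i) ((sumf X Y)^~ z))).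
    * congr (Ex Q _); apply/funext => y.
      under eq_fun do rewrite sumfE.
      rewrite (gf_ibp gX (s1 (Y^~ y)) i).
      by apply: eq_Rintegral => x _; rewrite sumfE.
    * exact: L1Z.
    * move=> y; have [_ nn _] := s1 (Y^~ y).
      by under eq_fun do rewrite sumfE; exact: (gfam_L1 gX (nn i)).
  + by apply: (L1Z (fun u => u (inl i) * f u)); apply: niceM => //; exact: nice_proj.
  + move=> y; have [nn _ _] := s1 (Y^~ y).
    under eq_fun do rewrite sumfE.
    by apply: (gfam_L1 gX (f := fun u => u i * f (sumv u (Y^~ y)))); apply: niceM => //; exact: nice_proj.
- have [nf ndf _] := sf.
  have s1 x := smooth1_sumr x sf.
  rewrite (Ex_pprod12 (f := fun z => Y j z.2 * f ((sumf X Y)^~ z))).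
  + rewrite (Ex_pprod12 (f := fun z => df (inr j) ((sumf X Y)^~ z))).
    * congr (Ex P _); apply/funext => x.
      under eq_fun do rewrite sumfE.
      rewrite (gf_ibp gY (s1 (X^~ x)) j).
      by apply: eq_Rintegral => y _; rewrite sumfE.
    * exact: L1Z.
    * move=> x; have [_ nn _] := s1 (X^~ x).
      by under eq_fun do rewrite sumfE; exact: (gfam_L1 gY (nn j)).
  + by apply: (L1Z (fun u => u (inr j) * f u)); apply: niceM => //; exact: nice_proj.
  + move=> x; have [nn _ _] := s1 (X^~ x).
    under eq_fun do rewrite sumfE.
    by apply: (gfam_L1 gY (f := fun u => u j * f (sumv (X^~ x) u))); apply: niceM => //; exact: nice_proj.
Qed.

End fubini.

(** * Gaussian interpolation *)

Section interpolation.
Context {R : realType}.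

Lemma derive_le0_le (f df : R -> R) (a b : R) : a <= b ->
  (forall x, is_derive x (1 : R) f (df x)) ->
  (forall x, a < x < b -> df x <= 0) -> f b <= f a.
Proof.
rewrite le_eqVlt => /predU1P[->//|ab] dF dle.
have cf : {within `[a, b], continuous f}.
  apply: continuous_subspaceT => x.
  by apply/differentiable_continuous/derivable1_diffP; case: (dF x).
have [c cab] := MVT ab (fun x _ => dF x) cf.
move=> e; rewrite -subr_le0 e; apply: mulr_le0_ge0; last by rewrite subr_ge0 ltW.
by apply: dle; move: cab; rewrite in_itv.
Qed.

Section ibp.
Context d (T : measurableType d) (P : probability T R) (I M : finType) (X : I -> T -> R).
Hypothesis gX : gfam P X.

Lemma ibp_lin (c : I -> R) (A : M -> I -> R) (f : (M -> R) -> R) df : smooth1 f df ->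
  Ex P (fun w => (\sum_i c i * X i w) * f (lin A (X^~ w))) =
  \sum_m (\sum_i c i * A m i) * Ex P (fun w => df m (lin A (X^~ w))).
Proof.
move=> sf; have [nf ndf _] := sf; have sl := smooth1_lin A sf.
have [nl ndl _] := sl.
have L1m m : L1 P (fun w => df m (lin A (X^~ w))).
  exact: (gfam_L1 gX (nice_lin A (ndf m))).
transitivity (\sum_i c i * Ex P (fun w => X i w * f (lin A (X^~ w)))).
  under eq_fun do rewrite mulr_suml; rewrite Ex_sum.
    apply: eq_bigr => i _; under eq_fun do rewrite -mulrA.
    rewrite ExZ//; apply: (gfam_L1 gX (f := fun u => u i * f (lin A u))).
    by apply: niceM => //; exact: nice_proj.
  move=> i; apply: (gfam_L1 gX (f := fun u => c i * u i * f (lin A u))).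
  by apply: niceM => //; apply: niceZ; exact: nice_proj.
under eq_bigr => i _.
  rewrite (gf_ibp gX sl i) Ex_sum; last first.
    by move=> m; under eq_fun do rewrite mulrC; exact: L1Z.
  under eq_bigr => m _ do under eq_fun do rewrite mulrC.
  under eq_bigr => m _ do rewrite ExZ//.
  rewrite mulr_sumr; under eq_bigr do rewrite mulrA.
  over.
by rewrite exchange_big/=; apply: eq_bigr => m _; rewrite mulr_suml.
Qed.

Variables (U U' : R -> M -> I -> R) (K : R).
Hypothesis dU : forall t m i, is_derive t (1 : R) (fun a => U a m i) (U' t m i).
Hypothesis bU : forall t m i, `|U t m i| <= K.
Hypothesis bU' : forall t m i, `|U' t m i| <= K.

(** Differentiation under the expectation leaves a factor linear in the Gaussians; integrating it by
    parts turns it into a second derivative, with coefficients that are inner products of rows of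
    [U'] and [U]. Only covariances survive. *)
Lemma interpolation (f : (M -> R) -> R) df ddf :
  smooth1 f df -> (forall m, smooth1 (df m) (ddf m)) -> forall t,
  is_derive t (1 : R) (fun a => Ex P (fun w => f (lin (U a) (X^~ w))))
    (\sum_m \sum_m' (\sum_i U' t m i * U t m' i) *
       Ex P (fun w => ddf m m' (lin (U t) (X^~ w)))).
Proof.
move=> sf sdf t; have [nf ndf cf] := sf.
have K0 m i : 0 <= K := le_trans (normr_ge0 _) (bU 0 m i).
pose K1 := 1 + \sum_(m : M) \sum_(i : I) K.
have K10 : 0 <= K1 by rewrite addr_ge0// sumr_ge0// => m _; rewrite sumr_ge0// => i _; exact: K0.
have vU a x : vbnd (lin (U a) x) <= K1 * vbnd x.
  apply: le_trans (vbnd_lin _ _) _.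
  rewrite ler_wpM2r ?(le_trans ler01 (vbnd_ge1 _))// lerD2l ler_sum// => m _.
  by rewrite ler_sum// => i _; exact: bU.
have vU' a x m : `|lin (U' a) x m| <= K1 * vbnd x.
  have h : vbnd (lin (U' a) x) <= K1 * vbnd x.
    apply: le_trans (vbnd_lin _ _) _.
    rewrite ler_wpM2r ?(le_trans ler01 (vbnd_ge1 _))// lerD2l ler_sum// => m' _.
    by rewrite ler_sum// => i _; exact: bU'.
  apply: le_trans h; rewrite /vbnd (bigD1 m)//= addrCA lerDl addr_ge0// sumr_ge0//.
have [C [k [C0 bf]]] : exists C k, 0 <= C /\ forall u, \sum_m `|df m u| <= C * vbnd u ^+ k.
  have : pbd (fun u => \sum_m `|df m u|).
    have nS (s : seq M) : pbd (fun x => \sum_(m <- s) `|df m x|).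
      elim: s => [|m s IH].
        by apply: (@pbd_bounded _ _ _ 0) => u; rewrite big_nil normr0.
      under eq_fun do rewrite big_cons.
      apply: pbdD IH; have [_ [C [k H]] _] := ndf m.
      by exists C, k => u; rewrite normr_id.
    exact: nS.
  move=> /pbd_posC[C [k [C0 H]]]; exists C, k; split => // u.
  by rewrite (le_trans _ (H u))// ler_norm.
pose F a w := f (lin (U a) (X^~ w)).
pose F' a w := \sum_m df m (lin (U a) (X^~ w)) * lin (U' a) (X^~ w) m.
have dF a w : is_derive a (1 : R) (F^~ w) (F' a w).
  apply: (cf (fun a => lin (U a) (X^~ w)) (lin (U' a) (X^~ w)) a) => m.
  rewrite /lin.
  have H i : is_derive a (1 : R) (fun s => U s m i * X i w) (U' a m i * X i w).
    have := is_deriveZ (X i w) (dU a m i).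
    rewrite /GRing.scale/= mulrC (_ : _ \*: _ = (fun s => U s m i * X i w))//.
    by apply/funext => s; rewrite mulrC.
  exact: (is_derive_bsum _ H).
(* A dominating function that does not depend on the parameter, obtained from the uniform bound [K]
   on [U] and [U']. *)
pose G w := C * K1 ^+ k * K1 * vbnd (X^~ w) ^+ k.+1.
have G0 w : 0 <= G w.
  by rewrite !mulr_ge0 ?exprn_ge0// (le_trans ler01 (vbnd_ge1 _)).
have LG : L1 P G by apply: L1Z; exact: gfam_vbnd.
have bG a w : `|F' a w| <= G w.
  apply: (@le_trans _ _ ((\sum_m `|df m (lin (U a) (X^~ w))|) * (K1 * vbnd (X^~ w)))).
    rewrite (le_trans (ler_norm_sum _ _ _))// mulr_suml ler_sum// => m _.
    by rewrite normrM ler_wpM2l.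
  apply: (@le_trans _ _ (C * (K1 * vbnd (X^~ w)) ^+ k * (K1 * vbnd (X^~ w)))).
    rewrite ler_wpM2r ?mulr_ge0 ?(le_trans ler01 (vbnd_ge1 _))//.
    rewrite (le_trans (bf _))// ler_wpM2l// lerXn2r ?nnegrE ?mulr_ge0 ?(le_trans ler01 (vbnd_ge1 _))//.
  by rewrite /G exprMn exprS le_eqVlt; apply/orP; left; apply/eqP; ring.
have LF a : L1 P (F a) by exact: (gfam_L1 gX (nice_lin (U a) nf)).
have p1E a w : partial1of2 F a w = F' a w by rewrite partial1of2E; exact: derive_val.
have It : `]t - 1, t + 1[%classic t by rewrite /= in_itv/= ltrBlDr ltrDl ltr01.
have der x y : `]t - 1, t + 1[%classic x -> setT y -> derivable (F^~ y) x 1.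
  by move=> _ _; case: (dF x y).
have bd x y : `]t - 1, t + 1[%classic x -> setT y -> `|partial1of2 F x y| <= G y.
  by move=> _ _; rewrite p1E.
have D1 := derivable_under_integral measurableT It (fun x _ => LF x) der G0 LG bd.
have D2 := differentiation_under_integral measurableT It (fun x _ => LF x) der G0 LG bd.
apply: DeriveDef; first exact: D1.
rewrite -derive1E [LHS]D2.
under eq_Rintegral do rewrite p1E.
rewrite -/(Ex P (F' t)) /F'.
have Ls m : L1 P (fun w => df m (lin (U t) (X^~ w)) * lin (U' t) (X^~ w) m).
  apply: (gfam_L1 gX (f := fun u => df m (lin (U t) u) * lin (U' t) u m)).
  by apply: niceM; [exact: nice_lin|exact: nice_lin_coord].
rewrite Ex_sum//; apply: eq_bigr => m _.
under eq_fun do rewrite mulrC.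
by rewrite (ibp_lin (U' t m) (U t) (sdf m)).
Qed.

End ibp.

Section law.
Context d1 d2 (T1 : measurableType d1) (T2 : measurableType d2).
Context (P : probability T1 R) (Q : probability T2 R).
Context (I J M : finType) (X : I -> T1 -> R) (Y : J -> T2 -> R).
Hypotheses (gX : gfam P X) (gY : gfam Q Y).

Lemma Ex_fst (f : T1 -> R) : L1 P f -> Ex (pprod P Q) (fun z => f z.1) = Ex P f.
Proof.
move=> iF; rewrite Ex_pprod12; first by apply: eq_Rintegral => x _; exact: (Ex_cst Q (f x)).
  exact: L1_fst.
by move=> x; exact: (L1_cst Q (f x)).
Qed.

Lemma Ex_snd (f : T2 -> R) : L1 Q f -> Ex (pprod P Q) (fun z => f z.2) = Ex Q f.
Proof.
move=> iF; rewrite Ex_pprod21; first by apply: eq_Rintegral => x _; exact: (Ex_cst P (f x)).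
  exact: L1_snd.
by move=> x; exact: (L1_cst P (f x)).
Qed.

(** Along the rotation cos(a) A X + sin(a) B Y of independent families, the derivative carries the
    factor sin(a) cos(a) times the difference of the two covariances, which is 0. Hence the values
    at 0 and pi/2 agree. This is the only form in which equality of Gaussian laws is used. *)
Lemma eq_law (A : M -> I -> R) (B : M -> J -> R) (f : (M -> R) -> R) df ddf :
  (forall m m', \sum_i A m i * A m' i = \sum_j B m j * B m' j) ->
  smooth1 f df -> (forall m, smooth1 (df m) (ddf m)) ->
  Ex P (fun w => f (lin A (X^~ w))) = Ex Q (fun w => f (lin B (Y^~ w))).
Proof.
move=> AB sf sdf; have [nf _ _] := sf.
pose U (a : R) m (k : I + J) : R :=
  match k with inl i => cos a * A m i | inr j => sin a * B m j end.
pose U' (a : R) m (k : I + J) : R :=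
  match k with inl i => - sin a * A m i | inr j => cos a * B m j end.
pose K := (\sum_m \sum_i `|A m i|) + (\sum_m \sum_j `|B m j|).
have dU t m k : is_derive t (1 : R) (fun a => U a m k) (U' t m k).
  case: k => k /=.
    have := is_deriveZ (A m k) (is_derive_cos t); rewrite /GRing.scale/= mulrC.
    by rewrite (_ : _ \*: _ = (fun a => cos a * A m k))//; apply/funext => s; rewrite mulrC.
  have := is_deriveZ (B m k) (is_derive_sin t); rewrite /GRing.scale/= mulrC.
  by rewrite (_ : _ \*: _ = (fun a => sin a * B m k))//; apply/funext => s; rewrite mulrC.
have bA m k : `|A m k| <= K.
  rewrite /K (bigD1 m)//= (bigD1 k)//= -!addrA lerDl !addr_ge0// sumr_ge0// => *; exact: sumr_ge0.
have bB m k : `|B m k| <= K.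
  rewrite /K addrC (bigD1 m)//= (bigD1 k)//= -!addrA lerDl !addr_ge0// sumr_ge0// => *; exact: sumr_ge0.
have c1 (t : R) : `|cos t| <= 1 by rewrite ler_norml cos_geN1 cos_le1.
have s1 (t : R) : `|sin t| <= 1 by rewrite ler_norml sin_geN1 sin_le1.
have bU t m k : `|U t m k| <= K.
  by case: k => k /=; rewrite normrM; [apply: le_trans (bA m k)|apply: le_trans (bB m k)]; rewrite ler_piMl.
have bU' t m k : `|U' t m k| <= K.
  by case: k => k /=; rewrite normrM ?normrN; [apply: le_trans (bA m k)|apply: le_trans (bB m k)]; rewrite ler_piMl.
have gZ := gfam_prod gX gY.
have H := interpolation gZ dU bU bU' sf sdf.
pose E a := Ex (pprod P Q) (fun w => f (lin (U a) ((sumf X Y)^~ w))).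
have E0 a : is_derive a (1 : R) E 0.
  have := H a; rewrite big1// => m _; rewrite big1// => m' _.
  rewrite big_sumType /= -[RHS](mul0r (Ex (pprod P Q) (fun w => ddf m m' (lin (U a) ((sumf X Y)^~ w))))).
  congr (_ * _).
  under eq_bigr => i _ do rewrite mulrACA.
  under [X in _ + X]eq_bigr => i _ do rewrite mulrACA.
  by rewrite -!mulr_sumr AB; ring.
have := is_derive_0_is_cst 0 (pi / 2) E0; rewrite /E.
have -> : Ex (pprod P Q) (fun w => f (lin (U 0) ((sumf X Y)^~ w))) = Ex P (fun w => f (lin A (X^~ w))).
  rewrite -(Ex_fst (f := fun w => f (lin A (X^~ w)))); last exact: (gfam_L1 gX (nice_lin A nf)).
  apply: eq_Rintegral => w _; congr f; apply/funext => m; rewrite /lin big_sumType /=.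
  rewrite [X in _ + X]big1 ?addr0; last by move=> j _; rewrite sin0 !mul0r.
  by apply: eq_bigr => i _; rewrite cos0 mul1r.
have -> : Ex (pprod P Q) (fun w => f (lin (U (pi / 2)) ((sumf X Y)^~ w))) = Ex Q (fun w => f (lin B (Y^~ w))).
  rewrite -(Ex_snd (f := fun w => f (lin B (Y^~ w)))); last exact: (gfam_L1 gY (nice_lin B nf)).
  apply: eq_Rintegral => w _; congr f; apply/funext => m; rewrite /lin big_sumType /=.
  rewrite [X in X + _]big1 ?add0r; last by move=> j _; rewrite cos_pihalf !mul0r.
  by apply: eq_bigr => i _; rewrite sin_pihalf mul1r.
by [].
Qed.

End law.
End interpolation.

(** * Correlated copies of the disorder and the variance *)

Section smooth_pairs.
Context {R : realType}.
Implicit Types M N : finType.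

Lemma sum_CS (I : finType) (a b : I -> R) :
  (\sum_i a i * b i) ^+ 2 <= (\sum_i a i ^+ 2) * (\sum_i b i ^+ 2).
Proof.
set c := \sum_i a i * b i; set x := \sum_i a i ^+ 2; set y := \sum_i b i ^+ 2.
have x0 : 0 <= x by apply: sumr_ge0 => i _; exact: sqr_ge0.
have y0 : 0 <= y by apply: sumr_ge0 => i _; exact: sqr_ge0.
have H (s t : R) : 0 <= s ^+ 2 * x + 2 * s * t * c + t ^+ 2 * y.
  rewrite /x /y /c !mulr_sumr -!big_split/=; apply: sumr_ge0 => i _.
  by rewrite (_ : _ + _ = (s * a i + t * b i) ^+ 2) ?sqr_ge0//; ring.
have [y00|yn0] := eqVneq y 0.
  have := H (- c) (x + 1); rewrite y00 mulr0 addr0 => H3.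
  by rewrite mulr0; nra.
have yp : 0 < y by rewrite lt_def yn0.
have := H y (- c).
rewrite (_ : _ + _ = y * (x * y - c ^+ 2)); last by ring.
by rewrite pmulr_rge0// subr_ge0.
Qed.

(** In the variable t = -ln a the function is log-convex on a half-line, and a bounded log-convex
    function on a half-line cannot increase. If [C a > C b] with [a < b], sampling along the
    geometric sequence b (a/b)^n yields successive ratios that never drop below their first value r
    > 1, contradicting the bound. *)
Lemma logconvex_bounded_mono (C : R -> R) (Bd : R) :
  (forall a, 0 <= a <= 1 -> 0 <= C a) -> (forall a, 0 <= a <= 1 -> C a <= Bd) ->
  (forall a b, 0 <= a <= 1 -> 0 <= b <= 1 -> C (a * b) ^+ 2 <= C (a ^+ 2) * C (b ^+ 2)) ->
  forall a b, 0 < a -> a <= b -> b <= 1 -> C a <= C b.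
Proof.
move=> C0 Cb Cl a b.
move=> a0; rewrite le_eqVlt => /predU1P[->//|ab] b1.
rewrite leNgt; apply/negP => cab.
have b0 : 0 < b := lt_trans a0 ab.
pose q := a / b.
have q0 : 0 < q by rewrite divr_gt0.
have q1 : q <= 1 by rewrite ler_pdivrMr// mul1r ltW.
pose x n := b * q ^+ n.
have x0 n : 0 < x n by rewrite mulr_gt0// exprn_gt0.
have x1 n : x n <= 1.
  by rewrite /x mulr_ile1 ?exprn_ge0 ?(ltW b0) ?(ltW q0)// exprn_ile1// ltW.
have x01 n : 0 <= x n <= 1 by rewrite ltW//=.
pose c n := C (x n).
have c0 n : 0 <= c n by exact: C0.
have cx0 : c 0%N = C b by rewrite /c /x expr0 mulr1.
have cx1 : c 1%N = C a by rewrite /c /x expr1 /q mulrCA divff ?mulr1// gt_eqF.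
(* The hypothesis is applied at the square roots of two points of the sequence; their product is the
   point in between. *)
have lc n : c n.+1 ^+ 2 <= c n * c n.+2.
  pose y := Num.sqrt (x n); pose z := Num.sqrt (x n.+2).
  have sq (t : R) : 0 <= t <= 1 -> 0 <= Num.sqrt t <= 1.
    by move=> /andP[t0 t1]; rewrite sqrtr_ge0/= -[leRHS]sqrtr1 ler_wsqrtr.
  have := Cl _ _ (sq _ (x01 n)) (sq _ (x01 n.+2)).
  rewrite !sqr_sqrtr ?(ltW (x0 _))// -sqrtrM ?(ltW (x0 _))//.
  rewrite (_ : x n * x n.+2 = x n.+1 ^+ 2) ?sqrtr_sqr ?ger0_norm ?(ltW (x0 _))//.
  by rewrite /x !exprS; ring.
have cb : 0 < c 0%N.
  rewrite lt_neqAle c0 andbT eq_sym; apply/eqP => e.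
  have := lc 0%N; rewrite e mul0r cx1 => h.
  have : 0 < C a ^+ 2 by rewrite exprn_gt0// (le_lt_trans _ cab)// -cx0.
  by rewrite ltNge h.
pose r := c 1%N / c 0%N.
have r1 : 1 < r by rewrite /r ltr_pdivlMr// mul1r cx0 cx1.
have step n : 0 < c n /\ r * c n <= c n.+1.
  elim: n => [|n [cn rn]]; first by split => //; rewrite /r mulfVK// gt_eqF.
  have cn1 : 0 < c n.+1 by apply: lt_le_trans rn; rewrite mulr_gt0// (lt_trans ltr01).
  split=> //; rewrite -(ler_pM2l cn) (le_trans _ (lc n))//.
  by rewrite expr2 mulrCA mulrA ler_pM2r.
(* Linear growth, by Bernoulli's inequality for the powers of r, is already enough for a
   contradiction. *)
have grow n : c 0%N * (1 + n%:R * (r - 1)) <= c n.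
  elim: n => [|n ih]; first by rewrite mul0r addr0 mulr1.
  have [_ h] := step n; apply: le_trans h.
  apply: (@le_trans _ _ (r * (c 0%N * (1 + n%:R * (r - 1))))); last first.
    by rewrite ler_pM2l// (lt_trans ltr01).
  rewrite mulrCA ler_pM2l// -subr_ge0.
  rewrite (_ : _ - _ = n%:R * (r - 1) ^+ 2); first by rewrite mulr_ge0// sqr_ge0.
  by rewrite -natr1; ring.
have bd n : c n <= Bd by exact: Cb.
pose n := (Num.truncn (Bd / (c 0%N * (r - 1)))).+1.
have := le_trans (grow n) (bd n); rewrite leNgt => /negP; apply.
have t0 : 0 < c 0%N * (r - 1) by rewrite mulr_gt0// subr_gt0.
have : Bd / (c 0%N * (r - 1)) < n%:R by exact: truncnS_gt.
rewrite ltr_pdivrMr// => h; apply: lt_le_trans h _.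
by rewrite [leRHS]mulrDr mulr1 [leLHS]mulrCA lerDr ltW.
Qed.

Lemma sum_sqr_le (I : finType) (x y z : I -> R) : (forall i, 0 <= x i) -> (forall i, 0 <= y i) ->
  (forall i, z i ^+ 2 <= x i * y i) -> (\sum_i z i) ^+ 2 <= (\sum_i x i) * (\sum_i y i).
Proof.
move=> x0 y0 zxy.
have h : `|\sum_i z i| <= \sum_i Num.sqrt (x i) * Num.sqrt (y i).
  apply: le_trans (ler_norm_sum _ _ _) _; apply: ler_sum => i _.
  by rewrite -sqrtrM// -sqrtr_sqr ler_wsqrtr.
apply: (@le_trans _ _ ((\sum_i Num.sqrt (x i) * Num.sqrt (y i)) ^+ 2)).
  rewrite -real_normK ?num_real//; apply: lerXn2r => //; rewrite ?nnegrE ?normr_ge0//.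
  exact: le_trans h.
apply: le_trans (sum_CS _ _) _.
by under eq_bigr do rewrite sqr_sqrtr//; under [X in _ * X <= _]eq_bigr do rewrite sqr_sqrtr//.
Qed.

Definition smooth2 M (f : (M -> R) -> R) df ddf :=
  smooth1 f df /\ forall m, smooth1 (df m) (ddf m).

Lemma smooth2M M (f g : (M -> R) -> R) df dg ddf ddg :
  smooth2 f df ddf -> smooth2 g dg ddg ->
  smooth2 (fun u => f u * g u) (fun m u => f u * dg m u + g u * df m u)
    (fun m m' u => f u * ddg m m' u + dg m u * df m' u +
                   (g u * ddf m m' u + df m u * dg m' u)).
Proof.
move=> [sf sdf] [sg sdg]; split; first exact: smooth1M.
by move=> m; apply: smooth1D; exact: smooth1M.
Qed.

Lemma smooth1_sum M (J : Type) (s : seq J) (f : J -> (M -> R) -> R) df :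
  (forall j, smooth1 (f j) (df j)) ->
  smooth1 (fun u => \sum_(j <- s) f j u) (fun m u => \sum_(j <- s) df j m u).
Proof.
move=> sf; split.
- by apply: nice_sum => j; case: (sf j).
- by move=> m; apply: nice_sum => j; case: (sf j).
- by apply: cdf_sum => j; case: (sf j).
Qed.

Lemma smooth2_sum M (J : Type) (s : seq J) (f : J -> (M -> R) -> R) df ddf :
  (forall j, smooth2 (f j) (df j) (ddf j)) ->
  smooth2 (fun u => \sum_(j <- s) f j u) (fun m u => \sum_(j <- s) df j m u)
    (fun m m' u => \sum_(j <- s) ddf j m m' u).
Proof.
move=> sf; split; first by apply: smooth1_sum => j; case: (sf j).
by move=> m; apply: smooth1_sum => j; case: (sf j).
Qed.

Lemma smooth2Z M c (f : (M -> R) -> R) df ddf : smooth2 f df ddf ->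
  smooth2 (fun u => c * f u) (fun m u => c * df m u) (fun m m' u => c * ddf m m' u).
Proof. by move=> [sf sdf]; split; [|move=> m]; apply: smooth1Z. Qed.

(** [pl] and [pr] read a function of one system in the joint variables of two, so that a product of
    both is a smooth function of a single Gaussian family. *)
Definition pl M N (f : (M -> R) -> R) (u : M + N -> R) := f (fun m => u (inl m)).
Definition pr M N (f : (N -> R) -> R) (u : M + N -> R) := f (fun m => u (inr m)).
Definition dpl M N (df : M -> (M -> R) -> R) (k : M + N) (u : M + N -> R) : R :=
  match k with inl m => df m (fun m => u (inl m)) | inr _ => 0 end.
Definition dpr M N (df : N -> (N -> R) -> R) (k : M + N) (u : M + N -> R) : R :=
  match k with inl _ => 0 | inr m => df m (fun m => u (inr m)) end.

Lemma nice_pl M N (f : (M -> R) -> R) : nice f -> nice (@pl M N f).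
Proof. by move=> nf; apply: (nice_comp nf) => m; exact: nice_proj. Qed.

Lemma nice_pr M N (f : (N -> R) -> R) : nice f -> nice (@pr M N f).
Proof. by move=> nf; apply: (nice_comp nf) => m; exact: nice_proj. Qed.

Lemma smooth1_pl M N (f : (M -> R) -> R) df : smooth1 f df ->
  smooth1 (@pl M N f) (@dpl M N df).
Proof.
move=> [nf ndf cf]; split; first exact: nice_pl.
  by case=> m; [exact: (nice_pl N (ndf m))|exact: nice_cst].
move=> u u' t du; rewrite big_sumType/= [X in _ + X]big1 ?addr0 => [|j _]; last by rewrite mul0r.
exact: (cf (fun s m => u s (inl m)) (fun m => u' (inl m)) t).
Qed.

Lemma smooth1_pr M N (f : (N -> R) -> R) df : smooth1 f df ->
  smooth1 (@pr M N f) (@dpr M N df).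
Proof.
move=> [nf ndf cf]; split; first exact: nice_pr.
  by case=> m; [exact: nice_cst|exact: (nice_pr M (ndf m))].
move=> u u' t du; rewrite big_sumType/= [X in X + _]big1 ?add0r => [|j _]; last by rewrite mul0r.
exact: (cf (fun s m => u s (inr m)) (fun m => u' (inr m)) t).
Qed.

Definition ddpl M N (ddf : M -> M -> (M -> R) -> R) (k : M + N) : M + N -> (M + N -> R) -> R :=
  match k with inl m => dpl (ddf m) | inr _ => fun _ _ => 0 end.
Definition ddpr M N (ddf : N -> N -> (N -> R) -> R) (k : M + N) : M + N -> (M + N -> R) -> R :=
  match k with inl _ => fun _ _ => 0 | inr m => dpr (ddf m) end.

Lemma smooth2_pl M N (f : (M -> R) -> R) df ddf : smooth2 f df ddf ->
  smooth2 (@pl M N f) (@dpl M N df) (@ddpl M N ddf).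
Proof.
move=> [sf sdf]; split; first exact: smooth1_pl.
by case=> m; [exact: (smooth1_pl N (sdf m))|exact: smooth1_cst].
Qed.

Lemma smooth2_pr M N (f : (N -> R) -> R) df ddf : smooth2 f df ddf ->
  smooth2 (@pr M N f) (@dpr M N df) (@ddpr M N ddf).
Proof.
move=> [sf sdf]; split; first exact: smooth1_pr.
by case=> m; [exact: smooth1_cst|exact: (smooth1_pr M (sdf m))].
Qed.

End smooth_pairs.

(** * Correlated copies and the Ornstein-Uhlenbeck semigroup *)

Section correlation.
Context {R : realType} d (T : measurableType d) (P : probability T R).
Context (I M : finType) (X : I -> T -> R) (A : M -> I -> R).
Hypothesis gX : gfam P X.

Definition mixl (a s : R) (x y : T) : M -> R :=
  fun m => a * lin A (X^~ x) m + s * lin A (X^~ y) m.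

Definition cpl (a : R) := Num.sqrt (1 - a ^+ 2).

(** The second argument keeps the first copy with weight a and adds an independent one with weight
    sqrt(1 - a^2), so both arguments have the same covariance. *)
Definition corr (f : (M -> R) -> R) (a : R) : R :=
  Ex (pprod P P) (fun z => f (lin A (X^~ z.1)) * f (mixl a (cpl a) z.1 z.2)).

Let k m m' := \sum_i A m i * A m' i.

Lemma cpl_sqr a : 0 <= a <= 1 -> cpl a ^+ 2 = 1 - a ^+ 2.
Proof.
move=> /andP[a0 a1]; rewrite sqr_sqrtr// subr_ge0.
by rewrite expr_le1.
Qed.

Section one.
Variables (f : (M -> R) -> R) (df : M -> (M -> R) -> R) (ddf : M -> M -> (M -> R) -> R).
Hypothesis sf : smooth2 f df ddf.

Let nf : nice f. Proof. by case: sf => -[]. Qed.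

(** Any Gaussian pair with these covariances computes [corr]. This permits switching between the
    asymmetric definition and symmetric realisations with one shared and two private blocks of
    disorder. *)
Lemma corr_law d' (T' : measurableType d') (Q : probability T' R) (J : finType)
    (Y : J -> T' -> R) (B : M + M -> J -> R) a : gfam Q Y -> 0 <= a <= 1 ->
  (forall m m', \sum_j B (inl m) j * B (inl m') j = k m m') ->
  (forall m m', \sum_j B (inl m) j * B (inr m') j = a * k m m') ->
  (forall m m', \sum_j B (inr m) j * B (inr m') j = k m m') ->
  Ex Q (fun w => f (fun m => lin B (Y^~ w) (inl m)) * f (fun m => lin B (Y^~ w) (inr m))) =
  corr f a.
Proof.
move=> gY a01 ll lr rr.
have a2 := cpl_sqr a01.
pose Ba (k : M + M) (i : I + I) : R := match k, i with
  | inl m, inl i => A m i | inl m, inr i => 0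
  | inr m, inl i => a * A m i | inr m, inr i => cpl a * A m i end.
have s2 := smooth2M (smooth2_pl M sf) (smooth2_pr M sf).
have [s21 s22] := s2.
rewrite (eq_law gY (gfam_prod gX gX) (A := B) (B := Ba) _ s21 s22).
  apply: eq_Rintegral => z _; rewrite /pl /pr; congr (f _ * f _); apply/funext => m.
    rewrite /lin big_sumType/= [X in _ + X]big1 ?addr0// => i _; by rewrite mul0r.
  rewrite /mixl /lin big_sumType/= !mulr_sumr; congr (_ + _); apply: eq_bigr => i _;
  by rewrite mulrA.
move=> [m|m] [m'|m']; rewrite big_sumType/=.
- by rewrite ll [X in _ + X]big1 ?addr0// => i _; rewrite mul0r.
- rewrite lr [X in _ + X]big1 ?addr0 => [|i _]; last by rewrite mul0r.
  by rewrite /k mulr_sumr; apply: eq_bigr => i _; ring.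
- under eq_bigr do rewrite mulrC.
  rewrite lr [X in _ + X]big1 ?addr0 => [|i _]; last by rewrite mulr0.
  by rewrite /k mulr_sumr; apply: eq_bigr => i _; ring.
- rewrite rr; under eq_bigr do rewrite mulrACA.
  under [X in _ + X]eq_bigr do rewrite mulrACA.
  by rewrite -!mulr_sumr -mulrDl -!expr2 a2 subrKC mul1r.
Qed.

(** Mehler's formula for the Ornstein-Uhlenbeck semigroup at time -ln a, as a function of the
    retained noise [x]. *)
Definition pavg a (x : T) := Ex P (fun y => f (mixl a (cpl a) x y)).

Let Bab a b (k : M + M) (i : I + (I + I)) : R := match k, i with
  | inl m, inl i => a * A m i | inl m, inr (inl i) => cpl a * A m i | inl m, inr (inr i) => 0
  | inr m, inl i => b * A m i | inr m, inr (inl i) => 0 | inr m, inr (inr i) => cpl b * A m i end.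

Let gZ3 := gfam_prod gX (gfam_prod gX gX).

Let linBl a b z m : lin (Bab a b) ((sumf X (sumf X X))^~ z) (inl m) = mixl a (cpl a) z.1 z.2.1 m.
Proof.
rewrite /mixl /lin big_sumType/= big_sumType/= [X in _ + (_ + X)]big1 ?addr0 => [|i _]; last by rewrite mul0r.
by rewrite !mulr_sumr; congr (_ + _); apply: eq_bigr => i _; rewrite mulrA.
Qed.

Let linBr a b z m : lin (Bab a b) ((sumf X (sumf X X))^~ z) (inr m) = mixl b (cpl b) z.1 z.2.2 m.
Proof.
rewrite /mixl /lin big_sumType/= big_sumType/= [X in _ + (X + _)]big1 ?add0r => [|i _]; last by rewrite mul0r.
by rewrite !mulr_sumr; congr (_ + _); apply: eq_bigr => i _; rewrite mulrA.
Qed.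

Let L1y a x : L1 P (fun y => f (mixl a (cpl a) x y)).
Proof.
apply: (gfam_L1 gX (f := fun u => f (fun m => a * lin A (X^~ x) m + cpl a * lin A u m))).
apply: (nice_comp nf) => m; apply: niceD; first exact: nice_cst.
by apply: niceZ; exact: nice_lin_coord.
Qed.

Let L1z a b : L1 (pprod P (pprod P P))
  (fun z => f (mixl a (cpl a) z.1 z.2.1) * f (mixl b (cpl b) z.1 z.2.2)).
Proof.
have [[n2 _ _] _] := smooth2M (smooth2_pl M sf) (smooth2_pr M sf).
have := gfam_L1 gZ3 (nice_lin (Bab a b) n2).
apply: eq_integrable => // z _ /=; congr (_%:E); rewrite /pl /pr; congr (f _ * f _);
by apply/funext => m; rewrite ?linBl ?linBr.
Qed.

Let inner a b x : Ex (pprod P P) (fun y => f (mixl a (cpl a) x y.1) * f (mixl b (cpl b) x y.2)) =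
  pavg a x * pavg b x.
Proof.
rewrite Ex_pprod12.
- rewrite /pavg mulrC -ExZ//; apply: eq_Rintegral => y _ /=.
  by rewrite ExZ// mulrC.
- apply: L1_sqrM.
  + exact: (measurableT_comp (L1_meas (L1y a x)) measurable_fst).
  + exact: (measurableT_comp (L1_meas (L1y b x)) measurable_snd).
  + apply: (L1_fst _ (f := fun y => f (mixl a (cpl a) x y) ^+ 2)).
    apply: (gfam_L1 gX (f := fun u => f (fun m => a * lin A (X^~ x) m + cpl a * lin A u m) ^+ 2)).
    have nn : nice (fun u => f (fun m => a * lin A (X^~ x) m + cpl a * lin A u m)).
      apply: (nice_comp nf) => m; apply: niceD; first exact: nice_cst.
      by apply: niceZ; exact: nice_lin_coord.
    by under eq_fun do rewrite expr2; exact: niceM.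
  + apply: (L1_snd _ (f := fun y => f (mixl b (cpl b) x y) ^+ 2)).
    apply: (gfam_L1 gX (f := fun u => f (fun m => b * lin A (X^~ x) m + cpl b * lin A u m) ^+ 2)).
    have nn : nice (fun u => f (fun m => b * lin A (X^~ x) m + cpl b * lin A u m)).
      apply: (nice_comp nf) => m; apply: niceD; first exact: nice_cst.
      by apply: niceZ; exact: nice_lin_coord.
    by under eq_fun do rewrite expr2; exact: niceM.
- by move=> y; exact: (L1Z (f (mixl a (cpl a) x y)) (L1y b x)).
Qed.

Let L1in a b x : L1 (pprod P P) (fun y => f (mixl a (cpl a) x y.1) * f (mixl b (cpl b) x y.2)).
Proof.
have [[n2 _ _] _] := smooth2M (smooth2_pl M sf) (smooth2_pr M sf).
pose g (k : M + M) (u : I + I -> R) : R := match k with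
  | inl m => a * lin A (X^~ x) m + cpl a * lin A (fun i => u (inl i)) m
  | inr m => b * lin A (X^~ x) m + cpl b * lin A (fun i => u (inr i)) m end.
have ng kk : nice (g kk).
  case: kk => m; apply: niceD; try exact: nice_cst; apply: niceZ.
    exact: (nice_pl I (nice_lin_coord A m)).
  exact: (nice_pr I (nice_lin_coord A m)).
exact: (gfam_L1 (gfam_prod gX gX) (nice_comp n2 ng)).
Qed.

(** Two copies sharing [x] with weights a and b, and with independent complements, have correlation
    a b and are conditionally independent given [x]. Thus [corr] is an inner product in L^2. *)
Lemma corr_pavg a b : 0 <= a <= 1 -> 0 <= b <= 1 ->
  corr f (a * b) = Ex P (fun x => pavg a x * pavg b x) /\
  L1 P (fun x => pavg a x * pavg b x).
Proof.
move=> a01 b01; have a2 := cpl_sqr a01; have b2 := cpl_sqr b01.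
have ab01 : 0 <= a * b <= 1.
  by case/andP: a01 => ? ?; case/andP: b01 => ? ?; rewrite mulr_ge0//= mulr_ile1.
split.
  rewrite -(corr_law (B := Bab a b) gZ3 ab01).
  - transitivity (Ex (pprod P (pprod P P))
      (fun z => f (mixl a (cpl a) z.1 z.2.1) * f (mixl b (cpl b) z.1 z.2.2))).
      apply: eq_Rintegral => z _; congr (f _ * f _); apply/funext => m; rewrite ?linBl ?linBr//.
    by rewrite (Ex_pprod12 (L1z a b) (L1in a b)); apply: eq_Rintegral => x _; exact: inner.
  - move=> m m'; rewrite !big_sumType/= [X in _ + (_ + X)]big1 ?addr0 => [|i _]; last by rewrite mul0r.
    under eq_bigr do rewrite mulrACA.
    under [X in _ + X]eq_bigr do rewrite mulrACA.
    by rewrite -!mulr_sumr -mulrDl -!expr2 a2 subrKC mul1r.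
  - move=> m m'; rewrite !big_sumType/= [X in _ + (X + _)]big1 ?add0r => [|i _]; last by rewrite mulr0.
    rewrite [X in _ + X]big1 ?addr0 => [|i _]; last by rewrite mul0r.
    by rewrite /k mulr_sumr; apply: eq_bigr => i _; rewrite mulrACA.
  - move=> m m'; rewrite !big_sumType/= [X in _ + (X + _)]big1 ?add0r => [|i _]; last by rewrite mul0r.
    under eq_bigr do rewrite mulrACA.
    under [X in _ + X]eq_bigr do rewrite mulrACA.
    by rewrite -!mulr_sumr -mulrDl -!expr2 b2 subrKC mul1r.
have := L1_inner (L1z a b) (fun x => L1in a b x).
apply: eq_integrable => // x _ /=; congr (_%:E); exact: inner.
Qed.

Lemma pavg_meas a : 0 <= a <= 1 -> measurable_fun setT (pavg a).
Proof.
move=> a01.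
have iz : L1 (pprod P P) (fun z => f (mixl a (cpl a) z.1 z.2)).
  pose g (m : M) (u : I + I -> R) : R :=
    a * lin A (fun i => u (inl i)) m + cpl a * lin A (fun i => u (inr i)) m.
  have ng m : nice (g m).
    apply: niceD; apply: niceZ; [exact: (nice_pl I (nice_lin_coord A m))|exact: (nice_pr I (nice_lin_coord A m))].
  exact: (gfam_L1 (gfam_prod gX gX) (nice_comp nf ng)).
exact: (L1_meas (L1_inner iz (fun x => L1y a x))).
Qed.

(** Cauchy-Schwarz for the inner product of [corr_pavg]. *)
Lemma corr_logconvex a b : 0 <= a <= 1 -> 0 <= b <= 1 ->
  corr f (a * b) ^+ 2 <= corr f (a ^+ 2) * corr f (b ^+ 2).
Proof.
move=> a01 b01.
have [-> _] := corr_pavg a01 b01.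
have [ea la] := corr_pavg a01 a01; have [eb lb] := corr_pavg b01 b01.
have sqE c : (fun x => pavg c x * pavg c x) = (fun x => pavg c x ^+ 2).
  by apply/funext => x; rewrite expr2.
rewrite [a ^+ 2]expr2 [b ^+ 2]expr2 ea eb !sqE; rewrite !sqE in la lb.
by apply: Ex_CS => //; exact: pavg_meas.
Qed.

(** The value at a is the second moment of [pavg] at sqrt a. *)
Lemma corr_ge0 a : 0 <= a <= 1 -> 0 <= corr f a.
Proof.
move=> /andP[a0 a1].
have s01 : 0 <= Num.sqrt a <= 1.
  by rewrite sqrtr_ge0/= -[leRHS]sqrtr1 ler_wsqrtr.
have [e _] := corr_pavg s01 s01.
by rewrite -[a]sqr_sqrtr// expr2 e; apply: Ex_ge0 => x; rewrite -expr2 sqr_ge0.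
Qed.

(** From u v <= (u^2 + v^2) / 2, both marginals having the law of the uncorrelated system. The
    resulting uniform bound is what [logconvex_bounded_mono] needs. *)
Lemma corr_le a : 0 <= a <= 1 -> corr f a <= Ex P (fun x => f (lin A (X^~ x)) ^+ 2).
Proof.
move=> a01; have a2 := cpl_sqr a01.
have sff := smooth2M sf sf; have [sff1 sff2] := sff; have [nff _ _] := sff1.
pose B1 (m : M) (k : I + I) : R := match k with inl i => A m i | inr _ => 0 end.
pose B2 (m : M) (k : I + I) : R := match k with inl i => a * A m i | inr i => cpl a * A m i end.
have gXX := gfam_prod gX gX.
have e1 z : lin B1 ((sumf X X)^~ z) = lin A (X^~ z.1).
  apply/funext => m; rewrite /lin big_sumType/= [X in _ + X]big1 ?addr0// => i _.
  by rewrite mul0r.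
have e2 z : lin B2 ((sumf X X)^~ z) = mixl a (cpl a) z.1 z.2.
  apply/funext => m; rewrite /mixl /lin big_sumType/= !mulr_sumr.
  by congr (_ + _); apply: eq_bigr => i _; rewrite mulrA.
have l1 : L1 (pprod P P) (fun z => f (lin A (X^~ z.1)) ^+ 2).
  have := gfam_L1 gXX (nice_lin B1 nff); apply: eq_integrable => // z _ /=.
  by rewrite e1 expr2.
have l2 : L1 (pprod P P) (fun z => f (mixl a (cpl a) z.1 z.2) ^+ 2).
  have := gfam_L1 gXX (nice_lin B2 nff); apply: eq_integrable => // z _ /=.
  by rewrite e2 expr2.
have E1 : Ex (pprod P P) (fun z => f (lin A (X^~ z.1)) ^+ 2) =
    Ex P (fun x => f (lin A (X^~ x)) ^+ 2).
  apply: (Ex_fst _ (f := fun x => f (lin A (X^~ x)) ^+ 2)).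
  by under eq_fun do rewrite expr2; exact: (gfam_L1 gX (nice_lin A nff)).
have E2 : Ex (pprod P P) (fun z => f (mixl a (cpl a) z.1 z.2) ^+ 2) =
    Ex P (fun x => f (lin A (X^~ x)) ^+ 2).
  have := eq_law gXX gX (A := B2) (B := A) _ sff1 sff2.
  under eq_fun do rewrite e2 -expr2.
  move=> ->; first by apply: eq_Rintegral => x _; rewrite expr2.
  move=> m m'; rewrite big_sumType/=; under eq_bigr do rewrite mulrACA.
  under [X in _ + X]eq_bigr do rewrite mulrACA.
  by rewrite -!mulr_sumr -mulrDl -!expr2 a2 subrKC mul1r.
have -> : Ex P (fun x => f (lin A (X^~ x)) ^+ 2) = Ex (pprod P P) (fun z =>
    2^-1 * (f (lin A (X^~ z.1)) ^+ 2 + f (mixl a (cpl a) z.1 z.2) ^+ 2)).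
  by rewrite ExZ ?ExD ?E1 ?E2//; [field|exact: L1D].
apply: Ex_le.
- have [[n2 _ _] _] := smooth2M (smooth2_pl M sf) (smooth2_pr M sf).
  pose B3 (k : M + M) : I + I -> R := match k with inl m => B1 m | inr m => B2 m end.
  have := gfam_L1 gXX (nice_lin B3 n2); apply: eq_integrable => // z _ /=.
  by rewrite -e1 -e2.
- by apply: L1Z; exact: L1D.
- move=> z; set u := f _; set v := f _.
  have := sqr_ge0 (u - v); rewrite sqrrB => h.
  rewrite -subr_ge0 (_ : _ - _ = 2^-1 * (u ^+ 2 - u * v *+ 2 + v ^+ 2)); last by rewrite -mulr_natl; field.
  by rewrite mulr_ge0// invr_ge0.
Qed.

Lemma corr_mono (a b : R) : 0 < a -> a <= b -> b <= 1 -> corr f a <= corr f b.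
Proof. exact: (logconvex_bounded_mono corr_ge0 corr_le corr_logconvex). Qed.

End one.

Section variance_bound.
Variables (F : (M -> R) -> R) (dF : M -> (M -> R) -> R).
Variables (ddF : M -> M -> (M -> R) -> R) (dddF : M -> M -> M -> (M -> R) -> R).
Hypothesis sF : smooth2 F dF ddF.
Hypothesis sdF : forall m, smooth2 (dF m) (ddF m) (dddF m).

Let fi (i : I) (u : M -> R) := \sum_m A m i * dF m u.

Lemma smooth2_fi i : smooth2 (fi i) (fun m u => \sum_m0 A m0 i * ddF m0 m u)
  (fun m m' u => \sum_m0 A m0 i * dddF m0 m m' u).
Proof. by apply: smooth2_sum => m; exact: smooth2Z. Qed.

(* Correlation of the gradients of [x |-> F (lin A x)] at two copies of the disorder with correlation [a]. *)
Definition csum a := \sum_i corr (fi i) a.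

Lemma csum_mono a b : 0 < a -> a <= b -> b <= 1 -> csum a <= csum b.
Proof. by move=> a0 ab b1; apply: ler_sum => i _; apply: (corr_mono (smooth2_fi i)). Qed.

Lemma csum_ge0 a : 0 <= a <= 1 -> 0 <= csum a.
Proof. by move=> a01; apply: sumr_ge0 => i _; exact: (corr_ge0 (smooth2_fi i)). Qed.

(** Log-convexity of each summand, with 1 as one argument, is summed by Cauchy-Schwarz. It carries
    smallness at a^2 to a, and iterating it brings the correlation close to 1. *)
Lemma csum_sqr a : 0 <= a <= 1 -> csum a ^+ 2 <= csum 1 * csum (a ^+ 2).
Proof.
move=> a01.
have a201 : 0 <= a ^+ 2 <= 1.
  by case/andP: a01 => a0 a1; rewrite sqr_ge0/= expr_le1.
apply: sum_sqr_le => i.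
- by apply: (corr_ge0 (smooth2_fi i)); rewrite ler01 lexx.
- exact: (corr_ge0 (smooth2_fi i)).
- have i01 : 0 <= (1 : R) <= 1 by rewrite ler01 lexx.
  by have := corr_logconvex (smooth2_fi i) i01 a01; rewrite mul1r expr1n.
Qed.

Let cF (t : R) := Ex (pprod P P) (fun z => F (lin A (X^~ z.1)) * F (mixl (cos t) (sin t) z.1 z.2)).

Let U (t : R) (k : M + M) (i : I + I) : R := match k, i with
  | inl m, inl i => A m i | inl m, inr i => 0
  | inr m, inl i => cos t * A m i | inr m, inr i => sin t * A m i end.
Let U' (t : R) (k : M + M) (i : I + I) : R := match k, i with
  | inl m, _ => 0
  | inr m, inl i => - sin t * A m i | inr m, inr i => cos t * A m i end.

Let linU t z : (fun m => lin (U t) ((sumf X X)^~ z) (inl m)) = lin A (X^~ z.1) /\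
  (fun m => lin (U t) ((sumf X X)^~ z) (inr m)) = mixl (cos t) (sin t) z.1 z.2.
Proof.
split; apply/funext => m; rewrite /mixl /lin big_sumType/=.
  by rewrite [X in _ + X]big1 ?addr0// => i _; rewrite mul0r.
by rewrite !mulr_sumr; congr (_ + _); apply: eq_bigr => i _; rewrite mulrA.
Qed.

(** The derivative exists at every t, but its identification with the gradient correlation requires
    [sin t = cpl (cos t)], whence the restriction to the open quarter turn. *)
Let dcF : exists2 D : R -> R, forall t, is_derive t (1 : R) cF (D t) &
  forall t, 0 < t < pi / 2 -> D t = - sin t * csum (cos t).
Proof.
have gXX := gfam_prod gX gX.
have [s1 s2] := smooth2M (smooth2_pl M sF) (smooth2_pr M sF).
pose K := 1 + \sum_m \sum_i `|A m i|.
have AK m i : `|A m i| <= K.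
  rewrite /K (bigD1 m)//= (bigD1 i)//= addrCA -addrA lerDl.
  by rewrite addr_ge0// ?addr_ge0// ?sumr_ge0// => ? _; rewrite sumr_ge0.
have K0 : 0 <= K by rewrite /K addr_ge0// sumr_ge0// => m _; rewrite sumr_ge0.
have bU s mm i : `|U s mm i| <= K.
  case: mm => m; case: i => i //=; rewrite ?normr0// normrM.
    by rewrite -[leRHS]mul1r ler_pM// cos_max.
  by rewrite -[leRHS]mul1r ler_pM// sin_max.
have bU' s mm i : `|U' s mm i| <= K.
  case: mm => m; case: i => i //=; rewrite ?normr0// normrM ?normrN.
    by rewrite -[leRHS]mul1r ler_pM// sin_max.
  by rewrite -[leRHS]mul1r ler_pM// cos_max.
have dU s mm i : is_derive s (1 : R) (fun a => U a mm i) (U' s mm i).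
  case: mm => m; case: i => i /=; try exact: is_derive_cst.
    by apply: is_derive_eq; rewrite /GRing.scale/=; ring.
  by apply: is_derive_eq; rewrite /GRing.scale/=; ring.
have := interpolation gXX dU bU bU' s1 s2.
have -> : (fun a => Ex (pprod P P) (fun w => pl F (lin (U a) ((sumf X X)^~ w)) *
    pr F (lin (U a) ((sumf X X)^~ w)))) = cF.
  apply/funext => a; apply: eq_Rintegral => z _; rewrite /pl /pr.
  by have [-> ->] := linU a z.
move=> h; eexists; first exact: h.
move=> t /andP[t0 t1].
have ct : 0 < cos t by apply: cos_gt0_pihalf; rewrite t1 (lt_trans _ t0)// oppr_lt0 divr_gt0 ?pi_gt0.
have st : 0 < sin t.
  by apply: sin_gt0_pi; rewrite t0 (lt_trans t1)// ltr_pdivrMr// ltr_pMr ?pi_gt0// ltr1n.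
have ecpl : cpl (cos t) = sin t by rewrite /cpl -sin2cos2 sqrtr_sqr ger0_norm// ltW.
have l1 m m' : L1 (pprod P P) (fun z => dF m (lin A (X^~ z.1)) * dF m' (mixl (cos t) (sin t) z.1 z.2)).
  have [[nm _ _] _] := sdF m; have [[nm' _ _] _] := sdF m'.
  have nn := niceM (nice_pl M nm) (nice_pr M nm').
  have := gfam_L1 gXX (nice_lin (U t) nn); apply: eq_integrable => // z _ /=.
  by rewrite /pl /pr; have [-> ->] := linU t z.
rewrite big_sumType/= [X in X + _]big1 ?add0r => [|m _]; last first.
  by rewrite big1// => k' _; rewrite big1 ?mul0r// => i _; rewrite mul0r.
transitivity (\sum_m \sum_m' (- sin t * k m m') *
  Ex (pprod P P) (fun z => dF m' (lin A (X^~ z.1)) * dF m (mixl (cos t) (sin t) z.1 z.2))).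
  apply: eq_bigr => m _; rewrite big_sumType/= [X in _ + X]big1 ?addr0 => [|m' _]; last first.
    rewrite big_sumType/= (_ : _ + _ = 0) ?mul0r//.
    by rewrite -big_split/= big1// => i _; ring.
  apply: eq_bigr => m' _; congr (_ * _).
    rewrite big_sumType/= [X in _ + X]big1 ?addr0 => [|i _]; last by rewrite mulr0.
    by rewrite /k mulr_sumr; apply: eq_bigr => i _; rewrite mulrA.
  apply: eq_Rintegral => z _; rewrite /pl /pr; have [-> ->] := linU t z.
  by ring.
pose e m m' := Ex (pprod P P)
  (fun z => dF m' (lin A (X^~ z.1)) * dF m (mixl (cos t) (sin t) z.1 z.2)).
have ce i : corr (fi i) (cos t) = \sum_m \sum_m' A m' i * A m i * e m m'.
  rewrite /corr ecpl.
  rewrite (_ : (fun z => _) = (fun z => \sum_m \sum_m' A m' i * A m i *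
      (dF m' (lin A (X^~ z.1)) * dF m (mixl (cos t) (sin t) z.1 z.2)))); last first.
    apply/funext => z; rewrite /fi mulr_suml exchange_big/=; apply: eq_bigr => m _.
    by rewrite mulr_sumr; apply: eq_bigr => m' _; ring.
  rewrite Ex_sum; last by move=> m; apply: L1_sum => m'; exact: L1Z.
  apply: eq_bigr => m _; rewrite Ex_sum; last by move=> m'; exact: L1Z.
  by apply: eq_bigr => m' _; rewrite ExZ.
rewrite /csum; under [in RHS]eq_bigr do rewrite ce.
rewrite [in RHS]exchange_big/= mulr_sumr; apply: eq_bigr => m _.
rewrite [in RHS]exchange_big/= mulr_sumr; apply: eq_bigr => m' _.
by rewrite -mulr_suml /k mulrA; congr (_ * _ * _); apply: eq_bigr => i _; rewrite mulrC.
Qed.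

(** The variance is [cF 0 - cF (pi / 2)], an integral of sin(s) [csum (cos s)]. The quarter turn is
    split at acos a: before it the correlation is at most [csum 1] and sin integrates to 1 - a,
    after it the correlation is at most [csum a] and sin integrates to a. *)
Lemma variance_le a : 0 < a < 1 ->
  Ex P (fun x => F (lin A (X^~ x)) ^+ 2) - Ex P (fun x => F (lin A (X^~ x))) ^+ 2 <=
  (1 - a) * csum 1 + a * csum a.
Proof.
move=> /andP[a0 a1].
have [[nF _ _] _] := sF.
have gXX := gfam_prod gX gX.
have LF : L1 P (fun x => F (lin A (X^~ x))) := gfam_L1 gX (nice_lin A nF).
have c0 : cF 0 = Ex P (fun x => F (lin A (X^~ x)) ^+ 2).
  rewrite -(Ex_fst P (f := fun x => F (lin A (X^~ x)) ^+ 2)); last first.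
    by under eq_fun do rewrite expr2; exact: (gfam_L1 gX (nice_lin A (niceM nF nF))).
  apply: eq_Rintegral => z _; rewrite expr2; congr (_ * F _).
  by apply/funext => m; rewrite /mixl cos0 sin0 mul1r mul0r addr0.
have cpi : cF (pi / 2) = Ex P (fun x => F (lin A (X^~ x))) ^+ 2.
  have -> : cF (pi / 2) = Ex (pprod P P) (fun z => F (lin A (X^~ z.1)) * F (lin A (X^~ z.2))).
    apply: eq_Rintegral => z _; congr (_ * F _).
    by apply/funext => m; rewrite /mixl cos_pihalf sin_pihalf mul1r mul0r add0r.
  rewrite Ex_pprod12.
  - rewrite expr2 -ExZ//; apply: eq_Rintegral => x _ /=; by rewrite ExZ// mulrC.
  - pose B (k : M + M) (i : I + I) : R := match k, i with
      | inl m, inl i => A m i | inr m, inr i => A m i | _, _ => 0 end.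
    have := gfam_L1 gXX (nice_lin B (niceM (nice_pl M nF) (nice_pr M nF))).
    apply: eq_integrable => // z _ /=; congr (F _ * F _)%:E; apply/funext => m;
    rewrite /lin big_sumType/=.
    + by rewrite [X in _ + X]big1 ?addr0// => i _; rewrite mul0r.
    + by rewrite [X in X + _]big1 ?add0r// => i _; rewrite mul0r.
  - by move=> x; exact: (L1Z (F (lin A (X^~ x))) LF).
pose t := acos a.
have a11 : -1 <= a <= 1 by rewrite (le_trans _ (ltW a0)) ?oppr_le0// ltW.
have ct : cos t = a by rewrite /t acosK// in_itv.
have pi20 : 0 < pi / 2 :> R by rewrite divr_gt0 ?pi_gt0.
have t0 : 0 < t by apply: acos_gt0; rewrite (le_trans _ (ltW a0)) ?oppr_le0//=.
have le_cos (x y : R) : x \in `[0, pi] -> y \in `[0, pi] -> (cos x <= cos y) = (y <= x).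
  by move=> xi yi; rewrite !leNgt ltr_cos.
have pp : pi / 2 <= pi :> R by rewrite ler_pdivrMr// ler_pMr ?pi_gt0// ler1n.
have tpi : t < pi / 2.
  rewrite ltNge; apply/negP => h; move: a0; rewrite -ct ltNge => /negP; apply.
  rewrite -cos_pihalf le_cos//; rewrite in_itv/=.
    by rewrite acos_ge0//= acos_lepi.
  by rewrite (ltW pi20)/= pp.
have cosle (s s' : R) : 0 <= s -> s <= s' -> s' <= pi / 2 -> cos s' <= cos s.
  move=> s0 ss sp; rewrite le_cos// in_itv/=.
    by rewrite (le_trans s0 ss)/= (le_trans sp pp).
  by rewrite s0/= (le_trans ss (le_trans sp pp)).
have cosgt (s : R) : 0 <= s -> s < pi / 2 -> 0 < cos s.
  by move=> s0 sp; apply: cos_gt0_pihalf; rewrite sp (lt_le_trans _ s0)// oppr_lt0.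
have cos1 (s : R) : cos s <= 1 by exact: cos_le1.
have sinp (s : R) : 0 < s -> s < pi / 2 -> 0 < sin s.
  move=> s0 sp; apply: sin_gt0_pi; rewrite s0 (lt_trans sp)//.
  by rewrite ltr_pdivrMr// ltr_pMr ?pi_gt0// ltr1n.
have [D dcD DE] := dcF.
have ge1 : cF 0 - cF t <= csum 1 * (1 - a).
  pose f (s : R) := csum 1 * cos s - cF s.
  have df s : is_derive s (1 : R) f (csum 1 * - sin s - D s).
    have := dcD s => ds; apply: is_derive_eq; by rewrite /GRing.scale/=; ring.
  have := derive_le0_le (ltW t0) df; rewrite /f cos0 mulr1 ct => h.
  suff : csum 1 * a - cF t <= csum 1 - cF 0 by rewrite mulrBr mulr1; lra.
  apply: h => s /andP[s0 st].
  have sp := lt_trans st tpi.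
  rewrite DE ?s0// (_ : _ - _ = - (sin s * (csum 1 - csum (cos s)))); last by ring.
  rewrite oppr_le0 mulr_ge0 ?(ltW (sinp _ _ _))// subr_ge0; apply: csum_mono => //.
  exact: cosgt (ltW s0) sp.
have ge2 : cF t - cF (pi / 2) <= a * csum a.
  pose f (s : R) := csum a * cos s - cF s.
  have df s : is_derive s (1 : R) f (csum a * - sin s - D s).
    have := dcD s => ds; apply: is_derive_eq; by rewrite /GRing.scale/=; ring.
  have := derive_le0_le (ltW tpi) df; rewrite /f cos_pihalf mulr0 ct => h.
  suff : 0 - cF (pi / 2) <= csum a * a - cF t by rewrite (mulrC a); lra.
  apply: h => s /andP[ts sp].
  have s0 := lt_trans t0 ts.
  rewrite DE ?s0// (_ : _ - _ = - (sin s * (csum a - csum (cos s)))); last by ring.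
  rewrite oppr_le0 mulr_ge0 ?(ltW (sinp _ _ _))// subr_ge0; apply: csum_mono (ltW a1).
    exact: cosgt (ltW s0) sp.
  by rewrite -ct; apply: cosle; rewrite ltW.
rewrite -c0 -cpi (mulrC (1 - a)); lra.
Qed.

End variance_bound.
End correlation.

Lemma cvg_fsum (R : realType) (S : Type) (F : set_system S) (FF : Filter F) (J : Type)
    (s : seq J) (f : J -> S -> R) (l : J -> R) :
  (forall j, f j x @[x --> F] --> l j) ->
  \sum_(j <- s) f j x @[x --> F] --> \sum_(j <- s) l j.
Proof.
move=> fl; elim: s => [|j s IH].
  by rewrite big_nil; under eq_fun do rewrite big_nil; exact: cvg_cst.
by rewrite big_cons; under eq_fun do rewrite big_cons; exact: cvgD.
Qed.

(** * Finite Gibbs measures *)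

Section gibbs.
Context {R : realType} (V : finType) (om : V -> R) (be : R).
Hypothesis om0 : forall v, 0 <= om v.
Hypothesis om1 : \sum_v om v = 1.
Hypothesis be0 : 0 < be.
Implicit Types h : V -> R.

Definition gZ h := \sum_v om v * expR (be * h v).
Definition gF h := be^-1 * ln (gZ h).
Definition gp v h := om v * expR (be * h v) / gZ h.

Lemma gZ_gt0 h : 0 < gZ h.
Proof.
rewrite lt_def sumr_ge0 ?andbT => [|v _]; last by rewrite mulr_ge0// expR_ge0.
apply/eqP => /psumr_eq0P z.
have : \sum_v om v = 0.
  apply: big1 => v _; have /eqP := z (fun v _ => mulr_ge0 (om0 v) (expR_ge0 _)) v isT.
  by rewrite mulf_eq0 (gt_eqF (expR_gt0 _)) orbF => /eqP.
by rewrite om1 => /eqP; rewrite oner_eq0.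
Qed.

Lemma gp_ge0 v h : 0 <= gp v h.
Proof. by rewrite divr_ge0 ?mulr_ge0 ?expR_ge0// ltW// gZ_gt0. Qed.

Lemma sum_gp h : \sum_v gp v h = 1.
Proof. by rewrite -mulr_suml divff// gt_eqF// gZ_gt0. Qed.

Lemma gp_le1 v h : gp v h <= 1.
Proof.
by rewrite -(sum_gp h) (bigD1 v)//= lerDl sumr_ge0// => w _; exact: gp_ge0.
Qed.

Lemma gF_le h c : (forall v, h v <= c) -> gF h <= c.
Proof.
move=> hc; rewrite /gF -(ler_pM2l be0) mulVKf ?gt_eqF//.
rewrite -[leRHS]expRK ler_ln ?posrE ?gZ_gt0 ?expR_gt0//.
rewrite -[leRHS]mul1r -om1 mulr_suml; apply: ler_sum => v _.
by rewrite ler_wpM2l// ler_expR ler_pM2l.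
Qed.

Lemma gF_ge h c : (forall v, c <= h v) -> c <= gF h.
Proof.
move=> hc; rewrite /gF -(ler_pM2l be0) mulVKf ?gt_eqF//.
rewrite -[leLHS]expRK ler_ln ?posrE ?gZ_gt0 ?expR_gt0//.
rewrite -[leLHS]mul1r -om1 mulr_suml; apply: ler_sum => v _.
by rewrite ler_wpM2l// ler_expR ler_pM2l.
Qed.

(** The partition function is at least the contribution of one atom; the logarithm of its weight is
    the entropic cost. *)
Lemma gF_ge1 h v : 0 < om v -> h v + be^-1 * ln (om v) <= gF h.
Proof.
move=> w0; rewrite /gF -(ler_pM2l be0) mulrDr !mulVKf ?gt_eqF//.
rewrite -[X in X + _]expRK -lnM ?posrE ?expR_gt0//.
rewrite ler_ln ?posrE ?gZ_gt0 ?mulr_gt0 ?expR_gt0//.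
rewrite /gZ (bigD1 v)//= mulrC lerDl sumr_ge0// => w _.
by rewrite mulr_ge0// expR_ge0.
Qed.

Lemma gF_norm h : `|gF h| <= \sum_v `|h v|.
Proof.
have hv v : `|h v| <= \sum_v `|h v| by rewrite (bigD1 v)//= lerDl sumr_ge0.
rewrite ler_norml; apply/andP; split; [apply: gF_ge => v|apply: gF_le => v].
  by apply: le_trans (lerNnormlW _) => //; rewrite lerN2.
exact: le_trans (ler_norm _) _.
Qed.

Lemma ccl_gZ : ccl gZ.
Proof.
move=> S FF Ff x l xl; apply: cvg_fsum => v; apply: cvgM; first exact: cvg_cst.
apply: (@cvg_comp _ _ _ (fun s => be * x s v) expR _ (nbhs (be * l v))).
  by apply: cvgM; [exact: cvg_cst|exact: xl].
exact: continuous_expR.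
Qed.

Lemma mcl_gZ : mcl gZ.
Proof.
move=> d U X mX; apply: measurable_sum => v; apply: measurable_funM => //.
by apply: measurableT_comp => //; apply: measurable_funM.
Qed.

Lemma nice_gF : nice gF.
Proof.
split.
- move=> d U X mX; apply: measurable_funM => //.
  apply: (measurableT_comp (@measurable_ln R)).
  exact: mcl_gZ.
- exists 1, 1%N => u; rewrite mul1r expr1 (le_trans (gF_norm u))//.
  by rewrite /vbnd lerDr.
- move=> S FF Ff x l xl; apply: cvgM; first exact: cvg_cst.
  apply: (@cvg_comp _ _ _ (fun s => gZ (x s)) (@ln R) _ (nbhs (gZ l))).
    exact: ccl_gZ.
  exact: continuous_ln (gZ_gt0 l).
Qed.

(** A form free of division: regularity and the gradient of the Gibbs weights are inherited from
    those of the free energy. *)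
Lemma gpE v h : gp v h = om v * expR (be * (h v - gF h)).
Proof.
rewrite mulrBr expRD expRN /gF mulVKf ?gt_eqF// lnK ?posrE ?gZ_gt0//.
by rewrite mulrA.
Qed.

Lemma nice_gp v : nice (gp v).
Proof.
have [mF _ cF] := nice_gF.
split.
- move=> d U X mX; under eq_fun do rewrite gpE; apply: measurable_funM => //.
  apply: (measurableT_comp (@measurable_expR R)); apply: measurable_funM => //.
  by apply: measurable_funB => //; exact: mF.
- apply: (@pbd_bounded _ _ _ 1) => u.
  by rewrite ger0_norm ?gp_ge0 ?gp_le1.
- move=> S FF Ff x l xl; under eq_fun do rewrite gpE.
  rewrite gpE; apply: cvgM; first exact: cvg_cst.
  apply: (@cvg_comp _ _ _ (fun s => be * (x s v - gF (x s))) expR _ (nbhs (be * (l v - gF l)))).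
    by apply: cvgM; [exact: cvg_cst|apply: cvgB; [exact: xl|exact: cF]].
  exact: continuous_expR.
Qed.

Lemma cdf_gZ : cdf gZ (fun m h => be * (om m * expR (be * h m))).
Proof.
have ce v : cdf (fun h => om v * expR (be * h v))
    (fun m h => (m == v)%:R * (be * (om v * expR (be * h v)))).
  have c1 := cdfM (@cdf_cst R V be) (@cdf_proj R V v).
  have c2 := cdf_comp1 (h := expR) (h' := expR) (fun u => is_derive_expR _) c1.
  refine (cdf_ext _ _ (cdfM (@cdf_cst R V (om v)) c2)) => // m u /=; ring.
refine (cdf_ext _ _ (cdf_sum (index_enum V) ce)) => // m u.
rewrite (bigD1 m)//= eqxx mul1r big1 ?addr0// => v vm.
by rewrite eq_sym (negPf vm) mul0r.
Qed.

Lemma smooth1_gF : smooth1 gF gp.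
Proof.
split; [exact: nice_gF|exact: nice_gp|].
have c1 := cdf_comp1 (h := @ln R) (h' := fun x => x^-1) (fun u => is_derive1_ln (gZ_gt0 u)) cdf_gZ.
refine (cdf_ext _ _ (cdfM (@cdf_cst R V be^-1) c1)) => // m u /=.
by rewrite mulr0 addr0 /gp; field; rewrite !gt_eqF// gZ_gt0.
Qed.

Definition dgp v m h := be * (gp v h * ((m == v)%:R - gp m h)).

Lemma smooth1_gp v : smooth1 (gp v) (dgp v).
Proof.
split; first exact: nice_gp.
  move=> m; apply: niceZ; apply: niceM; first exact: nice_gp.
  by apply: niceB; [exact: nice_cst|exact: nice_gp].
have [_ _ cF] := smooth1_gF.
have c1 := cdfM (@cdf_cst R V be) (cdfD (@cdf_proj R V v) (cdfM (@cdf_cst R V (-1)) cF)).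
have c2 := cdf_comp1 (h := expR) (h' := expR) (fun u => is_derive_expR _) c1.
have e u : om v * expR (be * (u v + -1 * gF u)) = gp v u by rewrite mulN1r gpE.
refine (cdf_ext e _ (cdfM (@cdf_cst R V (om v)) c2)) => m u /=.
by rewrite /dgp -e /=; ring.
Qed.

Definition ddgp v m m' h := be * (gp v h * (- dgp m m' h) + ((m == v)%:R - gp m h) * dgp v m' h).

Lemma smooth2_gp v : smooth2 (gp v) (dgp v) (ddgp v).
Proof.
split; first exact: smooth1_gp.
move=> m; apply: smooth1Z.
have s1 := smooth1D (smooth1_cst _ ((m == v)%:R)) (smooth1Z (-1) (smooth1_gp m)).
refine (smooth1_ext _ _ (smooth1M (smooth1_gp v) s1)) => [u|m' u] /=.
  by rewrite mulN1r.
by ring.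
Qed.

Lemma smooth2_gF : smooth2 gF gp dgp.
Proof. by split; [exact: smooth1_gF|exact: smooth1_gp]. Qed.

End gibbs.

(** * Comparison of free energies in the manner of Sudakov and Fernique *)

Section sudakov_fernique.
Context {R : realType} (V : finType) (om : V -> R) (be : R).
Hypothesis om0 : forall v, 0 <= om v.
Hypothesis om1 : \sum_v om v = 1.
Hypothesis be0 : 0 < be.

(** For a covariance [D] this is the second moment of the increment between [v] and [w]. *)
Definition incr (D : V -> V -> R) v w := D v v + D w w - 2 * D v w.

(** The rows of the Hessian of the free energy sum to 0, so its contraction with [D] sees only
    increments. *)
Lemma gibbs_hessian (D : V -> V -> R) h :
  \sum_v \sum_w D v w * dgp om be v w h =
  be / 2 * \sum_v \sum_w gp om be v h * gp om be w h * incr D v w.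
Proof.
pose p v := gp om be v h.
have ps : \sum_v p v = 1 := sum_gp be om0 om1 h.
pose S := \sum_v \sum_w p v * p w * D v w.
pose S1 := \sum_v p v * D v v.
transitivity (be * (S1 - S)).
  rewrite /S1 /S -sumrB mulr_sumr; apply: eq_bigr => v _.
  rewrite (eq_bigr (fun w => be * (p v * D v w * (w == v)%:R - p v * p w * D v w))) => [|w _]; last first.
    by rewrite /dgp -/(p v) -/(p w); ring.
  rewrite -mulr_sumr sumrB (bigD1 v)//= eqxx mulr1 big1 ?addr0// => w /negPf->.
  by rewrite mulr0.
have e1 : \sum_v \sum_w p v * p w * D v v = S1.
  apply: eq_bigr => v _; under eq_bigr do rewrite mulrAC.
  by rewrite -mulr_sumr ps mulr1.
have e2 : \sum_v \sum_w p v * p w * D w w = S1.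
  rewrite exchange_big/= -e1; apply: eq_bigr => v _; apply: eq_bigr => w _.
  by rewrite (mulrC (p w)).
rewrite (_ : \sum_v _ = S1 + S1 - 2 * S).
  by field.
rewrite -{1}e1 -e2 /S mulr_sumr -big_split/= -sumrB; apply: eq_bigr => v _.
rewrite mulr_sumr -big_split/= -sumrB; apply: eq_bigr => w _.
by rewrite /incr -/(p v) -/(p w); ring.
Qed.

Context d (T : measurableType d) (P : probability T R).
Context d' (T' : measurableType d') (Q : probability T' R).
Context (I J : finType) (X : I -> T -> R) (Y : J -> T' -> R).
Hypothesis gX : gfam P X.
Hypothesis gY : gfam Q Y.
Variables (A : V -> I -> R) (B : V -> J -> R).
Let kA v w := \sum_i A v i * A w i.
Let kB v w := \sum_j B v j * B w j.

(** The derivative along the rotation from A X to B Y is sin cos times the Hessian contracted with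
    the difference of covariances. By [gibbs_hessian] it is an average of differences of increments,
    all nonnegative. *)
Lemma sudakov_fernique : (forall v w, incr kA v w <= incr kB v w) ->
  Ex P (fun w => gF om be (lin A (X^~ w))) <= Ex Q (fun w => gF om be (lin B (Y^~ w))).
Proof.
move=> AB; have [nF _ _] := smooth1_gF om0 om1 be0.
pose U (t : R) v (k : I + J) : R :=
  match k with inl i => cos t * A v i | inr j => sin t * B v j end.
pose U' (t : R) v (k : I + J) : R :=
  match k with inl i => - sin t * A v i | inr j => cos t * B v j end.
have gXY := gfam_prod gX gY.
pose K := 1 + \sum_m (\sum_i `|A m i| + \sum_j `|B m j|).
have s0 m : 0 <= \sum_i `|A m i| + \sum_j `|B m j| by rewrite addr_ge0 ?sumr_ge0.
have K0 : 0 <= K by rewrite addr_ge0// sumr_ge0.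
have AK m : \sum_i `|A m i| + \sum_j `|B m j| <= K.
  by rewrite /K (bigD1 m)//= addrCA lerDl addr_ge0// sumr_ge0.
have AK1 m i : `|A m i| <= K.
  apply: le_trans (AK m); rewrite (bigD1 i)//= -addrA lerDl.
  by rewrite addr_ge0// sumr_ge0.
have AK2 m i : `|B m i| <= K.
  apply: le_trans (AK m); rewrite [X in _ + X](bigD1 i)//= addrCA lerDl.
  by rewrite addr_ge0// sumr_ge0.
have bU s v i : `|U s v i| <= K.
  case: i => i /=; rewrite normrM -[leRHS]mul1r ler_pM//; first exact: cos_max.
  exact: sin_max.
have bU' s v i : `|U' s v i| <= K.
  case: i => i /=; rewrite normrM ?normrN -[leRHS]mul1r ler_pM//; first exact: sin_max.
  exact: cos_max.
have dU s v i : is_derive s (1 : R) (fun a => U a v i) (U' s v i).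
  by case: i => i /=; apply: is_derive_eq; rewrite /GRing.scale/=; ring.
have [sF sp] := smooth2_gF om0 om1 be0.
pose c (a : R) := Ex (pprod P Q) (fun w => gF om be (lin (U a) ((sumf X Y)^~ w))).
pose D (t : R) := \sum_m \sum_m' (\sum_i U' t m i * U t m' i) *
  Ex (pprod P Q) (fun w => dgp om be m m' (lin (U t) ((sumf X Y)^~ w))).
have dc t : is_derive t (1 : R) c (D t) := interpolation gXY dU bU bU' sF sp t.
have LA : L1 P (fun w => gF om be (lin A (X^~ w))) := gfam_L1 gX (nice_lin A nF).
have LB : L1 Q (fun w => gF om be (lin B (Y^~ w))) := gfam_L1 gY (nice_lin B nF).
have <- : c 0 = Ex P (fun w => gF om be (lin A (X^~ w))).
  rewrite -(Ex_fst Q LA); apply: eq_Rintegral => z _; congr gF; apply/funext => v.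
  rewrite /lin big_sumType/= [X in _ + X]big1 ?addr0 => [|j _].
    by apply: eq_bigr => i _; rewrite cos0 mul1r.
  by rewrite sin0 !mul0r.
have <- : c (pi / 2) = Ex Q (fun w => gF om be (lin B (Y^~ w))).
  rewrite -(Ex_snd P LB); apply: eq_Rintegral => z _; congr gF; apply/funext => v.
  rewrite /lin big_sumType/= [X in X + _]big1 ?add0r => [|j _].
    by apply: eq_bigr => i _; rewrite sin_pihalf mul1r.
  by rewrite cos_pihalf !mul0r.
have pi20 : 0 < pi / 2 :> R by rewrite divr_gt0 ?pi_gt0.
rewrite -lerN2.
have dN (x : R) : is_derive x (1 : R) (fun t => - c t) (- D x).
  have dx := dc x; exact: (@is_deriveN _ _ _ c x 1 (D x)).
refine (derive_le0_le (ltW pi20) dN _).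
move=> t /andP[t0 t1]; rewrite oppr_le0.
have ct : 0 < cos t by apply: cos_gt0_pihalf; rewrite t1 (lt_trans _ t0)// oppr_lt0.
have st : 0 < sin t by apply: sin_gt0_pihalf; rewrite t0.
have kE v w : \sum_i U' t v i * U t w i = sin t * cos t * (kB v w - kA v w).
  rewrite big_sumType/= mulrBr addrC -mulNr /kA /kB !mulr_sumr; congr (_ + _);
  by apply: eq_bigr => i _; ring.
have Lp v w : L1 (pprod P Q) (fun z => dgp om be v w (lin (U t) ((sumf X Y)^~ z))).
  by have [_ nd _] := sp v; exact: (gfam_L1 gXY (nice_lin (U t) (nd w))).
rewrite /D.
rewrite (_ : \sum_m _ = Ex (pprod P Q) (fun z => \sum_v \sum_w
    (sin t * cos t * (kB v w - kA v w)) * dgp om be v w (lin (U t) ((sumf X Y)^~ z)))).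
  apply: Ex_ge0 => z; rewrite (gibbs_hessian (fun v w => sin t * cos t * (kB v w - kA v w))).
  rewrite mulr_ge0 ?divr_ge0 ?(ltW be0)//.
  apply: sumr_ge0 => v _; apply: sumr_ge0 => w _.
  apply: mulr_ge0; first by rewrite mulr_ge0// gp_ge0.
  rewrite (_ : incr _ v w = sin t * cos t * (incr kB v w - incr kA v w)); last by rewrite /incr; ring.
  by rewrite !mulr_ge0 ?(ltW ct) ?(ltW st)// subr_ge0.
rewrite Ex_sum; last by move=> v; apply: L1_sum => w; exact: L1Z.
apply: eq_bigr => v _; rewrite Ex_sum; last by move=> w; exact: L1Z.
by apply: eq_bigr => w _; rewrite kE ExZ.
Qed.

End sudakov_fernique.

(** * Suprema of Gaussian fields, independently of the number of points *)

Section supremum.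
Context {R : realType} (V : finType).
Context d (T : measurableType d) (P : probability T R).
Context d' (T' : measurableType d') (Q : probability T' R).

(** The squared gradient of the free energy is a two-replica Gibbs average of the covariance of the
    field, hence at most its largest entry. *)
Lemma csum1_le (I : finType) (X : I -> T -> R) (A : V -> I -> R) om be kap : gfam P X ->
  (forall v, 0 <= om v) -> \sum_v om v = 1 -> 0 < be ->
  (forall v w, \sum_i A v i * A w i <= kap) ->
  csum P X A (gp om be) 1 <= kap.
Proof.
move=> gX om0 om1 be0 kk.
have sp := smooth2_gp om0 om1 be0.
have np v : nice (gp om be v) := nice_gp om0 om1 be0 v.
have nf i : nice (fun u => (\sum_v A v i * gp om be v u) ^+ 2).
  under eq_fun do rewrite expr2.
  by apply: niceM; apply: nice_sum => v; exact: niceZ.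
apply: (@le_trans _ _ (\sum_i Ex P (fun x => (\sum_v A v i * gp om be v (lin A (X^~ x))) ^+ 2))).
  apply: ler_sum => i _; apply: (corr_le A gX (smooth2_fi A sp i)).
  by rewrite ler01 lexx.
rewrite -Ex_sum; last by move=> i; exact: (gfam_L1 gX (nice_lin A (nf i))).
rewrite -(Ex_cst P kap); apply: Ex_le; last first.
- move=> x; set h := lin A _.
  have -> : \sum_i (\sum_v A v i * gp om be v h) ^+ 2 =
      \sum_v \sum_w gp om be v h * gp om be w h * (\sum_i A v i * A w i).
    under eq_bigr do rewrite expr2 mulr_suml.
    rewrite exchange_big/=; apply: eq_bigr => v _.
    under eq_bigr do rewrite mulr_sumr.
    rewrite exchange_big/=; apply: eq_bigr => w _; rewrite mulr_sumr.
    by apply: eq_bigr => i _; ring.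
  rewrite -[leRHS]mul1r -(sum_gp be om0 om1 h) mulr_suml; apply: ler_sum => v _.
  rewrite -[X in _ <= _ * X]mul1r -[X in _ <= _ * (X * _)](sum_gp be om0 om1 h) mulr_suml mulr_sumr.
  by apply: ler_sum => w _; rewrite -mulrA ler_wpM2l ?gp_ge0// ler_wpM2l ?gp_ge0.
- exact: L1_cst.
- by apply: L1_sum => i; exact: (gfam_L1 gX (nice_lin A (nf i))).
Qed.

Lemma Ex_dev_le (f : T -> R) : measurable_fun setT f -> L1 P (fun w => f w ^+ 2) -> L1 P f ->
  forall B, Ex P (fun w => f w ^+ 2) - Ex P f ^+ 2 <= B ->
  Ex P (fun w => `|f w - Ex P f|) <= Num.sqrt B.
Proof.
move=> mf f2 f1 B hB; set m := Ex P f.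
have mg : measurable_fun setT (fun w => `|f w - m|).
  by apply: measurable_norm; exact: measurable_funB.
have e2 w : `|f w - m| ^+ 2 = f w ^+ 2 - 2 * m * f w + m ^+ 2.
  by rewrite real_normK ?num_real//; ring.
have l2 : L1 P (fun w => `|f w - m| ^+ 2).
  under eq_fun do rewrite e2.
  by apply: L1D; [apply: L1B => //; exact: L1Z|exact: L1_cst].
have o2 : L1 P (fun w => 1 ^+ 2) by exact: L1_cst.
have h : Ex P (fun w => `|f w - m| * 1) ^+ 2 <= Ex P (fun w => `|f w - m| ^+ 2) * Ex P (fun w => 1 ^+ 2).
  by apply: Ex_CS => //; exact: measurable_cst.
have e1 : (fun w => `|f w - m| * 1) = (fun w => `|f w - m|) by apply/funext => w; rewrite mulr1.
rewrite e1 expr1n Ex_cst mulr1 in h.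
have e0 : 0 <= Ex P (fun w => `|f w - m|) by exact: Ex_ge0.
rewrite -(ger0_norm e0) -sqrtr_sqr ler_wsqrtr// (le_trans h)//.
under eq_fun do rewrite e2.
have l3 := L1Z (2 * m) f1; have l4 := L1B f2 l3; have l5 := L1_cst P (m ^+ 2).
rewrite (ExD l4 l5) (ExB f2 l3) (ExZ _ f1) Ex_cst -/m.
by move: hB; rewrite -/m; nra.
Qed.

(** The maximum is replaced by a free energy [F], and [D] is the deviation of [F] from its mean. The
    variance bound controls [D], and comparison with the linear field c (x . Y) controls the mean.
    The number of points does not occur in the result, so it survives refinement of the grid. *)
Lemma gauss_sup (I : finType) (X : I -> T -> R) (A : V -> I -> R) N (Y : 'I_N -> T' -> R)
    (x : V -> 'I_N -> R) (c kap : R) : gfam P X -> gfam Q Y -> (0 < N)%N -> (0 < #|V|)%N ->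
  0 <= c -> (forall v, \sum_i x v i ^+ 2 = 1) ->
  (forall v w, \sum_i A v i * A w i <= kap) ->
  (forall v w, incr (fun v w => \sum_i A v i * A w i) v w <=
     c ^+ 2 * \sum_i (x v i - x w i) ^+ 2) ->
  exists D : T -> R, [/\ L1 P D, forall w, 0 <= D w, Ex P D <= Num.sqrt kap &
    forall w v, lin A (X^~ w) v <= c * Num.sqrt N%:R + 1 + D w].
Proof.
move=> gX gY N0 V0 c0 x1 kk kinc.
pose om (v : V) : R := (#|V|%:R)^-1.
have om0 v : 0 <= om v by rewrite invr_ge0.
have omp v : 0 < om v by rewrite invr_gt0 ltr0n.
have om1 : \sum_v om v = 1.
  by rewrite /om sumr_const -[LHS]mulr_natr mulVf// pnatr_eq0 -lt0n.
(* This temperature makes the entropic cost ln |V| / be at most 1. *)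
pose be : R := 1 + `|ln #|V|%:R|.
have be0 : 0 < be by rewrite ltr_wpDr.
have nF : nice (gF om be) := nice_gF om0 om1 be0.
pose F w := gF om be (lin A (X^~ w)).
have LF : L1 P F := gfam_L1 gX (nice_lin A nF).
have LF2 : L1 P (fun w => F w ^+ 2).
  by under eq_fun do rewrite expr2; exact: (gfam_L1 gX (nice_lin A (niceM nF nF))).
exists (fun w => `|F w - Ex P F|); split => //.
- by apply: L1_abs; apply: L1B => //; exact: L1_cst.
- apply: (Ex_dev_le (L1_meas LF) LF2 LF).
  (* Since [csum] is monotone, [variance_le] at 1/2 returns the Poincare bound [csum 1]. *)
  have hh : 0 < (2^-1 : R) < 1 by lra.
  have := variance_le A gX (smooth2_gF om0 om1 be0) (smooth2_gp om0 om1 be0) hh.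
  move=> h; apply: le_trans h _.
  have c1 := csum1_le gX om0 om1 be0 kk.
  have c2 : csum P X A (gp om be) 2^-1 <= csum P X A (gp om be) 1.
    by apply: (csum_mono A gX (smooth2_gp om0 om1 be0)); lra.
  by move: c1 c2; set a := csum _ _ _ _ 1; set b := csum _ _ _ _ _; lra.
move=> w v.
have h1 : lin A (X^~ w) v <= F w + 1.
  have := gF_ge1 om0 om1 be0 (lin A (X^~ w)) (omp v); rewrite -/(F w).
  rewrite /om lnV ?posrE ?ltr0n// mulrN => h.
  have : be^-1 * ln #|V|%:R <= 1.
    rewrite mulrC ler_pdivrMr// mul1r /be (le_trans (ler_norm _))//.
    by rewrite lerDr.
  by move: h; set a := be^-1 * _; lra.
have h2 : Ex P F <= c * Num.sqrt N%:R.
  pose B v i := c * x v i.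
  have := sudakov_fernique om0 om1 be0 gX gY (A := A) (B := B); rewrite -/F.
  have sN : 0 < Num.sqrt N%:R :> R by rewrite sqrtr_gt0 ltr0n.
  move=> h; have {h}: Ex P F <= Ex Q (fun w => gF om be (lin B (Y^~ w))).
    apply: h => u u'; apply: le_trans (kinc u u') _.
    rewrite /incr mulr_sumr (mulr_sumr _ _ _ 2) -big_split/= -sumrB; apply: ler_sum => i _.
    by rewrite /B le_eqVlt; apply/orP; left; apply/eqP; ring.
  move=> h; apply: le_trans h _.
  (* With s = sqrt N, the inequality |Y| <= (|Y|^2 / s + s) / 2 replaces the expected norm by a
     second moment and has the exact mean s. *)
  pose G w := c / 2 * ((Num.sqrt N%:R)^-1 * (\sum_i Y i w ^+ 2) + Num.sqrt N%:R).
  have LY i : L1 Q (fun w => Y i w ^+ 2).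
    under eq_fun do rewrite expr2.
    exact: (gfam_L1 gY (niceM (nice_proj i) (nice_proj i))).
  have EY i : Ex Q (fun w => Y i w ^+ 2) = 1.
    under eq_fun do rewrite expr2.
    by rewrite (gf_ibp gY (smooth1_proj i) i) eqxx Ex_cst.
  have LG : L1 Q G.
    apply: L1Z; apply: L1D; last exact: L1_cst.
    by apply: L1Z; apply: L1_sum => i; exact: LY.
  have -> : c * Num.sqrt N%:R = Ex Q G.
    have l1 : L1 Q (fun w => \sum_i Y i w ^+ 2) by apply: L1_sum => i; exact: LY.
    have l2 := L1Z (Num.sqrt N%:R)^-1 l1; have l3 := L1_cst Q (Num.sqrt N%:R).
    rewrite /G (ExZ _ (L1D l2 l3)) (ExD l2 l3) (ExZ _ l1) Ex_cst.
    rewrite Ex_sum; last by move=> i; exact: LY.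
    under eq_bigr do rewrite EY.
    rewrite sumr_const card_ord.
    have -> : (Num.sqrt N%:R)^-1 * N%:R = Num.sqrt N%:R :> R.
      by rewrite -{2}[N%:R](@sqr_sqrtr R)// expr2 mulKf// gt_eqF.
    by field.
  apply: Ex_le => //; first exact: (gfam_L1 gY (nice_lin B nF)).
  move=> w'; apply: gF_le => // u; rewrite /lin /B.
  have -> : \sum_i c * x u i * Y i w' = c * \sum_i x u i * Y i w'.
    by rewrite mulr_sumr; apply: eq_bigr => i _; rewrite mulrA.
  rewrite /G -mulrA ler_wpM2l//.
  set s := Num.sqrt N%:R in sN *.
  have -> : 2^-1 * (s^-1 * (\sum_i Y i w' ^+ 2) + s) =
      \sum_i 2^-1 * (s^-1 * Y i w' ^+ 2 + s * x u i ^+ 2).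
    by rewrite -mulr_sumr big_split/= -!mulr_sumr x1 mulr1.
  apply: ler_sum => i _; rewrite -subr_ge0.
  rewrite (_ : _ - _ = 2^-1 * s^-1 * (Y i w' - s * x u i) ^+ 2).
    by rewrite mulr_ge0 ?sqr_ge0// mulr_ge0// invr_ge0 ltW.
  by field; rewrite gt_eqF.
have := ler_norm (F w - Ex P F).
by move: h1 h2; lra.
Qed.

End supremum.

(** * Disorder chaos for finite Gibbs measures *)

Section replicas.
Context {R : realType} (V : finType) (om : V -> R) (be : R).
Hypothesis om0 : forall v, 0 <= om v.
Hypothesis om1 : \sum_v om v = 1.
Hypothesis be0 : 0 < be.
Context d (T : measurableType d) (P : probability T R) (J : finType) (X : J -> T -> R).
Hypothesis gX : gfam P X.
Variables E1 E2 : V -> J -> R.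

Definition P1 v (G : J -> R) := gp om be v (lin E1 G).
Definition P2 v (G : J -> R) := gp om be v (lin E2 G).

Lemma smooth1_gp_lin (E : V -> J -> R) v : smooth1 (fun G => gp om be v (lin E G))
  (fun i G => be * (gp om be v (lin E G) * (E v i - \sum_u gp om be u (lin E G) * E u i))).
Proof.
have s := smooth1_lin E (smooth1_gp om0 om1 be0 v).
refine (smooth1_ext _ _ s) => // i G; rewrite /dgp.
set p := fun u => gp om be u (lin E G); rewrite -/(p v).
rewrite (eq_bigr (fun u => be * p v * ((u == v)%:R * E u i) - be * p v * (p u * E u i))) => [|u _]; last first.
  by rewrite -/(p u) -/(p v); ring.
rewrite sumrB -!mulr_sumr (bigD1 v)//= eqxx mul1r big1 ?addr0 => [|u /negPf->]; last by rewrite mul0r.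
by rewrite mulrBr !mulrBr !mulrA.
Qed.

Lemma nice_P1 v : nice (P1 v). Proof. by have [] := smooth1_gp_lin E1 v. Qed.
Lemma nice_P2 v : nice (P2 v). Proof. by have [] := smooth1_gp_lin E2 v. Qed.
Lemma P1_ge0 v G : 0 <= P1 v G. Proof. exact: gp_ge0. Qed.
Lemma P2_ge0 v G : 0 <= P2 v G. Proof. exact: gp_ge0. Qed.
Lemma sum_P1 G : \sum_v P1 v G = 1. Proof. exact: sum_gp. Qed.
Lemma sum_P2 G : \sum_v P2 v G = 1. Proof. exact: sum_gp. Qed.

Definition rfun := (J -> R) -> V -> V -> V -> V -> R.
Implicit Types F H : rfun.

Definition niceR F := forall s s' t t', nice (fun G => F G s s' t t').

(** [s] and [s'] are replicas of the first system, [t] and [t'] of the second, all independent given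
    the disorder [G]. *)
Definition AV F (G : J -> R) : R :=
  \sum_s \sum_s' \sum_t \sum_t' P1 s G * P1 s' G * P2 t G * P2 t' G * F G s s' t t'.

Definition EE F : R := Ex P (fun w => AV F (X^~ w)).

Lemma nice_AV F : niceR F -> nice (AV F).
Proof.
move=> nF; apply: nice_sum => s; apply: nice_sum => s'; apply: nice_sum => t; apply: nice_sum => t'.
apply: niceM => //; apply: niceM; last exact: nice_P2; apply: niceM; last exact: nice_P2.
by apply: niceM; exact: nice_P1.
Qed.

Lemma L1_AV F : niceR F -> L1 P (fun w => AV F (X^~ w)).
Proof. by move=> nF; exact: (gfam_L1 gX (nice_AV nF)). Qed.

Lemma EE_ext F H : (forall G s s' t t', F G s s' t t' = H G s s' t t') -> EE F = EE H.
Proof.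
move=> FH; apply: eq_Rintegral => w _; rewrite /AV.
by apply: eq_bigr => s _; apply: eq_bigr => s' _; apply: eq_bigr => t _;
   apply: eq_bigr => t' _; rewrite FH.
Qed.

Lemma EED F H : niceR F -> niceR H ->
  EE (fun G s s' t t' => F G s s' t t' + H G s s' t t') = EE F + EE H.
Proof.
move=> nF nH; rewrite /EE -ExD; try exact: L1_AV.
apply: eq_Rintegral => w _; rewrite /AV.
do 4! (rewrite -big_split/=; apply: eq_bigr => ? _).
by rewrite -mulrDr.
Qed.

Lemma EEZ c F : niceR F -> EE (fun G s s' t t' => c * F G s s' t t') = c * EE F.
Proof.
move=> nF; rewrite /EE -ExZ; try exact: L1_AV.
apply: eq_Rintegral => w _; rewrite /AV.
do 4! (rewrite mulr_sumr; apply: eq_bigr => ? _).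
by rewrite mulrCA.
Qed.

Lemma EEN F : niceR F -> EE (fun G s s' t t' => - F G s s' t t') = - EE F.
Proof. by move=> nF; rewrite -mulN1r -EEZ//; apply: EE_ext => *; rewrite mulN1r. Qed.

Lemma EEB F H : niceR F -> niceR H ->
  EE (fun G s s' t t' => F G s s' t t' - H G s s' t t') = EE F - EE H.
Proof.
move=> nF nH; rewrite -EEN// -EED// => s s' t t'.
by apply: niceN; exact: nH.
Qed.

Lemma EE_sum (K : Type) (r : seq K) (F : K -> rfun) : (forall k, niceR (F k)) ->
  EE (fun G s s' t t' => \sum_(k <- r) F k G s s' t t') = \sum_(k <- r) EE (F k).
Proof.
move=> nF; elim: r => [|k r IH].
  rewrite big_nil (EE_ext (H := fun _ _ _ _ _ => 0 * 0)) => [|*]; last by rewrite big_nil mul0r.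
  by rewrite (@EEZ 0 (fun _ _ _ _ _ => 0)) ?mul0r// => s s' t t'; exact: nice_cst.
rewrite big_cons -IH -EED//; last by move=> s s' t t'; apply: nice_sum => k'; exact: nF.
by apply: EE_ext => *; rewrite big_cons.
Qed.

Lemma AV1 (Y : (J -> R) -> R) G : AV (fun G _ _ _ _ => Y G) G = Y G.
Proof.
rewrite /AV; set y := Y G.
transitivity (\sum_s P1 s G * \sum_s' P1 s' G * \sum_t P2 t G * \sum_t' P2 t' G * y).
  apply: eq_bigr => s _; rewrite mulr_sumr; apply: eq_bigr => s' _.
  rewrite 2!mulr_sumr; apply: eq_bigr => t _; rewrite 3!mulr_sumr; apply: eq_bigr => t' _.
  by rewrite !mulrA.
have e2 : \sum_t P2 t G * y = y by rewrite -mulr_suml sum_P2 mul1r.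
have e1 : \sum_t P1 t G * y = y by rewrite -mulr_suml sum_P1 mul1r.
by rewrite !e2 !e1.
Qed.

Lemma EE_G (Y : (J -> R) -> R) : EE (fun G _ _ _ _ => Y G) = Ex P (fun w => Y (X^~ w)).
Proof. by apply: eq_Rintegral => w _; rewrite AV1. Qed.

Lemma AV_le F H G : (forall s s' t t', F G s s' t t' <= H G s s' t t') -> AV F G <= AV H G.
Proof.
move=> FH; rewrite /AV; do 4! (apply: ler_sum => ? _).
apply: ler_wpM2l; last exact: FH.
exact: (mulr_ge0 (mulr_ge0 (mulr_ge0 (P1_ge0 _ _) (P1_ge0 _ _)) (P2_ge0 _ _)) (P2_ge0 _ _)).
Qed.

Lemma EE_le F H : niceR F -> niceR H ->
  (forall G s s' t t', F G s s' t t' <= H G s s' t t') -> EE F <= EE H.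
Proof.
move=> nF nH FH; apply: Ex_le; try exact: L1_AV.
by move=> w; apply: AV_le => *; exact: FH.
Qed.

Lemma EE_swap1 F : EE F = EE (fun G s s' t t' => F G s' s t t').
Proof.
apply: eq_Rintegral => w _; rewrite /AV exchange_big/=.
apply: eq_bigr => s _; apply: eq_bigr => s' _; apply: eq_bigr => t _; apply: eq_bigr => t' _.
by rewrite (mulrC (P1 s' _)).
Qed.

Lemma EE_swap2 F : EE F = EE (fun G s s' t t' => F G s s' t' t).
Proof.
apply: eq_Rintegral => w _; rewrite /AV.
apply: eq_bigr => s _; apply: eq_bigr => s' _; rewrite exchange_big/=; apply: eq_bigr => t _.
apply: eq_bigr => t' _.
by rewrite (mulrAC _ (P2 t' _)).
Qed.

(** The weight of [t'] sums to 1; [t0] fills an argument on which [F] does not depend. *)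
Lemma AV3 F G : (forall s s' t t' t2, F G s s' t t' = F G s s' t t2) -> forall t0,
  AV F G = \sum_s \sum_s' \sum_t P1 s G * P1 s' G * P2 t G * F G s s' t t0.
Proof.
move=> FF t0; apply: eq_bigr => s _; apply: eq_bigr => s' _; apply: eq_bigr => t _.
under eq_bigr => t' _ do rewrite (FF _ _ _ _ t0) mulrAC.
by rewrite -mulr_sumr sum_P2 mulr1.
Qed.

Lemma Ex_sum3 (h : V -> V -> V -> T -> R) : (forall s s' t, L1 P (h s s' t)) ->
  Ex P (fun w => \sum_s \sum_s' \sum_t h s s' t w) = \sum_s \sum_s' \sum_t Ex P (h s s' t).
Proof.
move=> l; rewrite Ex_sum; last by move=> s; apply: L1_sum => s'; apply: L1_sum => t.
apply: eq_bigr => s _; rewrite Ex_sum; last by move=> s'; apply: L1_sum => t.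
by apply: eq_bigr => s' _; rewrite Ex_sum.
Qed.

(** Differentiating the weights of [s] and [s'] yields the values at both minus twice the Gibbs mean
    of the first system, kept as a sum over [u]. The weight of [t] yields the value at [t] minus a
    Gibbs mean of the second system, which is written with the fresh replica [t']. The second
    hypothesis on [c] removes the derivative of [f]. *)
Lemma EE_ibp (c : V -> V -> V -> J -> R) (f : (J -> R) -> R) df : smooth1 f df ->
  (forall s s' t i G, c s s' t i * df i G = 0) ->
  EE (fun G s s' t t' => f G * \sum_i c s s' t i * G i) =
  be * EE (fun G s s' t t' => f G * (\sum_i c s s' t i * E1 s i + \sum_i c s s' t i * E1 s' i -
    2 * \sum_u P1 u G * \sum_i c s s' t i * E1 u i +
    \sum_i c s s' t i * E2 t i - \sum_i c s s' t i * E2 t' i)).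
Proof.
move=> sf cf.
have [nf ndf _] := sf.
have sP s s' t := smooth1M sf (smooth1M (smooth1M (smooth1_gp_lin E1 s) (smooth1_gp_lin E1 s')) (smooth1_gp_lin E2 t)).
pose K1 s s' t u := \sum_i c s s' t i * E1 u i.
pose K2 s s' t u := \sum_i c s s' t i * E2 u i.
pose pp s s' t G := P1 s G * P1 s' G * P2 t G.
pose B s s' t G := K1 s s' t s + K1 s s' t s' - 2 * (\sum_u P1 u G * K1 s s' t u) +
  K2 s s' t t - \sum_u P2 u G * K2 s s' t u.
have npp s s' t : nice (pp s s' t).
  by apply: niceM; [apply: niceM; exact: nice_P1|exact: nice_P2].
have nB s s' t : nice (B s s' t).
  apply: niceB; [apply: niceD; [apply: niceB|]|]; try exact: nice_cst.
    by apply: niceZ; apply: nice_sum => u; apply: niceM; [exact: nice_P1|exact: nice_cst].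
  by apply: nice_sum => u; apply: niceM; [exact: nice_P2|exact: nice_cst].
have key s s' t : Ex P (fun w => \sum_i c s s' t i * X i w * (f (X^~ w) * pp s s' t (X^~ w))) =
    be * Ex P (fun w => f (X^~ w) * pp s s' t (X^~ w) * B s s' t (X^~ w)).
  have [nfp ndfp _] := sP s s' t.
  rewrite Ex_sum; last first.
    move=> i; apply: (gfam_L1 gX (f := fun G => c s s' t i * G i * (f G * pp s s' t G))).
    by apply: niceM; [apply: niceZ; exact: nice_proj|exact: niceM].
  rewrite -ExZ; last first.
    apply: (gfam_L1 gX (f := fun G => f G * pp s s' t G * B s s' t G)).
    by apply: niceM => //; exact: niceM.
  transitivity (\sum_i c s s' t i * Ex P (fun w => X i w * (f (X^~ w) * pp s s' t (X^~ w)))).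
    apply: eq_bigr => i _; rewrite -ExZ; first by apply: eq_Rintegral => w _; rewrite -mulrA.
    apply: (gfam_L1 gX (f := fun G => G i * (f G * pp s s' t G))).
    by apply: niceM; [exact: nice_proj|exact: niceM].
  under eq_bigr => i _.
    rewrite (gf_ibp gX (sP s s' t) i) -(ExZ _ (gfam_L1 gX (ndfp i))).
    over.
  rewrite -Ex_sum; last by move=> i; exact: (L1Z _ (gfam_L1 gX (ndfp i))).
  apply: eq_Rintegral => w _; set G := X^~ w.
  pose m1 i := \sum_u P1 u G * E1 u i; pose m2 i := \sum_u P2 u G * E2 u i.
  have em1 : \sum_u P1 u G * K1 s s' t u = \sum_i c s s' t i * m1 i.
    under eq_bigr do rewrite mulr_sumr; rewrite exchange_big/=; apply: eq_bigr => i _.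
    by rewrite mulr_sumr; apply: eq_bigr => u _; rewrite mulrCA.
  have em2 : \sum_u P2 u G * K2 s s' t u = \sum_i c s s' t i * m2 i.
    under eq_bigr do rewrite mulr_sumr; rewrite exchange_big/=; apply: eq_bigr => i _.
    by rewrite mulr_sumr; apply: eq_bigr => u _; rewrite mulrCA.
  have -> : B s s' t G = \sum_i c s s' t i * (E1 s i + E1 s' i - 2 * m1 i + E2 t i - m2 i).
    rewrite /B em1 em2 /K1 /K2 mulr_sumr -big_split/= -sumrB -big_split/= -sumrB.
    by apply: eq_bigr => i _; ring.
  rewrite !mulr_sumr; apply: eq_bigr => i _.
  have := cf s s' t i G; rewrite /pp /P1 /P2 => e.
  rewrite -/(m1 i) -/(m2 i).
  set a := gp _ _ s _; set b := gp _ _ s' _; set q := gp _ _ t _.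
  rewrite mulrDr [X in _ + X = _](_ : _ = 0); first by rewrite addr0 /m1 /m2 /P1 /P2; ring.
  by rewrite mulrCA e mulr0.
(* The index set is nonempty because the weights sum to 1. *)
have [t0 _|V0] := pickP (fun _ : V => true); last first.
  have := om1; rewrite big1 => [/eqP|v]; last by have := V0 v.
  by rewrite eq_sym oner_eq0.
have eL : EE (fun G s s' t t' => f G * \sum_i c s s' t i * G i) =
    \sum_s \sum_s' \sum_t Ex P (fun w => \sum_i c s s' t i * X i w * (f (X^~ w) * pp s s' t (X^~ w))).
  have l1 s s' t : L1 P (fun w => \sum_i c s s' t i * X i w * (f (X^~ w) * pp s s' t (X^~ w))).
    apply: (gfam_L1 gX (f := fun G => \sum_i c s s' t i * G i * (f G * pp s s' t G))).
    by apply: nice_sum => i; apply: niceM; [apply: niceZ; exact: nice_proj|exact: niceM].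
  rewrite -(Ex_sum3 l1); apply: eq_Rintegral => w _; rewrite (AV3 _ t0)//.
  apply: eq_bigr => s _; apply: eq_bigr => s' _; apply: eq_bigr => t _.
  by rewrite !mulr_sumr; apply: eq_bigr => i _; rewrite /pp; ring.
rewrite eL; transitivity (be * \sum_s \sum_s' \sum_t
    Ex P (fun w => f (X^~ w) * pp s s' t (X^~ w) * B s s' t (X^~ w))).
  by do 3! (rewrite mulr_sumr; apply: eq_bigr => ? _); exact: key.
congr (_ * _).
have l2 s s' t : L1 P (fun w => f (X^~ w) * pp s s' t (X^~ w) * B s s' t (X^~ w)).
  apply: (gfam_L1 gX (f := fun G => f G * pp s s' t G * B s s' t G)).
  by apply: niceM => //; exact: niceM.
rewrite -(Ex_sum3 l2).
apply: eq_Rintegral => w _; rewrite /AV; set G := X^~ w.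
apply: eq_bigr => s _; apply: eq_bigr => s' _; apply: eq_bigr => t _.
pose Z := K1 s s' t s + K1 s s' t s' - 2 * (\sum_u P1 u G * K1 s s' t u) + K2 s s' t t.
rewrite (_ : f G * pp s s' t G * B s s' t G = \sum_t' P1 s G * P1 s' G * P2 t G * P2 t' G *
  (f G * (Z - K2 s s' t t')))//.
rewrite (eq_bigr (fun t' => P1 s G * P1 s' G * P2 t G * f G * Z * P2 t' G -
  P1 s G * P1 s' G * P2 t G * f G * (P2 t' G * K2 s s' t t'))) => [|t' _]; last by ring.
rewrite sumrB -!mulr_sumr sum_P2 /B -/Z /pp; ring.
Qed.

End replicas.

Ltac nice_tac := repeat first [exact: nice_cst | exact: nice_proj | apply: nice_sum => ? |
  apply: niceB | apply: niceD | apply: niceM | apply: niceN].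

Section replica_swap.
Context {R : realType} (V : finType) (om : V -> R) (be : R).
Hypothesis om0 : forall v, 0 <= om v.
Hypothesis om1 : \sum_v om v = 1.
Hypothesis be0 : 0 < be.
Context d (T : measurableType d) (P : probability T R) (J : finType) (X : J -> T -> R).
Hypothesis gX : gfam P X.
Variables E1 E2 : V -> J -> R.
Hypothesis E11 : forall v w, \sum_i E1 v i * E1 w i = \sum_i E2 v i * E2 w i.
Hypothesis E12 : forall v w, \sum_i E1 v i * E2 w i = \sum_i E2 v i * E1 w i.

(** An explicit Gibbs mean over [u] is the same as reading [u] as the replica [s']: the original
    weight of [s'] sums to 1 and that of [u] takes its place. *)
Lemma EE_avg (F : rfun V J) :
  EE om be P X E1 E2 (fun G s s' t t' => \sum_u P1 om be E1 u G * F G s u t t') =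
  EE om be P X E1 E2 F.
Proof.
apply: eq_Rintegral => w _; rewrite /AV; set G := X^~ w; apply: eq_bigr => s _.
transitivity (\sum_s' P1 om be E1 s' G * \sum_u \sum_t \sum_t' P1 om be E1 s G *
   P1 om be E1 u G * P2 om be E2 t G * P2 om be E2 t' G * F G s u t t').
  apply: eq_bigr => s' _.
  rewrite mulr_sumr [RHS](eq_bigr (fun u => \sum_t \sum_t' P1 om be E1 s G *
    P1 om be E1 s' G * P2 om be E2 t G * P2 om be E2 t' G * (P1 om be E1 u G * F G s u t t'))).
    rewrite [RHS]exchange_big/=; apply: eq_bigr => t _.
    rewrite [RHS]exchange_big/=; apply: eq_bigr => t' _.
    by rewrite mulr_sumr.
  move=> u _; rewrite mulr_sumr; apply: eq_bigr => t _; rewrite mulr_sumr; apply: eq_bigr => t' _.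
  by ring.
by rewrite -mulr_suml sum_P1// mul1r.
Qed.

(** Exchanging the two systems preserves the joint covariance, so [eq_law] applies to the product of
    Gibbs weights. The observable [Psi] is deterministic, which keeps the whole expression a
    function of the two fields. *)
Lemma EE_swap12 (Psi : V -> V -> V -> V -> R) :
  EE om be P X E1 E2 (fun G s s' t t' => Psi s s' t t') =
  EE om be P X E1 E2 (fun G s s' t t' => Psi t t' s s').
Proof.
pose A (k : V + V) := match k with inl v => E1 v | inr v => E2 v end.
pose B (k : V + V) := match k with inl v => E2 v | inr v => E1 v end.
have sl v := smooth2_pl V (smooth2_gp om0 om1 be0 v).
have sr v := smooth2_pr V (smooth2_gp om0 om1 be0 v).
have sf s s' t t' := smooth2Z (Psi s s' t t') (smooth2M (smooth2M (sl s) (sl s')) (smooth2M (sr t) (sr t'))).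
have [sF1 sF2] := smooth2_sum (index_enum V) (fun s => smooth2_sum (index_enum V) (fun s' =>
  smooth2_sum (index_enum V) (fun t => smooth2_sum (index_enum V) (fun t' => sf s s' t t')))).
have AB m m' : \sum_i A m i * A m' i = \sum_j B m j * B m' j.
  by case: m => v; case: m' => w /=; rewrite ?E11 ?E12.
have := eq_law gX gX AB sF1 sF2.
have eA w v : pl (gp om be v) (lin A (X^~ w)) = P1 om be E1 v (X^~ w) by [].
have eA' w v : pr (gp om be v) (lin A (X^~ w)) = P2 om be E2 v (X^~ w) by [].
have eB w v : pl (gp om be v) (lin B (X^~ w)) = P2 om be E2 v (X^~ w) by [].
have eB' w v : pr (gp om be v) (lin B (X^~ w)) = P1 om be E1 v (X^~ w) by [].
move=> e; transitivity (Ex P (fun w => \sum_s \sum_s' \sum_t \sum_t' Psi s s' t t' *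
  (pl (gp om be s) (lin A (X^~ w)) * pl (gp om be s') (lin A (X^~ w)) *
   (pr (gp om be t) (lin A (X^~ w)) * pr (gp om be t') (lin A (X^~ w)))))).
  apply: eq_Rintegral => w _; do 4! (apply: eq_bigr => ? _).
  by rewrite !eA !eA'; ring.
rewrite e; apply: eq_Rintegral => w _; rewrite /AV.
under eq_bigr => s _ do rewrite exchange_big/=.
rewrite exchange_big/=; apply: eq_bigr => t _.
rewrite [RHS](eq_bigr (fun t' => \sum_s \sum_s' P1 om be E1 t (X^~ w) * P1 om be E1 t' (X^~ w) *
  P2 om be E2 s (X^~ w) * P2 om be E2 s' (X^~ w) * Psi s s' t t'))//.
rewrite [RHS]exchange_big/=; apply: eq_bigr => s _.
rewrite [RHS]exchange_big/=; apply: eq_bigr => s' _; apply: eq_bigr => t' _.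
by rewrite !eB !eB'; ring.
Qed.

End replica_swap.

(** * The overlap estimate: inequalities between four averaged quantities *)

Section chaos.
Context {R : realType} (V : finType) (om : V -> R) (be : R).
Hypothesis om0 : forall v, 0 <= om v.
Hypothesis om1 : \sum_v om v = 1.
Hypothesis be0 : 0 < be.
Context d (T : measurableType d) (P : probability T R) (I : finType) (X : I + (I + I) -> T -> R).
Hypothesis gX : gfam P X.
Variables (N : nat) (x : V -> 'I_N -> R).
Hypothesis N2 : (2 <= N)%N.
Hypothesis x1 : forall v, \sum_i x v i ^+ 2 = 1.
Variables (e : V -> I -> R) (de : 'I_N -> V -> I -> R) (dde : 'I_N -> 'I_N -> V -> I -> R).
Variables (xi1 xi2 : R -> R).
Definition dot v w := \sum_i x v i * x w i.
(** [e], [de] and [dde] stand for the normalised p-spin monomials and their first two derivatives,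
    [xi1] and [xi2] for xi' and xi''. [K1] and [K2] are the derivatives in [v] of the covariance N
    xi(v . w). *)
Hypothesis K1 : forall i v w, \sum_a de i v a * e w a = N%:R * x w i * xi1 (dot v w).
Hypothesis K2 : forall i j v w,
  \sum_a dde i j v a * e w a = N%:R * x w i * x w j * xi2 (dot v w).
Variables eps sn : R.
Hypothesis eps0 : 0 <= eps.
Hypothesis sn0 : 0 <= sn.
Hypothesis es1 : eps ^+ 2 + sn ^+ 2 = 1.

(** The three blocks are the shared disorder and the private disorder of the first and of the second
    system; the two systems have correlation eps^2. *)
Definition E1 v (k : I + (I + I)) : R :=
  match k with inl a => eps * e v a | inr (inl a) => sn * e v a | inr (inr a) => 0 end.
Definition E2 v (k : I + (I + I)) : R :=
  match k with inl a => eps * e v a | inr (inl a) => 0 | inr (inr a) => sn * e v a end.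

Local Notation J := (I + (I + I))%type.
Local Notation Eav := (EE om be P X E1 E2).

Definition bx (c : I -> R) (k : J) : R := match k with inl a => c a | _ => 0 end.
Definition b1 (c : I -> R) (k : J) : R := match k with inr (inl a) => c a | _ => 0 end.
Definition bh (c : I -> R) (k : J) : R :=
  match k with inl a => eps * c a | inr (inl a) => sn * c a | _ => 0 end.

Definition lx c (G : J -> R) := \sum_k bx c k * G k.
Definition l1 c (G : J -> R) := \sum_k b1 c k * G k.
Definition lh c (G : J -> R) := \sum_k bh c k * G k.

Lemma lxE c G : lx c G = \sum_a c a * G (inl a).
Proof. by rewrite /lx big_sumType/= [X in _ + X]big1 ?addr0// => -[] a _; rewrite mul0r. Qed.

Lemma l1E c G : l1 c G = \sum_a c a * G (inr (inl a)).
Proof.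
rewrite /l1 big_sumType/= big_sumType/= [X in X + _]big1 => [|a _]; last by rewrite mul0r.
by rewrite add0r [X in _ + X]big1 ?addr0// => a _; rewrite mul0r.
Qed.

Lemma lhE c G : lh c G = eps * lx c G + sn * l1 c G.
Proof.
rewrite lxE l1E /lh big_sumType/= big_sumType/= [X in _ + (_ + X)]big1 => [|a _]; last by rewrite mul0r.
by rewrite addr0 !mulr_sumr; congr (_ + _); apply: eq_bigr => a _; rewrite mulrA.
Qed.

(** The covariance of the field with coefficients [c] and the field at [u], driven by the same unit
    disorder. *)
Definition ker (c : I -> R) u := \sum_a c a * e u a.

Lemma bxE1 c u : \sum_k bx c k * E1 u k = eps * ker c u.
Proof.
rewrite big_sumType/= [X in _ + X]big1 ?addr0 => [|[] a _]; try by rewrite mul0r.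
by rewrite mulr_sumr; apply: eq_bigr => a _; rewrite mulrCA.
Qed.

Lemma bxE2 c u : \sum_k bx c k * E2 u k = eps * ker c u.
Proof.
rewrite big_sumType/= [X in _ + X]big1 ?addr0 => [|[] a _]; try by rewrite mul0r.
by rewrite mulr_sumr; apply: eq_bigr => a _; rewrite mulrCA.
Qed.

Lemma b1E1 c u : \sum_k b1 c k * E1 u k = sn * ker c u.
Proof.
rewrite big_sumType/= big_sumType/= [X in X + _]big1 => [|a _]; last by rewrite mul0r.
rewrite add0r [X in _ + X]big1 => [|a _]; last by rewrite mul0r.
by rewrite addr0 mulr_sumr; apply: eq_bigr => a _; rewrite mulrCA.
Qed.

Lemma b1E2 c u : \sum_k b1 c k * E2 u k = 0.
Proof. by rewrite big1// => -[|[]] a _; rewrite ?mul0r ?mulr0. Qed.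

Lemma EEext (F H : rfun V J) : (forall G s s' t t', F G s s' t t' = H G s s' t t') -> Eav F = Eav H.
Proof. exact: EE_ext. Qed.
Let EED' := EED om0 om1 be0 gX E1 E2.
Let EEZ' := EEZ om0 om1 be0 gX E1 E2.
Let EEB' := EEB om0 om1 be0 gX E1 E2.
Let EEN' := EEN om0 om1 be0 gX E1 E2.
Let EEle := EE_le om0 om1 be0 gX E1 E2.
Let EEsum := EE_sum om0 om1 be0 gX E1 E2.

(** By [EE_avg] the Gibbs mean becomes the replica [s'], so s + s' - 2 mean turns into s - s'. The
    shared disorder also enters the second system, hence the additional t - t'. *)
Lemma EE_ibp_x (c : V -> V -> I -> R) :
  Eav (fun G s s' t t' => lx (c s t) G) =
  be * eps * Eav (fun G s s' t t' => ker (c s t) s - ker (c s t) s' + ker (c s t) t - ker (c s t) t').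
Proof.
have := EE_ibp om0 om1 be0 gX E1 E2 (c := fun s s' t => bx (c s t)) (smooth1_cst _ 1).
move=> /(_ (fun _ _ _ _ _ => mulr0 _)) h.
transitivity (Eav (fun G s s' t t' => 1 * \sum_k bx (c s t) k * G k)).
  by apply: EEext => *; rewrite mul1r.
rewrite h -mulrA; congr (_ * _).
have nP u : nice (P1 om be E1 u) by exact: nice_P1.
have n1 : niceR (fun (G : J -> R) s s' t t' => ker (c s t) s + ker (c s t) s' + ker (c s t) t - ker (c s t) t').
  by move=> s s' t t'; nice_tac.
have n2 : niceR (fun G s (s' : V) t (t' : V) => \sum_u P1 om be E1 u G * ker (c s t) u).
  by move=> s s' t t'; apply: nice_sum => u; apply: niceM => //; exact: nice_cst.
transitivity (Eav (fun G s s' t t' => eps * ((ker (c s t) s + ker (c s t) s' + ker (c s t) t - ker (c s t) t') -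
    2 * \sum_u P1 om be E1 u G * ker (c s t) u))).
  apply: EEext => G s s' t t'; rewrite !bxE1 !bxE2 mul1r.
  under eq_bigr do rewrite bxE1 mulrCA.
  by rewrite -mulr_sumr; ring.
rewrite EEZ'; last first.
  by move=> s s' t t'; apply: niceB; [exact: n1|apply: niceZ; exact: n2].
congr (_ * _); rewrite EEB' ?EEZ'//; last by move=> s s' t t'; apply: niceZ; exact: n2.
rewrite (EE_avg be om0 om1 P X E1 E2 (fun G s u t t' => ker (c s t) u)).
rewrite -EEZ' -?EEB'; first by apply: EEext => G s s' t t'; ring.
- by [].
- by move=> s s' t t'; nice_tac.
- by move=> s s' t t'; nice_tac.
Qed.

Lemma EE_ibp_1 (c : V -> V -> I -> R) :
  Eav (fun G s s' t t' => l1 (c s t) G) =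
  be * sn * Eav (fun G s s' t t' => ker (c s t) s - ker (c s t) s').
Proof.
have := EE_ibp om0 om1 be0 gX E1 E2 (c := fun s s' t => b1 (c s t)) (smooth1_cst _ 1).
move=> /(_ (fun _ _ _ _ _ => mulr0 _)) h.
transitivity (Eav (fun G s s' t t' => 1 * \sum_k b1 (c s t) k * G k)).
  by apply: EEext => *; rewrite mul1r.
rewrite h -mulrA; congr (_ * _).
have nP u : nice (P1 om be E1 u) by exact: nice_P1.
have n1 : niceR (fun (G : J -> R) s s' t (t' : V) => ker (c s t) s + ker (c s t) s').
  by move=> s s' t t'; nice_tac.
have n2 : niceR (fun G s (s' : V) t (t' : V) => \sum_u P1 om be E1 u G * ker (c s t) u).
  by move=> s s' t t'; apply: nice_sum => u; apply: niceM => //; exact: nice_cst.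
transitivity (Eav (fun G s s' t t' => sn * ((ker (c s t) s + ker (c s t) s') -
    2 * \sum_u P1 om be E1 u G * ker (c s t) u))).
  apply: EEext => G s s' t t'; rewrite !b1E1 !b1E2 mul1r.
  under eq_bigr do rewrite b1E1 mulrCA.
  by rewrite -mulr_sumr; ring.
rewrite EEZ'; last first.
  by move=> s s' t t'; apply: niceB; [exact: n1|apply: niceZ; exact: n2].
congr (_ * _); rewrite EEB' ?EEZ'//; last by move=> s s' t t'; apply: niceZ; exact: n2.
rewrite (EE_avg be om0 om1 P X E1 E2 (fun G s u t t' => ker (c s t) u)).
rewrite -EEZ' -?EEB'; first by apply: EEext => G s s' t t'; ring.
- by [].
- by move=> s s' t t'; nice_tac.
- by move=> s s' t t'; nice_tac.
Qed.

(* Gaussian integration by parts in the private disorder of the first system: the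
   rotation kernels [ker (r t v) w] are antisymmetric, so everything cancels. *)
Lemma EE_rotation (psi : V -> V -> R) (r : V -> V -> I -> R) (f : (J -> R) -> R) df :
  smooth1 f df -> (forall b G, df (inr (inl b)) G = 0) ->
  (forall t v w, ker (r t v) w = - ker (r t w) v) ->
  Eav (fun G s s' t t' => f G * (psi t s * (l1 (r t s) G - l1 (r t s') G))) = 0.
Proof.
move=> sf df0 anti; have [nf _ _] := sf.
pose c s s' t k := psi t s * (b1 (r t s) k - b1 (r t s') k).
have cdf0 s s' t k G : c s s' t k * df k G = 0.
  by rewrite /c; case: k => [a|[a|a]] /=; rewrite ?subrr ?mulr0 ?mul0r ?df0 ?mulr0.
have ckE s s' t u : \sum_k c s s' t k * E1 u k = sn * (psi t s * (ker (r t s) u - ker (r t s') u)).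
  rewrite (eq_bigr (fun k => psi t s * (b1 (r t s) k * E1 u k) - psi t s * (b1 (r t s') k * E1 u k))) => [|k _].
    by rewrite sumrB -!mulr_sumr !b1E1; ring.
  by rewrite /c; ring.
have ckE2 s s' t u : \sum_k c s s' t k * E2 u k = 0.
  rewrite (eq_bigr (fun k => psi t s * (b1 (r t s) k * E2 u k) - psi t s * (b1 (r t s') k * E2 u k))) => [|k _].
    by rewrite sumrB -!mulr_sumr !b1E2; ring.
  by rewrite /c; ring.
have nP u : nice (P1 om be E1 u) by exact: nice_P1.
have kk0 t v : ker (r t v) v = 0 by have := anti t v v; lra.
transitivity (Eav (fun G s s' t t' => f G * \sum_k c s s' t k * G k)).
  apply: EEext => G s s' t t'; congr (_ * _); rewrite /l1 -sumrB mulr_sumr.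
  by apply: eq_bigr => k _; rewrite /c; ring.
rewrite (EE_ibp om0 om1 be0 gX E1 E2 sf cdf0).
have nA : niceR (fun G (s s' t t' : V) => f G * (psi t s * ker (r t s) s')).
  by move=> s s' t t'; apply: niceM => //; exact: nice_cst.
have nB : niceR (fun G (s s' t t' : V) => \sum_u P1 om be E1 u G * (f G * (psi t s * ker (r t s) u))).
  by move=> s s' t t'; apply: nice_sum => u; do 2![apply: niceM => //]; exact: nice_cst.
have nC : niceR (fun G (s s' t t' : V) => \sum_u P1 om be E1 u G * (f G * (psi t s * ker (r t s') u))).
  by move=> s s' t t'; apply: nice_sum => u; do 2![apply: niceM => //]; exact: nice_cst.
rewrite (EEext (H := fun G s s' t t' => 2 * sn * (f G * (psi t s * ker (r t s) s') -
    (\sum_u P1 om be E1 u G * (f G * (psi t s * ker (r t s) u)) -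
     \sum_u P1 om be E1 u G * (f G * (psi t s * ker (r t s') u)))))); last first.
  move=> G s s' t t'; rewrite !ckE !ckE2 !kk0 (anti t s' s).
  rewrite -sumrB.
  rewrite (eq_bigr (fun u => sn * (P1 om be E1 u G * (psi t s * (ker (r t s) u - ker (r t s') u))))) => [|u _]; last first.
    by rewrite ckE; ring.
  rewrite -mulr_sumr [in RHS](eq_bigr (fun u => f G * (P1 om be E1 u G * (psi t s * (ker (r t s) u - ker (r t s') u))))) => [|u _]; last by ring.
  by rewrite -mulr_sumr; ring.
rewrite EEZ'; last first.
  move=> s s' t t'; apply: niceB; first exact: nA.
  by apply: niceB; [exact: nB|exact: nC].
rewrite EEB'//; last by move=> s s' t t'; apply: niceB; [exact: nB|exact: nC].
rewrite EEB'// (EE_avg be om0 om1 P X E1 E2 (fun G s u t t' => f G * (psi t s * ker (r t s) u))).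
suff -> : Eav (fun G s s' t t' => \sum_u P1 om be E1 u G * (f G * (psi t s * ker (r t s') u))) = 0.
  by rewrite subr0 subrr !mulr0.
apply/eqP; rewrite /EE; set q := Ex _ _.
suff -> : q = Ex P (fun=> 0) by rewrite Ex_cst.
apply: eq_Rintegral => w _; set G := X^~ w; rewrite /AV.
apply: big1 => s _; rewrite exchange_big/=; apply: big1 => t _; rewrite exchange_big/=; apply: big1 => t' _.
set p := P1 om be E1.
pose S := \sum_s' \sum_u p s' G * p u G * ker (r t s') u.
have S0 : S = 0.
  have : S = - S.
    rewrite {1}/S exchange_big/= -sumrN; apply: eq_bigr => v _; rewrite -sumrN.
    by apply: eq_bigr => u _; rewrite anti; ring.
  by lra.
rewrite (_ : \sum_s' _ = p s G * P2 om be E2 t G * P2 om be E2 t' G * f G * psi t s * S); first by rewrite S0 mulr0.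
rewrite /S mulr_sumr; apply: eq_bigr => s' _; rewrite !mulr_sumr; apply: eq_bigr => u _.
by ring.
Qed.

Lemma dotC v w : dot v w = dot w v.
Proof. by apply: eq_bigr => i _; rewrite mulrC. Qed.

Lemma dotvv v : dot v v = 1.
Proof. by rewrite -(x1 v); apply: eq_bigr => i _; rewrite expr2. Qed.

Lemma dot_le1 v w : `|dot v w| <= 1.
Proof.
have := sum_CS (x v) (x w); rewrite -/(dot v w) !x1 mulr1 => h.
by rewrite -(expr_le1 (n := 2))// real_normK ?num_real.
Qed.

Lemma sum_delta (u : 'I_N -> R) j : \sum_i (i == j)%:R * u i = u j.
Proof. by rewrite (bigD1 j)//= eqxx mul1r big1 ?addr0// => i /negPf->; rewrite mul0r. Qed.

Lemma ker_de (u : 'I_N -> R) v w :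
  ker (fun a => \sum_i u i * de i v a) w = N%:R * xi1 (dot v w) * \sum_i u i * x w i.
Proof.
rewrite /ker; under eq_bigr do rewrite mulr_suml.
rewrite exchange_big/= mulr_sumr; apply: eq_bigr => i _.
under eq_bigr do rewrite -mulrA.
by rewrite -mulr_sumr K1; ring.
Qed.

Lemma ker_dde (u : 'I_N -> R) v w :
  ker (fun a => \sum_i \sum_j u i * u j * dde i j v a) w =
  N%:R * xi2 (dot v w) * (\sum_i u i * x w i) ^+ 2.
Proof.
rewrite /ker; under eq_bigr do rewrite mulr_suml.
rewrite exchange_big/= expr2 mulr_suml mulr_sumr; apply: eq_bigr => i _.
under eq_bigr do rewrite mulr_suml.
rewrite exchange_big/= !mulr_sumr; apply: eq_bigr => j _.
under eq_bigr do rewrite -mulrA.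
by rewrite -mulr_sumr K2; ring.
Qed.

Lemma kerZ c (f : I -> R) w : ker (fun a => c * f a) w = c * ker f w.
Proof. by rewrite /ker mulr_sumr; apply: eq_bigr => a _; rewrite mulrA. Qed.

Lemma kerD (f g : I -> R) w : ker (fun a => f a + g a) w = ker f w + ker g w.
Proof. by rewrite /ker -big_split/=; apply: eq_bigr => a _; rewrite mulrDl. Qed.

Lemma ker_sum (K : finType) (f : K -> I -> R) w :
  ker (fun a => \sum_k f k a) w = \sum_k ker (f k) w.
Proof.
rewrite /ker; under eq_bigr do rewrite mulr_suml.
by rewrite exchange_big.
Qed.

Lemma nice_lx f : nice (lx f). Proof. by rewrite /lx; nice_tac. Qed.
Lemma nice_l1 f : nice (l1 f). Proof. by rewrite /l1; nice_tac. Qed.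
Lemma nice_lh f : nice (lh f). Proof. by rewrite /lh; nice_tac. Qed.

(* The rotation field [y_j(v) = (v . t) e_j - v_j t] at [v]. *)
Definition rot t v j i : R := dot v t * (i == j)%:R - x v j * x t i.
Definition Xe t j v a := \sum_i rot t v j i * de i v a.
Definition psi t v j := dot v t * x v j.
(** The derivative of [psi] along the rotation field for unit [t]: the field sends (v . t) to (v .
    t) t_j - v_j and v_j to (v . t) - v_j t_j. *)
Definition Xpsi t v j := (dot v t * x t j - x v j) * x v j + dot v t * (dot v t - x v j * x t j).
(** The rotation field applied to its own coefficients; together with second derivatives it gives
    X_j X_j in [dXe]. *)
Definition rot2 t v j i : R :=
  (dot v t * x t j - x v j) * (i == j)%:R - (dot v t - x v j * x t j) * x t i.
Definition dXe t j v a :=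
  \sum_i \sum_i' rot t v j i * rot t v j i' * dde i i' v a + \sum_i rot2 t v j i * de i v a.

(** [HH] is X_j applied to the first Hamiltonian, [QQ] its part from the shared disorder, [dQ] a
    further X_j of [QQ], and [lam] the radial derivative. *)
Definition HH t v j G := lh (Xe t j v) G.
Definition QQ t v j G := eps * lx (Xe t j v) G.
Definition dQ t v j G := eps * lx (dXe t j v) G.
Definition lam v a := \sum_i x v i * de i v a.

(** Integration by parts along X_j makes these four averages vanish for the uniform measure; on a
    fine grid they are at most 1. In [He1] and [He4] the test function depends on the rotated
    replica and is differentiated. In [He2] and [He3] the field is rotated at [s'] while the test
    function lives at [s], so no derivative appears. *)
Hypothesis He1 : `|Eav (fun G s s' t t' => \sum_j (Xpsi t s j + be * (psi t s j * HH t s j G)))| <= 1.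
Hypothesis He2 : `|Eav (fun G s s' t t' => \sum_j be * (psi t s j * HH t s' j G))| <= 1.
Hypothesis He3 : `|Eav (fun G s s' t t' => \sum_j be * (QQ t s j G * HH t s' j G))| <= 1.
Hypothesis He4 : `|Eav (fun G s s' t t' => \sum_j (dQ t s j G + be * (QQ t s j G * HH t s j G)))| <= 1.

(** The radial field is at most [K], of order N, plus a random excess of mean at most [eta], of
    order sqrt N. *)
Variables (K eta : R) (Dx D1 : T -> R).
Hypothesis K0 : 0 <= K.
Hypothesis eta0 : 0 <= eta.
Hypothesis LDx : L1 P Dx.
Hypothesis LD1 : L1 P D1.
Hypothesis Dx0 : forall w, 0 <= Dx w.
Hypothesis D10 : forall w, 0 <= D1 w.
Hypothesis EDx : Ex P Dx <= eta.
Hypothesis ED1 : Ex P D1 <= eta.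
Hypothesis supx : forall w v, lx (lam v) (X^~ w) <= K + Dx w.
Hypothesis sup1 : forall w v, l1 (lam v) (X^~ w) <= K + D1 w.

(** The squared length of a u - b v for unit vectors with u . v = s. With a = s . t and b = s' . t
    it is the sum over j of (psi t s j - psi t s' j)^2. *)
Definition DD (a b s : R) := a ^+ 2 + b ^+ 2 - 2 * a * b * s.
(** The three inequalities compare the kernels produced by integration by parts with [DD], so that
    all of them become multiples of the single quantity [ED]. *)
Hypothesis ineqA : forall a b s, `|a| <= 1 -> `|b| <= 1 -> `|s| <= 1 ->
  xi1 1 * DD a b s <= 2 * (xi1 1 * (a ^+ 2 + b ^+ 2) - 2 * a * b * xi1 s).
Hypothesis ineqB : forall a b s, `|a| <= 1 -> `|b| <= 1 -> `|s| <= 1 ->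
  xi1 1 * (a ^+ 2 + b ^+ 2) - 2 * a * b * xi1 s <= xi2 1 * DD a b s.
Hypothesis ineqC : forall a b s, `|a| <= 1 -> `|b| <= 1 -> `|s| <= 1 ->
  `|a * xi1 a + b * xi1 b - s * (a * xi1 b + b * xi1 a)| <= xi2 1 * DD a b s.
Hypothesis xi2_ge0 : forall s, `|s| <= 1 -> 0 <= xi2 s.
Hypothesis xi2_le : forall s, `|s| <= 1 -> xi2 s <= xi2 1.
Hypothesis xi1_ge0 : 0 <= xi1 1.

Lemma DD_ge0 a b s : `|s| <= 1 -> 0 <= DD a b s.
Proof.
rewrite ler_norml => /andP[s1 s2].
rewrite (_ : DD a b s = (1 - s) / 2 * (a + b) ^+ 2 + (1 + s) / 2 * (a - b) ^+ 2).
  by rewrite addr_ge0// mulr_ge0 ?sqr_ge0//; lra.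
by rewrite /DD; field.
Qed.

Lemma EE_sym1 (F : rfun V J) : niceR F ->
  Eav F = Eav (fun G s s' t t' => 2^-1 * (F G s s' t t' + F G s' s t t')).
Proof.
move=> nF; rewrite EEZ'; last by move=> s s' t t'; apply: niceD; exact: nF.
have nF' : niceR (fun G s s' t t' => F G s' s t t') by move=> s s' t t'; exact: nF.
rewrite (EED' nF nF').
by rewrite -(EE_swap1 om be P X E1 E2 F); field.
Qed.

Lemma EE_sym2 (F : rfun V J) : niceR F ->
  Eav F = Eav (fun G s s' t t' => 2^-1 * (F G s s' t t' + F G s s' t' t)).
Proof.
move=> nF; rewrite EEZ'; last by move=> s s' t t'; apply: niceD; exact: nF.
have nF' : niceR (fun G s s' t t' => F G s s' t' t) by move=> s s' t t'; exact: nF.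
rewrite (EED' nF nF').
by rewrite -(EE_swap2 om be P X E1 E2 F); field.
Qed.

Definition phi := Eav (fun G s s' t t' => dot s t ^+ 2).
Definition ED := Eav (fun G s s' t t' => DD (dot s t) (dot s' t) (dot s s')).
(** The scaling be N / 2 is the one in which [ED] comes out of Gaussian integration by parts; in it
    the quantity stays of order N phi + sqrt N as [be] grows. *)
Definition Dq := be * N%:R / 2 * ED.

Lemma ED_swap : Eav (fun G s s' t t' => DD (dot s t) (dot s t') (dot t t')) = ED.
Proof.
rewrite /ED [RHS](EE_swap12 om0 om1 be0 gX (E1 := E1) (E2 := E2)
  _ _ (fun s s' t t' => DD (dot s t) (dot s' t) (dot s s'))).
- by apply: EEext => G s s' t t'; rewrite (dotC s t) (dotC s t').
- move=> v w; rewrite !big_sumType/=; congr (_ + _).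
  by rewrite addrC; congr (_ + _); apply: eq_bigr => a _; rewrite ?mulr0 ?mul0r.
- move=> v w; rewrite !big_sumType/=; congr (_ + _).
  by rewrite addrC; congr (_ + _); apply: eq_bigr => a _; rewrite ?mulr0 ?mul0r.
Qed.

Lemma sum_Xpsi t v : \sum_j Xpsi t v j = N%:R * dot v t ^+ 2 - 1.
Proof.
rewrite /Xpsi (eq_bigr (fun j => dot v t ^+ 2 - x v j ^+ 2 +
   (dot v t * (x v j * x t j) - dot v t * (x v j * x t j)))) => [|j _]; last by ring.
rewrite big_split/= sumrB x1 [X in _ + X]big1 ?addr0 => [|j _]; last by rewrite subrr.
by rewrite sumr_const card_ord mulr_natl.
Qed.

Lemma phi_ge0 : 0 <= phi.
Proof.
apply: Ex_ge0 => w; rewrite -(AV1 be om0 om1 E1 E2 (fun=> 0) (X^~ w)).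
by apply: AV_le => // s s' t t'; exact: sqr_ge0.
Qed.

Lemma ED_ge0 : 0 <= ED.
Proof.
apply: Ex_ge0 => w; rewrite -(AV1 be om0 om1 E1 E2 (fun=> 0) (X^~ w)).
by apply: AV_le => // s s' t t'; exact/DD_ge0/dot_le1.
Qed.

Lemma niceRc (F : V -> V -> V -> V -> R) : niceR (fun (G : J -> R) => F).
Proof. by move=> s s' t t'; exact: nice_cst. Qed.

Let nHH t s j : nice (HH t s j). Proof. exact: nice_lh. Qed.
Let nQQ t s j : nice (QQ t s j). Proof. by apply: niceZ; exact: nice_lx. Qed.
Let ndQ t s j : nice (dQ t s j). Proof. by apply: niceZ; exact: nice_lx. Qed.

(** The -1 in [sum_Xpsi] cancels against the error allowed by [He1], which leaves a bound without
    additive constant. *)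
Lemma psiHH_le : - Eav (fun G s s' t t' => \sum_j psi t s j * HH t s j G) <= N%:R * phi / be.
Proof.
have n1 : niceR (fun G s (s' : V) t (t' : V) => \sum_j psi t s j * HH t s j G).
  by move=> s s' t t'; apply: nice_sum => j; exact: niceZ.
have := He1; rewrite (EEext (H := fun G s s' t t' => (N%:R * dot s t ^+ 2 - 1) +
    be * \sum_j psi t s j * HH t s j G)); last first.
  move=> G s s' t t'; rewrite -sum_Xpsi mulr_sumr -big_split/=.
  by apply: eq_bigr => j _.
rewrite EED'; [|exact: niceRc|by move=> s s' t t'; apply: niceZ; exact: n1].
rewrite EEB'; [|exact: niceRc|exact: niceRc].
rewrite EEZ'; last exact: niceRc.
rewrite EEZ'// -/phi (EE_G be om0 om1 P X E1 E2 (fun=> 1)) Ex_cst.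
rewrite ler_pdivlMr// ler_norml => /andP[h _].
by move: h; set q := Eav _; lra.
Qed.

Definition tau_der s t a := dot s t * \sum_i x t i * de i s a.

(** The direction (s . t) t equals the radial vector (s . t)^2 s minus the combination of the
    rotation fields with coefficients [psi]. The radial part is bounded by the supremum, the
    tangential part by integration by parts on the sphere. *)
Lemma tau_der_split s t G : lh (tau_der s t) G =
  dot s t ^+ 2 * lh (lam s) G - \sum_j psi t s j * HH t s j G.
Proof.
have te a : tau_der s t a = dot s t ^+ 2 * lam s a - \sum_j psi t s j * Xe t j s a.
  have -> : \sum_j psi t s j * Xe t j s a = dot s t ^+ 2 * lam s a - tau_der s t a.
    rewrite /tau_der /lam /Xe.
    transitivity (\sum_j (dot s t ^+ 2 * (x s j * de j s a) -
        x s j ^+ 2 * (dot s t * \sum_i x t i * de i s a))).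
      apply: eq_bigr => j _; rewrite /rot /psi.
      rewrite (eq_bigr (fun i => dot s t * ((i == j)%:R * de i s a) - x s j * (x t i * de i s a))) => [|i _]; last by ring.
      rewrite sumrB -!mulr_sumr sum_delta; ring.
    by rewrite sumrB -!mulr_sumr -mulr_suml x1 mul1r.
  by rewrite subKr.
have tl (g : I -> R) : \sum_a tau_der s t a * g a =
    dot s t ^+ 2 * (\sum_a lam s a * g a) - \sum_j psi t s j * \sum_a Xe t j s a * g a.
  rewrite (eq_bigr (fun a => dot s t ^+ 2 * (lam s a * g a) - \sum_j psi t s j * (Xe t j s a * g a))) => [|a _]; last first.
    by rewrite te mulrBl mulr_suml -mulrA; congr (_ - _); apply: eq_bigr => j _; rewrite mulrA.
  rewrite sumrB -mulr_sumr exchange_big/=; congr (_ - _).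
  by apply: eq_bigr => j _; rewrite mulr_sumr.
rewrite (eq_bigr (fun j => eps * (psi t s j * lx (Xe t j s) G) + sn * (psi t s j * l1 (Xe t j s) G))) => [|j _]; last first.
  by rewrite /HH lhE; ring.
rewrite big_split/= -!mulr_sumr !lhE lxE l1E !tl.
rewrite -(lxE (lam s)) -(l1E (lam s)).
rewrite (eq_bigr (fun j => psi t s j * lx (Xe t j s) G)) => [|j _]; last by rewrite lxE.
rewrite [X in _ + sn * (_ - X) = _](eq_bigr (fun j => psi t s j * l1 (Xe t j s) G)) => [|j _]; last by rewrite l1E.
by ring.
Qed.

(** The deterministic part of the supremum keeps the factor (s . t)^2 and yields [phi]; for the
    random excess the factor is bounded by 1, which costs only [eta]. *)
Lemma lam_le : Eav (fun G s s' t t' => dot s t ^+ 2 * lh (lam s) G) <= 2 * K * phi + 2 * eta.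
Proof.
have e1 : eps <= 1 by rewrite -(expr_le1 (n := 2))// -es1 lerDl sqr_ge0.
have s1 : sn <= 1 by rewrite -(expr_le1 (n := 2))// -es1 lerDr sqr_ge0.
have n0 : niceR (fun (G : J -> R) s (s' : V) t (t' : V) => dot s t ^+ 2) by exact: niceRc.
have n1 : niceR (fun G s (s' : V) t (t' : V) => dot s t ^+ 2 * lh (lam s) G).
  by move=> s s' t t'; apply: niceZ; exact: nice_lh.
apply: (@le_trans _ _ (Ex P (fun w => 2 * K * AV om be E1 E2 (fun G s s' t t' => dot s t ^+ 2) (X^~ w) + (Dx w + D1 w)))).
  have lav := L1_AV om0 om1 be0 gX E1 E2 n0.
  apply: Ex_le.
  - exact: L1_AV.
  - by apply: L1D; [exact: L1Z|exact: L1D].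
  - move=> w; set G := X^~ w.
    have -> : 2 * K * AV om be E1 E2 (fun G s s' t t' => dot s t ^+ 2) G + (Dx w + D1 w) =
      AV om be E1 E2 (fun G s s' t t' => 2 * K * dot s t ^+ 2 + (Dx w + D1 w)) G.
      rewrite -[X in _ + X = _](AV1 be om0 om1 E1 E2 (fun=> Dx w + D1 w) G) /AV.
      rewrite mulr_sumr -big_split/=; apply: eq_bigr => s _.
      rewrite mulr_sumr -big_split/=; apply: eq_bigr => s' _.
      rewrite mulr_sumr -big_split/=; apply: eq_bigr => t _.
      rewrite mulr_sumr -big_split/=; apply: eq_bigr => t' _.
      by ring.
    apply: AV_le => // s s' t t'.
    have h : lh (lam s) G <= 2 * K + (Dx w + D1 w).
      rewrite lhE; have := supx w s; have := sup1 w s; rewrite -/G => h1 h2.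
      have a1 : eps * lx (lam s) G <= K + Dx w.
        apply: le_trans (_ : eps * (K + Dx w) <= _); first by rewrite ler_wpM2l.
        by rewrite ler_piMl// addr_ge0.
      have a2 : sn * l1 (lam s) G <= K + D1 w.
        apply: le_trans (_ : sn * (K + D1 w) <= _); first by rewrite ler_wpM2l.
        by rewrite ler_piMl// addr_ge0.
      lra.
    have t01 : dot s t ^+ 2 <= 1.
      by rewrite -real_normK ?num_real// expr_le1// dot_le1.
    apply: (@le_trans _ _ (dot s t ^+ 2 * (2 * K + (Dx w + D1 w)))).
      by rewrite ler_wpM2l ?sqr_ge0.
    have := sqr_ge0 (dot s t); have := Dx0 w; have := D10 w; nra.
rewrite (ExD (L1Z _ (L1_AV om0 om1 be0 gX E1 E2 n0)) (L1D LDx LD1)) (ExD LDx LD1).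
rewrite (ExZ _ (L1_AV om0 om1 be0 gX E1 E2 n0)) -/(EE _ _ _ _ _ _ _) -/phi.
by move: EDx ED1; lra.
Qed.

Lemma ker_tau s t u : ker (tau_der s t) u = dot s t * (N%:R * xi1 (dot s u) * dot t u).
Proof. by rewrite kerZ ker_de. Qed.

Let N0 : 0 <= N%:R :> R. Proof. exact: ler0n. Qed.

(** Symmetrised in [s] and [s'], the kernel is N/2 times the right-hand combination of [ineqA]
    without its factor 2, whence the constant 1/4. *)
Lemma tau_self_ge : N%:R * xi1 1 / 4 * ED <=
  Eav (fun G s s' t t' => ker (tau_der s t) s - ker (tau_der s t) s').
Proof.
rewrite EE_sym1; last exact: niceRc.
rewrite /ED -EEZ'; last exact: niceRc.
apply: EEle; [exact: niceRc|exact: niceRc|move=> G s s' t t'].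
rewrite !ker_tau !dotvv (dotC t s) (dotC t s') (dotC s' s).
have := ineqA (dot_le1 s t) (dot_le1 s' t) (dot_le1 s s').
move: (dot s t) (dot s' t) (dot s s') => a b r h.
rewrite (_ : 2^-1 * _ = N%:R / 4 * (2 * (xi1 1 * (a ^+ 2 + b ^+ 2) - 2 * a * b * xi1 r))); last by field.
rewrite (_ : N%:R * xi1 1 / 4 * DD a b r = N%:R / 4 * (xi1 1 * DD a b r)); last by ring.
by rewrite ler_wpM2l// divr_ge0.
Qed.

(** Symmetrisation in [t] and [t'] produces the expression of [ineqC]; [ED_swap] turns the resulting
    [DD] of the second system into that of the first. *)
Lemma tau_cross_ge : - (N%:R * xi2 1 / 2 * ED) <=
  Eav (fun G s s' t t' => ker (tau_der s t) t - ker (tau_der s t) t').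
Proof.
rewrite EE_sym2; last exact: niceRc.
rewrite -ED_swap -EEZ' -?EEN'; try exact: niceRc.
apply: EEle; [exact: niceRc|exact: niceRc|move=> G s s' t t'].
rewrite !ker_tau !dotvv (dotC t' t).
have := ineqC (dot_le1 s t) (dot_le1 s t') (dot_le1 t t').
move: (dot s t) (dot s t') (dot t t') => a b r.
rewrite ler_norml => /andP[h _].
rewrite (_ : 2^-1 * _ = N%:R / 2 * (a * xi1 a + b * xi1 b - r * (a * xi1 b + b * xi1 a))); last by field.
rewrite (_ : - _ = N%:R / 2 * (- (xi2 1 * DD a b r))); last by ring.
by rewrite ler_wpM2l// divr_ge0.
Qed.

(** The mean of the derivative in direction (s . t) t is computed in two ways: by Gaussian
    integration by parts, giving [Dq] with weight sn^2 plus a shared contribution with weight eps^2,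
    and by the radial and tangential splitting, giving [phi] and [eta]. *)
Lemma Dq_bound : sn ^+ 2 * (xi1 1 / 2) * Dq <=
  2 * K * phi + 2 * eta + N%:R * phi / be + eps ^+ 2 * xi2 1 * Dq.
Proof.
have h1 := EE_ibp_1 tau_der; have h2 := EE_ibp_x tau_der.
have nl1 : niceR (fun G s (s' : V) t (t' : V) => l1 (tau_der s t) G) by move=> *; exact: nice_l1.
have nlx : niceR (fun G s (s' : V) t (t' : V) => lx (tau_der s t) G) by move=> *; exact: nice_lx.
have e0 : eps * Eav (fun G s s' t t' => lx (tau_der s t) G) + sn * Eav (fun G s s' t t' => l1 (tau_der s t) G) =
    Eav (fun G s s' t t' => dot s t ^+ 2 * lh (lam s) G) -
    Eav (fun G s s' t t' => \sum_j psi t s j * HH t s j G).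
  rewrite -!EEZ'// -EED' -?EEB'.
  - by apply: EEext => G s s' t t'; rewrite -tau_der_split lhE.
  - by move=> s s' t t'; apply: niceZ; exact: nice_lh.
  - by move=> s s' t t'; apply: nice_sum => j; exact: niceZ.
  - by move=> s s' t t'; apply: niceZ; exact: nice_lx.
  - by move=> s s' t t'; apply: niceZ; exact: nice_l1.
rewrite h1 h2 in e0.
have es : Eav (fun G s s' t t' => ker (tau_der s t) s - ker (tau_der s t) s' +
    ker (tau_der s t) t - ker (tau_der s t) t') =
  Eav (fun G s s' t t' => ker (tau_der s t) s - ker (tau_der s t) s') +
  Eav (fun G s s' t t' => ker (tau_der s t) t - ker (tau_der s t) t').
  rewrite -EED'; try exact: niceRc.
  by apply: EEext => G s s' t t'; rewrite addrA.
rewrite es in e0.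
have g1 := tau_self_ge; have g2 := tau_cross_ge; have g3 := lam_le; have g4 := psiHH_le.
have g5 : 0 <= N%:R * xi1 1 / 4 * ED by rewrite mulr_ge0 ?ED_ge0// divr_ge0// mulr_ge0.
move: g1 g2 g3 g4 g5 e0; rewrite /Dq.
set A := Eav _; set B := Eav (fun G s s' t t' => _ - _); set C := Eav _; set D := Eav _.
move=> g1 g2 g3 g4 g5 e0.
have b2 : 0 <= be * eps ^+ 2 by rewrite mulr_ge0 ?sqr_ge0// ltW.
have b3 : 0 <= be * sn ^+ 2 by rewrite mulr_ge0 ?sqr_ge0// ltW.
have i1 : be * sn ^+ 2 * (N%:R * xi1 1 / 4 * ED) <= be * sn ^+ 2 * A by rewrite ler_wpM2l.
have i2 : be * eps ^+ 2 * (- (N%:R * xi2 1 / 2 * ED)) <= be * eps ^+ 2 * B by rewrite ler_wpM2l.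
have i3 : 0 <= be * eps ^+ 2 * A by rewrite mulr_ge0// (le_trans g5 g1).
have i4 : be * eps ^+ 2 * A + be * eps ^+ 2 * B + be * sn ^+ 2 * A = C - D by rewrite -e0; ring.
rewrite (_ : sn ^+ 2 * (xi1 1 / 2) * _ = be * sn ^+ 2 * (N%:R * xi1 1 / 4 * ED)); last by field.
rewrite (_ : eps ^+ 2 * xi2 1 * _ = - (be * eps ^+ 2 * - (N%:R * xi2 1 / 2 * ED))); last by field.
move: i1 i2 i3 i4 g3 g4.
set u1 := be * sn ^+ 2 * _; set u2 := be * eps ^+ 2 * _; set u3 := be * eps ^+ 2 * A.
set u4 := be * eps ^+ 2 * B; set u5 := be * sn ^+ 2 * A; set u6 := 2 * K * phi; set u7 := N%:R * phi / be.
lra.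
Qed.

Definition Qq := be * N%:R * Eav (fun G s s' t t' => xi1 1 - dot s s' * xi1 (dot s s')).

(** Gaussian integration by parts for the radial field in the private disorder produces exactly
    [Qq]; the supremum bound on that field does the rest. *)
Lemma Qq_bound : sn ^+ 2 * Qq <= K + eta.
Proof.
have s1 : sn <= 1 by rewrite -(expr_le1 (n := 2))// -es1 lerDr sqr_ge0.
have h := EE_ibp_1 (fun s t => lam s).
have nl1 : niceR (fun G s (s' t t' : V) => l1 (lam s) G) by move=> *; exact: nice_l1.
have -> : sn ^+ 2 * Qq = sn * Eav (fun G s s' t t' => l1 (lam s) G).
  rewrite h /Qq [in RHS](EEext (H := fun G s s' t t' => N%:R * (xi1 1 - dot s s' * xi1 (dot s s')))).
    by rewrite EEZ'; [ring|exact: niceRc].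
  move=> G s s' t t'; rewrite /lam !ker_de -/(dot s s) -/(dot s s') !dotvv; ring.
have hle : Eav (fun G s s' t t' => l1 (lam s) G) <= K + eta.
  apply: (@le_trans _ _ (Ex P (fun w => K + D1 w))).
    apply: Ex_le.
    - exact: L1_AV.
    - by apply: L1D => //; exact: L1_cst.
    - move=> w; rewrite -[leRHS](AV1 be om0 om1 E1 E2 (fun=> K + D1 w) (X^~ w)).
      by apply: AV_le => // s s' t t'; exact: sup1.
  by rewrite ExD ?Ex_cst ?lerD2l//; exact: L1_cst.
apply: le_trans (_ : sn * (K + eta) <= _); first by rewrite ler_wpM2l.
by rewrite ler_piMl// addr_ge0.
Qed.

Lemma ker_Xe t j v w : ker (Xe t j v) w =
  N%:R * xi1 (dot v w) * (dot v t * x w j - x v j * dot w t).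
Proof.
rewrite /Xe ker_de; congr (_ * _); rewrite /rot.
rewrite (eq_bigr (fun i => dot v t * ((i == j)%:R * x w i) - x v j * (x w i * x t i))) => [|i _]; last by ring.
by rewrite sumrB -!mulr_sumr sum_delta.
Qed.

(** The infinitesimal form of the rotation invariance of xi(v . w): rotating both arguments together
    changes nothing. *)
Lemma ker_Xe_anti t j v w : ker (Xe t j v) w = - ker (Xe t j w) v.
Proof. by rewrite !ker_Xe (dotC w v); ring. Qed.

Lemma rotation_psi : Eav (fun G s s' t t' => \sum_j psi t s j * (l1 (Xe t j s) G - l1 (Xe t j s') G)) = 0.
Proof.
rewrite EEsum => [|j s s' t t']; last by apply: niceZ; apply: niceB; exact: nice_l1.
apply: big1 => j _.
rewrite -(EE_rotation (fun t s => psi t s j) (r := fun t s => Xe t j s) (f := fun=> 1) (smooth1_cst _ 1)) //.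
- by apply: EEext => *; rewrite mul1r.
- by move=> *; exact: ker_Xe_anti.
Qed.

(** [QQ] is linear in the shared disorder. Expanding it, each shared Gaussian serves as the factor
    [f] of [EE_rotation], its derivative in the private disorder being 0. *)
Lemma rotation_QQ : Eav (fun G s s' t t' => \sum_j QQ t s j G * (l1 (Xe t j s) G - l1 (Xe t j s') G)) = 0.
Proof.
have nl (f g : I -> R) : nice (fun G => l1 f G - l1 g G) by apply: niceB; exact: nice_l1.
rewrite EEsum => [|j s s' t t']; last by apply: niceM.
apply: big1 => j _.
rewrite (EEext (H := fun G s s' t t' => \sum_a G (inl a) * (eps * Xe t j s a * (l1 (Xe t j s) G - l1 (Xe t j s') G)))); last first.
  move=> G s s' t t'; rewrite /QQ lxE mulr_sumr mulr_suml; apply: eq_bigr => a _; ring.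
rewrite EEsum => [|a s s' t t']; last by apply: niceM; [exact: nice_proj|exact: niceZ].
apply: big1 => a _.
by apply: (EE_rotation (fun t s => eps * Xe t j s a) (r := fun t s => Xe t j s)
  (smooth1_proj (inl a))) => // *; exact: ker_Xe_anti.
Qed.

(** The sum over j of X_j X_j acting on [s] in xi(s . u), with arguments s . u, s . t and t . u. *)
Definition kap (s0 th b : R) := xi2 s0 * (th ^+ 2 - 2 * th * b * s0 + b ^+ 2) -
  xi1 s0 * ((N%:R - 2) * th * b + s0).

Lemma ker_dXe s t u : ker (fun a => \sum_j dXe t j s a) u =
  N%:R * kap (dot s u) (dot s t) (dot t u).
Proof.
rewrite ker_sum (eq_bigr (fun j => N%:R * xi2 (dot s u) * (dot s t * x u j - x s j * dot t u) ^+ 2 +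
   N%:R * xi1 (dot s u) * ((dot s t * x t j - x s j) * x u j - (dot s t - x s j * x t j) * dot t u))) => [|j _]; last first.
  rewrite /dXe kerD ker_de ker_dde; congr (_ * _ ^+ 2 + _ * _); rewrite ?/rot ?/rot2.
    rewrite (eq_bigr (fun i => dot s t * ((i == j)%:R * x u i) - x s j * (x t i * x u i))) => [|i _]; last by ring.
    by rewrite sumrB -!mulr_sumr sum_delta.
  rewrite (eq_bigr (fun i => (dot s t * x t j - x s j) * ((i == j)%:R * x u i) - (dot s t - x s j * x t j) * (x t i * x u i))) => [|i _]; last by ring.
  by rewrite sumrB -!mulr_sumr sum_delta.
have s1 : \sum_j (dot s t * x u j - x s j * dot t u) ^+ 2 =
    dot s t ^+ 2 - 2 * dot s t * dot t u * dot s u + dot t u ^+ 2.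
  rewrite (eq_bigr (fun j => dot s t ^+ 2 * x u j ^+ 2 - (2 * dot s t * dot t u) * (x s j * x u j) + dot t u ^+ 2 * x s j ^+ 2)) => [|j _]; last by ring.
  by rewrite big_split/= sumrB -!mulr_sumr !x1 -/(dot s u); ring.
have s2 : \sum_j ((dot s t * x t j - x s j) * x u j - (dot s t - x s j * x t j) * dot t u) =
    - ((N%:R - 2) * dot s t * dot t u + dot s u).
  rewrite (eq_bigr (fun j => dot s t * (x t j * x u j) - x s j * x u j - (dot s t * dot t u - dot t u * (x s j * x t j)))) => [|j _]; last by ring.
  rewrite sumrB [X in X - _]sumrB [X in _ - X]sumrB -!mulr_sumr -/(dot t u) -/(dot s u) -/(dot s t).
  by rewrite sumr_const card_ord -mulr_natl; ring.
by rewrite big_split/= -!mulr_sumr s1 s2 /kap; ring.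
Qed.

(** The Gram determinant of three unit vectors, by Cauchy-Schwarz for the components of [s] and [u]
    orthogonal to [t]. *)
Lemma gram_ge0 s t u : 0 <= 1 - dot s t ^+ 2 - dot s u ^+ 2 - dot t u ^+ 2 +
  2 * dot s t * dot s u * dot t u.
Proof.
have := sum_CS (fun i => x s i - dot s t * x t i) (fun i => x u i - dot t u * x t i).
have e1 : \sum_i (x s i - dot s t * x t i) * (x u i - dot t u * x t i) = dot s u - dot s t * dot t u.
  rewrite (eq_bigr (fun i => x s i * x u i - dot t u * (x s i * x t i) - dot s t * (x t i * x u i) + dot s t * dot t u * x t i ^+ 2)) => [|i _]; last by ring.
  by rewrite big_split/= !sumrB -!mulr_sumr x1 -/(dot s u) -/(dot s t) -/(dot t u); ring.
have e2 v : \sum_i (x v i - dot v t * x t i) ^+ 2 = 1 - dot v t ^+ 2.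
  rewrite (eq_bigr (fun i => x v i ^+ 2 - 2 * dot v t * (x v i * x t i) + dot v t ^+ 2 * x t i ^+ 2)) => [|i _]; last by ring.
  by rewrite big_split/= sumrB -!mulr_sumr !x1 -/(dot v t); ring.
rewrite e1 e2 (dotC t u) e2; nra.
Qed.

(** Both replica differences are symmetrised. The part with weight N - 2, nonnegative as N >= 2,
    falls under [ineqB] or [ineqC]; the remainder is treated by [xi2_le] and, for the second system,
    by the Gram determinant. *)
Lemma dXe_bound : - Eav (fun G s s' t t' => kap (dot s s) (dot s t) (dot t s) - kap (dot s s') (dot s t) (dot t s') +
     kap (dot s t) (dot s t) (dot t t) - kap (dot s t') (dot s t) (dot t t')) <=
  N%:R * xi2 1 * ED + Eav (fun G s s' t t' => xi1 1 - dot s s' * xi1 (dot s s')).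
Proof.
have N2' : 2 <= N%:R :> R by rewrite (ler_nat _ 2).
have p1 : Eav (fun G s s' t t' => - kap (dot s s) (dot s t) (dot t s) + kap (dot s s') (dot s t) (dot t s')) <=
    N%:R * xi2 1 / 2 * ED + Eav (fun G s s' t t' => xi1 1 - dot s s' * xi1 (dot s s')).
  rewrite EE_sym1; last exact: niceRc.
  rewrite /ED -EEZ' -?EED'; try exact: niceRc.
  apply: EEle; [exact: niceRc|exact: niceRc|move=> G s s' t t'].
  rewrite !dotvv (dotC t s) (dotC t s') (dotC s' s).
  have r1 := dot_le1 s s'.
  have := ineqB (dot_le1 s t) (dot_le1 s' t) r1.
  have := DD_ge0 (dot s t) (dot s' t) r1; have := xi2_le r1.
  move: (dot s t) (dot s' t) (dot s s') => a b r h1 h2 h3.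
  rewrite (_ : 2^-1 * _ = (N%:R - 2) / 2 * (xi1 1 * (a ^+ 2 + b ^+ 2) - 2 * a * b * xi1 r) +
     xi2 r * DD a b r + (xi1 1 - r * xi1 r)); last by rewrite /kap /DD; field.
  rewrite lerD2r (_ : N%:R * xi2 1 / 2 * DD a b r = (N%:R - 2) / 2 * (xi2 1 * DD a b r) + xi2 1 * DD a b r); last by field.
  by apply: lerD; [rewrite ler_wpM2l// divr_ge0// subr_ge0|rewrite ler_wpM2r].
have p2 : Eav (fun G s s' t t' => - kap (dot s t) (dot s t) (dot t t) + kap (dot s t') (dot s t) (dot t t')) <=
    N%:R * xi2 1 / 2 * ED.
  rewrite EE_sym2; last exact: niceRc.
  rewrite -ED_swap -EEZ'; try exact: niceRc.
  apply: EEle; [exact: niceRc|exact: niceRc|move=> G s s' t t'].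
  rewrite !dotvv (dotC t' t).
  have r1 := dot_le1 t t'.
  have := ineqC (dot_le1 s t) (dot_le1 s t') r1; rewrite ler_norml => /andP[_].
  have := DD_ge0 (dot s t) (dot s t') r1; have := xi2_ge0 (dot_le1 s t).
  have := xi2_ge0 (dot_le1 s t'); have := gram_ge0 s t t'.
  have := xi2_ge0 (s := 1); rewrite normr1 => /(_ (lexx _)).
  move: (dot s t) (dot s t') (dot t t') => a b r x20 gr xb xa dd ic.
  rewrite (_ : 2^-1 * _ = (N%:R - 2) / 2 * (a * xi1 a + b * xi1 b - r * (a * xi1 b + b * xi1 a)) -
     2^-1 * ((xi2 a + xi2 b) * (1 - a ^+ 2 - b ^+ 2 - r ^+ 2 + 2 * a * b * r))); last by rewrite /kap; field.
  rewrite (_ : N%:R * xi2 1 / 2 * DD a b r = (N%:R - 2) / 2 * (xi2 1 * DD a b r) + xi2 1 * DD a b r); last by field.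
  apply: lerD; first by rewrite ler_wpM2l// divr_ge0// subr_ge0.
  apply: le_trans (_ : 0 <= _); last by rewrite mulr_ge0.
  by rewrite oppr_le0 mulr_ge0// ?invr_ge0// mulr_ge0// addr_ge0.
rewrite -EEN'; last exact: niceRc.
rewrite (EEext (H := fun G s s' t t' =>
   (- kap (dot s s) (dot s t) (dot t s) + kap (dot s s') (dot s t) (dot t s')) +
   (- kap (dot s t) (dot s t) (dot t t) + kap (dot s t') (dot s t) (dot t t')))); last by move=> *; ring.
rewrite [leLHS]EED'; try exact: niceRc.
apply: le_trans (lerD p1 p2) _.
by rewrite le_eqVlt; apply/orP; left; apply/eqP; field.
Qed.

(** By exchangeability of [s] and [s'] this is [be] times the expected Gibbs variance of the shared
    fields [QQ], summed over j. *)
Definition S2 := be * Eav (fun G s s' t t' => \sum_j QQ t s j G * (QQ t s j G - QQ t s' j G)).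

Lemma HHE t v j G : HH t v j G = QQ t v j G + sn * l1 (Xe t j v) G.
Proof. by rewrite /HH lhE. Qed.

(** [rotation_QQ] allows one factor [QQ] to be completed to the full [HH] at no cost. Then [He3] and
    [He4] exchange the product for -E [dQ] up to 2. This mean is linear in the shared disorder, so
    Gaussian integration by parts gives it a second factor eps. *)
Lemma S2_bound : S2 <= 2 + eps ^+ 2 * (2 * N%:R * xi2 1 * Dq + Qq).
Proof.
have nj (f : 'I_N -> V -> V -> V -> V -> (J -> R) -> R) : (forall j s s' t t', nice (f j s s' t t')) ->
    niceR (fun G s s' t t' => \sum_j f j s s' t t' G) by move=> nf s s' t t'; exact: nice_sum.
have nA : niceR (fun G s (s' : V) t (t' : V) => \sum_j be * (QQ t s j G * HH t s j G)).
  by apply: nj => *; apply: niceZ; exact: niceM.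
have nB : niceR (fun G s s' t (t' : V) => \sum_j be * (QQ t s j G * HH t s' j G)).
  by apply: (nj (fun j s s' t t' G => _)) => *; apply: niceZ; exact: niceM.
have nC : niceR (fun G s s' t (t' : V) => \sum_j QQ t s j G * (l1 (Xe t j s) G - l1 (Xe t j s') G)).
  by apply: (nj (fun j s s' t t' G => _)) => *; apply: niceM => //; apply: niceB; exact: nice_l1.
have nD : niceR (fun G s (s' : V) t (t' : V) => \sum_j dQ t s j G) by exact: nj.
have nE : niceR (fun G s s' t (t' : V) => \sum_j QQ t s j G * (QQ t s j G - QQ t s' j G)).
  by apply: (nj (fun j s s' t t' G => _)) => *; apply: niceM => //; exact: niceB.
have -> : S2 = Eav (fun G s s' t t' => \sum_j be * (QQ t s j G * HH t s j G)) -
    Eav (fun G s s' t t' => \sum_j be * (QQ t s j G * HH t s' j G)).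
  transitivity (S2 + be * sn * Eav (fun G s s' t t' =>
      \sum_j QQ t s j G * (l1 (Xe t j s) G - l1 (Xe t j s') G))).
    by rewrite rotation_QQ mulr0 addr0.
  rewrite /S2 -!EEZ'// -EEB'// -EED'//.
    apply: EEext => G s s' t t'; rewrite !mulr_sumr -sumrB -big_split/=; apply: eq_bigr => j _.
    by rewrite !HHE; ring.
  - by move=> s s' t t'; apply: niceZ; exact: nE.
  - by move=> s s' t t'; apply: niceZ; exact: nC.
have h3 := He3; have h4 := He4.
rewrite (EEext (H := fun G s s' t t' => \sum_j dQ t s j G + \sum_j be * (QQ t s j G * HH t s j G))) in h4; last first.
  by move=> *; rewrite -big_split.
rewrite EED'// in h4.
have eD : Eav (fun G s s' t t' => \sum_j dQ t s j G) = be * eps ^+ 2 * N%:R *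
    Eav (fun G s s' t t' => kap (dot s s) (dot s t) (dot t s) - kap (dot s s') (dot s t) (dot t s') +
     kap (dot s t) (dot s t) (dot t t) - kap (dot s t') (dot s t) (dot t t')).
  rewrite (EEext (H := fun G s s' t t' => eps * lx (fun a => \sum_j dXe t j s a) G)); last first.
    move=> G s s' t t'; rewrite /dQ lxE -mulr_sumr; congr (_ * _).
    rewrite [RHS](eq_bigr (fun a => \sum_j dXe t j s a * G (inl a))) => [|a _]; last by rewrite mulr_suml.
    by rewrite [RHS]exchange_big/=; apply: eq_bigr => j _; rewrite lxE.
  rewrite EEZ'; last by move=> *; exact: nice_lx.
  rewrite (EE_ibp_x (fun s t a => \sum_j dXe t j s a)).
  rewrite (EEext (H := fun G s s' t t' => N%:R * (kap (dot s s) (dot s t) (dot t s) - kap (dot s s') (dot s t) (dot t s') +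
     kap (dot s t) (dot s t) (dot t t) - kap (dot s t') (dot s t) (dot t t')))); last first.
    by move=> G s s' t t'; rewrite !ker_dXe; ring.
  by rewrite EEZ'; [ring|exact: niceRc].
have := dXe_bound; rewrite eD in h4; move: h3 h4; rewrite /Qq /Dq.
set A := Eav _; set B := Eav (fun G s s' t t' => \sum_j _); set C := Eav _; set Q := Eav _.
rewrite !ler_norml => /andP[h3 _] /andP[_ h4] h5.
have b0 : 0 <= be * eps ^+ 2 * N%:R by rewrite mulr_ge0// mulr_ge0 ?sqr_ge0// ltW.
have h6 := ler_wpM2l b0 h5.
rewrite (_ : eps ^+ 2 * _ = be * eps ^+ 2 * N%:R * (N%:R * xi2 1 * ED + Q)); last by field.
move: h3 h4 h6; rewrite mulrN.
by set u := be * eps ^+ 2 * N%:R * _; set v := be * eps ^+ 2 * N%:R * _; lra.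
Qed.

(** The difference of [He1] and [He2] expresses N phi - 1 through [psi] times the increment of [HH],
    with total error 2. The private part vanishes by [rotation_psi]; the shared part is estimated by
    the weighted inequality between means, [la] being the weight. *)
Lemma phi_bound la : 0 < la -> N%:R * phi - 1 <= 2 + la / 2 * (Dq / N%:R) + S2 / (2 * la).
Proof.
move=> la0.
have nj (f : 'I_N -> V -> V -> V -> V -> (J -> R) -> R) : (forall j s s' t t', nice (f j s s' t t')) ->
    niceR (fun G s s' t t' => \sum_j f j s s' t t' G) by move=> nf s s' t t'; exact: nice_sum.
have nA : niceR (fun G s (s' : V) t (t' : V) => \sum_j be * (psi t s j * HH t s j G)).
  by apply: nj => *; apply: niceZ; exact: niceZ.
have nB : niceR (fun G s s' t (t' : V) => \sum_j be * (psi t s j * HH t s' j G)).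
  by apply: (nj (fun j s s' t t' G => _)) => *; apply: niceZ; exact: niceZ.
have nC : niceR (fun G s s' t (t' : V) => \sum_j psi t s j * (l1 (Xe t j s) G - l1 (Xe t j s') G)).
  by apply: (nj (fun j s s' t t' G => _)) => *; apply: niceZ; apply: niceB; exact: nice_l1.
have nD : niceR (fun G s s' t (t' : V) => \sum_j psi t s j * (QQ t s j G - QQ t s' j G)).
  by apply: (nj (fun j s s' t t' G => _)) => *; apply: niceZ; exact: niceB.
have nE : niceR (fun G s s' t (t' : V) => \sum_j QQ t s j G * (QQ t s j G - QQ t s' j G)).
  by apply: (nj (fun j s s' t t' G => _)) => *; apply: niceM => //; exact: niceB.
have h1 := He1; have h2 := He2.
rewrite (EEext (H := fun G s s' t t' => (N%:R * dot s t ^+ 2 - 1) +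
    \sum_j be * (psi t s j * HH t s j G))) in h1; last first.
  by move=> G s s' t t'; rewrite -sum_Xpsi -big_split.
rewrite EED'// in h1; last exact: niceRc.
rewrite EEB' in h1; [|exact: niceRc|exact: niceRc].
rewrite EEZ' in h1; last exact: niceRc.
rewrite -/phi (EE_G be om0 om1 P X E1 E2 (fun=> 1)) Ex_cst in h1.
have e1 : Eav (fun G s s' t t' => \sum_j be * (psi t s j * HH t s j G)) -
    Eav (fun G s s' t t' => \sum_j be * (psi t s j * HH t s' j G)) =
    be * Eav (fun G s s' t t' => \sum_j psi t s j * (QQ t s j G - QQ t s' j G)).
  transitivity (be * Eav (fun G s s' t t' => \sum_j psi t s j * (QQ t s j G - QQ t s' j G)) +
      be * sn * Eav (fun G s s' t t' => \sum_j psi t s j * (l1 (Xe t j s) G - l1 (Xe t j s') G))); last first.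
    by rewrite rotation_psi mulr0 addr0.
  rewrite -!EEZ'// -EEB'// -EED'//.
    apply: EEext => G s s' t t'; rewrite !mulr_sumr -sumrB -big_split/=; apply: eq_bigr => j _.
    by rewrite !HHE; ring.
  - by move=> s s' t t'; apply: niceZ; exact: nD.
  - by move=> s s' t t'; apply: niceZ; exact: nC.
have e2 : - Eav (fun G s s' t t' => \sum_j psi t s j * (QQ t s j G - QQ t s' j G)) <=
    la / 4 * ED + (2 * la)^-1 * Eav (fun G s s' t t' => \sum_j QQ t s j G * (QQ t s j G - QQ t s' j G)).
  rewrite EE_sym1// [X in _ <= _ + _ * X]EE_sym1// -EEN'; last first.
    by move=> s s' t t'; apply: niceZ; apply: niceD; exact: nD.
  rewrite /ED -EEZ'; last exact: niceRc.
  rewrite -EEZ'; last by move=> s s' t t'; apply: niceZ; apply: niceD; exact: nE.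
  rewrite -EED'; [|exact: niceRc|]; last first.
    by move=> s s' t t'; do 2![apply: niceZ]; apply: niceD; exact: nE.
  apply: EEle.
  - by move=> s s' t t'; apply: niceN; apply: niceZ; apply: niceD; exact: nD.
  - move=> s s' t t'; apply: niceD; first exact: nice_cst.
    by do 2![apply: niceZ]; apply: niceD; exact: nE.
  move=> G s s' t t'.
  have -> : DD (dot s t) (dot s' t) (dot s s') = \sum_j (psi t s j - psi t s' j) ^+ 2.
    rewrite /psi (eq_bigr (fun j => dot s t ^+ 2 * x s j ^+ 2 + dot s' t ^+ 2 * x s' j ^+ 2 -
      2 * dot s t * dot s' t * (x s j * x s' j))) => [|j _]; last by ring.
    by rewrite sumrB big_split/= -!mulr_sumr !x1 -/(dot s s') /DD; ring.
  rewrite -!big_split/= !mulr_sumr -big_split/= -sumrN; apply: ler_sum => j _.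
  rewrite -subr_ge0.
  (* The gap is a completed square in the increments of [psi] and [QQ]. *)
  rewrite (_ : _ - _ = (4 * la)^-1 * (la * (psi t s j - psi t s' j) + (QQ t s j G - QQ t s' j G)) ^+ 2).
    by rewrite mulr_ge0 ?sqr_ge0// invr_ge0 mulr_ge0// ltW.
  by field; rewrite gt_eqF.
have N2' : 0 < N%:R :> R by rewrite ltr0n (leq_trans _ N2).
have := ler_wpM2l (ltW be0) e2.
rewrite mulrN -e1 mulrDr.
rewrite (_ : be * (la / 4 * ED) = la / 2 * (Dq / N%:R)); last by rewrite /Dq; field; rewrite gt_eqF.
rewrite (_ : be * ((2 * la)^-1 * _) = S2 / (2 * la)); last by rewrite /S2; ring.
move: h1 h2; set A := Eav _; set B := Eav _; set u := N%:R * phi; set v := la / 2 * _; set w := S2 / _.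
rewrite !ler_norml => /andP[_ h1] /andP[h2 _].
by lra.
Qed.

End chaos.

(** * The p-spin covariance *)

Section product_rule.
Context {R : realType}.

Lemma smooth1_prod (M L : finType) (f : L -> (M -> R) -> R) df :
  (forall l, smooth1 (f l) (df l)) ->
  smooth1 (fun u => \prod_l f l u)
    (fun m u => \sum_k \prod_l (if l == k then df l m u else f l u)).
Proof.
move=> sf.
suff H (s : seq L) : uniq s -> smooth1 (fun u => \prod_(l <- s) f l u)
    (fun m u => \sum_(k <- s) \prod_(l <- s) (if l == k then df l m u else f l u)).
  by apply: H; exact: index_enum_uniq.
elim: s => [_|k0 s IH /= /andP[ks us]].
  by refine (smooth1_ext _ _ (smooth1_cst _ 1)) => *; rewrite big_nil.
refine (smooth1_ext _ _ (smooth1M (sf k0) (IH us))) => [u|m u]; first by rewrite big_cons.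
rewrite big_cons big_cons eqxx addrC; congr (_ + _).
  rewrite mulrC; congr (_ * _); rewrite !big_seq; apply: eq_bigr => l ls.
  by case: eqP => // e; rewrite -e ls in ks.
rewrite mulr_sumr !big_seq; apply: eq_bigr => k kss; rewrite big_cons ifN//.
by apply: contraNneq ks => ->.
Qed.

End product_rule.

Section pspin_polynomials.
Context {R : realType} (ga : nat -> R) (n N : nat).

Definition cidx := {p : 'I_n & {ffun 'I_p -> 'I_N}}.
(** After the substitution sigma = sqrt N v, the factor N^(-(p-1)/2) N^(p/2) becomes sqrt N for
    every p. *)
Definition cf (p : nat) : R := ga p * Num.sqrt N%:R.
Implicit Types (v w : 'I_N -> R) (a : cidx).

Definition pe a v : R := cf (tag a) * \prod_k v (tagged a k).
Definition dprod (p : nat) (f : 'I_p -> 'I_N) i k v : R :=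
  \prod_(l < p) (if l == k then (i == f l)%:R else v (f l)).
Definition ddprod (p : nat) (f : 'I_p -> 'I_N) i j k k' v : R :=
  \prod_(l < p) (if l == k' then (if l == k then 0 else (j == f l)%:R)
                 else if l == k then (i == f l)%:R else v (f l)).
Definition pde i a v : R := cf (tag a) * \sum_k dprod (tagged a) i k v.
Definition pdde i j a v : R := cf (tag a) * \sum_k \sum_k' ddprod (tagged a) i j k k' v.

Lemma smooth1_pe a : smooth1 (pe a) (fun i => pde i a).
Proof. by apply: smooth1Z; apply: smooth1_prod => l; exact: smooth1_proj. Qed.

Lemma smooth1_pde i a : smooth1 (pde i a) (fun j => pdde i j a).
Proof.
apply: smooth1Z; apply: smooth1_sum => k.
pose h (l : 'I_(tag a)) v : R := if l == k then (i == tagged a l)%:R else v (tagged a l).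
pose dh (l : 'I_(tag a)) j (v : 'I_N -> R) : R := if l == k then 0 else (j == tagged a l)%:R.
have sh l : smooth1 (h l) (dh l).
  by rewrite /h /dh; case: eqP => _; [exact: smooth1_cst|exact: smooth1_proj].
exact: smooth1_prod sh.
Qed.

Definition vdot v w := \sum_i v i * w i.

Lemma sum_cidx (F : forall p : 'I_n, {ffun 'I_p -> 'I_N} -> R) :
  \sum_(a : cidx) F (tag a) (tagged a) = \sum_(p < n) \sum_(f : {ffun 'I_p -> 'I_N}) F p f.
Proof. by rewrite (sig_big_dep (fun=> true) (fun _ _ => true) F). Qed.

Lemma sum_ffun_prod p (h : 'I_p -> 'I_N -> R) :
  \sum_(f : {ffun 'I_p -> 'I_N}) \prod_l h l (f l) = \prod_l \sum_m h l m.
Proof. by rewrite bigA_distr_bigA. Qed.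

Definition xi s := \sum_(p < n) ga p ^+ 2 * s ^+ p.
Definition xi' s := \sum_(p < n) ga p ^+ 2 * (p%:R * s ^+ p.-1).
Definition xi'' s := \sum_(p < n) ga p ^+ 2 * (p%:R * p.-1%:R * s ^+ p.-2).
(** By Euler's identity for homogeneous polynomials, N [zet] is the covariance of the radial
    derivative of the Hamiltonian. *)
Definition zet s := \sum_(p < n) ga p ^+ 2 * (p%:R ^+ 2 * s ^+ p).

Lemma cf2 p : cf p ^+ 2 = N%:R * ga p ^+ 2.
Proof. by rewrite /cf exprMn sqr_sqrtr// mulrC. Qed.

Lemma sum_deltaN (w : 'I_N -> R) i : \sum_m (i == m)%:R * w m = w i.
Proof.
rewrite (bigD1 i)//= eqxx mul1r big1 ?addr0// => m /negPf.
by rewrite eq_sym => ->; rewrite mul0r.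
Qed.

Lemma ker_pe v w : \sum_a pe a v * pe a w = N%:R * xi (vdot v w).
Proof.
rewrite (sum_cidx (fun p f => cf p * \prod_k v (f k) * (cf p * \prod_k w (f k)))).
rewrite /xi mulr_sumr; apply: eq_bigr => p _.
under eq_bigr do rewrite mulrACA -expr2 cf2 -big_split/=.
rewrite -mulr_sumr (sum_ffun_prod (fun _ m => v m * w m)) prodr_const card_ord.
by rewrite mulrA.
Qed.

Lemma ker_pde i v w : \sum_a pde i a v * pe a w = N%:R * w i * xi' (vdot v w).
Proof.
rewrite (sum_cidx (fun p f => cf p * (\sum_k dprod f i k v) * (cf p * \prod_k w (f k)))).
rewrite /xi' mulr_sumr; apply: eq_bigr => p _.
under eq_bigr do rewrite mulrACA -expr2 cf2 mulr_suml.
rewrite -mulr_sumr exchange_big/=.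
rewrite (eq_bigr (fun=> w i * vdot v w ^+ p.-1)) => [|k _].
  by rewrite sumr_const card_ord -mulr_natl; ring.
under eq_bigr do rewrite /dprod -big_split/=.
rewrite (sum_ffun_prod (fun l m => (if l == k then (i == m)%:R else v m) * w m)).
rewrite (bigD1 k)//= eqxx sum_deltaN; congr (_ * _).
rewrite (eq_bigr (fun=> vdot v w)) => [|l /negPf->]//.
by rewrite prodr_const cardC1 card_ord.
Qed.

Lemma ker_pdde i j v w :
  \sum_a pdde i j a v * pe a w = N%:R * w i * w j * xi'' (vdot v w).
Proof.
rewrite (sum_cidx (fun p f => cf p * (\sum_k \sum_k' ddprod f i j k k' v) * (cf p * \prod_k w (f k)))).
rewrite /xi'' mulr_sumr; apply: eq_bigr => p _.
under eq_bigr do rewrite mulrACA -expr2 cf2 mulr_suml.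
rewrite -mulr_sumr exchange_big/=.
rewrite (eq_bigr (fun=> p.-1%:R * (w i * w j * vdot v w ^+ p.-2))) => [|k _].
  by rewrite sumr_const card_ord -mulr_natl; ring.
under eq_bigr do rewrite mulr_suml.
(* Differentiating twice at the same position gives 0, which leaves p - 1 choices for [k']. *)
rewrite exchange_big/= (bigD1 k)//= [X in X + _]big1 ?add0r => [|f _]; last first.
  by rewrite /ddprod (bigD1 k)//= !eqxx mul0r mul0r.
rewrite (eq_bigr (fun=> w i * w j * vdot v w ^+ p.-2)) => [|k' kk].
  by rewrite sumr_const cardC1 card_ord mulr_natl.
under eq_bigr do rewrite /ddprod -big_split/=.
rewrite (sum_ffun_prod (fun l m => (if l == k' then (if l == k then 0 else (j == m)%:R)
                 else if l == k then (i == m)%:R else v m) * w m)).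
rewrite (bigD1 k)//= eq_sym (negPf kk) eqxx sum_deltaN -mulrA; congr (_ * _).
rewrite (bigD1 k')//= eqxx (negPf kk) sum_deltaN; congr (_ * _).
rewrite (eq_bigr (fun=> vdot v w)) => [|l /andP[/negPf-> /negPf->]]//.
rewrite prodr_const; congr (_ ^+ _).
have := cardC [pred l : 'I_p | (l == k) || (l == k')].
rewrite card_ord (_ : #|[pred l : 'I_p | (l == k) || (l == k')]| = 2); last first.
  by rewrite (@eq_card _ _ (pred2 k k')) ?card2 1?eq_sym ?kk.
move=> e; rewrite (_ : p.-2 = p - 2)%N; last by rewrite -subn2.
rewrite -[in RHS]e addKn; apply: eq_card => l; rewrite !inE negb_or.
by [].
Qed.

Lemma euler a v : \sum_i v i * pde i a v = (tag a)%:R * pe a v.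
Proof.
rewrite /pde /pe; transitivity (cf (tag a) * \sum_k \sum_i v i * dprod (tagged a) i k v).
  rewrite exchange_big/= mulr_sumr; apply: eq_bigr => i _.
  by rewrite -mulr_sumr mulrCA.
rewrite [RHS]mulrCA; congr (_ * _).
transitivity (\sum_(k < tag a) \prod_(l < tag a) v (tagged a l)); last first.
  by rewrite sumr_const card_ord mulr_natl.
apply: eq_bigr => k _; rewrite /dprod [RHS](bigD1 k)//= (eq_bigr (fun i => v i * (i == tagged a k)%:R *
  \prod_(l | l != k) v (tagged a l))) => [|i _].
  rewrite -mulr_suml; congr (_ * _).
  rewrite (bigD1 (tagged a k))//= eqxx mulr1 big1 ?addr0// => i /negPf->.
  by rewrite mulr0.
rewrite (bigD1 k)//= eqxx mulrA; congr (_ * _).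
by apply: eq_bigr => l /negPf->.
Qed.

Lemma ker_euler v w : \sum_(a : cidx) (tag a)%:R * pe a v * ((tag a)%:R * pe a w) = N%:R * zet (vdot v w).
Proof.
rewrite (sum_cidx (fun p f => p%:R * (cf p * \prod_k v (f k)) * (p%:R * (cf p * \prod_k w (f k))))).
rewrite /zet mulr_sumr; apply: eq_bigr => p _.
rewrite (eq_bigr (fun f : {ffun 'I_p -> 'I_N} => N%:R * ga p ^+ 2 * p%:R ^+ 2 * \prod_k (v (f k) * w (f k)))) => [|f _]; last first.
  by rewrite big_split/= -cf2; ring.
rewrite -mulr_sumr (sum_ffun_prod (fun _ m => v m * w m)) prodr_const card_ord.
by rewrite !mulrA.
Qed.

End pspin_polynomials.

(** * Scalar inequalities for even powers *)

Section inequalities.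
Context {R : realType}.
Implicit Types a b s t : R.

Lemma bernoulli m t : 0 <= t -> 1 + m%:R * (t - 1) <= t ^+ m.
Proof.
move=> t0; elim: m => [|m IH]; first by rewrite mul0r addr0 expr0.
rewrite exprS; apply: le_trans (_ : t * (1 + m%:R * (t - 1)) <= _); last by rewrite ler_wpM2l.
rewrite -natr1 -subr_ge0 (_ : _ - _ = m%:R * (t - 1) ^+ 2); last by ring.
by rewrite mulr_ge0// sqr_ge0.
Qed.

Lemma even_pow p s : ~~ odd p -> `|s| <= 1 -> 0 <= s ^+ p <= 1.
Proof.
move=> ev s1; rewrite exprn_even_ge0//=.
by rewrite -[leLHS]ger0_norm ?exprn_even_ge0// normrX exprn_ile1.
Qed.

(** With u = s^p, right side minus left side is again [DD], at the point s (2 u - 1), which lies in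
    [-1, 1] because evenness gives 0 <= u <= 1. *)
Lemma ineqA_pow p a b s : ~~ odd p -> `|s| <= 1 ->
  DD a b s <= 2 * (a ^+ 2 + b ^+ 2 - 2 * a * b * s ^+ p.+1).
Proof.
move=> ev s1; have /andP[u0 u1] := even_pow ev s1; rewrite [s ^+ p.+1]exprS.
set u := s ^+ p in u0 u1 *.
have t1 : `|s * (2 * u - 1)| <= 1.
  by rewrite normrM mulr_ile1// ler_norml; lra.
rewrite -subr_ge0 (_ : _ - _ = DD a b (s * (2 * u - 1))); first exact: DD_ge0.
by rewrite /DD; ring.
Qed.

(** The difference is p (a^2 + b^2) - 2 q a b with q = (p + 1) s - s^(p+1). It is nonnegative once
    |q| <= p, which is Bernoulli's inequality at |s|. *)
Lemma ineqB_pow p a b s : ~~ odd p -> `|s| <= 1 ->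
  a ^+ 2 + b ^+ 2 - 2 * a * b * s ^+ p.+1 <= p.+1%:R * DD a b s.
Proof.
move=> ev s1.
have key (r : R) : 0 <= r -> p.+1%:R * r - r ^+ p.+1 <= p%:R.
  by move=> r0; have := bernoulli p.+1 r0; rewrite -natr1; lra.
have t1 : `|p.+1%:R * s - s ^+ p.+1| <= p%:R.
  have [s0|s0] := leP 0 s.
    rewrite ger0_norm ?key// exprS mulrC -mulrBr mulr_ge0// subr_ge0.
    have /andP[_ u1] := even_pow ev s1; apply: le_trans u1 _.
    by rewrite (ler_nat _ 1).
  have := key (- s); rewrite oppr_ge0 (ltW s0) => /(_ isT).
  rewrite exprNn -signr_odd/= ev expr1 mulN1r => h.
  rewrite ler0_norm; first by move: h; rewrite mulrN; lra.
  rewrite exprS mulrC -mulrBr; apply: mulr_le0_ge0; first exact: ltW.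
  rewrite subr_ge0; have /andP[_ u1] := even_pow ev s1; apply: le_trans u1 _.
  by rewrite (ler_nat _ 1).
move: t1; set q := s ^+ _; rewrite ler_norml => /andP[h1 h2].
rewrite -subr_ge0 (_ : _ - _ = (p%:R + (p.+1%:R * s - q)) / 2 * (a - b) ^+ 2 +
    (p%:R - (p.+1%:R * s - q)) / 2 * (a + b) ^+ 2).
  by rewrite addr_ge0// mulr_ge0 ?sqr_ge0//; lra.
by rewrite /DD -natr1; field.
Qed.

Lemma pow_sub_le m (X Y : R) : 0 <= X <= 1 -> 0 <= Y <= 1 ->
  0 <= (X ^+ m - Y ^+ m) * (X - Y) <= m%:R * (X - Y) ^+ 2.
Proof.
move=> /andP[X0 X1] /andP[Y0 Y1]; rewrite subrXX.
set S := \sum_(i < m) _.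
have S0 : 0 <= S by apply: sumr_ge0 => i _; rewrite mulr_ge0// exprn_ge0.
have Sm : S <= m%:R.
  rewrite -[m in leRHS]card_ord -sumr_const; apply: ler_sum => i _.
  by rewrite mulr_ile1// ?exprn_ge0// exprn_ile1.
rewrite (_ : (X - Y) * S * (X - Y) = S * (X - Y) ^+ 2); last by ring.
by rewrite mulr_ge0 ?sqr_ge0//= ler_wpM2r ?sqr_ge0.
Qed.

(** With A = a^p and B = b^p the expression is half of (A + B) [DD] plus half of (A - B)(a^2 - b^2).
    Both terms are nonnegative since A and B are powers of a^2 and b^2, and the second is at most
    p/4 times (a^2 - b^2)^2. *)
Lemma ineqC_pow p a b s : ~~ odd p -> `|a| <= 1 -> `|b| <= 1 -> `|s| <= 1 ->
  `|a ^+ p.+2 + b ^+ p.+2 - s * (a * b ^+ p.+1 + b * a ^+ p.+1)| <= p.+1%:R * DD a b s.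
Proof.
move=> ev a1 b1 s1.
have /andP[A0 A1] := even_pow ev a1; have /andP[B0 B1] := even_pow ev b1.
have DD0 := DD_ge0 a b s1.
have sq1 (c : R) : `|c| <= 1 -> 0 <= c ^+ 2 <= 1 by move=> c1; exact: even_pow.
have pE (c : R) : c ^+ p = (c ^+ 2) ^+ p./2.
  by rewrite -exprM mul2n; rewrite -{1}(odd_double_half p) (negPf ev).
have /andP[W0 W1] := pow_sub_le p./2 (sq1 a a1) (sq1 b b1).
rewrite -!pE in W0 W1.
have hp : (p./2)%:R * 2 = p%:R :> R.
  by rewrite -natrM muln2 -[in RHS](odd_double_half p) (negPf ev).
(* [DD] is a convex combination of (a + b)^2 and (a - b)^2, each at most 4, so it dominates a
   quarter of their product. *)
have sqle : (a ^+ 2 - b ^+ 2) ^+ 2 <= 4 * DD a b s.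
  have e : (a ^+ 2 - b ^+ 2) ^+ 2 = (a - b) ^+ 2 * (a + b) ^+ 2 by ring.
  have m4 (c c' : R) : `|c| <= 1 -> `|c'| <= 1 -> (c + c') ^+ 2 <= 4.
    rewrite !ler_norml => /andP[? ?] /andP[? ?].
    by rewrite -subr_ge0 (_ : _ - _ = (2 - (c + c')) * (2 + (c + c'))) ?mulr_ge0//; [lra|lra|ring].
  have p1 := m4 _ _ a1 b1; have p2 := m4 a (- b); rewrite normrN in p2; have {}p2 := p2 a1 b1.
  have q1 := sqr_ge0 (a + b); have q2 := sqr_ge0 (a - b).
  have eD : 4 * DD a b s = (1 - s) / 2 * (4 * (a + b) ^+ 2) + (1 + s) / 2 * (4 * (a - b) ^+ 2).
    by rewrite /DD; field.
  rewrite eD e; move: s1; rewrite ler_norml => /andP[s1 s2].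
  set u := (a + b) ^+ 2 in p1 q1 *; set v := (a - b) ^+ 2 in p2 q2 *.
  have r1 : v * u <= 4 * u by rewrite ler_wpM2r.
  have r2 : v * u <= 4 * v by rewrite mulrC ler_wpM2r.
  have w1 : (1 - s) / 2 * (v * u) <= (1 - s) / 2 * (4 * u) by rewrite ler_wpM2l//; lra.
  have w2 : (1 + s) / 2 * (v * u) <= (1 + s) / 2 * (4 * v) by rewrite ler_wpM2l//; lra.
  by move: w1 w2; lra.
rewrite [a ^+ p.+2]exprS [b ^+ p.+2]exprS [a ^+ p.+1]exprS [b ^+ p.+1]exprS; move: A0 A1 B0 B1 W0 W1; set A := a ^+ p; set B := b ^+ p => A0 A1 B0 B1 W0 W1.
rewrite (_ : _ - _ = 2^-1 * (A + B) * DD a b s + 2^-1 * ((A - B) * (a ^+ 2 - b ^+ 2))); last by rewrite /DD; field.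
have k1 : 0 <= 2^-1 * (A + B) * DD a b s by rewrite mulr_ge0// mulr_ge0 ?invr_ge0// addr_ge0.
rewrite ger0_norm; last by rewrite addr_ge0// mulr_ge0// invr_ge0.
have k2 : 2^-1 * (A + B) * DD a b s <= DD a b s by rewrite ler_piMl//; lra.
have k3 : (p./2)%:R * (a ^+ 2 - b ^+ 2) ^+ 2 <= (p./2)%:R * (4 * DD a b s) by rewrite ler_wpM2l.
have k4 : (p./2)%:R * (4 * DD a b s) = 2 * p%:R * DD a b s by rewrite -hp; ring.
have -> : p.+1%:R * DD a b s = p%:R * DD a b s + DD a b s by rewrite -natr1; ring.
by move: k2 k3 k4 W1; lra.
Qed.

End inequalities.

Lemma Ex_dct (R : realType) d (T : measurableType d) (P : probability T R)
    (f_ : nat -> T -> R) (f g : T -> R) :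
  (forall n, measurable_fun setT (f_ n)) -> (forall x, f_ n x @[n --> \oo] --> f x) ->
  (forall n x, `|f_ n x| <= g x) -> L1 P g ->
  L1 P f /\ Ex P (f_ n) @[n --> \oo] --> Ex P f.
Proof.
move=> mf ff fg ig.
have mF : measurable_fun setT f.
  apply: (measurable_fun_cvg (h := f_)) => // x _; exact: ff.
have h := @dominated_convergence _ T R P setT measurableT (fun n => EFin \o f_ n) (EFin \o f) (EFin \o g).
have {h} [|||||if0 _ cv] := h.
- by move=> n; exact/measurable_EFinP.
- exact/measurable_EFinP.
- by apply: aeW => x _; apply: cvg_EFin; [exact: nearW|exact: ff].
- exact: ig.
- by apply: aeW => x n _; rewrite lee_fin; exact: fg.
split => //.
have fin : (\int[P]_x (f x)%:E)%E \is a fin_num by exact: integrable_fin_num if0.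
apply: (fine_cvg (f := fun n => (\int[P]_x (f_ n x)%:E)%E)).
by rewrite fineK.
Qed.

(** * The uniform measure on the sphere and its grid approximations *)

Section unit_ball.
Context {R : realType}.

(** Exponentials of polynomials are not of polynomial growth and so not [nice]. Boundedness is
    therefore asked only on the cube, which contains the sphere. *)
Definition okf (M : finType) (F : (M -> R) -> R) :=
  [/\ mcl F, ccl F & exists C, forall u, (forall i, `|u i| <= 1) -> `|F u| <= C].

Lemma okf_nice (M : finType) (F : (M -> R) -> R) : nice F -> okf F.
Proof.
move=> [mF /pbd_posC[C [k [C0 bF]]] cF]; split => //.
exists (C * (1 + #|M|%:R) ^+ k) => u u1; apply: le_trans (bF u) _.
rewrite ler_wpM2l//; apply: lerXn2r; rewrite ?nnegrE ?addr_ge0// ?sumr_ge0//.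
by rewrite /vbnd lerD2l -sum1_card natr_sum; apply: ler_sum.
Qed.

Lemma okfM (M : finType) (F H : (M -> R) -> R) : okf F -> okf H -> okf (fun u => F u * H u).
Proof.
move=> [mF cF [C bF]] [mH cH [D bH]]; split.
- by move=> d U X mX; apply: measurable_funM; [exact: mF|exact: mH].
- by move=> S FF Ff x l xl; apply: cvgM; [exact: cF|exact: cH].
- by exists (C * D) => u u1; rewrite normrM ler_pM// ?bF ?bH.
Qed.

Lemma okf_expR (M : finType) (F : (M -> R) -> R) : okf F -> okf (fun u => expR (F u)).
Proof.
move=> [mF cF [C bF]]; split.
- by move=> d U X mX; apply: (measurableT_comp (@measurable_expR R)); exact: mF.
- move=> S FF Ff x l xl.
  apply: (@cvg_comp _ _ _ (fun s => F (x s)) expR _ (nbhs (F l))); first exact: cF.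
  exact: continuous_expR.
- exists (expR C) => u u1; rewrite ger0_norm ?expR_ge0// ler_expR.
  exact: le_trans (ler_norm _) (bF _ u1).
Qed.

Lemma okf_comp (M I : finType) (F : (M -> R) -> R) (g : M -> (I -> R) -> R) :
  okf F -> (forall m, okf (g m)) -> (forall m u, (forall i, `|u i| <= 1) -> `|g m u| <= 1) ->
  okf (fun u => F (fun m => g m u)).
Proof.
move=> [mF cF [C bF]] og g1; split.
- by move=> d U X mX; apply: mF => m; case: (og m) => h _ _; exact: h.
- by move=> S FF Ff x l xl; apply: cF => m; case: (og m) => _ h _; exact: h.
- by exists C => u u1; apply: bF => m; exact: g1.
Qed.

Lemma nice_okf_comp (M I : finType) (F : (M -> R) -> R) (g : M -> (I -> R) -> R) :
  okf F -> (forall m, nice (g m)) -> (forall m u, `|g m u| <= 1) -> nice (fun u => F (fun m => g m u)).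
Proof.
move=> [mF cF [C bF]] ng g1; split.
- by move=> d U X mX; apply: mF => m; case: (ng m) => h _ _; exact: h.
- by apply: (@pbd_bounded _ _ _ C) => u; apply: bF.
- by move=> S FF Ff x l xl; apply: cF => m; case: (ng m) => _ _ h; exact: h.
Qed.

Lemma cdf_comp (M I : finType) (F : (M -> R) -> R) dF (g : M -> (I -> R) -> R) dg :
  cdf F dF -> (forall m, cdf (g m) (dg m)) ->
  cdf (fun u => F (fun m => g m u)) (fun i u => \sum_m dF m (fun m => g m u) * dg m i u).
Proof.
move=> cF cg u u' t du.
have := cF (fun s m => g m (u s)) (fun m => \sum_i dg m i (u t) * u' i) t (fun m => cg m u u' t du).
rewrite (_ : \sum_m _ = \sum_m (\sum_m0 dF m0 (fun m => g m (u t)) * dg m0 m (u t)) * u' m)//.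
under [RHS]eq_bigr do rewrite mulr_suml.
rewrite exchange_big/=; apply: eq_bigr => m _.
by rewrite mulr_sumr; apply: eq_bigr => i _; rewrite mulrA.
Qed.

End unit_ball.

(** * Integration by parts for rotations of the sphere *)

Section sphere_ibp.
Context {R : realType} d (T : measurableType d) (Q : probability T R) (N : nat).
Context (Y : 'I_N -> T -> R).
Hypothesis gY : gfam Q Y.
Implicit Types y : 'I_N -> R.

Definition nrm2 y := \sum_i y i ^+ 2.
Definition rho (t : R) := expR (- (2^-1 * ln t)).
(** A smooth substitute for the projection to the sphere: a positive [de] removes the singularity at
    the origin while the map keeps its direction. *)
Definition sphd de y i := y i * rho (de + nrm2 y).
(* The origin is sent to the first basis vector, so that the values always lie on the sphere. *)
Definition sph y (i : 'I_N) : R := if nrm2 y == 0 then (i == 0%N :> nat)%:R else y i * rho (nrm2 y).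

Lemma nrm2_ge0 y : 0 <= nrm2 y.
Proof. by apply: sumr_ge0 => i _; exact: sqr_ge0. Qed.

Lemma rho_sqr t : 0 < t -> rho t ^+ 2 = t^-1.
Proof.
move=> t0; rewrite /rho -expRM_natl (_ : 2 * _ = - ln t); last by field.
by rewrite expRN lnK.
Qed.

Lemma sph_nrm2 y : (0 < N)%N -> nrm2 (sph y) = 1.
Proof.
move=> N0; rewrite {1}/nrm2 /sph; have [y0|yn] := eqVneq (nrm2 y) 0.
  rewrite (bigD1 (Ordinal N0))//= expr1n big1 ?addr0// => i ni.
  by rewrite (_ : (i == 0%N :> nat) = false) ?expr0n//; apply: contraNF ni => /eqP e; apply/eqP/val_inj.
under eq_bigr do rewrite exprMn.
have y0 : 0 < nrm2 y by rewrite lt_def yn nrm2_ge0.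
by rewrite -mulr_suml rho_sqr// divff.
Qed.

Lemma nrm2_coord u i : nrm2 u <= 1 -> `|u i| <= 1.
Proof.
move=> u1; rewrite -(expr_le1 (n := 2))// real_normK ?num_real// (le_trans _ u1)//.
by rewrite /nrm2 (bigD1 i)//= lerDl sumr_ge0// => j _; exact: sqr_ge0.
Qed.

Section delta.
Variable de : R.
Hypothesis de0 : 0 < de.

Let pos y : 0 < de + nrm2 y. Proof. by rewrite ltr_wpDr// nrm2_ge0. Qed.

Lemma smooth1_nrm2 : smooth1 nrm2 (fun m (y : 'I_N -> R) => 2 * y m).
Proof.
have s i := smooth1M (smooth1_proj (R := R) (i : 'I_N)) (smooth1_proj i).
refine (smooth1_ext _ _ (smooth1_sum (index_enum _) s)) => [u|m u].
  by apply: eq_bigr => i _; rewrite expr2.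
rewrite (bigD1 m)//= eqxx big1 ?addr0 => [|i]; first by rewrite mulr1; ring.
by rewrite eq_sym => /negPf->; rewrite mulr0 addr0.
Qed.

Definition drho m y := - (y m * rho (de + nrm2 y) * (rho (de + nrm2 y) ^+ 2)).

Lemma rho_le y : rho (de + nrm2 y) <= rho de.
Proof.
rewrite /rho ler_expR lerN2 ler_pM2l// ?ler_ln ?posrE ?pos// lerDl.
exact: nrm2_ge0.
Qed.

Lemma nice_rho : nice (fun y => rho (de + nrm2 y)).
Proof.
have [[mn _ cn] _ _] := smooth1_nrm2.
split.
- move=> d0 U X mX; apply: (measurableT_comp (@measurable_expR R)).
  apply: measurableT_comp => //; apply: measurable_funM => //.
  apply: (measurableT_comp (@measurable_ln R)); apply: measurable_funD => //.
  exact: mn.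
- apply: (@pbd_bounded _ _ _ (rho de)) => u.
  by rewrite ger0_norm ?expR_ge0// rho_le.
- move=> S FF Ff x l xl.
  apply: (@cvg_comp _ _ _ (fun s => - (2^-1 * ln (de + nrm2 (x s)))) expR _
    (nbhs (- (2^-1 * ln (de + nrm2 l))))); last exact: continuous_expR.
  apply: cvgN; apply: cvgM; first exact: cvg_cst.
  apply: (@cvg_comp _ _ _ (fun s => de + nrm2 (x s)) (@ln R) _ (nbhs (de + nrm2 l))).
    by apply: cvgD; [exact: cvg_cst|exact: cn].
  exact: continuous_ln (pos l).
Qed.

Lemma sphd_nrm2 y : nrm2 (sphd de y) <= 1.
Proof.
rewrite /nrm2 /sphd; under eq_bigr do rewrite exprMn.
rewrite -mulr_suml rho_sqr// -/(nrm2 y) ler_pdivrMr// mul1r lerDr ltW//.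
Qed.

Lemma sphd_le1 i y : `|sphd de y i| <= 1.
Proof. exact: nrm2_coord (sphd_nrm2 y). Qed.

Lemma smooth1_rho : smooth1 (fun y => rho (de + nrm2 y)) drho.
Proof.
have [nn _ cn] := smooth1_nrm2.
split; first exact: nice_rho.
  move=> m; apply: niceN; apply: niceM.
    by apply: niceM; [exact: nice_proj|exact: nice_rho].
  by under eq_fun do rewrite expr2; apply: niceM; exact: nice_rho.
have c1 := cdfD (@cdf_cst R _ de) cn.
have c2 := cdf_comp1 (h := @ln R) (h' := fun x => x^-1) (fun u => is_derive1_ln (pos u)) c1.
have c3 := cdfM (@cdf_cst R _ (- 2^-1)) c2.
have c4 := cdf_comp1 (h := expR) (h' := expR) (fun u => is_derive_expR _) c3.
refine (cdf_ext _ _ c4) => [u|m u] /=; first by rewrite mulNr.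
rewrite /drho rho_sqr// mulNr -/(rho _); field.
by rewrite gt_eqF.
Qed.

Definition dsphd i m y := y i * drho m y + rho (de + nrm2 y) * (m == i)%:R.

Lemma nice_sphd i : nice (fun y => sphd de y i).
Proof. by apply: niceM; [exact: nice_proj|exact: nice_rho]. Qed.

Lemma smooth1_sphd i : smooth1 (fun y => sphd de y i) (dsphd i).
Proof. exact: smooth1M (smooth1_proj i) smooth1_rho. Qed.

(** Integrating E(y_i y_j f) by parts in either variable gives the same value, so y_i d_j - y_j d_i
    has mean 0 on every smooth function of the Gaussian vector. This operator annihilates radial
    factors, so the terms from [drho] cancel. *)
Lemma sphere_ibp_delta (F : ('I_N -> R) -> R) dF i j : okf F -> (forall m, okf (dF m)) -> cdf F dF ->
  Ex Q (fun w => sphd de (Y^~ w) i * dF j (sphd de (Y^~ w)) -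
                 sphd de (Y^~ w) j * dF i (sphd de (Y^~ w))) = 0.
Proof.
move=> oF odF cF.
pose f y := F (sphd de y).
pose df m y := \sum_l dF l (sphd de y) * dsphd l m y.
have nl m : nice (fun y => dF m (sphd de y)).
  by apply: (nice_okf_comp (odF m) nice_sphd) => *; exact: sphd_le1.
have sf : smooth1 f df.
  split.
  - by apply: (nice_okf_comp oF nice_sphd) => *; exact: sphd_le1.
  - by move=> m; apply: nice_sum => l; apply: niceM => //; case: (smooth1_sphd l).
  - by apply: (cdf_comp cF) => l; case: (smooth1_sphd l).
have [nf ndf _] := sf.
have ibp k l := gf_ibp gY (smooth1M (smooth1_proj k) sf) l.
have := ibp i j; have := ibp j i.
rewrite /= (_ : (fun w => Y i w * (Y j w * f (Y^~ w))) = (fun w => Y j w * (Y i w * f (Y^~ w)))); last first.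
  by apply/funext => w; rewrite mulrCA.
move=> -> e.
have l1 k l : L1 Q (fun w => Y k w * df l (Y^~ w) + f (Y^~ w) * (l == k)%:R).
  apply: (gfam_L1 gY (f := fun y => y k * df l y + f y * (l == k)%:R)).
  by apply: niceD; apply: niceM => //; [exact: nice_proj|exact: nice_cst].
transitivity (Ex Q (fun w => Y i w * df j (Y^~ w) + f (Y^~ w) * (j == i)%:R -
    (Y j w * df i (Y^~ w) + f (Y^~ w) * (i == j)%:R))); last first.
  by rewrite ExB// e subrr.
apply: eq_Rintegral => w _; set y := Y^~ w.
have -> : Y i w = y i by []. have -> : Y j w = y j by [].
have dfE m m' : y m * df m' y = rho (de + nrm2 y) * (y m * dF m' (sphd de y)) +
    y m * \sum_l dF l (sphd de y) * (y l * drho m' y).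
  rewrite /df /dsphd; under eq_bigr do rewrite mulrDr mulrA.
  rewrite big_split/= mulrDr addrC; congr (_ + _).
    rewrite (eq_bigr (fun l => rho (de + nrm2 y) * ((m' == l)%:R * dF l (sphd de y)))) => [|l _]; last by ring.
    by rewrite -mulr_sumr sum_deltaN; ring.
  by congr (_ * _); apply: eq_bigr => l _; rewrite mulrA.
rewrite !dfE (eq_sym j i) /sphd -/(sphd de y).
have dr m m' : y m * \sum_l dF l (sphd de y) * (y l * drho m' y) =
  y m' * \sum_l dF l (sphd de y) * (y l * drho m y).
  by rewrite !mulr_sumr; apply: eq_bigr => l _; rewrite /drho; ring.
by rewrite (dr j i); ring.
Qed.

End delta.

Hypothesis Y0 : Ex Q (fun w => (nrm2 (Y^~ w) == 0)%:R) = 0.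
Hypothesis mY0 : measurable_fun setT (fun w => (nrm2 (Y^~ w) == 0)%:R : R).

Lemma measurable_sph i : measurable_fun setT (fun w => sph (Y^~ w) i).
Proof.
rewrite (_ : (fun w => _) = (fun w => (nrm2 (Y^~ w) == 0)%:R * (i == 0%N :> nat)%:R +
   (1 - (nrm2 (Y^~ w) == 0)%:R) * (Y i w * rho (nrm2 (Y^~ w))))); last first.
  by apply/funext => w; rewrite /sph; case: eqP => _ /=; ring.
have [[mn _ _] _ _] := smooth1_nrm2.
apply: measurable_funD; first exact: measurable_funM.
apply: measurable_funM; first exact: measurable_funB.
apply: measurable_funM; first exact: (gf_meas gY).
apply: (measurableT_comp (@measurable_expR R)).
apply: measurableT_comp => //; apply: measurable_funM => //.
by apply: (measurableT_comp (@measurable_ln R)); apply: mn => k; exact: (gf_meas gY).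
Qed.

Lemma sph_le1 y i : (0 < N)%N -> `|sph y i| <= 1.
Proof. by move=> N0; apply: nrm2_coord; rewrite sph_nrm2. Qed.

(** The regularisation 1/(n+1) is sent to 0 by dominated convergence. *)
Lemma sphere_ibp (F : ('I_N -> R) -> R) dF i j : (0 < N)%N -> okf F -> (forall m, okf (dF m)) -> cdf F dF ->
  Ex Q (fun w => sph (Y^~ w) i * dF j (sph (Y^~ w)) - sph (Y^~ w) j * dF i (sph (Y^~ w))) = 0.
Proof.
move=> N0 oF odF cF.
pose I (u : 'I_N -> R) := u i * dF j u - u j * dF i u.
have [mi ci [Ci bi]] := odF i; have [mj cj [Cj bj]] := odF j.
have mI : mcl I.
  move=> d0 U X mX; apply: measurable_funB; apply: measurable_funM => //; [exact: mj|exact: mi].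
have cI : ccl I.
  by move=> S FF Ff x l xl; apply: cvgB; apply: cvgM => //; [exact: cj|exact: ci].
have bI u : (forall i, `|u i| <= 1) -> `|I u| <= Cj + Ci.
  move=> u1; apply: le_trans (ler_normB _ _) _; rewrite !normrM.
  by apply: lerD; rewrite -[leRHS]mul1r ler_pM// ?bi ?bj.
pose z w : R := (nrm2 (Y^~ w) == 0)%:R.
(* At the origin the regularised points are 0 and do not approach [sph], so the limit carries a
   cutoff; it is removed at the end since the origin has probability 0. *)
pose g w := (1 - z w) * I (sph (Y^~ w)).
have mIs : measurable_fun setT (fun w => I (sph (Y^~ w))) by apply: mI => k; exact: measurable_sph.
have sp1 w k : `|sph (Y^~ w) k| <= 1 by exact: sph_le1.
have z01 w : 0 <= z w <= 1 by rewrite /z; case: eqP => _ /=; rewrite ler01 lexx.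
have Lc := L1_cst Q (Cj + Ci).
have Lz : L1 Q z.
  apply: (L1_le _ _ (L1_cst Q 1)) => // w; have /andP[a b] := z01 w; by rewrite ger0_norm.
have LI : L1 Q (fun w => I (sph (Y^~ w))) by apply: (L1_le _ _ Lc) => // w; exact: bI.
have Lg : L1 Q g.
  apply: (L1_le _ _ Lc).
    by apply: measurable_funM => //; apply: measurable_funB.
  move=> w; rewrite normrM -[leRHS]mul1r ler_pM//; last exact: bI.
  by have /andP[a b] := z01 w; rewrite ger0_norm; lra.
have Eg : Ex Q g = 0.
  pose f_ n w := I (sphd (n.+1%:R^-1) (Y^~ w)).
  have n0 (n : nat) : 0 < n.+1%:R^-1 :> R by rewrite invr_gt0.
  have h1 n : measurable_fun setT (f_ n).
    by apply: mI => k; exact: (gfam_meas gY (nice_sphd (n0 n) k)).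
  have h2 w : f_ n w @[n --> \oo] --> g w.
    rewrite /g /z /f_; have [y0|yn] := eqVneq (nrm2 (Y^~ w)) 0.
      rewrite subrr mul0r.
      rewrite (_ : (fun n : nat => _) = fun=> 0); first exact: cvg_cst.
      apply/funext => n; rewrite /I /sphd.
      have yk k : Y k w = 0.
        apply/eqP; rewrite -sqrf_eq0; apply/eqP.
        by apply: (psumr_eq0P _ y0) => // l _; exact: sqr_ge0.
      by rewrite !yk !mul0r subrr.
    rewrite subr0 mul1r; apply: cI => k; rewrite /sphd /sph (negPf yn).
    apply: cvgM; first exact: cvg_cst.
    have y0 : 0 < nrm2 (Y^~ w) by rewrite lt_def yn nrm2_ge0.
    apply: (@cvg_comp _ _ _ (fun n : nat => - (2^-1 * ln (n.+1%:R^-1 + nrm2 (Y^~ w)))) expR _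
      (nbhs (- (2^-1 * ln (nrm2 (Y^~ w)))))); last exact: continuous_expR.
    apply: cvgN; apply: cvgM; first exact: cvg_cst.
    apply: (@cvg_comp _ _ _ (fun n : nat => n.+1%:R^-1 + nrm2 (Y^~ w)) (@ln R) _ (nbhs (nrm2 (Y^~ w)))).
      have hc : n.+1%:R^-1 + nrm2 (Y^~ w) @[n --> \oo] --> (0 : R) + nrm2 (Y^~ w).
        by apply: cvgD; [exact: cvg_harmonic|exact: cvg_cst].
      by rewrite add0r in hc.
    exact: continuous_ln.
  have h3 n w : `|f_ n w| <= Cj + Ci by apply: bI => k; exact: sphd_le1.
  have [_ h] := Ex_dct h1 h2 h3 Lc.
  have e n : Ex Q (f_ n) = 0 by exact: (sphere_ibp_delta (n0 n) i j oF odF cF).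
  have {}h : (fun=> 0) @ \oo --> Ex Q g by move: h; under eq_fun do rewrite e.
  have c0 : (fun=> 0 : R) @ \oo --> (0 : R) by exact: cvg_cst.
  by rewrite -(cvg_lim (@Rhausdorff R) h) (cvg_lim (@Rhausdorff R) c0).
rewrite -[RHS]Eg; apply/eqP; rewrite -subr_eq0 -normr_le0 -ExB//.
apply: le_trans (Ex_abs (L1B LI Lg)) _.
apply: (@le_trans _ _ (Ex Q (fun w => (Cj + Ci) * z w))).
  apply: Ex_le; [by apply: L1_abs; exact: L1B|exact: L1Z|move=> w].
  rewrite /g (_ : _ - _ = z w * I (sph (Y^~ w))); last by rewrite /I; ring.
  have /andP[a b] := z01 w; rewrite normrM (ger0_norm a) mulrC ler_wpM2r//.
  exact: bI.
by rewrite ExZ// Y0 mulr0.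
Qed.

End sphere_ibp.

Section discretization.
Context {R : realType} d (T : measurableType d) (Q : probability T R).

Lemma L1_bnd (f : T -> R) C : measurable_fun setT f -> (forall w, `|f w| <= C) -> L1 Q f.
Proof. by move=> mf fC; apply: (L1_le mf fC); exact: L1_cst. Qed.

Lemma measurable_boolR (b : T -> bool) : measurable_fun setT b ->
  measurable_fun setT (fun w => (b w)%:R : R).
Proof.
move=> mb; apply: (measurableT_comp (f := fun b : bool => b%:R : R)) => //.
Qed.

Context (V : finType) (q : T -> V).
Hypothesis mq : forall v, measurable_fun setT (fun w => (q w == v)%:R : R).

Definition qw v := Ex Q (fun w => (q w == v)%:R).

Lemma qw_ge0 v : 0 <= qw v.
Proof. by apply: Ex_ge0 => w; exact: ler0n. Qed.

Lemma dec_q (h : V -> R) w : h (q w) = \sum_v (q w == v)%:R * h v.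
Proof.
rewrite (bigD1 (q w))//= eqxx mul1r big1 ?addr0// => v.
by rewrite eq_sym => /negPf->; rewrite mul0r.
Qed.

Let Lq v : L1 Q (fun w => (q w == v)%:R).
Proof. by apply: (@L1_bnd _ 1) => // w; case: eqP => _ /=; rewrite ?normr1 ?normr0. Qed.

Lemma measurable_q (h : V -> R) : measurable_fun setT (fun w => h (q w)).
Proof.
under eq_fun do rewrite dec_q.
by apply: measurable_sum => v; exact: measurable_funM.
Qed.

Lemma sum_qw (h : V -> R) : \sum_v qw v * h v = Ex Q (fun w => h (q w)).
Proof.
under [in RHS]eq_fun do rewrite dec_q.
rewrite Ex_sum; last by move=> v; under eq_fun do rewrite mulrC; exact: L1Z.
apply: eq_bigr => v _; under eq_fun do rewrite mulrC.
by rewrite ExZ// mulrC.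
Qed.

Lemma sum_qw1 : \sum_v qw v = 1.
Proof. by have := sum_qw (fun=> 1); rewrite Ex_cst; under eq_bigr do rewrite mulr1. Qed.

Lemma sum_qw2 d0 (T0 : measurableType d0) (P0 : probability T0 R) (H : V -> T0 -> R) C :
  (forall v, measurable_fun setT (H v)) -> (forall v w, `|H v w| <= C) ->
  \sum_v qw v * Ex P0 (H v) = Ex (pprod Q P0) (fun z => H (q z.1) z.2).
Proof.
move=> mH HC.
have LH v : L1 P0 (H v) by apply: (L1_le (mH v) (HC v)); exact: L1_cst.
have mz v : measurable_fun setT (fun z : T * T0 => (q z.1 == v)%:R * H v z.2).
  apply: measurable_funM.
    exact: (measurableT_comp (mq v) measurable_fst).
  exact: (measurableT_comp (mH v) measurable_snd).
rewrite (_ : (fun z => _) = (fun z => \sum_v (q z.1 == v)%:R * H v z.2)); last first.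
  by apply/funext => z; rewrite (dec_q (fun v => H v z.2)).
have bz v z : `|(q z.1 == v)%:R * H v z.2| <= C.
  rewrite normrM; case: eqP => _ /=; rewrite ?normr1 ?mul1r// normr0 mul0r.
  exact: le_trans (normr_ge0 _) (HC v z.2).
have Lz v : L1 (pprod Q P0) (fun z => (q z.1 == v)%:R * H v z.2).
  by apply: (L1_le (mz v) (bz v)); exact: L1_cst.
rewrite Ex_sum//; apply: eq_bigr => v _.
rewrite Ex_pprod12//.
  by under [in RHS]eq_fun do rewrite /= ExZ// mulrC; rewrite ExZ// mulrC.
by move=> w; exact: (L1Z ((q w == v)%:R) (LH v)).
Qed.

End discretization.

(** * A grid on the sphere *)

Section grid.
Context {R : realType} d (T : measurableType d) (Q : probability T R) (N : nat).
Context (Y : 'I_N -> T -> R).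
Hypothesis gY : gfam Q Y.
Hypothesis N0 : (0 < N)%N.
Hypothesis mY0 : measurable_fun setT (fun w => (nrm2 (Y^~ w) == 0)%:R : R).

(** Coordinates run through j/(k+1) - 1 for 0 <= j <= 2(k+1), both ends included, so that rounding
    down also covers the value 1. *)
Definition gidx k := {ffun 'I_N -> 'I_(2 * k.+1).+1}.
Definition gz k (f : gidx k) (i : 'I_N) : R := (f i)%:R / k.+1%:R - 1.
(** Grid points are projected back to the sphere, so the unit length required in the overlap
    estimate is exact; only rotation invariance is lost. *)
Definition gx k (f : gidx k) : 'I_N -> R := sph (gz f).
Definition qz k (u : 'I_N -> R) : gidx k := [ffun i => inord (Num.truncn (k.+1%:R * (u i + 1)))].
Definition xk k (w : T) : 'I_N -> R := gx (qz k (sph (Y^~ w))).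

Lemma qz_val k u i : `|u i| <= 1 -> (qz k u i : nat) = Num.truncn (k.+1%:R * (u i + 1)).
Proof.
rewrite ler_norml => /andP[u1 u2]; rewrite ffunE inordK// ltnS.
rewrite truncn_le_nat -natr1.
have h : k.+1%:R * (u i + 1) <= (2 * k.+1)%:R :> R.
  by rewrite natrM mulrC ler_wpM2r//; lra.
by lra.
Qed.

Lemma qz_itv k u i (m : nat) : `|u i| <= 1 ->
  ((qz k u i : nat) == m) = (m%:R <= k.+1%:R * (u i + 1)) && (k.+1%:R * (u i + 1) < m.+1%:R).
Proof.
move=> u1; rewrite qz_val// truncn_eq//.
by rewrite mulr_ge0//; move: u1; rewrite ler_norml => /andP[? ?]; lra.
Qed.

Lemma measurable_qz k f : measurable_fun setT (fun w => (qz k (sph (Y^~ w)) == f)%:R : R).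
Proof.
have ms i : measurable_fun setT (fun w => k.+1%:R * (sph (Y^~ w) i + 1)).
  by apply: measurable_funM => //; apply: measurable_funD => //; exact: (measurable_sph gY mY0).
pose lo (i : 'I_N) w : bool := (((f i)%:R : R) <= k.+1%:R * (sph (Y^~ w) i + 1))%R.
pose up (i : 'I_N) w : bool := (k.+1%:R * (sph (Y^~ w) i + 1) < ((f i).+1%:R : R))%R.
rewrite (_ : (fun w => _) = (fun w => \prod_i ((lo i w)%:R * (up i w)%:R))).
  apply: measurable_prod => i _; apply: measurable_funM; apply: measurable_boolR.
    by apply: measurable_fun_ler.
  by apply: measurable_fun_ltr.
apply/funext => w; have u1 i : `|sph (Y^~ w) i| <= 1 by exact: sph_le1.
have e i : ((qz k (sph (Y^~ w)) i == f i)%:R : R) = (lo i w)%:R * (up i w)%:R.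
  rewrite -val_eqE/= qz_itv// -/(lo i w) -/(up i w).
  by case: (lo i w); case: (up i w); rewrite /= ?mulr1 ?mulr0.
under eq_bigr do rewrite -e.
have [->|ne] := eqVneq; first by rewrite big1// => i _; rewrite eqxx.
have [i ni] : exists i, qz k (sph (Y^~ w)) i != f i.
  apply/existsP; apply: contraNT ne; rewrite negb_exists => /forallP h.
  by apply/eqP/ffunP => i; apply/eqP; have := h i; rewrite negbK.
by rewrite (bigD1 i)//= (negPf ni) mul0r.
Qed.

Lemma gz_cvg u i : `|u i| <= 1 -> gz (qz k u) i @[k --> \oo] --> u i.
Proof.
move=> u1; have u0 k : 0 <= k.+1%:R * (u i + 1) :> R.
  by rewrite mulr_ge0//; move: u1; rewrite ler_norml => /andP[? ?]; lra.
have lo k : u i - k.+1%:R^-1 <= gz (qz k u) i.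
  rewrite /gz qz_val//; have /andP[_ h] := truncn_itv (u0 k).
  rewrite -[(Num.truncn _).+1%:R]natr1 in h; have k0 : 0 < k.+1%:R :> R by [].
  have : u i + 1 <= ((Num.truncn (k.+1%:R * (u i + 1)))%:R + 1) / k.+1%:R.
    by rewrite ler_pdivlMr// mulrC ltW.
  by rewrite mulrDl mul1r; set a := _ / _; set b := _^-1; lra.
have hi k : gz (qz k u) i <= u i.
  rewrite /gz qz_val//; have /andP[h _] := truncn_itv (u0 k).
  by rewrite lerBlDr ler_pdivrMr// [leRHS]mulrC.
apply: (@squeeze_cvgr _ _ _ _ (fun k : nat => u i - k.+1%:R^-1) (fun=> u i)); last exact: cvg_cst.
- by apply: nearW => k; rewrite lo hi.
- have h : u i - n.+1%:R^-1 @[n --> \oo] --> u i - (0 : R).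
    by apply: cvgB; [exact: cvg_cst|exact: cvg_harmonic].
  by rewrite subr0 in h.
Qed.

Lemma xk_cvg w i : xk k w i @[k --> \oo] --> sph (Y^~ w) i.
Proof.
set u := sph (Y^~ w); have u1 : nrm2 u = 1 by exact: sph_nrm2.
have cz j : gz (qz k u) j @[k --> \oo] --> u j.
  by apply: gz_cvg; apply: nrm2_coord; rewrite u1.
have [[_ _ cn] _ _] := @smooth1_nrm2 R N.
have cN : nrm2 (gz (qz k u)) @[k --> \oo] --> nrm2 u by exact: cn.
rewrite u1 in cN.
have np : \forall k \near \oo, 0 < nrm2 (gz (qz k u)).
  exact: (cvgr_gt _ cN 0 ltr01).
have : gz (qz k u) i * rho (nrm2 (gz (qz k u))) @[k --> \oo] --> u i * rho 1.
  apply: cvgM => //.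
  apply: (@cvg_comp _ _ _ (fun k => - (2^-1 * ln (nrm2 (gz (qz k u))))) expR _ (nbhs (- (2^-1 * ln 1)))); last exact: continuous_expR.
  apply: cvgN; apply: cvgM; first exact: cvg_cst.
  apply: (@cvg_comp _ _ _ (fun k => nrm2 (gz (qz k u))) (@ln R) _ (nbhs (1 : R))) => //.
  exact: continuous_ln.
rewrite {2}/rho ln1 mulr0 oppr0 expR0 mulr1; apply: cvg_trans.
apply: near_eq_cvg; near=> k.
rewrite /xk /gx /sph -/u ifN//; apply/eqP => e.
have : 0 < nrm2 (gz (qz k u)) by near: k.
by rewrite e ltxx.
Unshelve. all: by end_near.
Qed.

Lemma gx_unit k (f : gidx k) : \sum_i gx f i ^+ 2 = 1.
Proof. exact: sph_nrm2. Qed.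

Lemma gx_le1 k (f : gidx k) i : `|gx f i| <= 1.
Proof. exact: sph_le1. Qed.

End grid.

Lemma gibbs_frac (R : realType) (a b c x y u f z1 z2 : R) : z1 != 0 -> z2 != 0 ->
  a * x / z1 * (b * y / z1) * (c * u / z2) * f =
  a * (b * (c * (x * (y * (u * f))) / (z1 * z1 * z2))).
Proof. by move=> h1 h2; field; rewrite h1 h2. Qed.

(** * Gibbs averages as the mesh tends to 0 *)

Section grid_limit.
Context {R : realType} d' (T' : measurableType d') (Q : probability T' R) (N : nat).
Context (Y : 'I_N -> T' -> R).
Hypothesis gY : gfam Q Y.
Hypothesis N0 : (0 < N)%N.
Hypothesis mY0 : measurable_fun setT (fun w => (nrm2 (Y^~ w) == 0)%:R : R).

(** The weight of a grid point is the mass that the uniform measure gives to its cell, so grid sums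
    are expectations of the quantised uniform point. *)
Definition gom k (f : gidx N k) : R := qw Q (fun w => qz k (sph (Y^~ w))) f.

Lemma gom_ge0 k (f : gidx N k) : 0 <= gom f.
Proof. exact: qw_ge0. Qed.

Lemma sum_gom k : \sum_(f : gidx N k) gom f = 1.
Proof. by apply: sum_qw1 => f; exact: (measurable_qz gY N0 mY0). Qed.

Local Notation xk k := (@xk R _ T' N Y k).
Local Notation tri := (fun a b c : 'I_N -> R => sumv a (sumv b c)).

Lemma measurable_xk k i : measurable_fun setT (fun w => xk k w i).
Proof. exact: (measurable_q (measurable_qz gY N0 mY0 (k := k)) (fun f : gidx N k => gx f i)). Qed.

Lemma grid_Ex (F : ('I_N -> R) -> R) k :
  \sum_(f : gidx N k) gom f * F (gx f) = Ex Q (fun w => F (xk k w)).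
Proof. exact: (sum_qw Q (measurable_qz gY N0 mY0 (k := k)) (fun f : gidx N k => F (gx f))). Qed.

Lemma grid_cvg (F : ('I_N -> R) -> R) : okf F ->
  Ex Q (fun w => F (xk k w)) @[k --> \oo] --> Ex Q (fun w => F (sph (Y^~ w))).
Proof.
move=> [mF cF [C bF]].
have h1 k : measurable_fun setT (fun w => F (xk k w)) by apply: mF => i; exact: measurable_xk.
have h2 w : F (xk k w) @[k --> \oo] --> F (sph (Y^~ w)) by apply: cF => i; exact: xk_cvg.
have h3 k w : `|F (xk k w)| <= C by apply: bF => i; exact: gx_le1.
by have [] := Ex_dct h1 h2 h3 (L1_cst Q C).
Qed.

Let Q3 := pprod Q (pprod Q Q).

Lemma grid_Ex3 (F : ('I_N + ('I_N + 'I_N) -> R) -> R) k : okf F ->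
  \sum_(s : gidx N k) gom s * (\sum_(s' : gidx N k) gom s' * (\sum_(t : gidx N k) gom t *
    F (tri (gx s) (gx s') (gx t)))) =
  Ex Q3 (fun z => F (tri (xk k z.1) (xk k z.2.1) (xk k z.2.2))).
Proof.
move=> [mF cF [C bF]].
have mq (f : gidx N k) : measurable_fun setT (fun w => (qz k (sph (Y^~ w)) == f)%:R : R) by exact: (measurable_qz gY N0 mY0).
have bt (s s' t : gidx N k) : `|F (tri (gx s) (gx s') (gx t))| <= C.
  by apply: bF => -[|[]] i; exact: gx_le1.
have m2 (s : gidx N k) : measurable_fun setT (fun z : T' * T' => F (tri (gx s) (xk k z.1) (xk k z.2))).
  apply: (mF _ _ (fun i z => tri (gx s) (xk k z.1) (xk k z.2) i)) => -[i|[i|i]] /=.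
  - exact: measurable_cst.
  - exact: (measurableT_comp (measurable_xk k i) measurable_fst).
  - exact: (measurableT_comp (measurable_xk k i) measurable_snd).
have b2 (s : gidx N k) z : `|F (tri (gx s) (xk k z.1) (xk k z.2))| <= C by exact: bt.
rewrite /Q3 -(sum_qw2 Q mq (pprod Q Q) m2 b2).
apply: eq_bigr => s _; congr (_ * _).
have m1 (s' : gidx N k) : measurable_fun setT (fun w => F (tri (gx s) (gx s') (xk k w))).
  apply: (mF _ _ (fun i w => tri (gx s) (gx s') (xk k w) i)) => -[i|[i|i]] /=.
  - exact: measurable_cst.
  - exact: measurable_cst.
  - exact: measurable_xk.
have b1 (s' : gidx N k) w : `|F (tri (gx s) (gx s') (xk k w))| <= C by exact: bt.
rewrite -(sum_qw2 Q mq Q m1 b1); apply: eq_bigr => s' _; congr (_ * _).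
exact: (grid_Ex (fun t => F (tri (gx s) (gx s') t))).
Qed.

Lemma grid_cvg3 (F : ('I_N + ('I_N + 'I_N) -> R) -> R) : okf F ->
  (forall s' t, nrm2 s' = 1 -> nrm2 t = 1 -> Ex Q (fun w => F (tri (sph (Y^~ w)) s' t)) = 0) ->
  Ex Q3 (fun z => F (tri (xk k z.1) (xk k z.2.1) (xk k z.2.2))) @[k --> \oo] --> (0 : R).
Proof.
move=> [mF cF [C bF]] F0.
pose f (z : T' * (T' * T')) := F (tri (sph (Y^~ z.1)) (sph (Y^~ z.2.1)) (sph (Y^~ z.2.2))).
have mz (h : T' -> 'I_N -> R) : (forall i, measurable_fun setT (fun w => h w i)) ->
    measurable_fun setT (fun z : T' * (T' * T') => F (tri (h z.1) (h z.2.1) (h z.2.2))).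
  move=> mh; apply: (mF _ _ (fun i z => tri (h z.1) (h z.2.1) (h z.2.2) i)) => -[i|[i|i]] /=.
  - exact: (measurableT_comp (mh i) measurable_fst).
  - exact: (measurableT_comp (mh i) (measurableT_comp measurable_fst measurable_snd)).
  - exact: (measurableT_comp (mh i) (measurableT_comp measurable_snd measurable_snd)).
have h1 k := mz (xk k) (fun i => measurable_xk k i).
have h2 z : F (tri (xk k z.1) (xk k z.2.1) (xk k z.2.2)) @[k --> \oo] --> f z.
  by apply: cF => -[i|[i|i]] /=; exact: xk_cvg.
have h3 k z : `|F (tri (xk k z.1) (xk k z.2.1) (xk k z.2.2))| <= C.
  by apply: bF => -[i|[i|i]] /=; exact: gx_le1.
have [Lf cv] := Ex_dct h1 h2 h3 (L1_cst Q3 C).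
rewrite (_ : 0 = Ex Q3 f)// /Q3 Ex_pprod21//; last first.
  move=> z; apply: (@L1_bnd _ _ _ _ _ C).
    apply: (mF _ _ (fun i w => tri (sph (Y^~ w)) (sph (Y^~ z.1)) (sph (Y^~ z.2)) i)) => -[i|[i|i]] /=.
    - exact: (measurable_sph gY mY0).
    - exact: measurable_cst.
    - exact: measurable_cst.
  by move=> w; apply: bF => -[i|[i|i]] /=; exact: sph_le1.
rewrite -[LHS](Ex_cst (pprod Q Q) 0); apply: eq_Rintegral => z _; rewrite /f/= F0//; exact: sph_nrm2.
Qed.

Context d (T : measurableType d) (P : probability T R) (J : finType) (X : J -> T -> R).
Hypothesis gX : gfam P X.
Variable be : R.
Hypothesis be0 : 0 < be.
Variables V1 V2 : ('I_N -> R) -> J -> R.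
Hypothesis nV1 : forall j, nice (fun v => V1 v j).
Hypothesis nV2 : forall j, nice (fun v => V2 v j).

Variable F : (J -> R) -> ('I_N -> R) -> ('I_N -> R) -> ('I_N -> R) -> R.
Hypothesis nF : nice (fun z : ('I_N + ('I_N + 'I_N)) + J -> R =>
  F (fun j => z (inr j)) (fun i => z (inl (inl i))) (fun i => z (inl (inr (inl i))))
    (fun i => z (inl (inr (inr i))))).
Hypothesis F0 : forall G s' t, nrm2 s' = 1 -> nrm2 t = 1 ->
  Ex Q (fun w => expR (be * \sum_j V1 (sph (Y^~ w)) j * G j) * F G (sph (Y^~ w)) s' t) = 0.

Definition GE k := EE (@gom k) be P X (fun f => V1 (gx f)) (fun f => V2 (gx f)).

(** For fixed disorder the average is a quotient of expectations over quantised points. The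
    numerator tends to the integral that [F0] annihilates and the partition functions to positive
    limits. Dominated convergence over the disorder then uses a power of [vbnd], uniform in the mesh
    because all points lie in the cube. *)
Lemma GE_cvg0 : GE (fun G (s s' t t' : gidx N k) => F G (gx s) (gx s') (gx t)) @[k --> \oo] --> (0 : R).
Proof.
have om0 k := @gom_ge0 k.
have om1 k := sum_gom k.
have Fi k : gidx N k by exact: [ffun=> ord0].
have nFG G : nice (fun z : 'I_N + ('I_N + 'I_N) -> R => F G (fun i => z (inl i)) (fun i => z (inr (inl i)))
    (fun i => z (inr (inr i)))).
  pose g (m : ('I_N + ('I_N + 'I_N)) + J) (z : 'I_N + ('I_N + 'I_N) -> R) : R :=
    match m with inl i => z i | inr j => G j end.
  have ng m : nice (g m) by case: m => [i|j]; [exact: nice_proj|exact: nice_cst].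
  exact: (nice_comp nF ng).
have nFk k : niceR (fun G (s s' t t' : gidx N k) => F G (gx s) (gx s') (gx t)).
  move=> s s' t t'.
  pose g (m : ('I_N + ('I_N + 'I_N)) + J) (G : J -> R) : R :=
    match m with inl i => tri (gx s) (gx s') (gx t) i | inr j => G j end.
  have ng m : nice (g m) by case: m => [i|j]; [exact: nice_cst|exact: nice_proj].
  exact: (nice_comp nF ng).
have [_ /pbd_posC[C [l [C0 bF]]] _] := nF.
pose C' := C * (1 + #|{: 'I_N + ('I_N + 'I_N)}|%:R) ^+ l.
have dom G s s' t : (forall i, `|s i| <= 1) -> (forall i, `|s' i| <= 1) -> (forall i, `|t i| <= 1) ->
    `|F G s s' t| <= C' * vbnd G ^+ l.
  move=> s1 s'1 t1.
  have := bF (fun m => match m with inl i => tri s s' t i | inr j => G j end) => h.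
  apply: le_trans h _; rewrite /C' -mulrA ler_wpM2l// -exprMn; apply: lerXn2r.
  - by rewrite nnegrE (le_trans ler01)// vbnd_ge1.
  - by rewrite nnegrE; apply: mulr_ge0; [rewrite addr_ge0|exact: (le_trans ler01 (vbnd_ge1 _))].
  rewrite /vbnd big_sumType/= mulrDl mul1r mulrDr mulr1 addrA.
  have t3 : \sum_(i : 'I_N + ('I_N + 'I_N)) `|tri s s' t i| <= #|{: 'I_N + ('I_N + 'I_N)}|%:R.
    by rewrite -sum1_card natr_sum; apply: ler_sum => -[|[]] i _ /=.
  have g0 : 0 <= \sum_j `|G j| by rewrite sumr_ge0.
  have c0 : 0 <= #|{: 'I_N + ('I_N + 'I_N)}|%:R :> R by [].
  move: t3 g0 c0; set a := \sum_i _; set b := \sum_j _; set c := _%:R => t3 g0 c0.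
  by have := mulr_ge0 c0 g0; lra.
pose f_ k w := AV (@gom k) be (fun f => V1 (gx f)) (fun f => V2 (gx f))
   (fun G (s s' t t' : gidx N k) => F G (gx s) (gx s') (gx t)) (X^~ w).
have h1 k : measurable_fun setT (f_ k).
  apply: (gfam_meas gX); exact: (nice_AV (om0 k) (om1 k) be0).
have h3 k w : `|f_ k w| <= C' * vbnd (X^~ w) ^+ l.
  have le1 (s : gidx N k) : forall i, `|gx s i : R| <= 1 by move=> i; exact: gx_le1.
  rewrite ler_norml; apply/andP; split.
    rewrite -[leLHS](AV1 be (om0 k) (om1 k) (fun f => V1 (gx f)) (fun f => V2 (gx f)) (fun=> _) (X^~ w)).
    by apply: AV_le => // s s' t t'; rewrite lerNl (le_trans (ler_norm _))// normrN dom.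
  rewrite -[leRHS](AV1 be (om0 k) (om1 k) (fun f => V1 (gx f)) (fun f => V2 (gx f)) (fun=> _) (X^~ w)).
  by apply: AV_le => // s s' t t'; rewrite (le_trans (ler_norm _))// dom.
have h2 w : f_ k w @[k --> \oo] --> (0 : R); last first.
  have Lg : L1 P (fun w => C' * vbnd (X^~ w) ^+ l) by apply: L1Z; exact: gfam_vbnd.
  by have [_] := Ex_dct h1 h2 h3 Lg; rewrite Ex_cst.
set G := X^~ w.
pose e1 v := expR (be * \sum_j V1 v j * G j); pose e2 v := expR (be * \sum_j V2 v j * G j).
have nl (V0 : ('I_N -> R) -> J -> R) : (forall j, nice (fun v => V0 v j)) ->
    nice (fun v => be * \sum_j V0 v j * G j).
  by move=> nV; apply: niceZ; apply: nice_sum => j; apply: niceM; [exact: nV|exact: nice_cst].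
have o1 : okf e1 by apply: okf_expR; apply: okf_nice; exact: nl.
have o2 : okf e2 by apply: okf_expR; apply: okf_nice; exact: nl.
(* The unnormalised integrand of the numerator, as a function of three points on the sphere. *)
pose K (z : 'I_N + ('I_N + 'I_N) -> R) := e1 (fun i => z (inl i)) * (e1 (fun i => z (inr (inl i))) *
  (e2 (fun i => z (inr (inr i))) * F G (fun i => z (inl i)) (fun i => z (inr (inl i))) (fun i => z (inr (inr i))))).
have okp (e : ('I_N -> R) -> R) (p : 'I_N -> 'I_N + ('I_N + 'I_N)) : okf e ->
    okf (fun z : 'I_N + ('I_N + 'I_N) -> R => e (fun i => z (p i))).
  by move=> oe; apply: (okf_comp oe) => [m|m u u1]; [apply: okf_nice; exact: nice_proj|exact: u1].
have oK : okf K.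
  apply: okfM; first exact: okp o1; apply: okfM; first exact: (okp _ (fun i => inr (inl i)) o1).
  by apply: okfM; [exact: (okp _ (fun i => inr (inr i)) o2)|exact: okf_nice].
have Z1 k : gZ (@gom k) be (lin (fun f => V1 (gx f)) G) = Ex Q (fun w => e1 (xk k w)).
  by rewrite -grid_Ex.
have Z2 k : gZ (@gom k) be (lin (fun f => V2 (gx f)) G) = Ex Q (fun w => e2 (xk k w)).
  by rewrite -grid_Ex.
have fE k : f_ k w = Ex Q3 (fun z => K (tri (xk k z.1) (xk k z.2.1) (xk k z.2.2))) /
    (Ex Q (fun w => e1 (xk k w)) * Ex Q (fun w => e1 (xk k w)) * Ex Q (fun w => e2 (xk k w))).
  rewrite -(grid_Ex3 k oK) -Z1 -Z2 /f_ (AV3 be (om0 k) (om1 k) (fun f => V1 (gx f)) (fun f => V2 (gx f)) _ (Fi k))// -/G.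
  have z1 := gZ_gt0 be (om0 k) (om1 k) (lin (fun f => V1 (gx f)) G).
  have z2 := gZ_gt0 be (om0 k) (om1 k) (lin (fun f => V2 (gx f)) G).
  move: z1 z2; set z1 := gZ _ _ _; set z2 := gZ _ _ _ => z1p z2p.
  have p1 s : P1 (@gom k) be (fun f => V1 (gx f)) s G = gom s * e1 (gx s) / z1 by [].
  have p2 s : P2 (@gom k) be (fun f => V2 (gx f)) s G = gom s * e2 (gx s) / z2 by [].
  have kE (s s' t : gidx N k) : K (tri (gx s) (gx s') (gx t)) =
    e1 (gx s) * (e1 (gx s') * (e2 (gx t) * F G (gx s) (gx s') (gx t))) by [].
  clearbody z1 z2.
  rewrite mulr_suml; apply: eq_bigr => s _; rewrite -mulrA mulr_suml mulr_sumr; apply: eq_bigr => s' _.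
  rewrite -mulrA mulr_suml !mulr_sumr; apply: eq_bigr => t _.
  rewrite !p1 p2 kE.
  by apply: gibbs_frac; rewrite gt_eqF.
rewrite (_ : (fun k => f_ k w) = (fun k => Ex Q3 (fun z => K (tri (xk k z.1) (xk k z.2.1) (xk k z.2.2))) *
    (Ex Q (fun w => e1 (xk k w)) * Ex Q (fun w => e1 (xk k w)) * Ex Q (fun w => e2 (xk k w)))^-1)); last by apply/funext => k.
have pos (e : ('I_N -> R) -> R) : okf e -> 0 < Ex Q (fun w => expR (e (sph (Y^~ w)))).
  move=> oe; have [me _ [D bD]] := oe; have [mx _ [D' bD']] := okf_expR oe.
  apply: lt_le_trans (expR_gt0 (- D)) _; rewrite -[leLHS](Ex_cst Q).
  apply: Ex_le; first exact: L1_cst.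
    apply: (@L1_bnd _ _ _ _ _ D') => [|w0].
      by apply: mx => i; exact: (measurable_sph gY mY0).
    by apply: bD' => i; exact: sph_le1.
  move=> w0; rewrite ler_expR lerNl (le_trans (ler_norm _))// normrN.
  by apply: bD => i; exact: sph_le1.
have p1 : 0 < Ex Q (fun w => e1 (sph (Y^~ w))) := pos _ (okf_nice (nl _ nV1)).
have p2 : 0 < Ex Q (fun w => e2 (sph (Y^~ w))) := pos _ (okf_nice (nl _ nV2)).
rewrite -(mul0r (Ex Q (fun w => e1 (sph (Y^~ w))) * Ex Q (fun w => e1 (sph (Y^~ w))) * Ex Q (fun w => e2 (sph (Y^~ w))))^-1).
apply: cvgM.
  apply: grid_cvg3 => // s' t s1 t1.
  rewrite (_ : (fun w0 => _) = (fun w0 => e1 s' * e2 t * (e1 (sph (Y^~ w0)) * F G (sph (Y^~ w0)) s' t))); last first.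
    by apply/funext => w0; rewrite /K/=; ring.
  rewrite ExZ ?F0 ?mulr0//.
  have o3 : okf (fun u => e1 u * F G u s' t).
    apply: okfM => //; apply: okf_nice.
    pose g (m : 'I_N + ('I_N + 'I_N)) (u : 'I_N -> R) : R :=
      match m with inl i => u i | inr (inl i) => s' i | inr (inr i) => t i end.
    have ng m : nice (g m) by case: m => [i|[i|i]]; [exact: nice_proj|exact: nice_cst|exact: nice_cst].
    exact: (nice_comp (nFG G) ng).
  have [mo _ [D bD]] := o3.
  apply: (@L1_bnd _ _ _ _ _ D) => [|w0].
    by apply: mo => i; exact: (measurable_sph gY mY0).
  by apply: bD => i; exact: sph_le1.
apply: cvgV; first by rewrite gt_eqF// mulr_gt0// mulr_gt0.
apply: cvgM; last exact: (grid_cvg o2).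
by apply: cvgM; exact: (grid_cvg o1).
Qed.

End grid_limit.

(** * The rotation fields on the sphere and the p-spin Hamiltonian *)

Section rotation.
Context {R : realType} d' (T' : measurableType d') (Q : probability T' R) (N : nat).
Context (Y : 'I_N -> T' -> R).
Hypothesis gY : gfam Q Y.
Hypothesis N0 : (0 < N)%N.
Hypothesis mY0 : measurable_fun setT (fun w => (nrm2 (Y^~ w) == 0)%:R : R).
Hypothesis Y0 : Ex Q (fun w => (nrm2 (Y^~ w) == 0)%:R) = 0.
Implicit Types s t u v : 'I_N -> R.

Definition vrot t v (j i : 'I_N) : R := vdot v t * (i == j)%:R - v j * t i.
Definition vrot2 t v (j i : 'I_N) : R :=
  (vdot v t * t j - v j) * (i == j)%:R - (vdot v t - v j * t j) * t i.

Lemma sum_vrot t v j (h : 'I_N -> R) :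
  \sum_m vrot t v j m * h m = vdot v t * h j - v j * \sum_i t i * h i.
Proof.
rewrite (eq_bigr (fun m => vdot v t * ((j == m)%:R * h m) - v j * (t m * h m))) => [|m _].
  by rewrite sumrB -!mulr_sumr sum_deltaN.
by rewrite /vrot eq_sym; ring.
Qed.

(** The field X_j is the combination over i, with weights t_i, of the infinitesimal rotations u_i
    d_j - u_j d_i. [sphere_ibp] is applied to [psi] times the Gibbs density. *)
Lemma rot_ibp (be : R) psi dpsi (Hf : ('I_N -> R) -> R) dHf t j :
  smooth1 psi dpsi -> smooth1 Hf dHf ->
  Ex Q (fun w => expR (be * Hf (sph (Y^~ w))) *
     (\sum_m vrot t (sph (Y^~ w)) j m * dpsi m (sph (Y^~ w)) +
      be * (psi (sph (Y^~ w)) * \sum_m vrot t (sph (Y^~ w)) j m * dHf m (sph (Y^~ w))))) = 0.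
Proof.
move=> [np ndp cp] [nH ndH cH].
pose E u := expR (be * Hf u).
pose dF m u := E u * (dpsi m u + be * (psi u * dHf m u)).
have oE : okf E by apply: okf_expR; apply: okf_nice; exact: niceZ.
have oF : okf (fun u => psi u * E u) by apply: okfM => //; exact: okf_nice.
have odF m : okf (dF m).
  apply: okfM => //; apply: okf_nice; apply: niceD => //; apply: niceZ; exact: niceM.
have cF : cdf (fun u => psi u * E u) dF.
  have c1 := cdf_comp1 (h := expR) (h' := expR) (fun u => is_derive_expR _) (cdfM (@cdf_cst R _ be) cH).
  refine (cdf_ext _ _ (cdfM cp c1)) => // m u.
  by rewrite /dF /E; ring.
have ibp i := sphere_ibp gY Y0 mY0 i j N0 oF odF cF.
pose A i w := sph (Y^~ w) i * dF j (sph (Y^~ w)) - sph (Y^~ w) j * dF i (sph (Y^~ w)).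
have LA i : L1 Q (A i).
  have o3 : okf (fun u => u i * dF j u - u j * dF i u).
    have pi k : okf (fun u : 'I_N -> R => u k) by apply: okf_nice; exact: nice_proj.
    have [m1 c1 [C1 b1]] := okfM (pi i) (odF j); have [m2 c2 [C2 b2]] := okfM (pi j) (odF i).
    split.
    - by move=> d0 U X mX; apply: measurable_funB; [exact: m1|exact: m2].
    - by move=> S FF Ff x l xl; apply: cvgB; [exact: c1|exact: c2].
    - exists (C1 + C2) => u u1; apply: le_trans (ler_normB _ _) _.
      by apply: lerD; [exact: b1|exact: b2].
  have [m3 _ [C b3]] := o3.
  apply: (@L1_bnd _ _ _ _ _ C) => [|w].
    by apply: m3 => k; exact: (measurable_sph gY mY0).
  by apply: b3 => k; exact: sph_le1.
rewrite (_ : (fun w => _) = (fun w => \sum_i t i * A i w)).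
  rewrite Ex_sum; last by move=> i; exact: L1Z.
  by apply: big1 => i _; rewrite ExZ// ibp mulr0.
apply/funext => w; rewrite /A; set u := sph _.
rewrite !sum_vrot [in RHS](eq_bigr (fun i => dF j u * (u i * t i) - u j * (t i * dF i u))) => [|i _]; last by ring.
rewrite sumrB -!mulr_sumr -/(vdot u t) /dF.
rewrite [in RHS](eq_bigr (fun i => E u * (t i * dpsi i u) + E u * be * psi u * (t i * dHf i u))) => [|i _]; last by ring.
by rewrite big_split/= -!mulr_sumr -/(E u); ring.
Qed.

Lemma smooth1_vdot t : smooth1 (fun v => vdot v t) (fun m _ => t m).
Proof.
have s i := smooth1M (smooth1_proj (R := R) (i : 'I_N)) (smooth1_cst _ (t i)).
refine (smooth1_ext _ _ (smooth1_sum (index_enum _) s)) => // m u.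
rewrite (eq_bigr (fun i => (m == i)%:R * t i)) => [|i _]; first exact: sum_deltaN.
by rewrite mulr0 add0r mulrC.
Qed.

Context (ga : nat -> R) (n : nat) (eps sn be : R).
Local Notation I := (cidx n N).
Local Notation J := (I + (I + I))%type.
Implicit Types G : J -> R.

Definition V1 v (k : J) : R :=
  match k with inl a => eps * pe ga a v | inr (inl a) => sn * pe ga a v | inr (inr a) => 0 end.
Definition V2 v (k : J) : R :=
  match k with inl a => eps * pe ga a v | inr (inl a) => 0 | inr (inr a) => sn * pe ga a v end.

Lemma nice_pe a : nice (pe ga (n := n) (N := N) a). Proof. by case: (smooth1_pe ga a). Qed.
Lemma nice_pde i a : nice (pde ga (n := n) (N := N) i a). Proof. by case: (smooth1_pde ga i a). Qed.
Lemma nice_pdde i j a : nice (pdde ga (n := n) (N := N) i j a).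
Proof. by case: (smooth1_pde ga i a) => _ h _; exact: h. Qed.

Lemma nice_V1 k : nice (fun v => V1 v k).
Proof. by case: k => [a|[a|a]] /=; [apply: niceZ; exact: nice_pe|apply: niceZ; exact: nice_pe|exact: nice_cst]. Qed.
Lemma nice_V2 k : nice (fun v => V2 v k).
Proof. by case: k => [a|[a|a]] /=; [apply: niceZ; exact: nice_pe|exact: nice_cst|apply: niceZ; exact: nice_pe]. Qed.

Definition H1 G v := \sum_k V1 v k * G k.
Definition vXe t j v (a : I) := \sum_i vrot t v j i * pde ga i a v.
Definition vdXe t j v (a : I) :=
  \sum_i \sum_i' vrot t v j i * vrot t v j i' * pdde ga i i' a v + \sum_i vrot2 t v j i * pde ga i a v.
Definition vpsi t v j := vdot v t * v j.
Definition vXpsi t v (j : 'I_N) := (vdot v t * t j - v j) * v j + vdot v t * (vdot v t - v j * t j).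

Lemma smooth1_H1 G : smooth1 (H1 G) (fun m v => lh eps sn (fun a => pde ga m a v) G).
Proof.
have s (k : J) : smooth1 (fun v => V1 v k * G k) (fun m v => bh eps sn (fun a => pde ga m a v) k * G k).
  case: k => [a|[a|a]] /=.
  - refine (smooth1_ext _ _ (smooth1Z (eps * G (inl a)) (smooth1_pe ga a))) => *; ring.
  - refine (smooth1_ext _ _ (smooth1Z (sn * G (inr (inl a))) (smooth1_pe ga a))) => *; ring.
  - by refine (smooth1_ext _ _ (smooth1_cst _ 0)) => *; rewrite mul0r.
exact: (smooth1_sum (index_enum J) s).
Qed.

Lemma vrot_lh t v j G : \sum_m vrot t v j m * lh eps sn (fun a => pde ga m a v) G =
  lh eps sn (vXe t j v) G.
Proof.
rewrite /lh; under eq_bigr do rewrite mulr_sumr.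
rewrite exchange_big/=; apply: eq_bigr => k _; case: k => [a|[a|a]] /=.
- rewrite /vXe mulr_sumr mulr_suml; apply: eq_bigr => m _; ring.
- rewrite /vXe mulr_sumr mulr_suml; apply: eq_bigr => m _; ring.
- by rewrite mul0r big1// => m _; rewrite ?mul0r mulr0.
Qed.

Lemma smooth1_vpsi t j : smooth1 (fun v => vpsi t v j) (fun m v => vdot v t * (m == j)%:R + v j * t m).
Proof. exact: (smooth1M (smooth1_vdot t) (smooth1_proj j)). Qed.

Lemma vrot_dpsi t v j : nrm2 t = 1 ->
  \sum_m vrot t v j m * (vdot v t * (m == j)%:R + v j * t m) = vXpsi t v j.
Proof.
move=> t1; rewrite sum_vrot eqxx mulr1.
rewrite (eq_bigr (fun i => vdot v t * ((j == i)%:R * t i) + v j * t i ^+ 2)) => [|i _]; last by rewrite eq_sym; ring.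
by rewrite big_split/= -!mulr_sumr sum_deltaN -/(nrm2 t) t1 /vXpsi; ring.
Qed.

Definition dvQ t j G m v := eps * \sum_a G (inl a) *
  \sum_i (vrot t v j i * pdde ga i m a v + pde ga i a v * (t m * (i == j)%:R - (m == j)%:R * t i)).

Lemma smooth1_vQ t j G : smooth1 (fun v => eps * lx (vXe t j v) G) (dvQ t j G).
Proof.
apply: (smooth1Z eps).
have sr i : smooth1 (fun v => vrot t v j i) (fun m v => t m * (i == j)%:R - (m == j)%:R * t i).
  have s1 := smooth1M (smooth1_vdot t) (smooth1_cst _ (i == j)%:R).
  have s2 := smooth1Z (- t i) (smooth1_proj (R := R) j).
  refine (smooth1_ext _ _ (smooth1D s1 s2)) => [u|m u]; rewrite /vrot; ring.
have sa a := smooth1Z (G (inl a)) (smooth1_sum (index_enum _) (fun i => smooth1M (sr i) (smooth1_pde ga i a))).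
refine (smooth1_ext _ _ (smooth1_sum (index_enum _) sa)) => [u|m u] //.
by rewrite lxE; apply: eq_bigr => a _; rewrite mulrC.
Qed.

Lemma vrot_dvQ t v j G : nrm2 t = 1 ->
  \sum_m vrot t v j m * dvQ t j G m v = eps * lx (vdXe t j v) G.
Proof.
move=> t1; rewrite /dvQ lxE.
transitivity (eps * \sum_a G (inl a) * \sum_m vrot t v j m *
    \sum_i (vrot t v j i * pdde ga i m a v + pde ga i a v * (t m * (i == j)%:R - (m == j)%:R * t i))).
  rewrite (eq_bigr (fun m => \sum_a eps * (G (inl a) * (vrot t v j m *
    \sum_i (vrot t v j i * pdde ga i m a v + pde ga i a v * (t m * (i == j)%:R - (m == j)%:R * t i)))))) => [|m _]; last first.
    by rewrite mulrCA mulr_sumr mulr_sumr; apply: eq_bigr => a _; rewrite -mulrCA; ring.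
  by rewrite exchange_big/= mulr_sumr; apply: eq_bigr => a _; rewrite -mulr_sumr -mulr_sumr.
congr (_ * _); apply: eq_bigr => a _; rewrite mulrC; congr (_ * _); rewrite /vdXe.
under eq_bigr do rewrite mulr_sumr.
rewrite exchange_big/= -big_split/=; apply: eq_bigr => i _.
rewrite (eq_bigr (fun m => vrot t v j i * vrot t v j m * pdde ga i m a v +
   (pde ga i a v * (i == j)%:R * (vrot t v j m * t m) - pde ga i a v * t i * (vrot t v j m * (m == j)%:R)))) => [|m _]; last by ring.
rewrite big_split/= sumrB -!mulr_sumr; congr (_ + _).
rewrite !sum_vrot eqxx (eq_bigr (fun i => t i ^+ 2)) => [|k _]; last by rewrite expr2.
rewrite -/(nrm2 t) t1 (eq_bigr (fun k => (j == k)%:R * t k)) => [|k _]; last by rewrite eq_sym mulrC.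
rewrite sum_deltaN /vrot2 mulr1 (_ : true%:R = 1 :> R)//; ring.
Qed.

(** The integrands of [He1] to [He4]. In [F2] and [F3] the rotated replica comes first, because [F0]
    integrates over the first point; [EE_swap1] restores the order later. *)
Definition F1 G s (s' : 'I_N -> R) t := \sum_j (vXpsi t s j + be * (vpsi t s j * lh eps sn (vXe t j s) G)).
Definition F2 G s s' t := \sum_j be * (vpsi t s' j * lh eps sn (vXe t j s) G).
Definition F3 G s s' t := \sum_j be * (eps * lx (vXe t j s') G * lh eps sn (vXe t j s) G).
Definition F4 G s (s' : 'I_N -> R) t := \sum_j (eps * lx (vdXe t j s) G + be * (eps * lx (vXe t j s) G * lh eps sn (vXe t j s) G)).

Let Lint (F : ('I_N -> R) -> R) : nice F -> forall G,
  L1 Q (fun w => expR (be * H1 G (sph (Y^~ w))) * F (sph (Y^~ w))).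
Proof.
move=> nF G; have [nH _ _] := smooth1_H1 G.
have [m _ [C b]] : okf (fun u => expR (be * H1 G u) * F u).
  by apply: okfM; [apply: okf_expR; apply: okf_nice; exact: niceZ|exact: okf_nice].
apply: (@L1_bnd _ _ _ _ _ C) => [|w].
  by apply: m => k; exact: (measurable_sph gY mY0).
by apply: b => k; exact: sph_le1.
Qed.

Lemma nice_vrot t j i : nice (fun v => vrot t v j i).
Proof. by rewrite /vrot /vdot; nice_tac. Qed.

Lemma nice_vrot2 t j i : nice (fun v => vrot2 t v j i).
Proof. by rewrite /vrot2 /vdot; nice_tac. Qed.

Lemma nice_lhX t j G : nice (fun v => lh eps sn (vXe t j v) G).
Proof.
have nX a : nice (fun v => vXe t j v a).
  by apply: nice_sum => i; apply: niceM; [exact: nice_vrot|exact: nice_pde].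
apply: nice_sum => -[a|[a|a]] /=; apply: niceM; try exact: nice_cst; exact: niceZ.
Qed.

(** [rot_ibp] with test function 1: the derivative of the Gibbs density alone has mean 0. *)
Lemma HX0 t j G : be != 0 -> Ex Q (fun w => expR (be * H1 G (sph (Y^~ w))) * lh eps sn (vXe t j (sph (Y^~ w))) G) = 0.
Proof.
move=> bn; have := rot_ibp be t j (smooth1_cst _ 1) (smooth1_H1 G).
under eq_fun => w.
  rewrite big1 => [|m _]; last by rewrite mulr0.
  rewrite add0r mul1r vrot_lh mulrCA.
  over.
by rewrite ExZ ?(Lint (nice_lhX _ _ _))// => /eqP; rewrite mulf_eq0 (negPf bn)/= => /eqP.
Qed.

Lemma F1_0 G s' t : nrm2 s' = 1 -> nrm2 t = 1 ->
  Ex Q (fun w => expR (be * H1 G (sph (Y^~ w))) * F1 G (sph (Y^~ w)) s' t) = 0.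
Proof.
move=> _ t1.
under eq_fun do rewrite /F1 mulr_sumr.
have nv j : nice (fun v => vXpsi t v j + be * (vpsi t v j * lh eps sn (vXe t j v) G)).
  apply: niceD; first by rewrite /vXpsi /vdot; nice_tac.
  by apply: niceZ; apply: niceM; [rewrite /vpsi /vdot; nice_tac|exact: nice_lhX].
rewrite Ex_sum; last by move=> j; exact: (Lint (nv j)).
apply: big1 => j _.
rewrite -(rot_ibp be t j (smooth1_vpsi t j) (smooth1_H1 G)).
by apply: eq_Rintegral => w _; rewrite vrot_dpsi// vrot_lh.
Qed.

Lemma F2_0 G s' t : be != 0 -> nrm2 s' = 1 -> nrm2 t = 1 ->
  Ex Q (fun w => expR (be * H1 G (sph (Y^~ w))) * F2 G (sph (Y^~ w)) s' t) = 0.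
Proof.
move=> bn _ _.
rewrite (_ : (fun w => _) = (fun w => \sum_j be * vpsi t s' j *
   (expR (be * H1 G (sph (Y^~ w))) * lh eps sn (vXe t j (sph (Y^~ w))) G))); last first.
  by apply/funext => w; rewrite /F2 mulr_sumr; apply: eq_bigr => j _; ring.
rewrite Ex_sum; last by move=> j; apply: L1Z; exact: (Lint (nice_lhX t j G)).
by apply: big1 => j _; rewrite ExZ ?HX0 ?mulr0//; exact: (Lint (nice_lhX t j G)).
Qed.

Lemma F3_0 G s' t : be != 0 -> nrm2 s' = 1 -> nrm2 t = 1 ->
  Ex Q (fun w => expR (be * H1 G (sph (Y^~ w))) * F3 G (sph (Y^~ w)) s' t) = 0.
Proof.
move=> bn _ _.
rewrite (_ : (fun w => _) = (fun w => \sum_j be * (eps * lx (vXe t j s') G) *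
   (expR (be * H1 G (sph (Y^~ w))) * lh eps sn (vXe t j (sph (Y^~ w))) G))); last first.
  by apply/funext => w; rewrite /F3 mulr_sumr; apply: eq_bigr => j _; ring.
rewrite Ex_sum; last by move=> j; apply: L1Z; exact: (Lint (nice_lhX t j G)).
by apply: big1 => j _; rewrite ExZ ?HX0 ?mulr0//; exact: (Lint (nice_lhX t j G)).
Qed.

Lemma F4_0 G s' t : nrm2 s' = 1 -> nrm2 t = 1 ->
  Ex Q (fun w => expR (be * H1 G (sph (Y^~ w))) * F4 G (sph (Y^~ w)) s' t) = 0.
Proof.
move=> _ t1.
under eq_fun do rewrite /F4 mulr_sumr.
have nX a j : nice (fun v => vXe t j v a).
  by apply: nice_sum => i; apply: niceM; [exact: nice_vrot|exact: nice_pde].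
have ndX a j : nice (fun v => vdXe t j v a).
  apply: niceD; apply: nice_sum => i; last first.
    by apply: niceM; [exact: nice_vrot2|exact: nice_pde].
  apply: nice_sum => i'; apply: niceM; last exact: nice_pdde.
  by apply: niceM; exact: nice_vrot.
have nv j : nice (fun v => eps * lx (vdXe t j v) G + be * (eps * lx (vXe t j v) G * lh eps sn (vXe t j v) G)).
  apply: niceD.
    apply: niceZ; apply: nice_sum => -[a|k]; apply: niceM; try exact: nice_cst.
    exact: ndX.
  apply: niceZ; apply: niceM; last exact: nice_lhX.
  apply: niceZ; apply: nice_sum => -[a|k]; apply: niceM; try exact: nice_cst.
  exact: nX.
rewrite Ex_sum; last by move=> j; exact: (Lint (nv j)).
apply: big1 => j _.
rewrite -(rot_ibp be t j (smooth1_vQ t j G) (smooth1_H1 G)).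
by apply: eq_Rintegral => w _; rewrite vrot_dvQ// vrot_lh.
Qed.

End rotation.

Section nice_fields.
Context {R : realType} (N n : nat) (ga : nat -> R) (eps sn be : R) (M : finType).
Local Notation I := (cidx n N).
Local Notation J := (I + (I + I))%type.
Variables (sp tp rp : 'I_N -> M) (gp : J -> M).
Local Notation at_ z p := (fun i => z (p i)).

Let ncomp (F : ('I_N -> R) -> R) p : nice F -> nice (fun z : M -> R => F (at_ z p)).
Proof. by move=> nF; apply: (nice_comp nF) => m; exact: nice_proj. Qed.

Lemma nice_zrot j i : nice (fun z : M -> R => vrot (at_ z tp) (at_ z sp) j i).
Proof. by rewrite /vrot /vdot; nice_tac. Qed.

Lemma nice_zrot2 j i : nice (fun z : M -> R => vrot2 (at_ z tp) (at_ z sp) j i).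
Proof. by rewrite /vrot2 /vdot; nice_tac. Qed.

Lemma nice_zXe j a : nice (fun z : M -> R => vXe ga (n := n) (at_ z tp) j (at_ z sp) a).
Proof.
apply: nice_sum => i; apply: niceM; first exact: nice_zrot.
exact: (ncomp sp (nice_pde ga i a)).
Qed.

Lemma nice_zdXe j a : nice (fun z : M -> R => vdXe ga (n := n) (at_ z tp) j (at_ z sp) a).
Proof.
apply: niceD; apply: nice_sum => i.
  apply: nice_sum => i'; apply: niceM; last exact: (ncomp sp (nice_pdde ga i i' a)).
  by apply: niceM; exact: nice_zrot.
apply: niceM; first exact: nice_zrot2.
exact: (ncomp sp (nice_pde ga i a)).
Qed.

Lemma nice_zlh (c : (M -> R) -> I -> R) : (forall a, nice (fun z => c z a)) ->
  nice (fun z : M -> R => lh eps sn (c z) (at_ z gp)).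
Proof.
move=> nc; apply: nice_sum => -[a|[a|a]] /=; apply: niceM; try exact: nice_cst; try exact: nice_proj; exact: niceZ.
Qed.

Lemma nice_zlx (c : (M -> R) -> I -> R) : (forall a, nice (fun z => c z a)) ->
  nice (fun z : M -> R => lx (c z) (at_ z gp)).
Proof.
move=> nc; apply: nice_sum => -[a|k] /=; apply: niceM; try exact: nice_cst; try exact: nice_proj; exact: nc.
Qed.

End nice_fields.

Section grid_errors.
Context {R : realType} d' (T' : measurableType d') (Q : probability T' R) (N : nat).
Context (Y : 'I_N -> T' -> R).
Hypothesis gY : gfam Q Y.
Hypothesis N0 : (0 < N)%N.
Hypothesis mY0 : measurable_fun setT (fun w => (nrm2 (Y^~ w) == 0)%:R : R).
Hypothesis Y0 : Ex Q (fun w => (nrm2 (Y^~ w) == 0)%:R) = 0.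
Context (ga : nat -> R) (n : nat) (eps sn be : R).
Hypothesis be0 : 0 < be.
Local Notation I := (cidx n N).
Local Notation J := (I + (I + I))%type.
Context d (T : measurableType d) (P : probability T R) (X : J -> T -> R).
Hypothesis gX : gfam P X.

Let W1 := @V1 R N ga n eps sn.
Let W2 := @V2 R N ga n eps sn.
Local Notation gGE k := (@GE R _ T' Q N Y _ T P J X be W1 W2 k).

Let nW1 j : nice (fun v => W1 v j). Proof. exact: nice_V1. Qed.
Let nW2 j : nice (fun v => W2 v j). Proof. exact: nice_V2. Qed.
Let bn : be != 0. Proof. by rewrite gt_eqF. Qed.

Let err (F : (J -> R) -> ('I_N -> R) -> ('I_N -> R) -> ('I_N -> R) -> R) :
  nice (fun z : ('I_N + ('I_N + 'I_N)) + J -> R =>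
    F (fun j => z (inr j)) (fun i => z (inl (inl i))) (fun i => z (inl (inr (inl i))))
      (fun i => z (inl (inr (inr i))))) ->
  (forall G s' t, nrm2 s' = 1 -> nrm2 t = 1 ->
    Ex Q (fun w => expR (be * H1 ga eps sn G (sph (Y^~ w))) * F G (sph (Y^~ w)) s' t) = 0) ->
  \forall k \near \oo, `|gGE k (fun G s s' t t' => F G (gx s) (gx s') (gx t))| <= 1.
Proof.
move=> nF F0.
have := GE_cvg0 gY N0 mY0 gX be0 nW1 nW2 nF F0.
move=> /cvgr0_norm_le /(_ 1 ltr01).
by [].
Qed.

Lemma grid_errors : \forall k \near \oo,
  [/\ `|gGE k (fun G s s' t t' => F1 ga eps sn be G (gx s) (gx s') (gx t))| <= 1,
      `|gGE k (fun G s s' t t' => F2 ga eps sn be G (gx s') (gx s) (gx t))| <= 1,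
      `|gGE k (fun G s s' t t' => F3 ga eps sn be G (gx s') (gx s) (gx t))| <= 1 &
      `|gGE k (fun G s s' t t' => F4 ga eps sn be G (gx s) (gx s') (gx t))| <= 1].
Proof.
near=> k; split.
- near: k; apply: (err (F := F1 ga eps sn be)); last (by move=> *; exact: F1_0); apply: nice_sum => j; apply: niceD.
    by rewrite /vXpsi /vdot; nice_tac.
  apply: niceZ; apply: niceM; first by rewrite /vpsi /vdot; nice_tac.
  by apply: nice_zlh => a; exact: nice_zXe.
- rewrite /GE EE_swap1; near: k; apply: (err (F := F2 ga eps sn be)); last (by move=> *; exact: F2_0); apply: nice_sum => j; apply: niceZ; apply: niceM.
    by rewrite /vpsi /vdot; nice_tac.
  by apply: nice_zlh => a; exact: nice_zXe.
- rewrite /GE EE_swap1; near: k; apply: (err (F := F3 ga eps sn be)); last (by move=> *; exact: F3_0); apply: nice_sum => j; apply: niceZ; apply: niceM.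
    by apply: niceZ; apply: nice_zlx => a; exact: nice_zXe.
  by apply: nice_zlh => a; exact: nice_zXe.
- near: k; apply: (err (F := F4 ga eps sn be)); last (by move=> *; exact: F4_0); apply: nice_sum => j; apply: niceD.
    by apply: niceZ; apply: nice_zlx => a; exact: nice_zdXe.
  apply: niceZ; apply: niceM.
    by apply: niceZ; apply: nice_zlx => a; exact: nice_zXe.
  by apply: nice_zlh => a; exact: nice_zXe.
Unshelve. all: by end_near.
Qed.

End grid_errors.

(** * Chaos on the grid *)

Section mixture.
Context {R : realType} (ga : nat -> R) (n : nat).
Hypothesis odd0 : forall p, odd p -> ga p = 0.
Hypothesis ga0 : ga 0%N = 0.
Local Notation dxi := (xi' ga n).
Local Notation ddxi := (xi'' ga n).

(** Degrees with a nonzero coefficient have the form q + 2 with q even, which is the shape in which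
    the power inequalities are stated. *)
Lemma even_ind (A : nat -> Prop) : (forall p, ga p = 0 -> A p) ->
  (forall q, ~~ odd q -> A q.+2) -> forall p, A p.
Proof.
move=> h0 h1 [|[|q]]; [exact: h0|by apply: h0; exact: odd0|].
by have [oq|oq] := boolP (odd q); [apply: h0; apply: odd0; rewrite /= negbK|exact: h1].
Qed.

Lemma xi'1 : dxi 1 = \sum_(p < n) ga p ^+ 2 * p%:R.
Proof. by apply: eq_bigr => p _; rewrite expr1n mulr1. Qed.

Lemma xi''1 : ddxi 1 = \sum_(p < n) ga p ^+ 2 * (p%:R * p.-1%:R).
Proof. by apply: eq_bigr => p _; rewrite expr1n mulr1. Qed.

Lemma xi_ineqA a b s : `|a| <= 1 -> `|b| <= 1 -> `|s| <= 1 ->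
  dxi 1 * DD a b s <= 2 * (dxi 1 * (a ^+ 2 + b ^+ 2) - 2 * a * b * dxi s).
Proof.
move=> _ _ s1; rewrite xi'1 /xi' !mulr_suml mulr_sumr -sumrB mulr_sumr.
apply: ler_sum => p _; elim/even_ind: (p : nat) => [q ->|q ev]; first by rewrite expr0n !mul0r mulr0 subrr mulr0.
have := ineqA_pow a b ev s1; set u := s ^+ _ => h.
rewrite -subr_ge0 (_ : _ - _ = ga q.+2 ^+ 2 * q.+2%:R * (2 * (a ^+ 2 + b ^+ 2 - 2 * a * b * u) - DD a b s)).
  by rewrite mulr_ge0 ?subr_ge0// mulr_ge0// sqr_ge0.
by rewrite /= -/u; ring.
Qed.

Lemma xi_ineqB a b s : `|a| <= 1 -> `|b| <= 1 -> `|s| <= 1 ->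
  dxi 1 * (a ^+ 2 + b ^+ 2) - 2 * a * b * dxi s <= ddxi 1 * DD a b s.
Proof.
move=> _ _ s1; rewrite xi'1 xi''1 /xi' !mulr_suml mulr_sumr -sumrB.
apply: ler_sum => p _; elim/even_ind: (p : nat) => [q ->|q ev]; first by rewrite expr0n !mul0r mulr0 subrr.
have := ineqB_pow a b ev s1; set u := s ^+ _ => h.
rewrite -subr_ge0 (_ : _ - _ = ga q.+2 ^+ 2 * q.+2%:R * (q.+1%:R * DD a b s - (a ^+ 2 + b ^+ 2 - 2 * a * b * u))).
  by rewrite mulr_ge0 ?subr_ge0// mulr_ge0// sqr_ge0.
by rewrite /= -/u; ring.
Qed.

Lemma xi_ineqC a b s : `|a| <= 1 -> `|b| <= 1 -> `|s| <= 1 ->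
  `|a * dxi a + b * dxi b - s * (a * dxi b + b * dxi a)| <= ddxi 1 * DD a b s.
Proof.
move=> a1 b1 s1.
rewrite (_ : _ - _ = \sum_(p < n) ga p ^+ 2 * p%:R *
    (a * a ^+ p.-1 + b * b ^+ p.-1 - s * (a * b ^+ p.-1 + b * a ^+ p.-1))); last first.
  rewrite /xi' !mulr_sumr -!big_split/= mulr_sumr -sumrB.
  by apply: eq_bigr => p _; ring.
apply: le_trans (ler_norm_sum _ _ _) _; rewrite xi''1 mulr_suml.
apply: ler_sum => p _; elim/even_ind: (p : nat) => [q ->|q ev]; first by rewrite expr0n !mul0r normr0.
have := ineqC_pow ev a1 b1 s1; rewrite /= -!exprS => h.
have c0 : 0 <= ga q.+2 ^+ 2 * q.+2%:R by rewrite mulr_ge0// sqr_ge0.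
rewrite normrM (ger0_norm c0) [leRHS](_ : _ = ga q.+2 ^+ 2 * q.+2%:R * (q.+1%:R * DD a b s)); last by ring.
by rewrite ler_wpM2l.
Qed.

Lemma xi''_ge0 s : `|s| <= 1 -> 0 <= ddxi s.
Proof.
move=> s1; apply: sumr_ge0 => p _; elim/even_ind: (p : nat) => [q ->|q ev]; first by rewrite expr0n mul0r.
by have /andP[h _] := even_pow ev s1; rewrite mulr_ge0 ?sqr_ge0// mulr_ge0.
Qed.

Lemma xi''_le s : `|s| <= 1 -> ddxi s <= ddxi 1.
Proof.
move=> s1; rewrite xi''1; apply: ler_sum => p _.
elim/even_ind: (p : nat) => [q ->|q ev]; first by rewrite expr0n !mul0r.
by have /andP[_ h] := even_pow ev s1; rewrite ler_wpM2l ?sqr_ge0// ler_piMr.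
Qed.

Lemma xi'_ge0 : 0 <= dxi 1.
Proof. by rewrite xi'1; apply: sumr_ge0 => p _; rewrite mulr_ge0 ?sqr_ge0. Qed.

Lemma xi_le s : `|s| <= 1 -> xi ga n s <= xi ga n 1 * s ^+ 2.
Proof.
move=> s1; rewrite /xi mulr_suml; apply: ler_sum => p _.
elim/even_ind: (p : nat) => [q ->|q ev]; first by rewrite expr0n !mul0r.
rewrite expr1n mulr1 ler_wpM2l ?sqr_ge0// -addn2 exprD ler_piMl ?sqr_ge0//.
by have /andP[] := even_pow ev s1.
Qed.

(** This single moment dominates xi(1), xi''(1), [zet 1] and the Lipschitz constant of [zet], so one
    bound on it makes all constants uniform in the truncation degree. *)
Definition z3 := \sum_(p < n) ga p ^+ 2 * p%:R ^+ 3.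

Lemma zet_le s : `|s| <= 1 -> zet ga n s <= zet ga n 1.
Proof.
move=> s1; apply: ler_sum => p _; elim/even_ind: (p : nat) => [q ->|q ev]; first by rewrite expr0n !mul0r.
have ev2 : ~~ odd q.+2 by rewrite /= negbK.
have /andP[_ h] := even_pow ev2 s1.
by rewrite ler_wpM2l ?sqr_ge0// expr1n ler_wpM2l ?sqr_ge0.
Qed.

(** Termwise 1 - s^p <= p (1 - s): Bernoulli's inequality for s >= 0; for s < 0 the right side is at
    least 1 and s^p >= 0. *)
Lemma zet_incr s : `|s| <= 1 -> zet ga n 1 - zet ga n s <= z3 * (1 - s).
Proof.
move=> s1; rewrite /zet /z3 -sumrB mulr_suml; apply: ler_sum => p _.
elim/even_ind: (p : nat) => [q ->|q ev]; first by rewrite expr0n !mul0r subrr.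
have ev2 : ~~ odd q.+2 by rewrite /= negbK.
have /andP[u0 u1] := even_pow ev2 s1.
have h : 1 - s ^+ q.+2 <= q.+2%:R * (1 - s).
  have [s0|s0] := leP 0 s; first by have := bernoulli q.+2 s0; lra.
  have q1 : 1 <= q.+2%:R :> R by rewrite (ler_nat _ 1).
  have : 1 * 1 <= q.+2%:R * (1 - s) by rewrite ler_pM//; lra.
  by lra.
rewrite expr1n (_ : _ - _ = ga q.+2 ^+ 2 * q.+2%:R ^+ 2 * (1 - s ^+ q.+2)); last by ring.
rewrite (_ : _ * (1 - s) = ga q.+2 ^+ 2 * q.+2%:R ^+ 2 * (q.+2%:R * (1 - s))); last by ring.
by rewrite ler_wpM2l// mulr_ge0 ?sqr_ge0.
Qed.

Lemma mixture_le (f : nat -> R) : (forall p, (0 < p)%N -> f p <= p%:R ^+ 3) ->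
  \sum_(p < n) ga p ^+ 2 * f p <= z3.
Proof.
move=> fp; apply: ler_sum => -[[|p] /= _] _; first by rewrite ga0 expr0n !mul0r.
by rewrite ler_wpM2l ?sqr_ge0// fp.
Qed.

Lemma xi1_le : xi ga n 1 <= z3.
Proof.
rewrite /xi; apply: (mixture_le (f := fun p => 1 ^+ p)) => p p0.
by rewrite expr1n exprn_ege1// (ler_nat _ 1).
Qed.

Lemma zet1_le : zet ga n 1 <= z3.
Proof.
apply: (mixture_le (f := fun p => p%:R ^+ 2 * 1 ^+ p)) => p p0.
by rewrite expr1n mulr1 ler_weXn2l// (ler_nat _ 1).
Qed.

Lemma xi''1_le : ddxi 1 <= z3.
Proof.
rewrite xi''1; apply: (mixture_le (f := fun p => p%:R * p.-1%:R)) => p p0.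
have p1 : 1 <= p%:R :> R by rewrite (ler_nat _ 1).
apply: (@le_trans _ _ (p%:R * p%:R)); first by rewrite ler_wpM2l// ler_nat leq_pred.
by rewrite exprS ler_wpM2l// expr2 ler_peMl.
Qed.

End mixture.

(** * Solving the system of inequalities *)

Section numeric.
Context {R : realType}.

(** Here r is sqrt N, x1 and x2 stand for xi'(1) and xi''(1). [Dq_bound] gives D in terms of N phi +
    r, and [phi_bound] gives N phi in terms of a small multiple of D, so a small [eps] closes the
    loop. *)
Lemma chaos_numeric (lo M : R) : 0 < lo -> 1 <= M -> exists eps C : R, [/\ 0 < eps, eps < 1, 0 <= C &
  forall (sn r N be K eta D Q S2 phi x1 x2 : R), eps ^+ 2 + sn ^+ 2 = 1 -> 1 <= r -> N = r ^+ 2 ->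
  1 <= be -> lo <= x1 -> 0 <= x2 -> x2 <= M -> 0 <= K -> K <= 2 * M * N -> 0 <= eta -> eta <= M * r -> 0 <= phi ->
  0 <= D ->
  sn ^+ 2 * (x1 / 2) * D <= 2 * K * phi + 2 * eta + N * phi / be + eps ^+ 2 * x2 * D ->
  sn ^+ 2 * Q <= K + eta -> S2 <= 2 + eps ^+ 2 * (2 * N * x2 * D + Q) ->
  (forall la, 0 < la -> N * phi - 1 <= 2 + la / 2 * (D / N) + S2 / (2 * la)) ->
  phi <= C / r].
Proof.
move=> lo0 M1; have M0 : 0 < M by lra.
(* The number 160 gives eps (2 M) (40 M / lo) <= 1/2, which is what the absorption of D requires;
   the factor 1 + lo in addition keeps eps below 1/160. *)
pose eps := lo / (160 * M ^+ 2 * (1 + lo)).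
have den : 0 < 160 * M ^+ 2 * (1 + lo) by rewrite mulr_gt0 ?mulr_gt0 ?exprn_gt0//; lra.
have e0 : 0 < eps by rewrite divr_gt0.
have M2 : 1 <= M ^+ 2 by rewrite exprn_ege1.
have e1 : eps <= 160^-1.
  rewrite /eps ler_pdivrMr// (_ : 160^-1 * _ = M ^+ 2 * (1 + lo)); last by field.
  apply: (@le_trans _ _ (1 * (1 + lo))); first by lra.
  by rewrite ler_wpM2r//; lra.
have e2 : eps * (160 * M ^+ 2) <= lo.
  have l1 : 0 < 1 + lo by lra.
  rewrite (_ : eps * _ = lo / (1 + lo)); last by rewrite /eps; field; rewrite !gt_eqF.
  by rewrite ler_pdivrMr// ler_peMr//; lra.
have e5 : eps <= 1 by lra.
have e3 : eps ^+ 2 <= 2^-1.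
  apply: (@le_trans _ _ (160^-1 * 160^-1)); first by rewrite expr2 ler_pM// ltW.
  by rewrite -invfM -natrM lef_pV2 ?posrE// ler_nat.
have e4 : eps ^+ 2 * M <= lo / 8.
  have a1 : eps * M <= eps * M ^+ 2 by rewrite ler_pM2l// expr2 ler_peMr// ltW.
  have a2 : eps ^+ 2 * M <= eps * M by rewrite expr2 -mulrA ler_piMl// mulr_ge0// ltW.
  by lra.
exists eps, (2 / eps + 6 * M + 7); split => //.
- by lra.
- have q0 : 0 <= 2 / eps by rewrite divr_ge0// ltW.
  by lra.
move=> sn r N be K eta D Q S2 phi x1 x2 es r1 Nr be1 x1lo x20 x2M K0 KM eta0 etaM phi0 D0 h1 h2 h3 h4.
have r0 : 0 < r by lra.
have N1 : 1 <= N by rewrite Nr exprn_ege1.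
have N0 : 0 < N by lra.
have rN : r <= N by rewrite Nr expr2 ler_peMl// ltW.
have s2 : 2^-1 <= sn ^+ 2 by lra.
have Np : 0 <= N * phi by rewrite mulr_ge0// ltW.
(* As sn^2 >= 1/2, the left side of the first inequality is at least lo/4 D, and the shared term
   eps^2 x2 D uses up at most half of it. *)
have D1 : lo / 8 * D <= 5 * M * (N * phi) + 2 * M * r.
  have b1 : lo / 4 * D <= sn ^+ 2 * (x1 / 2) * D.
    rewrite ler_wpM2r//; apply: (@le_trans _ _ (2^-1 * (lo / 2))); first by lra.
    by rewrite ler_pM//; lra.
  have b2 : eps ^+ 2 * x2 * D <= lo / 8 * D.
    rewrite ler_wpM2r//; apply: le_trans e4; rewrite ler_wpM2l ?exprn_ge0// ltW//.
  have b3 : 2 * K * phi <= 4 * M * (N * phi).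
    rewrite mulrA ler_wpM2r//; lra.
  have b4 : N * phi / be <= N * phi by rewrite ler_pdivrMr ?ler_peMr//; lra.
  have b5 : 4 * M * (N * phi) + N * phi <= 5 * M * (N * phi).
    rewrite -subr_ge0 (_ : _ - _ = (M - 1) * (N * phi)); last by ring.
    by rewrite mulr_ge0//; lra.
  by lra.
have D2 : D <= 40 * M / lo * (N * phi + r).
  have c : D * (lo / 8) <= 5 * M * (N * phi + r).
    have : 2 * M * r <= 5 * M * r by rewrite ler_wpM2r; lra.
    by rewrite mulrC; lra.
  rewrite -ler_pdivlMr in c; last by lra.
  apply: le_trans c _; rewrite le_eqVlt; apply/orP; left; apply/eqP; field.
  by rewrite gt_eqF.
have Q1 : Q <= 6 * M * N.
  have [Q0|Q0] := leP Q 0; first by rewrite (le_trans Q0)// !mulr_ge0//; lra.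
  have : 2^-1 * Q <= sn ^+ 2 * Q by rewrite ler_wpM2r// ltW.
  have : M * r <= M * N by rewrite ler_pM2l.
  by lra.
(* The choice la = eps N balances the two terms: each becomes of order eps D plus constants
   depending on eps and M. *)
have := h4 (eps * N) (mulr_gt0 e0 N0).
have -> : eps * N / 2 * (D / N) = eps / 2 * D by field; rewrite gt_eqF.
have S1 : S2 / (2 * (eps * N)) <= eps^-1 + 3 * M * eps + eps * M * D.
  have en : 0 < 2 * (eps * N) by rewrite mulr_gt0// mulr_gt0.
  rewrite ler_pdivrMr//; apply: le_trans h3 _.
  have -> : (eps^-1 + 3 * M * eps + eps * M * D) * (2 * (eps * N)) =
    2 * N + 6 * M * N * eps ^+ 2 + 2 * eps ^+ 2 * N * M * D by field; rewrite gt_eqF.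
  have u1 : eps ^+ 2 * Q <= eps ^+ 2 * (6 * M * N) by rewrite ler_wpM2l ?sqr_ge0.
  have u2 : eps ^+ 2 * (2 * N * x2 * D) <= eps ^+ 2 * (2 * N * M * D).
    by rewrite ler_wpM2l ?sqr_ge0// ler_wpM2r// ler_wpM2l//; lra.
  by lra.
(* Inserting the bound on D leaves at most half of N phi, which moves to the left side; the rest is
   O(r). *)
have T1 : eps * (2^-1 + M) * D <= 2^-1 * (N * phi + r).
  apply: (@le_trans _ _ (eps * (2 * M) * (40 * M / lo * (N * phi + r)))).
    have c1 : 0 <= eps * (2^-1 + M) by rewrite mulr_ge0 ?(ltW e0)//; lra.
    have c2 : eps * (2^-1 + M) <= eps * (2 * M) by rewrite ler_pM2l//; lra.
    by rewrite ler_pM.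
  rewrite (_ : _ * _ = (eps * (160 * M ^+ 2)) / lo * (2^-1 * (N * phi + r))); last by field; rewrite gt_eqF.
  by rewrite ler_piMl ?ler_pdivrMr ?mul1r// mulr_ge0//; lra.
move=> g1.
have g2 : N * phi <= 6 + 2 / eps + 6 * M + r.
  have : 3 * M * eps <= 3 * M by rewrite ler_piMr; lra.
  by rewrite -/(eps^-1) in S1 *; set ei := eps^-1 in S1 *; lra.
have ei0 : 0 <= 2 / eps by rewrite divr_ge0// ltW.
rewrite ler_pdivlMr// -(ler_pM2r r0) -mulrA -expr2 -Nr mulrC; apply: le_trans g2 _.
have : 6 + 2 / eps + 6 * M <= (6 + 2 / eps + 6 * M) * r by rewrite ler_peMr//; lra.
by lra.
Qed.

End numeric.

(** * Disorder chaos on the grid *)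

Section grid_chaos.
Context {R : realType} d' (T' : measurableType d') (Q : probability T' R) (N : nat).
Context (Y : 'I_N -> T' -> R).
Hypothesis gY : gfam Q Y.
Hypothesis N2 : (2 <= N)%N.
Hypothesis mY0 : measurable_fun setT (fun w => (nrm2 (Y^~ w) == 0)%:R : R).
Hypothesis Y0 : Ex Q (fun w => (nrm2 (Y^~ w) == 0)%:R) = 0.
Context (ga : nat -> R) (n : nat).
Hypothesis odd0 : forall p, odd p -> ga p = 0.
Hypothesis ga0 : ga 0%N = 0.
Context (be : R).
Hypothesis be1 : 1 <= be.
Context d (T : measurableType d) (P : probability T R) (X : cidx n N -> T -> R).
Hypothesis gX : gfam P X.

Let N0 : (0 < N)%N. Proof. exact: leq_trans N2. Qed.
Let be0 : 0 < be. Proof. exact: lt_le_trans ltr01 be1. Qed.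

Definition gridA k (f : gidx N k) (a : cidx n N) : R := pe ga a (gx f).
Definition gridw k (f : gidx N k) : R := @gom R _ T' Q N Y k f.

Let om0 k (f : gidx N k) : 0 <= gridw f. Proof. exact: gom_ge0. Qed.
Let om1 k : \sum_(f : gidx N k) gridw f = 1. Proof. exact: sum_gom. Qed.
Let x1 k (f : gidx N k) : \sum_i gx (R := R) f i ^+ 2 = 1. Proof. exact: gx_unit. Qed.

Let lamA k (f : gidx N k) (a : cidx n N) : R := \sum_i gx f i * pde ga i a (gx f).

Lemma lamA_ker k (f g : gidx N k) :
  \sum_a lamA f a * lamA g a = N%:R * zet ga n (vdot (gx f) (gx g)).
Proof. by rewrite -ker_euler; apply: eq_bigr => a _; rewrite /lamA !euler. Qed.

Lemma vdot_gx k (f g : gidx N k) : `|vdot (gx f) (gx g) : R| <= 1.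
Proof. exact: (dot_le1 (x := fun f : gidx N k => gx f) (x1 (k := k))). Qed.

Lemma vdot_gxx k (f : gidx N k) : vdot (gx f) (gx f) = 1 :> R.
Proof. exact: (dotvv (x := fun f : gidx N k => gx f) (x1 (k := k))). Qed.

(** [gauss_sup] for the radial field: by [zet_incr] its increments are at most z3 N |x - y|^2, so
    the mean supremum is of order N whatever the mesh. *)
Lemma lamA_sup k : exists D : T -> R, [/\ L1 P D, forall w, 0 <= D w,
  Ex P D <= Num.sqrt (N%:R * zet ga n 1) &
  forall w (f : gidx N k), lin (@lamA k) (X^~ w) f <= Num.sqrt (z3 ga n * N%:R) * Num.sqrt N%:R + 1 + D w].
Proof.
have z30 : 0 <= z3 ga n by apply: sumr_ge0 => p _; rewrite mulr_ge0 ?sqr_ge0 ?exprn_ge0.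
apply: (gauss_sup (Q := Q) (Y := Y) (x := fun f : gidx N k => gx f) gX gY) => //.
- by apply/card_gt0P; exists [ffun=> ord0].
- by move=> f g; rewrite lamA_ker ler_wpM2l// zet_le// vdot_gx.
- move=> f g; rewrite /incr !lamA_ker !vdot_gxx sqr_sqrtr ?mulr_ge0//.
  have -> : \sum_i (gx f i - gx g i) ^+ 2 = 2 * (1 - vdot (gx f) (gx g)) :> R.
    rewrite (eq_bigr (fun i => gx f i ^+ 2 + gx g i ^+ 2 - 2 * (gx f i * gx g i))) => [|i _]; last by ring.
    by rewrite sumrB big_split/= !x1 -mulr_sumr -/(vdot _ _); ring.
  have := zet_incr n odd0 ga0 (vdot_gx f g); set s := vdot _ _ => h.
  rewrite (_ : _ - _ = 2 * N%:R * (zet ga n 1 - zet ga n s)); last by ring.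
  rewrite (_ : _ * (2 * _) = 2 * N%:R * (z3 ga n * (1 - s))); last by ring.
  by rewrite ler_wpM2l// mulr_ge0.
Qed.

Let P3 := pprod P (pprod P P).
Let X3 := sumf X (sumf X X).
Let gX3 : gfam P3 X3. Proof. exact: (gfam_prod gX (gfam_prod gX gX)). Qed.

Variables (eps sn : R).
Hypothesis eps0 : 0 <= eps.
Hypothesis sn0 : 0 <= sn.
Hypothesis es1 : eps ^+ 2 + sn ^+ 2 = 1.

Local Notation E1 k := (E1 (@gridA k) eps sn).
Local Notation E2 k := (E2 (@gridA k) eps sn).

Definition gphi k := EE (@gridw k) be P3 X3 (E1 k) (E2 k)
  (fun G s s' t t' => vdot (gx s) (gx t) ^+ 2).

(** The witnesses are [Dq], [Qq] and [S2] of the overlap estimate on three independent copies of the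
    disorder. They are quantified existentially because [chaos_numeric] uses only the
    inequalities. *)
Lemma grid_chaos_ineq : \forall k \near \oo, exists D Qv S : R, let phi := gphi k in
  let K := Num.sqrt (z3 ga n * N%:R) * Num.sqrt N%:R + 1 in
  let eta := Num.sqrt (N%:R * zet ga n 1) in
  [/\ 0 <= phi /\ 0 <= D,
      sn ^+ 2 * (xi' ga n 1 / 2) * D <= 2 * K * phi + 2 * eta + N%:R * phi / be + eps ^+ 2 * xi'' ga n 1 * D,
      sn ^+ 2 * Qv <= K + eta,
      S <= 2 + eps ^+ 2 * (2 * N%:R * xi'' ga n 1 * D + Qv) &
      forall la, 0 < la -> N%:R * phi - 1 <= 2 + la / 2 * (D / N%:R) + S / (2 * la)].
Proof.
have err := grid_errors gY N0 mY0 Y0 ga (n := n) eps sn be0 gX3.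
apply: filterS err => k [e1 e2 e3 e4].
have K1 i (v w : gidx N k) : \sum_a pde ga i a (gx v) * gridA w a =
    N%:R * gx w i * xi' ga n (dot (fun f : gidx N k => gx f) v w) by exact: ker_pde.
have K2 i j (v w : gidx N k) : \sum_a pdde ga i j a (gx v) * gridA w a =
    N%:R * gx w i * gx w j * xi'' ga n (dot (fun f : gidx N k => gx f) v w) by exact: ker_pdde.
have [D [LD D0 ED supD]] := lamA_sup k.
have LDx : L1 P3 (fun z => D z.1) := L1_fst _ LD.
have LD1 : L1 P3 (fun z => D z.2.1) := L1_snd _ (L1_fst _ LD).
have EDx : Ex P3 (fun z => D z.1) <= Num.sqrt (N%:R * zet ga n 1) by rewrite (Ex_fst _ LD).
have ED1 : Ex P3 (fun z => D z.2.1) <= Num.sqrt (N%:R * zet ga n 1).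
  by rewrite (Ex_snd _ (L1_fst P LD)) (Ex_fst _ LD).
have K0 : 0 <= Num.sqrt (z3 ga n * N%:R) * Num.sqrt N%:R + 1 by rewrite addr_ge0// mulr_ge0 ?sqrtr_ge0.
have et0 : 0 <= Num.sqrt (N%:R * zet ga n 1) by exact: sqrtr_ge0.
have supx (w : T * (T * T)) (v : gidx N k) :
    lx (lam (fun f : gidx N k => gx f) (fun i f a => pde ga i a (gx f)) v) (X3^~ w) <=
    Num.sqrt (z3 ga n * N%:R) * Num.sqrt N%:R + 1 + D w.1.
  by rewrite lxE; exact: supD.
have sup1 (w : T * (T * T)) (v : gidx N k) :
    l1 (lam (fun f : gidx N k => gx f) (fun i f a => pde ga i a (gx f)) v) (X3^~ w) <=
    Num.sqrt (z3 ga n * N%:R) * Num.sqrt N%:R + 1 + D w.2.1.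
  by rewrite l1E; exact: supD.
pose x (f : gidx N k) : 'I_N -> R := gx f.
exists (Dq (@gridw k) be P3 X3 x (@gridA k) eps sn), (Qq (@gridw k) be P3 X3 x (@gridA k) (xi' ga n) eps sn),
  (S2 (@gridw k) be P3 X3 x (@gridA k) (fun i f a => pde ga i a (gx f)) eps sn) => phi K eta.
split.
- split; first exact: (phi_ge0 be (om0 (k := k)) (om1 k) P3 X3 x (@gridA k) eps sn).
  apply: mulr_ge0; first by rewrite divr_ge0// mulr_ge0// ltW.
  exact: (ED_ge0 be (om0 (k := k)) (om1 k) P3 X3 (x1 (k := k)) (@gridA k) eps sn).
- exact: (Dq_bound (om0 (k := k)) (om1 k) be0 gX3 (x1 (k := k)) K1 eps0 sn0 es1 e1 K0 LDx LD1
    (fun w => D0 w.1) (fun w => D0 w.2.1) EDx ED1 supx sup1 (xi_ineqA n odd0 ga0) (xi_ineqC n odd0 ga0) (xi'_ge0 ga n)).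
- exact: (Qq_bound (om0 (k := k)) (om1 k) be0 gX3 (x1 (k := k)) K1 sn0 es1 K0 et0 LD1 ED1 sup1).
- exact: (S2_bound (om0 (k := k)) (om1 k) be0 gX3 N2 (x1 (k := k)) K1 K2 e3 e4 (xi_ineqB n odd0 ga0) (xi_ineqC n odd0 ga0)
    (xi''_ge0 n odd0 ga0) (xi''_le n odd0 ga0)).
- exact: (phi_bound (om0 (k := k)) (om1 k) be0 gX3 N2 (x1 (k := k)) K1 e1 e2).
Qed.

(** By [corr_law] the correlation eps^2 is realised by one shared and two private blocks. The
    gradients then correlate as N E xi(s . t), and evenness bounds xi by xi(1) times the square. *)
Lemma csum_gphi k : csum P X (@gridA k) (gp (@gridw k) be) (eps ^+ 2) <= N%:R * xi ga n 1 * gphi k.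
Proof.
have e01 : 0 <= eps ^+ 2 <= 1 by rewrite sqr_ge0/= -es1 lerDl sqr_ge0.
have sp := smooth2_gp (om0 (k := k)) (om1 k) be0.
pose B (m : gidx N k + gidx N k) := match m with inl f => E1 k f | inr f => E2 k f end.
have kk (f g : gidx N k) : \sum_i gridA f i * gridA g i = N%:R * xi ga n (vdot (gx f) (gx g)) by exact: ker_pe.
have c11 (f g : gidx N k) : \sum_j B (inl f) j * B (inl g) j = \sum_i gridA f i * gridA g i.
  rewrite /B !big_sumType/= [X in _ + (_ + X)]big1 ?addr0 => [|a _]; last by rewrite mul0r.
  rewrite (eq_bigr (fun a => eps ^+ 2 * (gridA f a * gridA g a))) => [|a _]; last by ring.
  rewrite [X in _ + X](eq_bigr (fun a => sn ^+ 2 * (gridA f a * gridA g a))) => [|a _]; last by ring.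
  by rewrite -!mulr_sumr -mulrDl es1 mul1r.
have c22 (f g : gidx N k) : \sum_j B (inr f) j * B (inr g) j = \sum_i gridA f i * gridA g i.
  rewrite /B !big_sumType/= [X in _ + (X + _)]big1 ?add0r => [|a _]; last by rewrite mul0r.
  rewrite (eq_bigr (fun a => eps ^+ 2 * (gridA f a * gridA g a))) => [|a _]; last by ring.
  rewrite [X in _ + X](eq_bigr (fun a => sn ^+ 2 * (gridA f a * gridA g a))) => [|a _]; last by ring.
  by rewrite -!mulr_sumr -mulrDl es1 mul1r.
have c12 (f g : gidx N k) : \sum_j B (inl f) j * B (inr g) j = eps ^+ 2 * \sum_i gridA f i * gridA g i.
  rewrite /B !big_sumType/= [X in _ + (_ + X)]big1 ?addr0 => [|a _]; last by rewrite mul0r.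
  rewrite [X in _ + X]big1 ?addr0 => [|a _]; last by rewrite mulr0.
  by rewrite mulr_sumr; apply: eq_bigr => a _; ring.
have e i := corr_law gX (smooth2_fi (@gridA k) sp i) gX3 e01 c11 c12 c22.
rewrite /csum (eq_bigr _ (fun i _ => esym (e i))) -Ex_sum; last first.
  move=> i; have [[n2 _ _] _] := smooth2M (smooth2_pl _ (smooth2_fi (@gridA k) sp i)) (smooth2_pr _ (smooth2_fi (@gridA k) sp i)).
  exact: (gfam_L1 gX3 (nice_lin B n2)).
pose Fx (s t : gidx N k) := N%:R * xi ga n (vdot (gx s) (gx t)).
have -> : Ex P3 (fun w => \sum_i (\sum_m gridA m i * gp (@gridw k) be m (fun m0 => lin B (X3^~ w) (inl m0))) *
     (\sum_m gridA m i * gp (@gridw k) be m (fun m0 => lin B (X3^~ w) (inr m0)))) =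
   EE (@gridw k) be P3 X3 (E1 k) (E2 k) (fun G s s' t t' => Fx s t).
  apply: eq_Rintegral => w _; set G := X3^~ w.
  transitivity (\sum_s \sum_t P1 (@gridw k) be (E1 k) s G * P2 (@gridw k) be (E2 k) t G * Fx s t).
    rewrite (eq_bigr (fun i => \sum_s \sum_t P1 (@gridw k) be (E1 k) s G * P2 (@gridw k) be (E2 k) t G * (gridA s i * gridA t i))) => [|i _]; last first.
      rewrite mulr_suml; apply: eq_bigr => s _; rewrite mulr_sumr; apply: eq_bigr => t _.
      by rewrite /P1 /P2; ring.
    rewrite exchange_big/=; apply: eq_bigr => s _; rewrite exchange_big/=; apply: eq_bigr => t _.
    by rewrite -mulr_sumr kk.
  rewrite (AV3 be (om0 (k := k)) (om1 k) (E1 k) (E2 k) _ [ffun=> ord0])//; apply: eq_bigr => s _.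
  rewrite exchange_big/=; apply: eq_bigr => t _.
  have ac (a b c f : R) : a * b * c * f = a * c * f * b by ring.
  transitivity (\sum_s' P1 (@gridw k) be (E1 k) s G * P2 (@gridw k) be (E2 k) t G * Fx s t * P1 (@gridw k) be (E1 k) s' G).
    by rewrite -mulr_sumr sum_P1// mulr1.
  by apply: eq_bigr => s' _; rewrite [RHS]ac.
rewrite /gphi -(EEZ (om0 (k := k)) (om1 k) be0 gX3); last by move=> *; exact: nice_cst.
apply: (EE_le (om0 (k := k)) (om1 k) be0 gX3); [by move=> *; exact: nice_cst|by move=> *; exact: nice_cst|].
move=> G s s' t t'; rewrite /Fx -mulrA ler_wpM2l//.
exact: (xi_le n odd0 ga0 (vdot_gx s t)).
Qed.

End grid_chaos.

(** * Variance of the ground state energy of a finite mixture *)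

Section descent.
Context {R : realType}.

(** The threshold [t] does not depend on N or on the sequence, so smallness relative to N at the
    start survives any fixed number of square roots. *)
Lemma root_descent (M : R) m de : 0 < M -> 0 < de -> exists2 t, 0 < t &
  forall (N : R) (y : nat -> R), 0 < N -> (forall j, 0 <= y j) ->
  (forall j, y j.+1 ^+ 2 <= N * M * y j) -> y 0%N <= t * N -> y m <= de * N.
Proof.
move=> M0; elim: m de => [|m IH] de de0; first by exists de.
have d2 : 0 < de ^+ 2 / M by rewrite divr_gt0// exprn_gt0.
have [t t0 h] := IH _ d2; exists t => // N y N0 y0 ys yt.
have ym := h N y N0 y0 ys yt.
have dN : 0 <= de * N by rewrite mulr_ge0// ltW.
rewrite -(ger0_norm (y0 m.+1)) -(ger0_norm dN) -!sqrtr_sqr ler_wsqrtr//.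
apply: le_trans (ys m) _; apply: (@le_trans _ _ (N * M * (de ^+ 2 / M * N))).
  by rewrite ler_wpM2l// mulr_ge0 ?ltW.
by rewrite le_eqVlt; apply/orP; left; apply/eqP; field; rewrite gt_eqF.
Qed.

(** The points are rho^(2^-j): each is the square root of the previous one, and they tend to 1. *)
Lemma near1_root (rho tau : R) : 0 < rho -> rho < 1 -> 0 < tau ->
  exists (m : nat) (a : nat -> R), [/\ a 0%N = rho, forall j, 0 < a j < 1,
    forall j, a j.+1 ^+ 2 = a j & 1 - a m <= tau].
Proof.
move=> r0 r1 t0; pose L := - ln rho.
have L0 : 0 < L by rewrite oppr_gt0 ln_lt0// r0 r1.
pose a j := expR (- (L / 2 ^+ j)).
have p2 j : 0 < 2 ^+ j :> R by rewrite exprn_gt0.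
(* From 1 - exp(-x) <= x and 2^m >= m this many roots suffice. *)
pose m := (Num.truncn (L / tau)).+1.
exists m, a; split.
- by rewrite /a expr0 divr1 /L opprK lnK.
- by move=> j; rewrite expR_gt0/= expR_lt1 oppr_lt0 divr_gt0.
- move=> j; rewrite /a -expRM_natl; congr expR; rewrite exprS; field.
  by rewrite gt_eqF.
have := expR_ge1Dx (- (L / 2 ^+ m)); rewrite -/(a m) => h.
apply: (@le_trans _ _ (L / 2 ^+ m)); first by rewrite lerBlDl -lerBlDr.
rewrite ler_pdivrMr// mulrC -ler_pdivrMr//.
apply: (@le_trans _ _ m%:R); first by apply/ltW/truncnS_gt.
by rewrite -natrX ler_nat ltnW// ltn_expl.
Qed.

End descent.

Lemma sph_cvg (R : realType) (N : nat) (S : Type) (F : set_system S) (FF : Filter F)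
    (x : S -> 'I_N -> R) u : nrm2 u = 1 -> (forall i, x s i @[s --> F] --> u i) ->
  forall i, sph (x s) i @[s --> F] --> u i.
Proof.
move=> u1 cz i.
have [[_ _ cn] _ _] := @smooth1_nrm2 R N.
have cN : nrm2 (x s) @[s --> F] --> nrm2 u by exact: cn.
rewrite u1 in cN.
have np : \forall s \near F, 0 < nrm2 (x s) by exact: (cvgr_gt _ cN 0 ltr01).
have : x s i * rho (nrm2 (x s)) @[s --> F] --> u i * rho 1.
  apply: cvgM => //.
  apply: (@cvg_comp _ _ _ (fun s => - (2^-1 * ln (nrm2 (x s)))) expR _ (nbhs (- (2^-1 * ln 1)))); last exact: continuous_expR.
  apply: cvgN; apply: cvgM; first exact: cvg_cst.
  apply: (@cvg_comp _ _ _ (fun s => nrm2 (x s)) (@ln R) _ (nbhs (1 : R))) => //.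
  exact: continuous_ln.
rewrite {2}/rho ln1 mulr0 oppr0 expR0 mulr1; apply: cvg_trans.
apply: near_eq_cvg; apply: filterS np => s s0.
by rewrite /sph ifN// gt_eqF.
Qed.

(** * Free energy on the sphere and its limit at zero temperature *)

Section free_energy_limit.
Context {R : realType} d' (T' : measurableType d') (Q : probability T' R) (N : nat).
Context (Y : 'I_N -> T' -> R).
Hypothesis gY : gfam Q Y.
Hypothesis N0 : (0 < N)%N.
Hypothesis mY0 : measurable_fun setT (fun w => (nrm2 (Y^~ w) == 0)%:R : R).
Definition inbox (v : 'I_N -> R) (r : R) (w : T') i : bool := `|Y i w - v i| < r.
Definition boxI (v : 'I_N -> R) (r : R) (w : T') : R := \prod_i (inbox v r w i)%:R.
Hypothesis mbox : forall v r, measurable_fun setT (boxI v r).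
Hypothesis Ybox : forall v r, 0 < r -> 0 < Ex Q (boxI v r).
Context (ga : nat -> R) (n : nat).
Implicit Types G : cidx n N -> R.

Definition Hn G v := \sum_a pe ga a v * G a.
Definition cbd : R := \sum_(a : cidx n N) `|cf ga N (tag a)|.
Definition hb G : R := cbd * vbnd G.
Definition Fb be G := be^-1 * ln (Ex Q (fun w => expR (be * Hn G (sph (Y^~ w))))).
Definition Lm G := sup [set Hn G v | v in [set v | nrm2 v = 1]].

Lemma pe_le a v : (forall i, `|v i| <= 1) -> `|pe ga a v| <= `|cf ga N (tag (a : cidx n N))|.
Proof.
move=> v1; rewrite /pe normrM ler_piMr// normr_prod.
by apply: prodr_ile1 => i _; rewrite normr_ge0 v1.
Qed.

Lemma Hn_le G v : (forall i, `|v i| <= 1) -> `|Hn G v| <= hb G.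
Proof.
move=> v1; apply: le_trans (ler_norm_sum _ _ _) _; rewrite /hb /cbd mulr_suml.
apply: ler_sum => a _; rewrite normrM; apply: ler_pM => //; first exact: pe_le.
by rewrite /vbnd (bigD1 a)//= addrCA lerDl addr_ge0// sumr_ge0.
Qed.

Lemma nice_Hn G : nice (Hn G).
Proof. by apply: nice_sum => a; apply: niceM; [exact: nice_pe|exact: nice_cst]. Qed.

Lemma okf_eHn be G : okf (fun u => expR (be * Hn G u)).
Proof. by apply: okf_expR; apply: okf_nice; apply: niceZ; exact: nice_Hn. Qed.

Let sp1 w i : `|sph (Y^~ w) i| <= 1. Proof. exact: sph_le1. Qed.

Lemma L1_eHn be G : L1 Q (fun w => expR (be * Hn G (sph (Y^~ w)))).
Proof.
have [m _ [C b]] := okf_eHn be G.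
apply: (@L1_bnd _ _ _ _ _ C) => [|w]; last exact: b.
by apply: m => k; exact: (measurable_sph gY mY0).
Qed.

Lemma Zb_gt0 be G : 0 < be -> 0 < Ex Q (fun w => expR (be * Hn G (sph (Y^~ w)))).
Proof.
move=> be0; apply: lt_le_trans (expR_gt0 (be * - hb G)) _; rewrite -[leLHS](Ex_cst Q).
apply: Ex_le; [exact: L1_cst|exact: L1_eHn|move=> w].
rewrite ler_expR ler_pM2l// lerNl (le_trans (ler_norm _))// normrN.
exact: Hn_le.
Qed.

Lemma grid_free_cvg be G : 0 < be ->
  gF (@gom R _ T' Q N Y k) be (lin (fun f : gidx N k => fun a => pe ga a (gx f)) G) @[k --> \oo] --> Fb be G.
Proof.
move=> be0; apply: cvgM; first exact: cvg_cst.
have e k : gZ (@gom R _ T' Q N Y k) be (lin (fun f : gidx N k => fun a => pe ga a (gx f)) G) =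
    Ex Q (fun w => expR (be * Hn G (xk Y k w))) by rewrite -(grid_Ex gY N0 mY0 (fun u => expR (be * Hn G u))).
under eq_fun do rewrite e.
apply: (continuous_cvg _ (continuous_ln (Zb_gt0 G be0))).
exact: (grid_cvg gY N0 mY0 (okf_eHn be G)).
Qed.

Lemma grid_free_le be G k : 0 < be ->
  `|gF (@gom R _ T' Q N Y k) be (lin (fun f : gidx N k => fun a => pe ga a (gx f)) G)| <= hb G.
Proof.
move=> be0.
have h (f : gidx N k) : `|lin (fun f : gidx N k => fun a => pe ga a (gx f)) G f| <= hb G.
  by apply: (Hn_le G (v := gx f)) => i; exact: gx_le1.
have o1 := sum_gom gY N0 mY0 k.
rewrite ler_norml; apply/andP; split; [apply: gF_ge => // f|apply: gF_le => // f].
- exact: gom_ge0.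
- by have := h f; rewrite ler_norml => /andP[].
- exact: gom_ge0.
- by have := h f; rewrite ler_norml => /andP[].
Qed.

Lemma Lm_ub G v : nrm2 v = 1 -> Hn G v <= Lm G.
Proof.
move=> v1; apply: ub_le_sup; last by exists v.
exists (hb G) => _ [u /= u1 <-]; apply: le_trans (ler_norm _) _.
by apply: Hn_le => i; apply: nrm2_coord; rewrite u1.
Qed.

Lemma Fb_le be G : 0 < be -> Fb be G <= Lm G.
Proof.
move=> be0; rewrite /Fb -(ler_pM2l be0) mulVKf ?gt_eqF//.
rewrite -[leRHS]expRK ler_ln ?posrE ?expR_gt0 ?Zb_gt0//.
rewrite -(Ex_cst Q (expR _)); apply: Ex_le; [exact: L1_eHn|exact: L1_cst|move=> w].
by rewrite ler_expR ler_pM2l// Lm_ub// sph_nrm2.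
Qed.

(** The boxes around [v] generate a filter along which coordinates converge, so continuity in the
    sense of [ccl] yields a box on which the Hamiltonian of the projected point stays large. *)
Lemma Hn_near G v et : nrm2 v = 1 -> 0 < et ->
  exists2 r, 0 < r & forall y, (forall i, `|y i - v i| < r) -> Hn G v - et < Hn G (sph y).
Proof.
move=> v1 et0.
pose F : set_system ('I_N -> R) := [set A | exists2 r : R, 0 < r & forall y, (forall i, `|y i - v i| < r) -> A y].
have FF : Filter F.
  split.
  - by exists 1.
  - move=> A B [r r0 hA] [s s0 hB]; exists (Num.min r s); first by rewrite lt_min r0 s0.
    by move=> y hy; split; [apply: hA => i|apply: hB => i]; have := hy i; rewrite lt_min => /andP[].
  - by move=> A B AB [r r0 hA]; exists r => // y hy; apply: AB; exact: hA.
have cy i : y i @[y --> F] --> v i.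
  apply/cvgrPdist_lt => e e0; exists e => // y hy.
  by rewrite distrC; exact: hy.
have cs := sph_cvg FF v1 cy.
have [_ _ cH] := nice_Hn G.
have cHs : Hn G (sph y) @[y --> F] --> Hn G v by exact: cH.
have lt : Hn G v - et < Hn G v by rewrite ltrBlDr ltrDl.
exact: (cvgr_gt _ cHs _ lt).
Qed.

(** Laplace's principle. The upper bound holds at every temperature. For the lower bound the
    Gaussian vector is confined to a box near a near-maximiser, at the cost ln(q) / be, where the
    mass q is fixed as [be] grows. *)
Lemma Fb_cvg G : Fb m.+1%:R G @[m --> \oo] --> Lm G.
Proof.
have m0 (m : nat) : 0 < m.+1%:R :> R by [].
apply/cvgrPdist_le => et et0.
have e2 : 0 < et / 2 by rewrite divr_gt0.
have e4 : 0 < et / 4 by rewrite divr_gt0.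
have hs : has_sup [set Hn G v | v in [set v | nrm2 v = 1]].
  split; first by exists (Hn G (sph (fun=> 0))), (sph (fun=> 0)) => //; exact: sph_nrm2.
  exists (hb G) => _ [u /= u1 <-]; apply: le_trans (ler_norm _) _.
  by apply: Hn_le => i; apply: nrm2_coord; rewrite u1.
have [_ [v /= v1 <-] hv] := sup_adherent e2 hs; rewrite -/(Lm G) in hv.
have [r r0 hr] := Hn_near G v1 e4.
have q0 := Ybox v r0; set q := Ex Q _ in q0.
have c0 : m.+1%:R^-1 * ln q @[m --> \oo] --> (0 : R) * ln q.
  by apply: cvgM; [exact: cvg_harmonic|exact: cvg_cst].
rewrite mul0r in c0.
have nn := cvgr_norm_le _ c0; rewrite normr0 in nn; have {}nn : \forall m \near \oo, `|m.+1%:R^-1 * ln q| <= et / 4 by exact: nn.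
apply: filterS nn => m hm.
have lo : Hn G v - et / 4 + m.+1%:R^-1 * ln q <= Fb m.+1%:R G.
  rewrite /Fb -(ler_pM2l (m0 m)) mulrDr !mulVKf ?gt_eqF//.
  rewrite -[X in X + _]expRK -lnM ?posrE ?expR_gt0//.
  rewrite ler_ln ?posrE ?mulr_gt0 ?expR_gt0 ?Zb_gt0// -ExZ; last first.
    apply: (@L1_bnd _ _ _ _ _ 1) => [|w]; first exact: mbox.
    rewrite /boxI normr_prod; apply: prodr_ile1 => i _.
    by case: inbox; rewrite ?normr1 ?normr0 ler01 lexx.
  apply: Ex_le; [|exact: L1_eHn|].
    apply: L1Z; apply: (@L1_bnd _ _ _ _ _ 1) => [|w]; first exact: mbox.
    rewrite /boxI normr_prod; apply: prodr_ile1 => i _.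
    by case: inbox; rewrite ?normr1 ?normr0 ler01 lexx.
  move=> w; have [/forallP h|] := boolP [forall i, inbox v r w i].
    rewrite /boxI big1 ?mulr1 => [|i _]; last by rewrite h.
    by rewrite ler_expR ler_pM2l// ltW// hr.
  rewrite negb_forall => /existsP[i hi]; rewrite /boxI (bigD1 i)//= (negPf hi) mul0r mulr0.
  exact: expR_ge0.
rewrite ger0_norm ?subr_ge0 ?Fb_le//.
move: hm; rewrite ler_norml => /andP[hm _].
have fin (x y z u t : R) : u - t / 2 < z -> z - t / 4 + x <= y -> - (t / 4) <= x -> u - y <= t by lra.
exact: fin hv lo hm.
Qed.

End free_energy_limit.

Lemma sqrtr_le_sqr (R : realType) (x y : R) : 0 <= y -> x <= y ^+ 2 -> Num.sqrt x <= y.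
Proof. by move=> y0 xy; rewrite -[leRHS](ger0_norm y0) -sqrtr_sqr ler_wsqrtr. Qed.

(** Chaos at eps^2 starts a chain of square roots ending at some a close to 1, where [variance_le]
    is applied. The threshold [N0] is fixed before the mixture, the temperature and the mesh. *)
Lemma grid_variance_eps (R : realType) (lo M de : R) : 0 < lo -> 1 <= M -> 0 < de ->
  exists2 N0 : nat, (2 <= N0)%N & forall (N n : nat) (ga : nat -> R), (N0 <= N)%N ->
  (forall p, odd p -> ga p = 0) -> ga 0%N = 0 -> lo <= xi' ga n 1 -> z3 ga n <= M ->
  forall be : R, 1 <= be ->
  forall d (T : measurableType d) (P : probability T R) (X : cidx n N -> T -> R), gfam P X ->
  forall d' (T' : measurableType d') (Q : probability T' R) (Y : 'I_N -> T' -> R), gfam Q Y ->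
  measurable_fun setT (fun w => (nrm2 (Y^~ w) == 0)%:R : R) ->
  Ex Q (fun w => (nrm2 (Y^~ w) == 0)%:R) = 0 ->
  \forall k \near \oo,
  Ex P (fun w => gF (@gridw R d' T' Q N Y k) be (lin (@gridA R N ga n k) (X^~ w)) ^+ 2) -
  Ex P (fun w => gF (@gridw R d' T' Q N Y k) be (lin (@gridA R N ga n k) (X^~ w))) ^+ 2 <= de * N%:R.
Proof.
move=> lo0 M1 de0; have M0 : 0 < M by lra.
have [eps [C [e0 e1 C0 num]]] := chaos_numeric lo0 M1.
have ee1 : eps ^+ 2 < 1 by rewrite expr_lt1// ltW.
have ee0 : 0 < eps ^+ 2 by rewrite exprn_gt0.
pose sn := Num.sqrt (1 - eps ^+ 2).
have sn0 : 0 <= sn by exact: sqrtr_ge0.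
have es1 : eps ^+ 2 + sn ^+ 2 = 1 by rewrite /sn sqr_sqrtr ?subr_ge0 ?ltW// addrC subrK.
(* This closeness to 1 makes (1 - a) [csum 1] at most half of de N, because [csum 1 <= N M]. *)
have tau0 : 0 < de / (2 * M) by rewrite divr_gt0// mulr_gt0.
have [m [a [a0 a01 aS am]]] := near1_root ee0 ee1 tau0.
have de20 : 0 < de / 2 by rewrite divr_gt0.
have [t t0 desc] := root_descent m M0 de20.
(* For such N one has sqrt N >= M C / t, so the initial bound N M C / sqrt N is at most t N, as
   [root_descent] requires. *)
exists (maxn 2 (Num.truncn ((M * C / t) ^+ 2)).+1); first exact: leq_maxl.
move=> N n ga; rewrite geq_max => /andP[N2 Nt] odd0 ga0 lox z3M be be1 d T P X gX d' T' Q Y gY mY0 Y0.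
have be0 : 0 < be by lra.
have N0 : (0 < N)%N by exact: leq_trans N2.
have Nr0 : 0 < N%:R :> R by rewrite ltr0n.
have N1 : 1 <= N%:R :> R by rewrite (ler_nat _ 1).
have Nge : M * C / t <= Num.sqrt N%:R.
  have q0 : 0 <= M * C / t by apply: divr_ge0; [apply: mulr_ge0 => //|]; exact: ltW.
  rewrite -(ger0_norm q0) -sqrtr_sqr ler_wsqrtr//.
  apply: (@le_trans _ _ (Num.truncn ((M * C / t) ^+ 2)).+1%:R); last by rewrite ler_nat.
  exact/ltW/truncnS_gt.
pose r : R := Num.sqrt N%:R.
have r1 : 1 <= r by rewrite /r -[leLHS]sqrtr1 ler_wsqrtr.
have r0 : 0 < r by lra.
have rN : N%:R = r ^+ 2 by rewrite /r sqr_sqrtr.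
have z30 : 0 <= z3 ga n by apply: sumr_ge0 => p _; rewrite mulr_ge0 ?sqr_ge0 ?exprn_ge0.
have xi10 : 0 <= xi ga n 1 by apply: sumr_ge0 => p _; rewrite expr1n mulr1 sqr_ge0.
have xiM : xi ga n 1 <= M := le_trans (xi1_le n ga0) z3M.
have MM : M <= M ^+ 2 by rewrite expr2 ler_peMl// ltW.
have NM : 1 <= M * N%:R by rewrite -[leLHS]mulr1 ler_pM.
have KM : Num.sqrt (z3 ga n * N%:R) * Num.sqrt N%:R + 1 <= 2 * M * N%:R.
  have h : Num.sqrt (z3 ga n * N%:R) <= M * r.
    apply: sqrtr_le_sqr; first by rewrite mulr_ge0// ltW.
    by rewrite exprMn -rN ler_wpM2r// (le_trans z3M).
  have : Num.sqrt (z3 ga n * N%:R) * Num.sqrt N%:R <= M * N%:R.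
    by apply: (@le_trans _ _ (M * r * r)); [rewrite ler_wpM2r// ltW|rewrite -mulrA -expr2 -rN].
  by move: NM; rewrite -[2 * M * _]mulrA; set x := M * _; set y := _ * _; lra.
have eM : Num.sqrt (N%:R * zet ga n 1) <= M * r.
  apply: sqrtr_le_sqr; first by rewrite mulr_ge0// ltW.
  by rewrite exprMn -rN mulrC ler_wpM2r// (le_trans (zet1_le n ga0))// (le_trans z3M).
have gch := grid_chaos_ineq gY N2 mY0 Y0 odd0 ga0 be1 gX (ltW e0) sn0 es1.
apply: filterS gch => k [D [Qv [S /= [[phi0 D0] i1 i2 i3 i4]]]].
have K0 : 0 <= Num.sqrt (z3 ga n * N%:R) * Num.sqrt N%:R + 1 by rewrite addr_ge0// mulr_ge0 ?sqrtr_ge0.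
have one1 : `|1 : R| <= 1 by rewrite normr1.
have phiC := num sn r N%:R be _ _ D Qv S _ _ _ es1 r1 rN be1 lox (xi''_ge0 n odd0 ga0 one1)
  (le_trans (xi''1_le n ga0) z3M) K0 KM (sqrtr_ge0 _) eM phi0 D0 i1 i2 i3 i4.
have om0 (f : gidx N k) : 0 <= @gridw R d' T' Q N Y k f by exact: gom_ge0.
have om1 : \sum_(f : gidx N k) @gridw R d' T' Q N Y k f = 1 by exact: sum_gom.
have sdF := smooth2_gp om0 om1 be0.
pose y j := csum P X (@gridA R N ga n k) (gp (@gridw R d' T' Q N Y k) be) (a j).
pose y1 := csum P X (@gridA R N ga n k) (gp (@gridw R d' T' Q N Y k) be) 1.
have y1M : y1 <= N%:R * M.
  apply: (csum1_le gX om0 om1 be0) => f g.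
  have -> : \sum_(i : cidx n N) gridA ga f i * gridA ga g i = N%:R * xi ga n (vdot (gx f) (gx g)) by exact: ker_pe.
  rewrite ler_wpM2l//; have v1 := @vdot_gx R N N2 k f g.
  apply: le_trans (xi_le n odd0 ga0 v1) _; apply: le_trans xiM.
  by rewrite ler_piMr// -real_normK ?num_real// exprn_ile1.
have a01' j : 0 <= a j <= 1 by have /andP[u v] := a01 j; rewrite !ltW.
have y0 j : 0 <= y j by exact: (csum_ge0 _ gX sdF).
have ys j : y j.+1 ^+ 2 <= N%:R * M * y j.
  apply: le_trans (csum_sqr (@gridA R N ga n k) gX sdF (a01' j.+1)) _.
  by rewrite aS -/(y j) -/y1 ler_wpM2r.
have y00 : y 0%N <= t * N%:R.
  rewrite /y a0; apply: le_trans (csum_gphi gY N2 mY0 odd0 ga0 be1 gX es1 k) _.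
  apply: (@le_trans _ _ (N%:R * M * (C / r))).
    by apply: ler_pM => //; [rewrite mulr_ge0|rewrite ler_wpM2l].
  rewrite [leRHS]mulrC -mulrA ler_wpM2l// mulrA ler_pdivrMr// [leRHS]mulrC -ler_pdivrMr//.
have ym := desc N%:R y Nr0 y0 ys y00.
have v := variance_le (@gridA R N ga n k) gX (smooth2_gF om0 om1 be0) sdF (a01 m).
apply: le_trans v _; rewrite -/y1 -/(y m).
have /andP[am0 am1] := a01 m.
have h1 : (1 - a m) * y1 <= de / 2 * N%:R.
  apply: (@le_trans _ _ (de / (2 * M) * (N%:R * M))).
    apply: ler_pM => //; first by rewrite subr_ge0 ltW.
    by rewrite /y1; apply: (csum_ge0 _ gX sdF); rewrite ler01 lexx.
  by rewrite le_eqVlt; apply/orP; left; apply/eqP; field; rewrite gt_eqF.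
have h2 : a m * y m <= de / 2 * N%:R by apply: le_trans ym; rewrite ler_piMl// ltW.
by apply: le_trans (lerD h1 h2) _; rewrite -mulrDl -splitr.
Qed.

Lemma variance_cvg (R : realType) d (T : measurableType d) (P : probability T R)
    (f_ : nat -> T -> R) (f g : T -> R) (c : R) :
  (forall n, measurable_fun setT (f_ n)) -> (forall x, f_ n x @[n --> \oo] --> f x) ->
  (forall n x, `|f_ n x| <= g x) -> L1 P g -> L1 P (fun x => g x ^+ 2) ->
  (\forall n \near \oo, Ex P (fun x => f_ n x ^+ 2) - Ex P (f_ n) ^+ 2 <= c) ->
  [/\ measurable_fun setT f, forall x, `|f x| <= g x, L1 P (fun x => f x ^+ 2) &
    Ex P (fun x => f x ^+ 2) - Ex P f ^+ 2 <= c].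
Proof.
move=> mf ff fg Lg Lg2 hc.
have [Lf cf] := Ex_dct mf ff fg Lg.
have mf2 n : measurable_fun setT (fun x => f_ n x ^+ 2) by exact: measurable_funX.
have ff2 x : f_ n x ^+ 2 @[n --> \oo] --> f x ^+ 2 by rewrite expr2; under eq_fun do rewrite expr2; exact: cvgM.
have fg2 n x : `|f_ n x ^+ 2| <= g x ^+ 2.
  by rewrite normrX lerXn2r ?nnegrE ?normr_ge0 ?fg// (le_trans _ (fg n x)).
have [Lf2 cf2] := Ex_dct mf2 ff2 fg2 Lg2.
split => //; first exact: L1_meas Lf.
- move=> x; rewrite leNgt; apply/negP => lt.
  have h : \forall n \near \oo, g x < `|f_ n x| by exact: (cvgr_gt _ (cvg_norm (ff x)) _ lt).
  have [n] := filter_ex h; by rewrite ltNge fg.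
- rewrite leNgt; apply/negP => lt.
  have cv : Ex P (fun x => f_ n x ^+ 2) - Ex P (f_ n) ^+ 2 @[n --> \oo] -->
      Ex P (fun x => f x ^+ 2) - Ex P f ^+ 2.
    apply: cvgB => //; rewrite expr2; under eq_fun do rewrite expr2; exact: cvgM.
  have h0 : \forall n \near \oo, c < Ex P (fun x => f_ n x ^+ 2) - Ex P (f_ n) ^+ 2 by exact: (cvgr_gt _ cv _ lt).
  suff: \forall n \near \oo, False by move=> /filter_ex[].
  by apply: filterS2 h0 hc => n u v; move: u; rewrite ltNge v.
Qed.

(** Two applications of [variance_cvg]: first the mesh tends to 0 at inverse temperature m + 1, then
    m tends to infinity. Both are dominated by [hb], all of whose moments are finite. *)
Lemma ground_state_variance (R : realType) (lo M de : R) : 0 < lo -> 1 <= M -> 0 < de ->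
  exists2 N0 : nat, (2 <= N0)%N & forall (N n : nat) (ga : nat -> R), (N0 <= N)%N ->
  (forall p, odd p -> ga p = 0) -> ga 0%N = 0 -> lo <= xi' ga n 1 -> z3 ga n <= M ->
  forall d (T : measurableType d) (P : probability T R) (X : cidx n N -> T -> R), gfam P X ->
  forall d' (T' : measurableType d') (Q : probability T' R) (Y : 'I_N -> T' -> R), gfam Q Y ->
  measurable_fun setT (fun w => (nrm2 (Y^~ w) == 0)%:R : R) ->
  Ex Q (fun w => (nrm2 (Y^~ w) == 0)%:R) = 0 ->
  (forall v r, measurable_fun setT (boxI Y v r)) ->
  (forall v (r : R), 0 < r -> 0 < Ex Q (boxI Y v r)) ->
  [/\ measurable_fun setT (fun w => Lm ga (X^~ w)), L1 P (fun w => Lm ga (X^~ w) ^+ 2) &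
   Ex P (fun w => Lm ga (X^~ w) ^+ 2) - Ex P (fun w => Lm ga (X^~ w)) ^+ 2 <= de * N%:R].
Proof.
move=> lo0 M1 de0; have [N0 N02 h] := grid_variance_eps lo0 M1 de0.
exists N0 => // N n ga N0N odd0 ga0 lox z3M d T P X gX d' T' Q Y gY mY0 Y0 mb Yb.
have Np : (0 < N)%N by apply: leq_trans N0N; exact: leq_trans N02.
have Lh j : L1 P (fun w => hb ga (X^~ w) ^+ j).
  by under eq_fun do rewrite /hb exprMn; apply: L1Z; exact: gfam_vbnd.
have Lh1 : L1 P (fun w => hb ga (X^~ w)) by have := Lh 1%N; under eq_fun do rewrite expr1.
have H (m : nat) : [/\ measurable_fun setT (fun w => Fb Q Y ga m.+1%:R (X^~ w)),
    forall w, `|Fb Q Y ga m.+1%:R (X^~ w)| <= hb ga (X^~ w),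
    L1 P (fun w => Fb Q Y ga m.+1%:R (X^~ w) ^+ 2) &
    Ex P (fun w => Fb Q Y ga m.+1%:R (X^~ w) ^+ 2) - Ex P (fun w => Fb Q Y ga m.+1%:R (X^~ w)) ^+ 2 <= de * N%:R].
  have be0 : 0 < m.+1%:R :> R by [].
  have be1 : 1 <= m.+1%:R :> R by rewrite (ler_nat _ 1).
  apply: (variance_cvg _ _ _ Lh1 (Lh 2%N) (h N n ga N0N odd0 ga0 lox z3M _ be1 _ _ _ _ gX _ _ _ _ gY mY0 Y0)).
  - move=> k; apply: (gfam_meas gX (f := fun x => gF _ _ (lin _ x))); apply: nice_lin; apply: nice_gF => //.
      by move=> f; exact: gom_ge0.
    exact: sum_gom.
  - by move=> w; exact: (grid_free_cvg gY Np mY0).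
  - by move=> k w; exact: (grid_free_le gY Np mY0).
have cF w : Fb Q Y ga m.+1%:R (X^~ w) @[m --> \oo] --> Lm ga (X^~ w) by exact: Fb_cvg.
have [mL _ L2 V] := variance_cvg (fun m => let: And4 a _ _ _ := H m in a)
  cF (fun m => let: And4 _ a _ _ := H m in a) Lh1 (Lh 2%N)
  (nearW _ (fun m => let: And4 _ _ _ a := H m in a)).
by split.
Qed.

(** * Infinite mixtures *)

Section null_sets.
Import HBNNSimple.
Context {R : realType} d (T : measurableType d) (P : probability T R).

Lemma Ex_indic (A : set T) : measurable A -> Ex P (\1_A) = fine (P A).
Proof. by move=> mA; rewrite /Ex /Rintegral integral_indic// setIT. Qed.

Variables (A : set T).
Hypothesis mA : measurable A.
Hypothesis PA : P (~` A) = 0%E.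

(* No measurability is assumed: [LN] may fail to be measurable on a null set. *)
Lemma ge0_integral_null_le (f1 f2 : T -> \bar R) : (forall x, 0 <= f1 x)%E -> (forall x, 0 <= f2 x)%E ->
  (forall x, A x -> f1 x = f2 x) -> (\int[P]_x f1 x <= \int[P]_x f2 x)%E.
Proof.
move=> f10 f20 e; rewrite (ge0_integralTE P f10) (ge0_integralTE P f20).
apply: ub_ereal_sup => _ [h /= hf <-].
apply: ereal_sup_ubound; exists (proj_nnsfun h mA) => /=.
  move=> x; rewrite /proj_nnsfun/= /mindic/= indicE; have [/set_mem xA|_] := boolP (x \in A).
    by rewrite mulr1 -e.
  by rewrite mulr0.
have mh : measurable_fun setT (h : T -> R) by exact: measurable_funPT.
have mp : measurable_fun setT (fun x => h x * \1_A x) by apply: measurable_funM => //; exact: measurable_indic.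
rewrite -!integralT_nnsfun; apply: ae_eq_integral => //.
- by apply/measurable_EFinP; first [exact: mh|exact: mp].
- by apply/measurable_EFinP; first [exact: mh|exact: mp].
exists (~` A); split => //; first exact: measurableC.
move=> x /= nx Ax; apply: nx => _.
by rewrite /mindic/= indicE mem_set// mulr1.
Qed.

Lemma integral_null (f1 f2 : T -> \bar R) :
  (forall x, A x -> f1 x = f2 x) -> (\int[P]_x f1 x = \int[P]_x f2 x)%E.
Proof.
move=> e; rewrite integralE [RHS]integralE; congr (_ - _)%E; apply/eqP; rewrite eq_le; apply/andP; split;
  by apply: ge0_integral_null_le => // x Ax; rewrite ?funeposE ?funenegE e.
Qed.

End null_sets.

(** On the interval the density is bounded below by its value at |v| + r. *)
Lemma normal_prob_ball (R : realType) (v r : R) : 0 < r ->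
  (0 < normal_prob 0 1 [set x : R | (`|x - v| < r)%R])%E.
Proof.
move=> r0.
pose I : set R := `]v - r, v + r[%classic.
have -> : [set x : R | `|x - v| < r] = I.
  by apply/seteqP; split => x /=; rewrite /I/= in_itv/= ltr_distl.
pose c : R := normal_peak 1 * expR (- ((`|v| + r) ^+ 2 / (1 ^+ 2 *+ 2))).
have n1 : (1 : R) != 0 by rewrite oner_eq0.
have c0 : 0 < c by rewrite mulr_gt0 ?expR_gt0 ?normal_peak_gt0.
apply: (@lt_le_trans _ _ (\int[lebesgue_measure]_(x in I) c%:E)%E).
  have muI : lebesgue_measure (`]v - r, v + r[%classic : set R) = (2 * r)%:E.
    rewrite lebesgue_measure_itv/= lte_fin ifT; last by lra.
    by rewrite -EFinB; congr EFin; ring.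
  rewrite integral_cst; last exact: measurable_itv.
  by rewrite [X in (_ * X)%E](_ : _ = (2 * r)%:E)// -EFinM lte_fin mulr_gt0// mulr_gt0.
apply: ge0_le_integral => //.
- exact: measurable_itv.
- by move=> x _; rewrite lee_fin ltW.
- by apply/measurable_EFinP; apply: measurable_funTS; exact: measurable_normal_pdf.
move=> x; rewrite /I/= in_itv/= => /andP[x1 x2].
rewrite lee_fin normal_pdfE// /c ler_wpM2l ?normal_peak_ge0// /normal_fun ler_expR subr0.
rewrite mulNr lerN2 ler_wpM2r ?invr_ge0// -[leLHS]real_normK ?num_real//.
rewrite lerXn2r ?nnegrE ?addr_ge0// ?ltW//.
have h : `|x - v| < r by rewrite ltr_distl x1 x2.
by rewrite -[x](subrK v) (le_lt_trans (ler_normD _ _))// addrC ltrD2l.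
Qed.

(** * Gaussian families extracted from the disorder *)

Section gaussian_vector.
Context {R : realType} d (T : measurableType d) (P : probability T R).
Context (g : gindex -> T -> R).
Hypothesis hg : forall i, standard_gaussian P (g i).
Hypothesis ig : mutually_independent P g.
Context (N : nat).
Hypothesis N0 : (0 < N)%N.

(** The indices with p = 0 supply a standard Gaussian vector, whose projection to the sphere is the
    uniform point. *)
Definition yix (i : 'I_N) : gindex := (0%N, [:: nat_of_ord i]).
Definition gY (i : 'I_N) := g (yix i).

Lemma yix_inj : injective yix.
Proof. by move=> i j [] /val_inj. Qed.

Lemma gfam_gY : gfam P gY.
Proof. exact: (gfam_indep hg ig yix_inj). Qed.

Let mg i : measurable_fun setT (g i). Proof. by case: (hg i). Qed.

Lemma gY_meas0 : measurable_fun setT (fun w => (nrm2 (gY^~ w) == 0)%:R : R).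
Proof.
have e w : (nrm2 (gY^~ w) == 0) = (nrm2 (gY^~ w) <= 0).
  by rewrite eq_le nrm2_ge0 andbT.
under eq_fun do rewrite e.
apply: (@measurable_boolR R _ _ (fun w => nrm2 (gY^~ w) <= 0)).
apply: measurable_fun_ler => //.
by apply: measurable_sum => i; apply: measurable_funX; exact: mg.
Qed.

Lemma gY_null0 : Ex P (fun w => (nrm2 (gY^~ w) == 0)%:R) = 0.
Proof.
pose i0 := Ordinal N0.
have m0 : measurable (gY i0 @^-1` [set 0]) by rewrite -[X in measurable X]setTI; exact: mg.
have z : P (gY i0 @^-1` [set 0]) = 0%E.
  have [_ ->//] := hg (yix i0).
  have /null_content_dominatesP h := @normal_prob_dominates R 0 1.
  by apply: h => //; exact: lebesgue_measure_set1.
have ge : 0 <= Ex P (fun w => (nrm2 (gY^~ w) == 0)%:R) by apply: Ex_ge0 => w; rewrite ler0n.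
apply/eqP; rewrite eq_le ge andbT.
rewrite -[leRHS](_ : Ex P (\1_(gY i0 @^-1` [set 0])) = 0); last by rewrite Ex_indic// z.
apply: Ex_le.
- apply: (@L1_bnd _ _ _ _ _ 1); first exact: gY_meas0.
  by move=> w; case: (_ == _); rewrite ?normr1 ?normr0.
- apply: (@L1_bnd _ _ _ _ _ 1); first exact: measurable_indic.
  by move=> w; rewrite indicE; case: (_ \in _); rewrite ?normr1 ?normr0.
move=> w; rewrite indicE; have [e|] := eqVneq (nrm2 (gY^~ w)) 0; last by rewrite ler0n.
rewrite mem_set//=; apply/eqP; rewrite -sqrf_eq0 -/(gY i0 w).
move/eqP: e; rewrite /nrm2 psumr_eq0 => [/allP h|i _]; last exact: sqr_ge0.
by have := h i0; rewrite mem_index_enum => /(_ isT).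
Qed.

Lemma gY_mbox v r : measurable_fun setT (boxI gY v r).
Proof.
apply: measurable_prod => i _; apply: (@measurable_boolR R _ _ (fun w => inbox gY v r w i)).
apply: measurable_fun_ltr => //; apply: measurableT_comp => //.
by apply: measurable_funB => //; exact: mg.
Qed.

Lemma gY_box v r : 0 < r -> 0 < Ex P (boxI gY v r).
Proof.
move=> r0.
pose Bl (i : 'I_N) := [set x : R | `|x - v i| < r].
pose B (j : gindex) : set R := if [pick i | yix i == j] is Some i then Bl i else setT.
have Be i : B (yix i) = Bl i.
  by rewrite /B; case: pickP => [j /eqP/yix_inj->//|/(_ i)]; rewrite eqxx.
have mBl i : measurable (Bl i).
  have -> : Bl i = `]v i - r, v i + r[%classic.
    by apply/seteqP; split => x; rewrite /Bl/= in_itv/= ltr_distl.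
  exact: measurable_itv.
have mB j : measurable (B j) by rewrite /B; case: pickP.
pose J := [seq yix i | i <- enum 'I_N].
have uJ : uniq J by rewrite (map_inj_uniq yix_inj) enum_uniq.
have := ig uJ mB; set A := \bigcap_(_ in _) _ => PA.
have pA : (0 < P A)%E.
  rewrite PA /J big_map big_enum/=; elim/big_ind : _ => // [x y|i _]; first exact: mule_gt0.
  by rewrite Be; have [_ ->//] := hg (yix i); exact: normal_prob_ball.
have bA : boxI gY v r = \1_A.
  apply/funext => w; rewrite indicE /boxI; have [/set_mem wA|wA] := boolP (w \in A).
    rewrite big1// => i _.
    have /wA : [set j | j \in J] (yix i) by apply: map_f; rewrite mem_enum.
    by rewrite /preimage/= Be /Bl/= -/(gY i w) /inbox => ->.
  have [/forallP h|] := boolP [forall i, inbox gY v r w i].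
    move/negP: wA => []; apply: mem_set => _ /= /mapP[i _ ->].
    by rewrite /preimage/= Be; exact: h.
  by rewrite negb_forall => /existsP[i hi]; rewrite (bigD1 i)//= (negPf hi) mul0r.
have mA : measurable A.
  have -> : A = boxI gY v r @^-1` [set 1].
    rewrite bA; apply/seteqP; split => w /=; rewrite indicE.
      by move=> wA; rewrite mem_set.
    by have [/set_mem//|_ /eqP] := boolP (w \in A); rewrite eq_sym oner_eq0.
  by rewrite -[X in measurable X]setTI; exact: gY_mbox.
rewrite bA Ex_indic// fine_gt0// pA/= (le_lt_trans (probability_le1 _ mA))//.
exact: ltry.
Qed.

Lemma gix_inj (p : nat) : injective (fun f : {ffun 'I_p -> 'I_N} => (p, [seq (f k : nat) | k <- enum 'I_p]) : gindex).
Proof.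
move=> f f' [] /eq_in_map h; apply/ffunP => k; apply: val_inj; apply: h.
by rewrite mem_enum.
Qed.

Definition cix n (a : cidx n N) : gindex :=
  (nat_of_ord (tag a), [seq (tagged a k : nat) | k <- enum 'I_(tag a)]).

Lemma cix_inj n : injective (@cix n).
Proof.
move=> [p f] [p' f'] e.
have pp : p = p' by apply: val_inj; move: e => /(congr1 fst).
by move: f' e; rewrite -pp => f' /gix_inj /= ->.
Qed.

Lemma gfam_cix n : gfam P (fun a : cidx n N => g (cix a)).
Proof. exact: (gfam_indep hg ig (@cix_inj n)). Qed.

Lemma gfam_gix p : gfam P (fun f : {ffun 'I_p -> 'I_N} => g (p, [seq (f k : nat) | k <- enum 'I_p])).
Proof. exact: (gfam_indep hg ig (@gix_inj p)). Qed.

End gaussian_vector.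

(** * Uniform bounds for homogeneous Gaussian forms *)

Section symmetrized.
Context {R : realType} (p N : nat).
Local Notation mi := {ffun 'I_p -> 'I_N}.
Implicit Types (G : mi -> R) (v : 'I_N -> R) (f : mi).

Definition cnt f : {ffun 'I_N -> 'I_p.+1} := [ffun i => inord #|[pred k | f k == i]|].
Definition monom v (al : {ffun 'I_N -> 'I_p.+1}) : R := \prod_i v i ^+ al i.
Definition pform G v : R := \sum_f G f * \prod_k v (f k).
Definition csize al : R := \sum_(f | cnt f == al) 1.
(** Coefficients of equal monomials are summed. Each nonempty group, divided by its size, has mean
    1, so the expectation counts monomials; an empty group contributes 0, as 0 divided by 0 is 0. *)
Definition symn G : R := \sum_al (\sum_(f | cnt f == al) G f) ^+ 2 / csize al.

Lemma prod_monom f v : \prod_k v (f k) = monom v (cnt f).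
Proof.
rewrite (partition_big f predT)//=; apply: eq_bigr => i _.
rewrite ffunE inordK; last by rewrite ltnS (leq_trans (max_card _))// card_ord.
by rewrite -prodr_const; apply: eq_big => [k|k /eqP ->].
Qed.

Lemma csize_ge0 al : 0 <= csize al.
Proof. exact: sumr_ge0. Qed.

Lemma symn_ge0 G : 0 <= symn G.
Proof. by apply: sumr_ge0 => al _; rewrite divr_ge0 ?sqr_ge0 ?csize_ge0. Qed.

(* Grouping equal monomials before Cauchy-Schwarz keeps the bound of size (p + 1) ^ N instead of N ^ p. *)
Lemma pform_sqr_le G v : nrm2 v = 1 -> pform G v ^+ 2 <= symn G.
Proof.
move=> v1; pose S al := \sum_(f | cnt f == al) G f.
have eW : pform G v = \sum_al (S al / Num.sqrt (csize al)) * (Num.sqrt (csize al) * monom v al).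
  rewrite /pform (partition_big cnt predT)//=; apply: eq_bigr => al _.
  rewrite (eq_bigr (fun f => G f * monom v al)) => [|f /eqP <-]; last by rewrite prod_monom.
  rewrite -mulr_suml -/(S al); have [n0|n0] := eqVneq (csize al) 0.
    have : csize al = 0 by [].
    move=> /psumr_eq0P z; rewrite n0 sqrtr0 invr0 mulr0 !mul0r /S big1 ?mul0r// => f /z.
    by move=> /(_ (fun _ _ => ler01)) /eqP; rewrite oner_eq0.
  by rewrite mulrA mulfVK// sqrtr_eq0 -ltNge lt_def n0 csize_ge0.
rewrite eW; apply: le_trans (sum_CS _ _) _.
have -> : \sum_i (Num.sqrt (csize i) * monom v i) ^+ 2 = 1.
  transitivity (\sum_(f : mi) \prod_k v (f k) ^+ 2).
    rewrite (partition_big cnt predT)//=; apply: eq_bigr => al _.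
    rewrite exprMn sqr_sqrtr ?csize_ge0// /csize mulr_suml; apply: eq_bigr => f /eqP <-.
    by rewrite mul1r -prod_monom prodrXl.
  rewrite -(bigA_distr_bigA (fun (k : 'I_p) i => v i ^+ 2)) big1// => k _; exact: v1.
rewrite mulr1; apply: ler_sum => al _.
by rewrite exprMn exprVn sqr_sqrtr ?csize_ge0.
Qed.

End symmetrized.

Section second_moment.
Context {R : realType} d (T : measurableType d) (P : probability T R).

Lemma gfam_cov (I : finType) (X : I -> T -> R) : gfam P X -> forall i j,
  Ex P (fun w => X i w * X j w) = (i == j)%:R.
Proof. by move=> gX i j; rewrite (gf_ibp gX (smooth1_proj j) i) Ex_cst. Qed.

Lemma L1_gfam2 (I : finType) (X : I -> T -> R) : gfam P X -> forall i j,
  L1 P (fun w => X i w * X j w).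
Proof.
move=> gX i j; apply: (gfam_L1 gX (f := fun u => u i * u j)).
by apply: niceM; exact: nice_proj.
Qed.

Lemma Ex_sqr_sum (I : finType) (X : I -> T -> R) (A : pred I) : gfam P X ->
  L1 P (fun w => (\sum_(i | A i) X i w) ^+ 2) /\
  Ex P (fun w => (\sum_(i | A i) X i w) ^+ 2) = \sum_(i | A i) 1.
Proof.
move=> gX.
have e : (fun w => (\sum_(i | A i) X i w) ^+ 2) =
    (fun w => \sum_(i | A i) \sum_(j | A j) X i w * X j w).
  by apply/funext => w; rewrite expr2 big_distrlr.
have L i : L1 P (fun w => \sum_(j | A j) X i w * X j w) by apply: L1_sum => j; exact: L1_gfam2.
rewrite e; split; first exact: L1_sum.
rewrite Ex_sum//; apply: eq_bigr => i Ai; rewrite Ex_sum => [|j]; last exact: L1_gfam2.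
rewrite (bigD1 i)//= gfam_cov// eqxx big1 ?addr0// => j /andP[_ ji].
by rewrite gfam_cov// eq_sym (negPf ji).
Qed.

Lemma Ex_symn p N (X : {ffun 'I_p -> 'I_N} -> T -> R) : gfam P X ->
  L1 P (fun w => symn (X^~ w)) /\ Ex P (fun w => symn (X^~ w)) <= p.+1%:R ^+ N.
Proof.
move=> gX.
have L al : L1 P (fun w => (\sum_(f | cnt f == al) X f w) ^+ 2 / @csize R p N al).
  under eq_fun do rewrite mulrC; apply: L1Z.
  by have [] := Ex_sqr_sum (fun f => cnt f == al) gX.
split; first exact: L1_sum.
rewrite /symn Ex_sum//.
apply: (@le_trans _ _ (\sum_(al : {ffun 'I_N -> 'I_p.+1}) 1)); last first.
  by rewrite sumr_const card_ffun !card_ord natrX.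
apply: ler_sum => al _.
have [L2 E2] := Ex_sqr_sum (fun f => cnt f == al) gX.
have -> : (fun w => (\sum_(f | cnt f == al) X f w) ^+ 2 / @csize R p N al) =
    (fun w => (@csize R p N al)^-1 * (\sum_(f | cnt f == al) X f w) ^+ 2).
  by apply/funext => w; rewrite mulrC.
rewrite ExZ// E2 -/(@csize R p N al).
by have [->|n0] := eqVneq (@csize R p N al) 0; rewrite ?mulr0// mulVf.
Qed.

End second_moment.

Section elementary.
Context {R : realType}.

Lemma bernoulli_nat (x : R) n : 0 <= x -> 1 + n%:R * x <= (1 + x) ^+ n.
Proof.
move=> x0; elim: n => [|n IH]; first by rewrite expr0 mul0r addr0.
rewrite exprS; apply: (@le_trans _ _ ((1 + x) * (1 + n%:R * x))); last first.
  by rewrite ler_wpM2l// addr_ge0.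
have h : 0 <= n%:R * x * x by rewrite !mulr_ge0.
by rewrite mulrDl mulrDr mul1r mulrDr -natr1 mulrDl !mul1r; rewrite !mulr1 [x * (_ * x)]mulrC; lra.
Qed.

(** Induction on the degree: the hypothesis is used at sqrt q, and the other sqrt q^p pays for the
    additional factor p + 1. *)
Lemma poly_le_exp (N : nat) (q : R) : 1 < q -> exists2 C, 0 < C & forall p, p.+1%:R ^+ N <= C * q ^+ p.
Proof.
elim: N q => [|N IH] q q1.
  exists 1 => // p; rewrite expr0 mul1r exprn_ege1// ltW//.
have s1 : 1 < Num.sqrt q by rewrite -sqrtr1 ltr_sqrt// (lt_trans ltr01).
have [C C0 h] := IH _ s1.
pose x := Num.sqrt q - 1; have x0 : 0 < x by rewrite subr_gt0.
exists (C * (1 + x^-1)); first by rewrite mulr_gt0// addr_gt0// invr_gt0.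
move=> p; rewrite exprSr -[q in q ^+ p]sqr_sqrtr; last by rewrite ltW// (lt_trans ltr01).
have e : Num.sqrt q = 1 + x by rewrite /x addrC subrK.
have h2 : p.+1%:R <= (1 + x^-1) * Num.sqrt q ^+ p.
  rewrite e; apply: (@le_trans _ _ ((1 + x^-1) * (1 + p%:R * x))); last first.
    by apply: ler_wpM2l; [rewrite addr_ge0// invr_ge0 ltW|apply: bernoulli_nat; exact: ltW].
  have -> : (1 + x^-1) * (1 + p%:R * x) = p.+1%:R + x^-1 + p%:R * x.
    by rewrite -natr1; field; rewrite gt_eqF.
  by rewrite -addrA lerDl addr_ge0 ?invr_ge0 ?mulr_ge0// ltW.
rewrite -exprM mulnC exprM expr2 [leRHS](_ : _ = (C * Num.sqrt q ^+ p) * ((1 + x^-1) * Num.sqrt q ^+ p)).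
  by apply: ler_pM => //; rewrite exprn_ge0.
by rewrite mulrACA.
Qed.

Lemma geometric_le (k : nat) : \sum_(i < k) (3 / 4) ^+ i <= 4 :> R.
Proof.
have -> : \sum_(i < k) (3 / 4) ^+ i = 4 * (1 - (3 / 4) ^+ k) :> R.
  elim: k => [|k IH]; first by rewrite big_ord0 expr0 subrr mulr0.
  by rewrite big_ord_recr/= IH exprS; field.
have : 0 <= (3 / 4) ^+ k :> R by rewrite exprn_ge0// divr_ge0.
by set x := _ ^+ _; lra.
Qed.

Lemma sup_image_le (U : Type) (A : set U) (f h : U -> R) (D : R) : A !=set0 ->
  (exists c, forall v, A v -> h v <= c) -> (forall v, A v -> f v <= h v + D) ->
  sup (f @` A) <= sup (h @` A) + D.
Proof.
move=> [v0 Av0] [c hc] fh; apply: ge_sup; first by exists (f v0), v0.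
move=> _ [v Av <-]; apply: le_trans (fh v Av) _; rewrite lerD2r.
by apply: ub_le_sup; [exists c => _ [u Au <-]; exact: hc|exists v].
Qed.

Lemma sup_image_dist (U : Type) (A : set U) (f h : U -> R) (D : R) : A !=set0 ->
  (exists c, forall v, A v -> h v <= c) -> (forall v, A v -> `|f v - h v| <= D) ->
  `|sup (f @` A) - sup (h @` A)| <= D.
Proof.
move=> A0 [c hc] fh.
have l1 v : A v -> f v <= h v + D by move=> /fh; rewrite ler_distl => /andP[].
have l2 v : A v -> h v <= f v + D by move=> /fh; rewrite ler_distl => /andP[]; rewrite lerBlDr.
have s1 := sup_image_le A0 (ex_intro _ c hc) l1.
have fc : exists c, forall v, A v -> f v <= c.
  by exists (c + D) => v Av; rewrite (le_trans (l1 v Av))// lerD2r hc.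
have s2 := sup_image_le A0 fc l2.
by rewrite ler_distl lerBlDr s1 s2.
Qed.

(** Cauchy-Schwarz with the weights (3/4)^(n+i), whose sum is at most 4 (3/4)^n. This factor is the
    decay of the truncation error. *)
Lemma weighted_CS (k : nat) (x : 'I_k -> R) (n : nat) :
  (\sum_i x i) ^+ 2 <= 4 * (3 / 4) ^+ n * \sum_(i < k) (4 / 3) ^+ (n + i) * x i ^+ 2.
Proof.
pose s : R := Num.sqrt (3 / 4).
have s0 : 0 < s by rewrite sqrtr_gt0 divr_gt0.
have s2 : s ^+ 2 = 3 / 4 by rewrite sqr_sqrtr// divr_ge0.
have := sum_CS (fun i : 'I_k => s ^+ (n + i)) (fun i => (s ^+ (n + i))^-1 * x i).
rewrite (eq_bigr x) => [h|i _]; last by rewrite mulVKf// expf_neq0// gt_eqF.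
apply: le_trans h _.
rewrite (eq_bigr (fun i : 'I_k => (3 / 4) ^+ n * (3 / 4) ^+ i)) => [|i _]; last first.
  by rewrite -exprM mulnC exprM s2 exprD.
rewrite -mulr_sumr [X in _ * X <= _](eq_bigr (fun i : 'I_k => (4 / 3) ^+ (n + i) * x i ^+ 2)) => [|i _]; last first.
  rewrite exprMn exprVn -exprM mulnC exprM s2 -exprVn; congr (_ ^+ _ * _).
  by rewrite invf_div.
apply: ler_wpM2r.
  by apply: sumr_ge0 => i _; rewrite mulr_ge0 ?sqr_ge0 ?exprn_ge0// divr_ge0.
by rewrite [leRHS]mulrC ler_wpM2l ?geometric_le// exprn_ge0// divr_ge0.
Qed.

End elementary.

Lemma EFin_Ex (R : realType) d (T : measurableType d) (P : probability T R) (f : T -> R) :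
  L1 P f -> (\int[P]_x (f x)%:E = (Ex P f)%:E)%E.
Proof. by move=> Lf; rewrite /Ex /Rintegral fineK//; exact: integrable_fin_num. Qed.

Lemma sum_from2 (V : zmodType) (F : nat -> V) n :
  \sum_(2 <= p < n) F p = \sum_(p < n) (if (2 <= p)%N then F p else 0).
Proof.
elim: n => [|n IH]; first by rewrite big_geq// big_ord0.
rewrite big_ord_recr/= -IH; have [n2|n2] := leqP 2 n; first by rewrite big_nat_recr.
by rewrite !big_geq ?addr0// ltnW.
Qed.

(** * Truncation of the mixture at fixed N *)

Section truncation.
Context {R : realType} d (T : measurableType d) (P : probability T R).
Context (g : gindex -> T -> R) (gamma : nat -> R).
Hypothesis hg : forall i, standard_gaussian P (g i).
Hypothesis ig : mutually_independent P g.
Context (N : nat).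
Hypothesis N0 : (0 < N)%N.

Definition ga2 p : R := if (2 <= p)%N then gamma p else 0.
Local Notation ga := ga2.
Variable S : R.
Hypothesis hS : forall n, \sum_(p < n) 2 ^+ p * ga p ^+ 2 <= S.

Definition Gp p w (f : {ffun 'I_p -> 'I_N}) : R := g (p, [seq (f k : nat) | k <- enum 'I_p]) w.
(** The weight (4/3)^p pays for [weighted_CS]. The mean of [symn] is at most (p+1)^N <= C (3/2)^p,
    and (4/3)(3/2) = 2 matches the summability assumed of gamma. *)
Definition tV p w : R := (4 / 3) ^+ p * ga p ^+ 2 * symn (@Gp p w).
Definition V w : \bar R := (\sum_(0 <= p <oo) (tV p w)%:E)%E.
Definition Vr w : R := fine (V w).
(** On this event of full probability the series of the Hamiltonian converges uniformly over the
    sphere. *)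
Definition good : set T := ~` (V @^-1` [set +oo%E]).

Let q0 p : 0 <= (4 / 3) ^+ p * ga p ^+ 2.
Proof. by rewrite mulr_ge0 ?sqr_ge0// exprn_ge0// divr_ge0. Qed.

Lemma tV_ge0 p w : 0 <= tV p w.
Proof. by rewrite mulr_ge0// symn_ge0. Qed.

Lemma V_ge0 w : (0 <= V w)%E.
Proof. by apply: nneseries_ge0 => p _ _; rewrite lee_fin tV_ge0. Qed.

Lemma Vr_ge0 w : 0 <= Vr w.
Proof. exact: fine_ge0 (V_ge0 w). Qed.

Lemma L1_tV p : L1 P (tV p).
Proof. by apply: L1Z; have [] := Ex_symn (gfam_gix hg ig N p). Qed.

Lemma Ex_tV p : Ex P (tV p) <= (4 / 3) ^+ p * ga p ^+ 2 * p.+1%:R ^+ N.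
Proof.
have [L E] := Ex_symn (gfam_gix hg ig N p).
by rewrite /tV ExZ// ler_wpM2l.
Qed.

Lemma measurable_V : measurable_fun setT V.
Proof.
apply: (ge0_emeasurable_sum (P := xpredT)) => [p w _ _|p _]; first by rewrite lee_fin tV_ge0.
by apply/measurable_EFinP; exact: L1_meas (L1_tV p).
Qed.

Lemma integrable_V : P.-integrable setT V.
Proof.
apply/integrableP; split; first exact: measurable_V.
under eq_integral do rewrite gee0_abs ?V_ge0//.
rewrite integral_nneseries => //; last 2 first.
- by move=> p; apply/measurable_EFinP; exact: L1_meas (L1_tV p).
- by move=> p w _; rewrite lee_fin tV_ge0.
under eq_eseriesr do rewrite (EFin_Ex (L1_tV _)).
have q1 : 1 < 3 / 2 :> R by lra.
have [C C0 hC] := poly_le_exp N q1.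
apply: (@le_lt_trans _ _ (C * S)%:E); last exact: ltry.
apply: lime_le.
  by apply: is_cvg_nneseries => p _ _; rewrite lee_fin; apply: Ex_ge0 => w; exact: tV_ge0.
apply: nearW => n; rewrite sumEFin lee_fin big_mkord.
apply: le_trans (ler_wpM2l (ltW C0) (hS n)); rewrite mulr_sumr; apply: ler_sum => p _.
apply: le_trans (Ex_tV p) _; apply: le_trans (ler_wpM2l (q0 p) (hC p)) _.
have -> : 2 ^+ p = (4 / 3) ^+ p * (3 / 2) ^+ p :> R by rewrite -exprMn; congr (_ ^+ _); field.
set a := _ ^+ _; set b := _ ^+ _; set c := _ ^+ _.
by rewrite le_eqVlt; apply/orP; left; apply/eqP; ring.
Qed.

Lemma measurable_good : measurable good.
Proof.
apply: measurableC; rewrite -[X in measurable X]setTI; exact: measurable_V.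
Qed.

Lemma good_null : P (~` good) = 0%E.
Proof.
apply: measure_negligible; first by apply: measurableC; exact: measurable_good.
apply: negligibleS (integrable_ae measurableT integrable_V) => w /=.
by move=> ng h; apply: ng => /= Vw; have := h I; rewrite Vw.
Qed.

Lemma V_fin w : good w -> V w = (Vr w)%:E.
Proof.
by move=> gw; rewrite fineK// ge0_fin_numE ?V_ge0// ltey; apply/eqP => e; apply: gw.
Qed.

Lemma sum_tV_le w n : good w -> \sum_(p < n) tV p w <= Vr w.
Proof.
move=> gw; rewrite -lee_fin -V_fin// -sumEFin -(big_mkord xpredT (fun p => (tV p w)%:E)).
by apply: nneseries_lim_ge => p _ _; rewrite lee_fin tV_ge0.
Qed.

Definition xt v p w : R := ga p * Num.sqrt N%:R * pform (@Gp p w) v.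
Definition HP n v w := \sum_(p < n) xt v p w.
Definition s34 : R := Num.sqrt (3 / 4).
Definition Dn n w := 2 * Num.sqrt (N%:R * Vr w) * s34 ^+ n.

Let s34_ge0 : 0 <= s34. Proof. exact: sqrtr_ge0. Qed.
Let s34_sqr : s34 ^+ 2 = 3 / 4. Proof. by rewrite sqr_sqrtr// divr_ge0. Qed.
Let s34_lt1 : s34 < 1.
Proof. by rewrite -[ltRHS]sqrtr1 ltr_sqrt//; lra. Qed.

Lemma Dn_ge0 n w : 0 <= Dn n w.
Proof. by rewrite !mulr_ge0 ?sqrtr_ge0// exprn_ge0. Qed.

(** The bound on the tail does not involve [v], so it passes to suprema over the sphere. *)
Lemma HP_dist w v n k : good w -> nrm2 v = 1 -> `|HP (n + k) v w - HP n v w| <= Dn n w.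
Proof.
move=> gw v1; rewrite -sqrtr_sqr; apply: sqrtr_le_sqr; first exact: Dn_ge0.
rewrite /HP big_split_ord/= addrAC subrr add0r.
apply: le_trans (weighted_CS (fun i : 'I_k => xt v (n + i) w) n) _.
rewrite [leRHS](_ : _ = 4 * (3 / 4) ^+ n * (N%:R * Vr w)); last first.
  rewrite /Dn !exprMn sqr_sqrtr ?mulr_ge0 ?Vr_ge0// -exprM mulnC exprM s34_sqr -exprMn.
  by set a := (_ / _) ^+ n; ring.
apply: ler_wpM2l; first by rewrite mulr_ge0// exprn_ge0// divr_ge0.
apply: (@le_trans _ _ (N%:R * \sum_(i < k) tV (n + i) w)).
  rewrite mulr_sumr; apply: ler_sum => i _.
  have -> : xt v (n + i) w ^+ 2 = ga (n + i) ^+ 2 * N%:R * pform (@Gp (n + i) w) v ^+ 2.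
    by rewrite /xt !exprMn sqr_sqrtr.
  rewrite /tV.
  have h := pform_sqr_le (@Gp (n + i) w) v1.
  rewrite [leLHS](_ : _ = N%:R * ((4 / 3) ^+ (n + i) * ga (n + i) ^+ 2) * pform (@Gp (n + i) w) v ^+ 2); last first.
    by set a := _ ^+ (n + i); set b := _ ^+ 2; set c := _ ^+ 2; ring.
  by rewrite [leRHS]mulrA ler_wpM2l// mulr_ge0.
apply: ler_wpM2l => //; apply: le_trans (sum_tV_le (n + k) gw).
rewrite big_split_ord/= lerDr; apply: sumr_ge0 => i _; exact: tV_ge0.
Qed.

Lemma HP_cvg w v : good w -> nrm2 v = 1 -> cvgn (fun n => HP n v w).
Proof.
move=> gw v1.
have -> : (fun n => HP n v w) = series (fun p => xt v p w).
  by apply/funext => n; rewrite /HP /series/= big_mkord.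
apply: normed_cvg; apply: (@series_le_cvg _ _ (geometric (2 * Num.sqrt (N%:R * Vr w)) s34)).
- by move=> n; exact: normr_ge0.
- by move=> n; exact: (Dn_ge0 n w).
- move=> n; have := HP_dist n 1 gw v1; rewrite addn1 /HP big_ord_recr/= addrAC subrr add0r.
  exact.
- by apply: is_cvg_geometric_series; rewrite ger0_norm.
Qed.

Lemma HP_lim w v n : good w -> nrm2 v = 1 -> `|limn (fun n => HP n v w) - HP n v w| <= Dn n w.
Proof.
move=> gw v1; rewrite leNgt; apply/negP => lt.
have cl : HP m v w @[m --> \oo] --> limn (fun n => HP n v w) by exact: HP_cvg.
have c1 : `|HP m v w - HP n v w| @[m --> \oo] --> `|limn (fun n => HP n v w) - HP n v w|.
  by apply: cvg_norm; apply: cvgB => //; exact: cvg_cst.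
have h : \forall m \near \oo, Dn n w < `|HP m v w - HP n v w| by exact: (cvgr_gt _ c1 _ lt).
suff: \forall m \near \oo, False by move=> /filter_ex[].
apply: filterS2 h (nbhs_infty_ge n) => m h nm; move: h; rewrite ltNge => /negP; apply.
by rewrite -(subnKC nm); exact: HP_dist.
Qed.

Lemma pspin_xt p v w : (2 <= p)%N -> pspin_term gamma g N p (fun i => Num.sqrt N%:R * v i) w = xt v p w.
Proof.
move=> p2; rewrite /pspin_term /xt /ga2 p2 /pform.
have Nr0 : 0 <= N%:R :> R by [].
have NN : N%:R != 0 :> R by rewrite pnatr_eq0 -lt0n.
have e : N%:R `^ (- ((p%:R - 1) / 2)) * Num.sqrt N%:R ^+ p = Num.sqrt N%:R :> R.
  rewrite -powR12_sqrt// -powR_mulrn ?powR_ge0// -powRrM -powRD; last by rewrite NN implybT.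
  by congr (_ `^ _); field.
rewrite -[in RHS]e !mulrA !mulr_sumr; apply: eq_bigr => f _.
rewrite big_split/= prodr_const card_ord /Gp.
by set a := _ `^ _; set b := _ ^+ p; set c := \prod_k _; ring.
Qed.

Lemma XN_HP v w : XN gamma g N (fun i => Num.sqrt N%:R * v i) w = limn (fun n => HP n v w).
Proof.
rewrite /XN.
suff -> : (fun n => \sum_(2 <= p < n) pspin_term gamma g N p (fun i => Num.sqrt N%:R * v i) w) =
    (fun n => HP n v w) by [].
apply/funext => n.
rewrite sum_from2; apply: eq_bigr => p _; case: ifPn => p2; first exact: pspin_xt.
by rewrite /xt /ga2 (negPf p2) !mul0r.
Qed.

Lemma LN_HP w : LN gamma g 0 N w = sup [set limn (fun n => HP n v w) | v in [set v | nrm2 v = 1]].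
Proof.
have Nr0 : 0 <= N%:R :> R by [].
have NN : N%:R != 0 :> R by rewrite pnatr_eq0 -lt0n.
have sN : Num.sqrt N%:R != 0 :> R by rewrite sqrtr_eq0 -ltNge ltr0n.
congr sup; apply/seteqP; split => [_ [s /= hs <-]|_ [v /= v1 <-]].
  exists (fun i => s i / Num.sqrt N%:R).
    rewrite /= /nrm2; under eq_bigr do rewrite exprMn exprVn sqr_sqrtr//.
    by rewrite -mulr_suml hs divff.
  rewrite /HN mul0r addr0 -XN_HP; congr (XN _ _ _ _ _); apply/funext => i.
  by rewrite mulrC mulfVK.
exists (fun i => Num.sqrt N%:R * v i); last by rewrite /HN mul0r addr0 XN_HP.
rewrite /spin_sphere/=; under eq_bigr do rewrite exprMn sqr_sqrtr//.
by rewrite -mulr_sumr -/(nrm2 v) v1 mulr1.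
Qed.

Definition Xc n (a : cidx n N) := g (cix a).
Definition Lc n w := Lm ga ((@Xc n)^~ w).

Lemma Hn_HP n v w : Hn ga ((@Xc n)^~ w) v = HP n v w.
Proof.
transitivity (\sum_(p < n) \sum_(f : {ffun 'I_p -> 'I_N}) ga p * Num.sqrt N%:R * \prod_k v (f k) * Gp w f).
  exact: (sum_cidx (fun (p : 'I_n) (f : {ffun 'I_p -> 'I_N}) => ga p * Num.sqrt N%:R * \prod_k v (f k) * Gp w f)).
apply: eq_bigr => p _; rewrite /xt /pform mulr_sumr; apply: eq_bigr => f _.
by rewrite -!mulrA; congr (_ * (_ * _)); rewrite mulrC.
Qed.

Lemma LN_dist w n : good w -> `|LN gamma g 0 N w - Lc n w| <= Dn n w.
Proof.
move=> gw; rewrite LN_HP; apply: sup_image_dist.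
- by exists (sph (fun=> 0)); exact: sph_nrm2.
- exists (hb ga ((@Xc n)^~ w)) => v v1; apply: le_trans (ler_norm _) _.
  by apply: Hn_le => i; apply: nrm2_coord; rewrite v1.
- by move=> v v1; rewrite Hn_HP; exact: HP_lim.
Qed.

Lemma Lc0 w : Lc 0 w = 0.
Proof.
rewrite /Lc /Lm (_ : [set _ | _ in _] = [set 0]) ?sup1//.
apply/seteqP; split => [_ [v _ <-]|_ ->]; first by rewrite Hn_HP /HP big_ord0.
by exists (sph (fun=> 0)); [exact: sph_nrm2|rewrite Hn_HP /HP big_ord0].
Qed.

Lemma Dn_le n w : Dn n w <= Dn 0 w.
Proof.
rewrite /Dn expr0 mulr1 ler_piMr ?mulr_ge0 ?sqrtr_ge0// exprn_ile1// ltW//.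
Qed.

Lemma Lc_le n w : good w -> `|Lc n w| <= 2 * Dn 0 w.
Proof.
move=> gw; have h1 := LN_dist n gw; have h2 := LN_dist 0 gw; rewrite Lc0 subr0 in h2.
rewrite -[Lc n w](subKr (LN gamma g 0 N w)) (le_trans (ler_normB _ _))//.
by rewrite mulr2n mulrDl !mul1r lerD// (le_trans h1)// Dn_le.
Qed.

(** On [good] the ground state energies of the truncations converge to that of the full model,
    dominated by a square integrable function. [LN] cut off outside [good] is a limit of measurable
    functions, and [integral_null] transfers its moments to [LN]. *)
Lemma LN_variance (c : R) n0 :
  (forall n, (n0 <= n)%N -> [/\ measurable_fun setT (Lc n), L1 P (fun w => Lc n w ^+ 2) &
    Ex P (fun w => Lc n w ^+ 2) - Ex P (Lc n) ^+ 2 <= c]) ->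
  (0 <= variance P (LN gamma g 0 N) <= c%:E)%E.
Proof.
move=> H.
pose z w : R := \1_good w.
have zg w : good w -> z w = 1 by move=> gw; rewrite /z indicE mem_set.
have zb w : ~ good w -> z w = 0 by move=> gw; rewrite /z indicE memNset.
pose f_ n w := Lc (n0 + n) w * z w.
pose f w := LN gamma g 0 N w * z w.
pose gd w := 2 * Dn 0 w.
have mVr : measurable_fun setT Vr.
  by apply: (measurableT_comp (f := fine)); [exact: fine_measurable|exact: measurable_V].
have mgd : measurable_fun setT gd.
  have -> : gd = (fun w => 4 * (N%:R * Vr w) `^ 2^-1).
    apply/funext => w; rewrite /gd /Dn expr0 mulr1 powR12_sqrt ?mulr_ge0 ?Vr_ge0// mulrA.
    by congr (_ * _); ring.
  apply: measurable_funM => //.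
  by apply: (measurableT_comp (f := fun x : R => x `^ 2^-1)); [exact: measurable_powR|exact: measurable_funM].
have LVr : L1 P Vr.
  apply: (le_integrable measurableT _ _ integrable_V).
    by apply/measurable_EFinP.
  move=> w _ /=; rewrite ger0_norm ?Vr_ge0// gee0_abs ?V_ge0//.
  by rewrite /Vr; have := V_ge0 w; case: (V w) => //= _; exact: leey.
have Lgd2 : L1 P (fun w => gd w ^+ 2).
  have -> : (fun w => gd w ^+ 2) = (fun w => 16 * N%:R * Vr w).
    apply/funext => w; rewrite /gd /Dn expr0 mulr1 !exprMn sqr_sqrtr ?mulr_ge0 ?Vr_ge0//; ring.
  exact: L1Z.
have Lgd : L1 P gd.
  apply: (L1_le mgd _ (L1D (L1_cst P 1) Lgd2)) => w.
  have := sqr_ge0 (`|gd w| - 1); rewrite -[gd w ^+ 2]real_normK ?num_real// sqrrB1.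
  have := sqr_ge0 (`|gd w|); set x := `|gd w| ^+ 2; set y := `|gd w|; lra.
have mf n : measurable_fun setT (f_ n).
  apply: measurable_funM; first by have [] := H (n0 + n)%N (leq_addr _ _).
  exact: measurable_indic measurable_good.
have ff w : f_ n w @[n --> \oo] --> f w.
  have [gw|bw] := pselect (good w); last first.
    by rewrite /f /f_ zb// mulr0; under eq_fun do rewrite mulr0; exact: cvg_cst.
  rewrite /f /f_ zg// mulr1; under eq_fun do rewrite mulr1.
  have c0 : geometric (Dn n0 w) s34 n @[n --> \oo] --> (0 : R).
    by apply: cvg_geometric; rewrite ger0_norm.
  apply/cvgrPdist_le => e e0.
  have nn := cvgr_norm_le _ c0; rewrite normr0 in nn.
  have {}nn : \forall n \near \oo, `|geometric (Dn n0 w) s34 n| <= e by exact: nn.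
  apply: filterS nn => n hn; apply: le_trans (LN_dist (n0 + n) gw) _.
  apply: le_trans hn; rewrite /= /Dn exprD mulrA; exact: ler_norm.
have fg n w : `|f_ n w| <= gd w.
  have [gw|bw] := pselect (good w); first by rewrite /f_ zg// mulr1 Lc_le.
  by rewrite /f_ zb// mulr0 normr0 mulr_ge0// Dn_ge0.
have ExE (f1 f2 : T -> R) : (forall w, good w -> f1 w = f2 w) -> Ex P f1 = Ex P f2.
  move=> e; rewrite /Ex /Rintegral; congr fine.
  by apply: (integral_null measurable_good good_null) => w gw; rewrite e.
have Vn : \forall n \near \oo, Ex P (fun x => f_ n x ^+ 2) - Ex P (f_ n) ^+ 2 <= c.
  apply: nearW => n; have [_ _] := H (n0 + n)%N (leq_addr _ _).
  rewrite (ExE (fun x => f_ n x ^+ 2) (fun x => Lc (n0 + n) x ^+ 2)); last by move=> w gw; rewrite /f_ zg// mulr1.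
  by rewrite (ExE (f_ n) (Lc (n0 + n))) => // w gw; rewrite /f_ zg// mulr1.
have [mF bF LF2 VF] := variance_cvg mf ff fg Lgd Lgd2 Vn.
have LF : L1 P f := L1_le mF bF Lgd.
rewrite /variance covariance.unlock !expectation.unlock.
have -> : (\int[P]_w (LN gamma g 0 N w)%:E = (Ex P f)%:E)%E.
  rewrite -(EFin_Ex LF); apply: (integral_null measurable_good good_null) => w gw.
  by rewrite /f zg// mulr1.
rewrite /=; set m := Ex P f.
have Lq : L1 P (fun w => f w ^+ 2 + ((- (2 * m)) * f w + m ^+ 2)).
  by apply: L1D => //; apply: L1D; [exact: L1Z|exact: L1_cst].
have -> : (\int[P]_w (((LN gamma g 0 N \- cst m) * (LN gamma g 0 N \- cst m)) w)%:E =
    \int[P]_w ((f w ^+ 2 + ((- (2 * m)) * f w + m ^+ 2))%:E))%E.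
  apply: (integral_null measurable_good good_null) => w gw; congr EFin.
  by rewrite /f zg// mulr1 /=; set x := LN _ _ _ _ _; rewrite -[LHS]/((x - m) * (x - m)); ring.
rewrite (EFin_Ex Lq) !lee_fin; apply/andP; split.
  apply: Ex_ge0 => w; rewrite (_ : _ + _ = (f w - m) ^+ 2) ?sqr_ge0//; ring.
rewrite ExD//; last by apply: L1D; [exact: L1Z|exact: L1_cst].
rewrite ExD; [|exact: L1Z|exact: L1_cst].
rewrite ExZ// Ex_cst -/m.
by rewrite (_ : _ + _ = Ex P (fun x => f x ^+ 2) - m ^+ 2)//; ring.
Qed.

End truncation.

Lemma LN_gamma0 (R : realType) T (g : gindex -> T -> R) (gamma : nat -> R) N :
  (forall p, (2 <= p)%N -> gamma p = 0) ->
  LN gamma g 0 N = cst (sup [set (0 : R) | _ in @spin_sphere R N]).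
Proof.
move=> z; apply/funext => w; rewrite /LN /=; congr sup; congr (_ @` _); apply/funext => s.
rewrite /HN mul0r addr0 /XN (_ : (fun n => _) = (fun=> 0)); first exact: lim_cst.
apply/funext => n; apply: big1_seq => p /=; rewrite mem_index_iota => /andP[p2 _].
by rewrite /pspin_term z// !mul0r.
Qed.

Theorem theorem4 (R : realType) (d : measure_display) (T : measurableType d)
    (P : probability T R) (g : gindex -> T -> R) (gamma : nat -> R) :
  (forall i, standard_gaussian P (g i)) ->
  mutually_independent P g ->
  (forall p, odd p -> gamma p = 0) ->
  (\sum_(2 <= p <oo) ((2%:R ^+ p * gamma p ^+ 2)%:E) < +oo)%E ->
  ((N%:R^-1)%:E * variance P (LN gamma g 0 N))%E @[N --> \oo] --> 0%E.
Proof.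
move=> hg ig odd0 sfin.
(* If all coefficients vanish then [LN] is constant. Otherwise a nonzero coefficient bounds xi'(1)
   below once the truncation degree exceeds [p0]. *)
have [[p0 [p2 gp0]]|ng] := pselect (exists p, (2 <= p)%N /\ gamma p <> 0); last first.
  have z p : (2 <= p)%N -> gamma p = 0.
    by move=> p2; apply: contrapT => gp; apply: ng; exists p.
  under eq_fun do rewrite (LN_gamma0 _ _ z) variance_cst mule0.
  exact: cvg_cst.
pose S0 := fine (\sum_(2 <= p <oo) ((2%:R ^+ p * gamma p ^+ 2)%:E))%E.
have t0 p : (0 <= (2%:R ^+ p * gamma p ^+ 2)%:E)%E by rewrite lee_fin mulr_ge0 ?sqr_ge0// exprn_ge0.
have S0E : (\sum_(2 <= p <oo) ((2%:R ^+ p * gamma p ^+ 2)%:E))%E = S0%:E.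
  by rewrite fineK// ge0_fin_numE// nneseries_ge0.
have hS n : \sum_(p < n) 2 ^+ p * ga2 gamma p ^+ 2 <= S0.
  rewrite -lee_fin -S0E; apply: le_trans (nneseries_lim_ge n (P := xpredT) (fun p _ _ => t0 p)).
  rewrite sumEFin lee_fin sum_from2 le_eqVlt; apply/orP; left; apply/eqP.
  apply: eq_bigr => p _; rewrite /ga2; case: ifP => // _.
  by rewrite expr0n mulr0.
have S00 : 0 <= S0 by have := hS 0%N; rewrite big_ord0.
have g0 : ga2 gamma 0 = 0 by [].
have godd p : odd p -> ga2 gamma p = 0 by rewrite /ga2; case: ifP => // _; exact: odd0.
pose lo := ga2 gamma p0 ^+ 2 * p0%:R.
have lo0 : 0 < lo.
  rewrite /lo /ga2 p2; apply: mulr_gt0; last by rewrite ltr0n (leq_trans _ p2).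
  by rewrite exprn_even_gt0//=; apply/eqP.
have q2 : 1 < 2 :> R by lra.
have [C C0 hC] := poly_le_exp 3 q2.
(* Summability against 2^p controls the third moment, since (p+1)^3 <= C 2^p; the added 1 is for the
   requirement 1 <= M. *)
pose M := 1 + C * S0.
have M1 : 1 <= M by rewrite lerDl mulr_ge0// ltW.
have z3M n : z3 (ga2 gamma) n <= M.
  apply: (@le_trans _ _ (C * S0)); last by rewrite lerDr.
  apply: le_trans (ler_wpM2l (ltW C0) (hS n)); rewrite mulr_sumr; apply: ler_sum => p _.
  rewrite [leRHS]mulrA [leRHS]mulrC; apply: ler_wpM2l; first exact: sqr_ge0.
  by apply: le_trans (hC p); rewrite lerXn2r ?nnegrE// ler_nat.
have lox n : (p0 < n)%N -> lo <= xi' (ga2 gamma) n 1.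
  move=> pn; rewrite xi'1 (bigD1 (Ordinal pn))//= lerDl; apply: sumr_ge0 => p _.
  by rewrite mulr_ge0 ?sqr_ge0.
(* Here the threshold on N is fixed first; for each such N the truncations of degree above [p0] then
   all satisfy the same bound. *)
have key de : 0 < de -> \forall N \near \oo, (0 <= variance P (LN gamma g 0 N) <= (de * N%:R)%:E)%E /\ (0 < N)%N.
  move=> de0; have [N1 N12 h] := ground_state_variance lo0 M1 de0.
  exists N1 => // N /= N1N.
  have N0 : (0 < N)%N by apply: leq_trans N1N; exact: leq_trans N12.
  split => //; apply: (LN_variance hg ig N0 hS (n0 := p0.+1)) => n pn.
  exact: (h N n (ga2 gamma) N1N godd g0 (lox n pn) (z3M n) _ _ _ _ (gfam_cix hg ig N n) _ _ _ _
    (gfam_gY hg ig N) (gY_meas0 hg N) (gY_null0 hg N0) (gY_mbox hg (N := N)) (gY_box hg ig (N := N))).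
apply/fine_cvgP; split.
  apply: filterS (key 1 ltr01) => N [/andP[v0 v1] _].
  rewrite fin_numM// ge0_fin_numE// (le_lt_trans v1)// ltry//.
apply/cvgrPdist_le => e e0; apply: filterS (key e e0) => N [/andP[v0 v1] N0].
have vf : variance P (LN gamma g 0 N) \is a fin_num by rewrite ge0_fin_numE// (le_lt_trans v1)// ltry.
have Nr : 0 < N%:R :> R by rewrite ltr0n.
move: v0 v1; rewrite /= sub0r normrN -(fineK vf) -EFinM !lee_fin /= => v0 v1.
by rewrite ger0_norm ?mulr_ge0 ?invr_ge0// mulrC ler_pdivrMr.
Qed.
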